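(* Assume that $\mathfrak g$ is of type $A_1$, $A_2$, $A_3$, or $B_2$. Then the Frobenius splitting $\operatorname{Fr}'\colon U_\zeta^-(\mathfrak g^* )\to U_\zeta^-(\mathfrak g)$ is fully compatible with the canonical basis, i.e. $\operatorname{Fr}'(G(b))=G(S_\infty(b))$ for every $b$ in the crystal $B(\infty)$ of $U_q^-(\mathfrak g^* )$.
   Context: **Quantum group.** A root datum consists of a finite index set $I$, simple roots $\alpha_i$, simple coroots $h_i$, a weight lattice $P\ni\alpha_i$ containing fundamental weights, and a symmetric bilinear form with $(\alpha_i,\alpha_i)\in2\mathbb Z_{>0}$ and $\langle h_i,\lambda\rangle=2(\alpha_i,\lambda)/(\alpha_i,\alpha_i)$, such that $(\langle h_i,\alpha_j\rangle)$ is the Cartan matrix of $\mathfrak g$. Put $q_i=q^{(\alpha_i,\alpha_i)/2}$, $[n]_i=(q_i^n-q_i^{-n})/(q_i-q_i^{-1})$. $U_q^-(\mathfrak g)$ is the $\mathbb Q(q)$-algebra generated by $f_i$ with the quantum Serre relations, $f_i^{(n)}=f_i^n/[n]_i!$; $U_{\mathbb Z}^-(\mathfrak g)$ is the $\mathbb Z[q,q^{-1}]$-subalgebra generated by all $f_i^{(n)}$, $U_{\mathbb Q}^-=\mathbb Q\otimes U_{\mathbb Z}^-$. Bar involution: $\mathbb Q$-algebra automorphism with $\overline{f_i}=f_i$, $\overline q=q^{-1}$. $A\subset\mathbb Q(q)$ is the ring of rational functions regular at $q=0$. Operators $e_i'$ on $U_q^-(\mathfrak g)$: $e_i'(1)=0$,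 $e_i'f_j=q_i^{-\langle h_i,\alpha_j\rangle}f_je_i'+\delta_{ij}$. **Canonical basis.** $U_q^-(\mathfrak g)=\bigoplus_{n\ge0}f_i^{(n)}\ker e_i'$; $\tilde e_i(f_i^{(n)}u)=f_i^{(n-1)}u$, $\tilde f_i(f_i^{(n)}u)=f_i^{(n+1)}u$ for $u\in\ker e_i'$. $L(\infty)$ is the $A$-submodule generated by all $\tilde f_{i_1}\cdots\tilde f_{i_r}1$, $B(\infty)\subset L(\infty)/qL(\infty)$ the set of images of these vectors, $b_\infty$ the image of $1$; $G$ is the inverse of the natural isomorphism $U_{\mathbb Q}^-\cap L(\infty)\cap\overline{L(\infty)}\to L(\infty)/qL(\infty)$, and the canonical basis is $\mathcal B(\infty)=G(B(\infty))$ (a $\mathbb Z[q,q^{-1}]$-basis of $U_{\mathbb Z}^-(\mathfrak g)$). **Frobenius splitting.** Let $l\ge1$ be an integer and $l_i$ the smallest positive integer with $l_i(\alpha_i,\alpha_i)/2\in l\mathbb Z$. $\mathfrak g^*$ is the Lie algebra of the root datum with simple roots $\alpha_i^*=l_i\alpha_i$, coroots $h_i^*=l_i^{-1}h_i$, weight lattice $\{\lambda\in P:\langle h_i,\lambda\rangle\in l_i\mathbb Z\ \forall i\}$, same bilinear form; the generators of $U_q^-(\mathfrak g^* )$ are again denoted $f_i$. $R$ is an integral domain containing $\zeta$, a primitive $l$-th or $2l$-th root of unity if $l$ is odd, and a primitive $2l$-th root of unity if $l$ is even; $R$ is a $\mathbb Z[q,q^{-1}]$-algebra via $q\mapsto\zeta$,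 and $U_\zeta^-(\cdot)=U_{\mathbb Z}^-(\cdot)\otimes_{\mathbb Z[q,q^{-1}]}R$, where $G(b)$ also denotes the image of a canonical basis element. $\operatorname{Fr}'\colon U_\zeta^-(\mathfrak g^* )\to U_\zeta^-(\mathfrak g)$ is Lusztig's $R$-algebra homomorphism with $\operatorname{Fr}'(f_i^{(n)})=f_i^{(l_in)}$. $S_\infty$ is Kashiwara's embedding of the crystal $B(\infty)$ of $\mathfrak g^*$ into the crystal $B(\infty)$ of $\mathfrak g$, with $S_\infty(b_\infty)=b_\infty$, $S_\infty(\tilde f_ib)=\tilde f_i^{l_i}S_\infty(b)$, $S_\infty(\tilde e_ib)=\tilde e_i^{l_i}S_\infty(b)$. *)

(* Defs.v *)
From HB Require Import structures.
From mathcomp Require Import all_boot all_order all_algebra.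
From mathcomp Require Import boolp classical_sets.

Set Implicit Arguments.
Unset Strict Implicit.
Unset Printing Implicit Defensive.

Import Order.TTheory GRing.Theory Num.Theory.

Local Open Scope classical_set_scope.
Local Open Scope ring_scope.

(** * Root data *)

(* [rd_V] is the rational space spanned by the weight lattice [rd_P]; the
   coroots and the form are extended to it by linearity. Keeping the ambient
   space lets the rescaled datum [star] use a sublattice of the same space. *)
Record root_datum := RootDatum {
  rd_I : finType;
  rd_V : vectType rat;
  rd_P : set rd_V;
  rd_alpha : rd_I -> rd_V;
  rd_h : rd_I -> rd_V -> rat;
  rd_form : rd_V -> rd_V -> rat }.

Arguments rd_P : clear implicits.
Arguments rd_alpha : clear implicits.
Arguments rd_h : clear implicits.
Arguments rd_form : clear implicits.

Record is_root_datum (D : root_datum) : Prop := IsRootDatum {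
  rd_lattice : exists r, exists2 e : r.-tuple (rd_V D),
    basis_of fullv e & forall v, rd_P D v <-> inIntSpan e v;
  rd_alphaP : forall i, rd_P D (rd_alpha D i);
  rd_form_sym : forall u v, rd_form D u v = rd_form D v u;
  rd_form_lin : forall u (c : rat) v w,
    rd_form D u (c *: v + w) = c * rd_form D u v + rd_form D u w;
  rd_form_even : forall i, exists2 m : nat,
    (0 < m)%N & rd_form D (rd_alpha D i) (rd_alpha D i) = (2 * m)%:R;
  rd_hE : forall i v, rd_h D i v =
    2 * rd_form D (rd_alpha D i) v / rd_form D (rd_alpha D i) (rd_alpha D i);
  rd_h_int : forall i v, rd_P D v -> rd_h D i v \is a Num.int;
  rd_fund_weights : forall j, exists2 w,
    rd_P D w & forall i, rd_h D i w = (i == j)%:R;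
  rd_cartan_le0 : forall i j, i != j -> rd_h D i (rd_alpha D j) <= 0 }.

(* [<h_i, alpha_j>], an integer for genuine root data. *)
Definition cartan (D : root_datum) (i j : rd_I D) : int :=
  numq (rd_h D i (rd_alpha D j)).

(* [(alpha_i, alpha_i) / 2], a positive integer for genuine root data. *)
Definition half_sq (D : root_datum) (i : rd_I D) : nat :=
  absz (numq (rd_form D (rd_alpha D i) (rd_alpha D i) / 2)).

Definition has_type (D : root_datum) n (C : 'M[int]_n) : Prop :=
  exists2 s : 'I_n -> rd_I D, bijective s &
    forall i j, cartan (s i) (s j) = C i j.

Definition cartanA n : 'M[int]_n :=
  \matrix_(i, j) if i == j then 2
                 else if (i.+1 == j) || (j.+1 == i) then -1 else 0.

Definition cartanB2 : 'M[int]_2 :=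
  \matrix_(i, j) if i == j then 2 else if i == 0 then -2 else -1.

Definition is_multipliers (l : nat) (D : root_datum) (li : rd_I D -> nat) :=
  forall i, [/\ (0 < li i)%N, (l %| li i * half_sq i)%N &
    forall m, (0 < m)%N -> (l %| m * half_sq i)%N -> (li i <= m)%N].

Definition star (D : root_datum) (li : rd_I D -> nat) : root_datum :=
  @RootDatum (rd_I D) (rd_V D)
    [set v | rd_P D v /\
             forall i, exists z : int, rd_h D i v = ((li i)%:Z * z)%:~R]
    (fun i => rd_alpha D i *+ li i)
    (fun i v => (li i)%:R^-1 * rd_h D i v)
    (rd_form D).

(** * Scalars *)

Definition Qq := {fraction {poly rat}}.
Definition q : Qq := tofrac 'X.

Definition regular0 : set Qq :=
  [set c | exists2 p : {poly rat} * {poly rat},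
             p.2.[0] != 0 & c = tofrac p.1 / tofrac p.2].

Definition laurentZ : set Qq :=
  [set c | exists (p : {poly int}) (n : nat),
             c = tofrac (map_poly intr p) / q ^+ n].

Definition ratQ : set Qq := [set c | exists a : rat, c = tofrac a%:P].

Definition qnum (d n : nat) : Qq :=
  ((q ^+ d) ^+ n - (q ^+ d) ^- n) / (q ^+ d - (q ^+ d)^-1).

Definition qfact (d n : nat) : Qq := \prod_(1 <= k < n.+1) qnum d k.

Section Generated.
Variables (U : algType Qq) (S : set Qq) (X : set U).

Inductive submod_gen : set U :=
| submod_in x : X x -> submod_gen x
| submod_0 : submod_gen 0
| submod_D x y : submod_gen x -> submod_gen y -> submod_gen (x + y)
| submod_Z c x : S c -> submod_gen x -> submod_gen (c *: x).

Inductive subalg_gen : set U :=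
| subalg_in x : X x -> subalg_gen x
| subalg_1 : subalg_gen 1
| subalg_D x y : subalg_gen x -> subalg_gen y -> subalg_gen (x + y)
| subalg_M x y : subalg_gen x -> subalg_gen y -> subalg_gen (x * y)
| subalg_Z c x : S c -> subalg_gen x -> subalg_gen (c *: x).
End Generated.

(** * The negative half of the quantum group *)

Section Serre.
Variables (D : root_datum) (U : algType Qq) (f : rd_I D -> U).

Definition divpow (i : rd_I D) (n : nat) : U :=
  (qfact (half_sq i) n)^-1 *: f i ^+ n.

Definition quantum_serre : Prop :=
  forall i j, i != j -> let b := absz (1 - cartan i j) in
    \sum_(k < b.+1) (-1) ^+ k *: (divpow i k * f j * divpow i (b - k)) = 0.
End Serre.

(* [U] is the algebra presented by the generators [f] and the quantum Serre
   relations, i.e. it has the universal property of that presentation. *)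
Definition is_Uminus (D : root_datum) (U : algType Qq) (f : rd_I D -> U) :=
  [/\ quantum_serre f,
      forall (B : algType Qq) (g : rd_I D -> B), quantum_serre g ->
        exists phi : {lrmorphism U -> B}, forall i, phi (f i) = g i &
      forall (B : algType Qq) (phi psi : {lrmorphism U -> B}),
        (forall i, phi (f i) = psi (f i)) -> phi =1 psi].

(* [U] with the standard maps on it, each of them pinned down uniquely by the
   listed equations. Since the [divpow i n * u] with [ud_e' i u = 0] span [U],
   this holds for the Kashiwara operators [ud_et], [ud_ft] as well. *)
Record uq_data (D : root_datum) := UqData {
  ud_U :> algType Qq;
  ud_f : rd_I D -> ud_U;
  ud_pres : is_Uminus ud_f;
  ud_bar : {rmorphism ud_U -> ud_U};
  ud_bar_q : ud_bar (q *: 1) = q^-1 *: 1;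
  ud_bar_f : forall i, ud_bar (ud_f i) = ud_f i;
  ud_e' : rd_I D -> {linear ud_U -> ud_U};
  ud_e'1 : forall i, ud_e' i 1 = 0;
  ud_e'f : forall i j x, ud_e' i (ud_f j * x) =
    (q ^+ half_sq i) ^ (- cartan i j) *: (ud_f j * ud_e' i x)
    + (i == j)%:R *: x;
  ud_et : rd_I D -> {linear ud_U -> ud_U};
  ud_et0 : forall i u, ud_e' i u = 0 -> ud_et i u = 0;
  ud_etS : forall i u n, ud_e' i u = 0 ->
    ud_et i (divpow ud_f i n.+1 * u) = divpow ud_f i n * u;
  ud_ft : rd_I D -> {linear ud_U -> ud_U};
  ud_ftE : forall i u n, ud_e' i u = 0 ->
    ud_ft i (divpow ud_f i n * u) = divpow ud_f i n.+1 * u }.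

Section Canonical.
Variables (D : root_datum) (U : uq_data D).

Definition UZ : set U :=
  subalg_gen laurentZ [set x | exists i n, x = divpow (ud_f U) i n].

Definition UQ : set U := submod_gen ratQ UZ.

Definition ft_string (s : seq (rd_I D)) : U := foldr (ud_ft U) 1 s.

Definition Linf : set U := submod_gen regular0 (range ft_string).

(* Elements of [Linf / q Linf] are represented by cosets, as subsets of [U]. *)
Definition cls (u : U) : set U := [set u + q *: w | w in Linf].

Definition Binf : set (set U) := range (cls \o ft_string).

Definition b_inf : set U := cls 1.

(* The operators induced on [Linf / q Linf]. *)
Definition cet (i : rd_I D) (b : set U) : set U :=
  \bigcup_(u in b) cls (ud_et U i u).

Definition cft (i : rd_I D) (b : set U) : set U :=
  \bigcup_(u in b) cls (ud_ft U i u).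

Definition balanced : set U := UQ `&` Linf `&` (ud_bar U @` Linf).

(* [G] is the inverse of the natural map [balanced -> Linf / q Linf]; its
   values outside [Linf / q Linf] are irrelevant. *)
Definition is_global (G : set U -> U) : Prop :=
  (forall b, (cls @` Linf) b -> balanced (G b) /\ cls (G b) = b) /\
  (forall u, balanced u -> G (cls u) = u).
End Canonical.

Arguments b_inf {D} U.
Arguments cet {D} U i b.
Arguments cft {D} U i b.

(** * Specialisation and the Frobenius splitting *)

(* [g], restricted to [UZ U], is a homomorphism of Z[q, q^-1]-algebras, where
   [q] acts on [B] as [zeta]. As [zeta] will be invertible, compatibility with
   [q] and additivity give compatibility with all of Z[q, q^-1]. *)
Definition hom_on_UZ (D : root_datum) (U : uq_data D) (R : comNzRingType)
    (zeta : R) (B : algType R) (g : U -> B) : Prop :=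
  g 1 = 1 /\
  forall x y, UZ x -> UZ y ->
    [/\ g (x + y) = g x + g y, g (x * y) = g x * g y &
        g (q *: x) = zeta *: g x].

(* [V], with [iota x = x (x) 1] on [UZ U], is the base change of [UZ U] along
   Z[q, q^-1] -> R, q |-> zeta; the values of [iota] outside [UZ U] are
   irrelevant. *)
Definition is_specialization (D : root_datum) (U : uq_data D)
    (R : comNzRingType) (zeta : R) (V : algType R) (iota : U -> V) : Prop :=
  [/\ hom_on_UZ zeta iota,
      forall (B : algType R) (g : U -> B), hom_on_UZ zeta g ->
        exists phi : {lrmorphism V -> B}, forall x, UZ x -> phi (iota x) = g x &
      forall (B : algType R) (phi psi : {lrmorphism V -> B}),
        (forall x, UZ x -> phi (iota x) = psi (iota x)) -> phi =1 psi].

Definition good_root_of_unity (R : nzRingType) (l : nat) (zeta : R) : bool :=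
  (odd l && l.-primitive_root zeta) || (l.*2).-primitive_root zeta.

Section Splitting.
Variables (D : root_datum) (li : rd_I D -> nat).
Variables (Us : uq_data (star li)) (U : uq_data D).

Definition is_Fr_splitting (R : comNzRingType) (Vs V : algType R)
    (iotas : Us -> Vs) (iota : U -> V) (Fr : {lrmorphism Vs -> V}) : Prop :=
  forall (i : rd_I D) n,
    Fr (iotas (divpow (ud_f Us) i n)) = iota (divpow (ud_f U) i (li i * n)).

(* The zero class [cls 0] plays the role of the element 0 adjoined to the
   crystals, so crystal maps send it to itself. *)
Record is_crystal_embedding (S : set Us -> set U) : Prop := CrystalEmbedding {
  ce_maps : forall b, Binf b -> Binf (S b);
  ce_inj : forall b b', Binf b -> Binf b' -> S b = S b' -> b = b';
  ce_0 : S (cls 0) = cls 0;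
  ce_b_inf : S (b_inf Us) = b_inf U;
  ce_ft : forall (i : rd_I D) b, Binf b ->
    S (cft Us i b) = iter (li i) (cft U i) (S b);
  ce_et : forall (i : rd_I D) b, Binf b ->
    S (cet Us i b) = iter (li i) (cet U i) (S b) }.
End Splitting.

(* Main.v *)
(* In types A1, A2, A3 and B2 there is an explicit PBW-type basis B(p), indexed
   by lattice points p, on which left and right multiplication by divided powers
   of the f_i act, modulo q, as explicit crystal operators h (left and right, one
   for each i).  If eps_h(p) = m > 0 and p' is obtained from p by lowering m
   times, then G(p) = f_h^(m) G(p') - sum of a_r G(r) over r with eps_h(r) > m,
   and likewise for g* with l_h m in place of m.  By induction Fr'(G(p)) - G(S p)
   is therefore, for every h with eps_h(p) > 0, a combination of G(r) of the
   weight of S p with eps_h(r) > l_h eps_h(p).  As the G(r) stay independent after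
   specialising q, and in these four types no r satisfies the inequality for all
   such h at once, the difference is 0. *)

Require Import Defs.
From HB Require Import structures.
From mathcomp Require Import all_boot all_order all_algebra.
From mathcomp Require Import boolp classical_sets.
From mathcomp Require Import ring zify.

Set Implicit Arguments.
Unset Strict Implicit.
Unset Printing Implicit Defensive.

Import Order.TTheory GRing.Theory Num.Theory.

Local Open Scope ring_scope.

(** * Identities in noncommutative algebras *)

(** Neither the independence of the PBW family nor the fact that it spans the crystal lattice is
    taken for granted. Both follow from congruences modulo [q] between one family and, for every
    side and index, a family adapted to that generator, by Nakayama's lemma and descent on powers of
    [q]. The hypothesis on [G] supplies the uniqueness of bar-invariant lifts; their existence, with
    the control of [eps] that the induction needs, is obtained by cancelling poles. The specialised
    algebra is given by a universal property among algebras, so independence there needs a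
    representation: the left regular one cut off above a height. In type A the second adapted family
    comes from another reduced word through rank two moves. In type B2 it is the image of the first
    under the anti-involution, and a central element makes the comparison possible. A further
    obstacle in type B2: when the multiplier of the short root is twice that of the long one, [star]
    exchanges the two lengths, and the map of parameters is no longer a rescaling. *)

Module NC.
Section NC.
Variables (F : fieldType) (U : algType F).

Inductive expr :=
| At of nat | One | Zero | Add of expr & expr | Opp of expr
| Sc of F & expr | Mul of expr & expr.

Variable env : seq U.

Fixpoint ev (e : expr) : U :=
  match e with
  | At n => nth 0 env n
  | One => 1
  | Zero => 0
  | Add a b => ev a + ev b
  | Opp a => - ev a
  | Sc c a => c *: ev a
  | Mul a b => ev a * ev b
  end.

Definition mon (m : seq nat) : U := foldr (fun i x => nth 0 env i * x) 1 m.

Definition poly := seq (F * seq nat).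

Definition pev (p : poly) : U := foldr (fun t x => t.1 *: mon t.2 + x) 0 p.

Definition scale (c : F) (p : poly) : poly := map (fun t => (c * t.1, t.2)) p.

Definition pmul (p r : poly) : poly :=
  flatten (map (fun t => map (fun u => (t.1 * u.1, cat t.2 u.2)) r) p).

Fixpoint norm (e : expr) : poly :=
  match e with
  | At n => [:: (1, [:: n])]
  | One => [:: (1, [::])]
  | Zero => [::]
  | Add a b => cat (norm a) (norm b)
  | Opp a => scale (-1) (norm a)
  | Sc c a => scale c (norm a)
  | Mul a b => pmul (norm a) (norm b)
  end.

Fixpoint sameseq (s t : seq nat) : bool :=
  match s, t with
  | [::], [::] => true
  | x :: s', y :: t' => if eqn x y then sameseq s' t' else false
  | _, _ => false
  end.

Fixpoint insert (c : F) (m : seq nat) (p : poly) : poly :=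
  match p with
  | [::] => [:: (c, m)]
  | t :: p' => if sameseq m t.2 then (c + t.1, m) :: p' else t :: insert c m p'
  end.

Definition collect (p : poly) : poly :=
  foldr (fun t r => insert t.1 t.2 r) [::] p.

(** The singleton case leaves no trailing [True], so that splitting the conjunction yields one goal
    per collected word. *)
Fixpoint vanish (p : poly) : Prop :=
  match p with
  | [::] => True
  | t :: [::] => t.1 = 0
  | t :: p' => t.1 = 0 /\ vanish p'
  end.

Lemma mon_cat s t : mon (s ++ t) = mon s * mon t.
Proof. by elim: s => [|i s IH] /=; rewrite ?mul1r // IH mulrA. Qed.

Lemma pev_cat p r : pev (p ++ r) = pev p + pev r.
Proof. by elim: p => [|t p IH] /=; rewrite ?add0r // IH addrA. Qed.

Lemma pev_scale c p : pev (scale c p) = c *: pev p.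
Proof. by elim: p => [|t p IH] /=; rewrite ?scaler0 // IH scalerDr scalerA. Qed.

Lemma pev_mul p r : pev (pmul p r) = pev p * pev r.
Proof.
rewrite /pmul; elim: p => [|t p IH] /=; first by rewrite mul0r.
rewrite pev_cat IH mulrDl; congr (_ + _).
elim: r {IH} => [|u r IH] /=; first by rewrite mulr0.
rewrite IH mon_cat mulrDr; congr (_ + _).
by rewrite -scalerAr -scalerAl scalerA mulrC.
Qed.

Lemma evE e : ev e = pev (norm e).
Proof.
elim: e => [n|||a IHa b IHb|a IHa|c a IHa|a IHa b IHb] //=.
- by rewrite mulr1 scale1r addr0.
- by rewrite scale1r addr0.
- by rewrite pev_cat IHa IHb.
- by rewrite pev_scale IHa scaleN1r.
- by rewrite pev_scale IHa.
- by rewrite pev_mul IHa IHb.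
Qed.

Lemma sameseqP s t : sameseq s t -> s = t.
Proof.
elim: s t => [|x s IH] [|y t] //=.
by case: (@eqnP x y) => // -> /IH ->.
Qed.

Lemma pev_insert c m p : pev (insert c m p) = c *: mon m + pev p.
Proof.
elim: p => [|t p IH] //=; case: ifP => [/sameseqP ->|_] /=.
  by rewrite scalerDl addrA.
by rewrite IH addrCA.
Qed.

Lemma pev_collect p : pev (collect p) = pev p.
Proof. by elim: p => [|t p IH] //=; rewrite pev_insert IH. Qed.

Lemma vanishP p : vanish p -> pev p = 0.
Proof.
elim: p => [|t p IH] //=; case: p IH => [|t' p] IH.
  by move=> ->; rewrite scale0r addr0.
by case=> -> /IH ->; rewrite scale0r addr0.
Qed.

Lemma solve e1 e2 : vanish (collect (norm (Add e1 (Opp e2)))) -> ev e1 = ev e2.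
Proof.
move/vanishP; rewrite pev_collect -evE /= => /eqP.
by rewrite subr_eq0 => /eqP.
Qed.
End NC.

Ltac inlist x l :=
  match l with
  | nil => constr:(false)
  | cons x _ => constr:(true)
  | cons _ ?l' => inlist x l'
  end.

Ltac add x l :=
  let b := inlist x l in
  match b with true => l | false => constr:(cons x l) end.

Ltac atoms l t :=
  match t with
  | @GRing.add _ ?a ?b => let l' := atoms l a in atoms l' b
  | @GRing.opp _ ?a => atoms l a
  | @GRing.scale _ _ ?c ?a => atoms l a
  | @GRing.mul _ ?a ?b => let l' := atoms l a in atoms l' b
  | @GRing.one _ => l
  | @GRing.zero _ => l
  | _ => add t l
  end.

Ltac index x l :=
  match l with
  | cons x _ => constr:(O)
  | cons _ ?l' => let n := index x l' in constr:(S n)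
  end.

Ltac reify F U l t :=
  match t with
  | @GRing.add _ ?a ?b =>
    let a' := reify F U l a in let b' := reify F U l b in
    constr:(@Add F a' b')
  | @GRing.opp _ ?a => let a' := reify F U l a in constr:(@Opp F a')
  | @GRing.scale _ _ ?c ?a =>
    let a' := reify F U l a in constr:(@Sc F c a')
  | @GRing.mul _ ?a ?b =>
    let a' := reify F U l a in let b' := reify F U l b in
    constr:(@Mul F a' b')
  | @GRing.one _ => constr:(@One F)
  | @GRing.zero _ => constr:(@Zero F)
  | _ => let n := index t l in constr:(@At F n)
  end.
End NC.

(* [nc F U] reduces an identity between noncommutative polynomial expressions
   in the [F]-algebra [U] to the equality of the coefficients of words. *)
Ltac nc F U :=
  match goal with
  | |- @eq ?T ?a ?b =>
    let l0 := constr:(@nil T) in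
    let l1 := NC.atoms l0 a in
    let l := NC.atoms l1 b in
    let e1 := NC.reify F U l a in
    let e2 := NC.reify F U l b in
    change (NC.ev (U := U) l e1 = NC.ev (U := U) l e2);
    apply: NC.solve;
    cbv [NC.norm NC.collect NC.insert NC.sameseq NC.scale NC.pmul NC.vanish
         foldr map flatten cat fst snd eqn Nat.eqb];
    do ?split
  end.

(** * Spans with coefficients in a subset of the field *)

Section Spans.
Variable F : fieldType.

(** Coefficient rings are predicates on one field, because the same vectors are expanded over
    several of them: rational functions regular at 0, Laurent polynomials, polynomials. The ideals
    are mostly the multiples of [q]. *)
Record subring_set (S : F -> Prop) : Prop := SubringSet {
  ss1 : S 1;
  ssB : forall x y, S x -> S y -> S (x - y);
  ssM : forall x y, S x -> S y -> S (x * y) }.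

Record ideal_set (S J : F -> Prop) : Prop := IdealSet {
  is0 : J 0;
  isD : forall x y, J x -> J y -> J (x + y);
  isM : forall x y, S x -> J y -> J (x * y);
  is_sub : forall x, J x -> S x }.

Section SubringTheory.
Variable S : F -> Prop.
Hypothesis HS : subring_set S.

Lemma ss0 : S 0.
Proof. by rewrite -(subrr 1); apply: ssB => //; apply: ss1. Qed.

Lemma ssN x : S x -> S (- x).
Proof. by move=> Sx; rewrite -sub0r; apply: ssB => //; exact: ss0. Qed.

Lemma ssD x y : S x -> S y -> S (x + y).
Proof. by move=> Sx Sy; rewrite -[y]opprK; apply: ssB => //; apply: ssN. Qed.

Lemma ssX x n : S x -> S (x ^+ n).
Proof.
move=> Sx; elim: n => [|n IH]; first exact: ss1.
by rewrite exprS; apply: ssM.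
Qed.

Lemma ss_nat n : S n%:R.
Proof.
elim: n => [|n IH]; first exact: ss0.
by rewrite -natr1; apply: ssD => //; exact: ss1.
Qed.

Lemma ideal_self : ideal_set S S.
Proof. by split=> //; [exact: ss0 | exact: ssD | exact: ssM]. Qed.

Lemma ideal_mul c : S c -> ideal_set S (fun x => exists2 y, S y & x = c * y).
Proof.
move=> Sc; split.
- by exists 0; [exact: ss0 | rewrite mulr0].
- by move=> _ _ [x Sx ->] [y Sy ->]; exists (x + y); [exact: ssD | rewrite mulrDr].
- by move=> x _ Sx [y Sy ->]; exists (x * y); [exact: ssM | rewrite mulrCA].
- by move=> _ [y Sy ->]; exact: ssM.
Qed.
End SubringTheory.

Lemma ideal_mulr S J x y : ideal_set S J -> J x -> J y -> J (x * y).
Proof. by move=> HJ Jx Jy; apply: (isM HJ) => //; apply: (is_sub HJ). Qed.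

Inductive spn (P : Type) (V : lmodType F) (S : F -> Prop) (X : P -> V)
    (D : P -> Prop) : V -> Prop :=
| spn0 : spn S X D 0
| spnS p c u : D p -> S c -> spn S X D u -> spn S X D (c *: X p + u).

Lemma spnE (P : Type) (V : lmodType F) (S : F -> Prop) (X : P -> V)
    (D : P -> Prop) (Q : V -> Prop) :
  Q 0 -> (forall u v, Q u -> Q v -> Q (u + v)) ->
  (forall p c, D p -> S c -> Q (c *: X p)) ->
  forall u, spn S X D u -> Q u.
Proof. by move=> Q0 QD QX u; elim=> // p c w Dp Sc _ Qw; apply: QD => //; apply: QX. Qed.

Section SpanTheory.
Variables (P : Type) (V : lmodType F).
Implicit Types (S : F -> Prop) (X Y : P -> V) (D E : P -> Prop).

Lemma spn_in S X D p c : D p -> S c -> spn S X D (c *: X p).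
Proof. by move=> Dp Sc; rewrite -[_ *: _]addr0; apply: spnS => //; apply: spn0. Qed.

Lemma spn_gen S X D p : subring_set S -> D p -> spn S X D (X p).
Proof. by move=> HS Dp; rewrite -[X p]scale1r; apply: spn_in => //; exact: ss1. Qed.

Lemma spnD S X D u v : spn S X D u -> spn S X D v -> spn S X D (u + v).
Proof. by move=> Su Sv; elim: Su => [|p c w Dp Sc _ IH]; rewrite ?add0r // -addrA; apply: spnS. Qed.

Lemma spn_sum S X D (I : Type) (r : seq I) (Q : pred I) (f : I -> V) :
  (forall i, Q i -> spn S X D (f i)) -> spn S X D (\sum_(i <- r | Q i) f i).
Proof. by move=> H; apply: (big_ind (spn S X D)) => //; [exact: spn0 | move=> *; exact: spnD]. Qed.

Lemma spn_scale S S' X D a u : (forall c, S c -> S' (a * c)) ->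
  spn S X D u -> spn S' X D (a *: u).
Proof.
move=> H; elim=> [|p c w Dp Sc _ IH]; first by rewrite scaler0; apply: spn0.
by rewrite scalerDr scalerA; apply: spnS => //; apply: H.
Qed.

Lemma spnW S S' X D E u : (forall c, S c -> S' c) -> (forall p, D p -> E p) ->
  spn S X D u -> spn S' X E u.
Proof. by move=> HS HD; elim=> [|p c w Dp Sc _ IH]; [exact: spn0 | apply: spnS; auto]. Qed.

Lemma spnB S X D u v : subring_set S ->
  spn S X D u -> spn S X D v -> spn S X D (u - v).
Proof.
move=> HS Hu Hv; apply: spnD => //; rewrite -scaleN1r.
by apply: spn_scale Hv => c Sc; rewrite mulN1r; exact: ssN.
Qed.

Lemma spnN S J X D u : subring_set S -> ideal_set S J ->
  spn J X D u -> spn J X D (- u).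
Proof.
move=> HS HJ Hu; rewrite -scaleN1r; apply: spn_scale Hu => c Jc.
by apply: (isM HJ) => //; apply: ssN => //; exact: ss1.
Qed.
End SpanTheory.

Lemma spn_trans (P P' : Type) (V : lmodType F) (S T W : F -> Prop)
    (X : P -> V) (Y : P' -> V) (D : P -> Prop) (E : P' -> Prop) u :
  (forall a b, S a -> T b -> W (a * b)) ->
  (forall p, D p -> spn T Y E (X p)) -> spn S X D u -> spn W Y E u.
Proof.
move=> HW HX; apply: spnE => [|v w|p c Dp Sc]; [exact: spn0 | exact: spnD |].
by apply: spn_scale (HX p Dp) => b Tb; apply: HW.
Qed.

Lemma spn_lin (P P' : Type) (V W : lmodType F) (f : {linear V -> W})
    (S : F -> Prop) (X : P -> V) (Y : P' -> W) (D : P -> Prop) (E : P' -> Prop) u :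
  (forall p c, D p -> S c -> spn S Y E (c *: f (X p))) ->
  spn S X D u -> spn S Y E (f u).
Proof.
move=> HX; apply: (spnE (Q := fun u => spn S Y E (f u))) => [|v w|p c Dp Sc].
- by rewrite linear0; apply: spn0.
- by rewrite linearD; apply: spnD.
- by rewrite linearZ; apply: HX.
Qed.

Lemma spn_relabel (P P' : Type) (V : lmodType F) (S : F -> Prop)
    (X : P -> V) (phi : P' -> P) (D : P -> Prop) (E : P' -> Prop) u :
  (forall p, E p -> D (phi p)) -> spn S (X \o phi) E u -> spn S X D u.
Proof.
move=> H; apply: spnE => [|v w|p c Ep Sc]; [exact: spn0 | exact: spnD |].
by apply: (spn_in X _ (p := phi p)) => //; apply: H.
Qed.

Section Congruence.
Variables (P : Type) (V : lmodType F) (S J : F -> Prop).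
Hypotheses (HS : subring_set S) (HJ : ideal_set S J).
Implicit Types (X Y Z : P -> V) (D : P -> Prop).

(** The error is measured in the span of [Y] only, so the relation is not symmetric by itself; the
    reverse direction needs a triangular shape or Nakayama's lemma. *)
Definition cong X Y D := forall p, D p -> spn J Y D (X p - Y p).

Lemma cong_refl X D : cong X X D.
Proof. by move=> p _; rewrite subrr; apply: spn0. Qed.

Lemma cong_trans X Y Z D : cong X Y D -> cong Y Z D -> cong X Z D.
Proof.
move=> XY YZ p Dp; rewrite -[X p](subrK (Y p)) -addrA.
apply: spnD (YZ p Dp); apply: spnE (XY p Dp) => [|u v|r c Dr Jc].
- exact: spn0.
- exact: spnD.
rewrite -[Y r](subrK (Z r)) scalerDr; apply: spnD; last exact: spn_in.
by apply: spn_scale (YZ r Dr) => b Jb; apply: (ideal_mulr HJ).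
Qed.

Lemma cong_span X Y D p : cong X Y D -> D p -> spn S Y D (X p).
Proof.
move=> XY Dp; rewrite -[X p](subrK (Y p)); apply: spnD; last exact: spn_gen.
by apply: spnW (XY p Dp) => // c; apply: (is_sub HJ).
Qed.

(** Induction on the rank inverts the unitriangular change of family one row at a time. *)
Lemma cong_triangular X Y D (rk : P -> nat) :
  (forall p, D p -> spn J Y (fun r => D r /\ (rk r < rk p)%N) (X p - Y p)) ->
  cong X Y D /\ cong Y X D.
Proof.
move=> H; split=> [p Dp|p Dp]; first by apply: spnW (H p Dp) => // r [].
have [n le_n] := ubnP (rk p); elim: n => // n IH in p Dp le_n *.
rewrite -opprB; apply: (spnN HS HJ).
apply: spnE (H p Dp) => [|u v|r c [Dr lt_r] Jc]; [exact: spn0 | exact: spnD |].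
rewrite -[Y r](subrK (X r)) scalerDr; apply: spnD; last exact: spn_in.
have lt_n : (rk r < n)%N by lia.
by apply: spn_scale (IH r Dr lt_n) => b Jb; apply: (ideal_mulr HJ).
Qed.

(* Nakayama's lemma for finitely generated modules over a local ring, with an
   arbitrary submodule [N]. *)
Lemma nakayama (T : eqType) (N : V -> Prop) (Y : T -> V) (s : seq T) :
  (forall a, J a -> (1 - a) != 0 /\ S (1 - a)^-1) ->
  N 0 -> (forall u v, N u -> N v -> N (u + v)) ->
  (forall a u, S a -> N u -> N (a *: u)) ->
  (forall p, p \in s -> exists2 n, N n & spn J Y (fun r => r \in s) (Y p - n)) ->
  forall p, p \in s -> N (Y p).
Proof.
move=> Junit N0 ND NZ; elim: s => // p0 s IH H.
have split_s u : spn J Y (fun r => r \in p0 :: s) u ->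
    exists a u', [/\ J a, spn J Y (fun r => r \in s) u' & u = a *: Y p0 + u'].
  elim=> [|r c w]; first by exists 0, 0; rewrite scale0r addr0; split=> //; [exact: (is0 HJ) | exact: spn0].
  rewrite inE => /orP[/eqP ->|rs] Jc _ [a [u' [Ja Hu' ->]]].
    exists (c + a), u'; split=> //; first exact: (isD HJ).
    by rewrite scalerDl addrA.
  by exists a, (c *: Y r + u'); split=> //; [exact: spnS | rewrite addrCA].
have [n0 Nn0 /split_s [a [u0 [Ja Hu0 E0]]]] := H p0 (mem_head _ _).
have [na0 Sa] := Junit a Ja.
have EY : Y p0 = (1 - a)^-1 *: (n0 + u0).
  have E1 : (1 - a) *: Y p0 = n0 + u0.
    move/eqP: E0; rewrite subr_eq => /eqP E0.
    by rewrite scalerBl scale1r {1}E0 addrAC (addrAC (a *: _)) subrr add0r addrC.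
  by rewrite -E1 scalerA mulVf // scale1r.
have Ns : forall p, p \in s -> N (Y p).
  apply: IH => p ps.
  have pin : p \in p0 :: s by rewrite inE ps orbT.
  have [n Nn /split_s [b [u [Jb Hu E]]]] := H p pin.
  exists (n + (b * (1 - a)^-1) *: n0).
    apply: ND => //; apply: NZ => //; apply: ssM => //; exact: (is_sub HJ).
  have -> : Y p - (n + (b * (1 - a)^-1) *: n0) = (b * (1 - a)^-1) *: u0 + u.
    by rewrite opprD addrA E EY scalerA scalerDr addrAC (addrAC (_ *: n0)) subrr add0r.
  apply: spnD => //; apply: spn_scale Hu0 => c Jc.
  apply: (isM HJ) => //; apply: ssM => //; exact: (is_sub HJ).
move=> p; rewrite inE => /orP[/eqP ->|]; last exact: Ns.
rewrite EY; apply: (NZ) => //; apply: (ND) => //.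
apply: (spnE N0 ND _ Hu0) => r c rs Jc; apply: NZ; [exact: (is_sub HJ) | exact: Ns].
Qed.
End Congruence.

(** Nakayama's lemma puts every [Y r] in the [S]-span of [X]; rewriting the error terms through it
    turns a [J]-combination of [Y] into one of [X]. *)
Lemma cong_sym (T : eqType) (V : lmodType F) (S J : F -> Prop)
    (X Y : T -> V) (D : T -> Prop) (s : seq T) :
  subring_set S -> ideal_set S J ->
  (forall a, J a -> (1 - a) != 0 /\ S (1 - a)^-1) ->
  (forall p, D p <-> p \in s) -> cong J X Y D -> cong J Y X D.
Proof.
move=> HS HJ Junit Ds XY.
have spY r : D r -> spn S X D (Y r).
  move/Ds; move: r; apply: (nakayama HS HJ Junit).
  - exact: spn0.
  - by move=> u w Hu Hw; exact: spnD.
  - by move=> a u Sa Su; apply: spn_scale Su => c Sc; exact: ssM.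
  move=> p /Ds Dp; exists (X p); first exact: spn_gen.
  rewrite -opprB; apply: (spnN HS HJ); apply: spnW (XY p Dp) => // q0 /Ds //.
move=> p Dp; rewrite -opprB; apply: (spnN HS HJ).
apply: (spn_trans _ spY (XY p Dp)) => a b Ja Sb.
by rewrite mulrC; apply: (isM HJ).
Qed.

Lemma cong_linear (P : Type) (V W : lmodType F) (f : {linear V -> W}) J
    (X Y : P -> V) D : cong J X Y D -> cong J (f \o X) (f \o Y) D.
Proof.
move=> H p Dp; rewrite /= -linearB.
by apply: spn_lin (H p Dp) => r c Dr Jc; rewrite -linearZ_LR linearZ; apply: (spn_in (f \o Y)).
Qed.

Lemma cong_relabel (P P' : Type) (V : lmodType F) (J : F -> Prop)
    (X Y : P -> V) (phi : P' -> P) (psi : P -> P') (D : P -> Prop) (E : P' -> Prop) :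
  (forall p, D p -> phi (psi p) = p) -> (forall p, D p -> E (psi p)) ->
  (forall p, E p -> D (phi p)) -> cong J X Y D -> cong J (X \o phi) (Y \o phi) E.
Proof.
move=> phiK HE HD H p Ep; apply: spnE (H _ (HD p Ep)) => [|u w|r c Dr Jc].
- exact: spn0.
- exact: spnD.
by rewrite -[r]phiK //; apply: (spn_in (Y \o phi)) => //; exact: HE.
Qed.
End Spans.

(** * Quantum integers and divided powers *)

(* The definitions are locked so that rewriting with ring laws does not look
   through them. *)
Fact q_key : unit. Proof. exact: tt. Qed.

Section QuantumIntegers.
Variables (F : fieldType) (v : F).

Definition qn n := locked_with q_key ((v ^+ n - v ^- n) / (v - v^-1)).
Definition qf n := locked_with q_key (\prod_(1 <= k < n.+1) qn k).
(** The quantum binomial coefficient of [m + n] over [m], indexed by its two parts so that no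
    subtraction occurs. *)
Definition qb m n := locked_with q_key (qf (m + n) / (qf m * qf n)).

Lemma qnE n : qn n = (v ^+ n - v ^- n) / (v - v^-1).
Proof. by rewrite /qn unlock. Qed.

Lemma qfE n : qf n = \prod_(1 <= k < n.+1) qn k.
Proof. by rewrite /qf unlock. Qed.

Lemma qbE m n : qb m n = qf (m + n) / (qf m * qf n).
Proof. by rewrite /qb unlock. Qed.

Hypotheses (v0 : v != 0) (qn_neq0 : forall n, qn n.+1 != 0).

Lemma vV_neq0 : v - v^-1 != 0.
Proof.
apply: contraNneq (qn_neq0 0) => E.
by rewrite !qnE E invr0 mulr0.
Qed.

Lemma qn0 : qn 0 = 0.
Proof. by rewrite !qnE !expr0 invr1 subrr mul0r. Qed.

Lemma qn1 : qn 1 = 1.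
Proof. by rewrite !qnE !expr1 divff // vV_neq0. Qed.

Lemma vvV_neq0 : v * v - 1 != 0.
Proof.
have H := vV_neq0; apply: contraNneq H => E.
have -> : v - v^-1 = (v * v - 1) * v^-1 by field.
by rewrite E mul0r.
Qed.

Lemma qn2 : qn 2 = v + v^-1.
Proof. by rewrite !qnE !expr2; field; rewrite vvV_neq0 v0. Qed.

Lemma vX_neq0 n : v ^+ n != 0.
Proof. by rewrite expf_neq0. Qed.

Lemma qnD m n : qn (m + n) = v ^+ n * qn m + v ^- m * qn n.
Proof. by rewrite !qnE !exprD; field; rewrite vvV_neq0 v0 !vX_neq0. Qed.

Lemma qnD' m n : qn (m + n) = v ^- n * qn m + v ^+ m * qn n.
Proof. by rewrite addnC qnD addrC. Qed.

Lemma qf0 : qf 0 = 1.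
Proof. by rewrite !qfE big_geq. Qed.

Lemma qfS n : qf n.+1 = qf n * qn n.+1.
Proof. by rewrite !qfE big_nat_recr. Qed.

Lemma qf_neq0 n : qf n != 0.
Proof. by elim: n => [|n IH]; rewrite ?qf0 ?oner_eq0 // qfS mulf_neq0. Qed.

Lemma qb0n n : qb 0 n = 1.
Proof. by rewrite !qbE qf0 mul1r divff // qf_neq0. Qed.

Lemma qbn0 n : qb n 0 = 1.
Proof. by rewrite !qbE addn0 qf0 mulr1 divff // qf_neq0. Qed.

Lemma qbC m n : qb m n = qb n m.
Proof. by rewrite !qbE addnC [qf m * _]mulrC. Qed.

Lemma qb1n n : qb 1 n = qn n.+1.
Proof. by rewrite !qbE add1n qfS !qfE big_nat1 -qfE qn1 mul1r mulrAC divff ?mul1r // qf_neq0. Qed.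

Lemma qbS m n : qb m.+1 n.+1 = v ^+ n.+1 * qb m n.+1 + v ^- m.+1 * qb m.+1 n.
Proof.
have -> : qb m n.+1 = qf (m + n).+1 * qn m.+1 / (qf m.+1 * qf n.+1).
  by rewrite !qbE addnS (qfS m); field; rewrite !qf_neq0 qn_neq0.
have -> : qb m.+1 n = qf (m + n).+1 * qn n.+1 / (qf m.+1 * qf n.+1).
  by rewrite !qbE addSn (qfS n); field; rewrite !qf_neq0 qn_neq0.
rewrite !qbE addSn addnS qfS -addSn -addnS qnD; field.
by rewrite !qf_neq0 !vX_neq0.
Qed.

(** The factor [v ^+ (m * n)] turns the symmetric binomial into a Gaussian polynomial in [v * v].
    Pascal's rule then has no negative powers, and integrality and constant term 1 follow by
    induction. *)
Lemma gbS m n : v ^+ (m.+1 * n.+1) * qb m.+1 n.+1 =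
  v ^+ n.+1 * v ^+ n.+1 * (v ^+ (m * n.+1) * qb m n.+1) + v ^+ (m.+1 * n) * qb m.+1 n.
Proof.
rewrite qbS mulrDr; congr (_ + _); first by rewrite mulSn exprD; ring.
by rewrite mulnS addnC exprD -mulrA mulVKf ?vX_neq0 ?mulrA // mulfK // vX_neq0.
Qed.

Section Integrality.
Variables S J : F -> Prop.
Hypotheses (HS : subring_set S) (HJ : ideal_set S J) (Sv : S v).
Hypothesis Jv : forall x, S x -> J (v * x).

Lemma gb_J m n : J (v ^+ (m * n) * qb m n - 1).
Proof.
elim: m n => [|m IHm] n; first by rewrite qb0n mul0n mul1r subrr; apply: (is0 HJ).
elim: n => [|n IHn]; first by rewrite qbn0 muln0 mul1r subrr; apply: (is0 HJ).
rewrite gbS -addrA; apply: (isD HJ) => //.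
rewrite exprS -!mulrA; apply: Jv; apply: (ssM HS); first exact: ssX.
apply: (ssM HS) => //; apply: (ssM HS); first exact: ssX.
rewrite -(subrK 1 (_ * qb _ _)); apply: ssD => //; last exact: ss1.
exact: (is_sub HJ).
Qed.

Lemma gb_S m n : S (v ^+ (m * n) * qb m n).
Proof.
rewrite -(subrK 1 (_ * qb _ _)); apply: ssD => //; last exact: ss1.
by apply: (is_sub HJ); apply: gb_J.
Qed.

Lemma qb_S m n : S v^-1 -> S (qb m n).
Proof.
move=> SV; have -> : qb m n = v^-1 ^+ (m * n) * (v ^+ (m * n) * qb m n).
  by rewrite exprVn mulKf // vX_neq0.
by apply: (ssM HS); [exact: ssX | exact: gb_S].
Qed.

(** The criterion behind the triangularity statements: the binomial starts with [v ^- (m * n)], so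
    any larger power of [v] in front puts the product in [J]. *)
Lemma vX_gb_J e m n k : (m * n < e)%N -> S k -> J (v ^+ e * qb m n * k).
Proof.
move=> lt_e Sk; set b := qb m n; have Sb : S (v ^+ (m * n) * b) by exact: gb_S.
have -> : v ^+ e * b * k = v * (v ^+ (e - m * n).-1 * (v ^+ (m * n) * b * k)).
  have -> : e = ((e - m * n).-1.+1 + m * n)%N by lia.
  rewrite exprD exprS addnK /=; ring.
by apply: Jv; apply: (ssM HS); [exact: ssX | exact: (ssM HS)].
Qed.
End Integrality.

Section DividedPowers.
Variable U : algType F.
Implicit Types x y z : U.

Definition dp x n := locked_with q_key ((qf n)^-1 *: x ^+ n).

Lemma dpE x n : dp x n = (qf n)^-1 *: x ^+ n.
Proof. by rewrite /dp unlock. Qed.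

Lemma dp0 x : dp x 0 = 1.
Proof. by rewrite !dpE qf0 invr1 scale1r. Qed.

Lemma dp1 x : dp x 1 = x.
Proof. by rewrite !dpE qfS qf0 mul1r qn1 invr1 scale1r. Qed.

Lemma dpSl x n : x * dp x n = qn n.+1 *: dp x n.+1.
Proof.
rewrite !dpE -scalerAr -exprS scalerA qfS invfM mulrCA divff ?mulr1 //.
Qed.

Lemma dpSr x n : dp x n * x = qn n.+1 *: dp x n.+1.
Proof.
rewrite !dpE -scalerAl -exprSr scalerA qfS invfM mulrCA divff ?mulr1 //.
Qed.

Lemma dpM x m n : dp x m * dp x n = qb m n *: dp x (m + n).
Proof.
rewrite !dpE -scalerAl -scalerAr !scalerA -exprD !qbE mulrAC divff ?qf_neq0 //.
by rewrite mul1r invfM.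
Qed.

(* Skew commutation passes to divided powers. *)
Lemma dp_skew x y c n : x * y = c *: (y * x) -> x * dp y n = c ^+ n *: (dp y n * x).
Proof.
move=> E; rewrite !dpE -scalerAr -scalerAl scalerA mulrC -scalerA; congr (_ *: _).
elim: n => [|n IH]; first by rewrite !expr0 mulr1 mul1r scale1r.
by rewrite exprSr mulrA IH -!scalerAl -mulrA E -scalerAr scalerA mulrA -exprSr.
Qed.

Lemma dp_skewl x y c n : x * y = c *: (y * x) -> dp x n * y = c ^+ n *: (y * dp x n).
Proof.
move=> E; rewrite !dpE -scalerAr -scalerAl scalerA mulrC -scalerA; congr (_ *: _).
elim: n => [|n IH]; first by rewrite !expr0 mulr1 mul1r scale1r.
by rewrite [in LHS]exprS -mulrA IH -!scalerAr mulrA E -scalerAl scalerA -mulrA -exprS -exprSr.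
Qed.
End DividedPowers.
End QuantumIntegers.

(* Names that survive the local shadowing of [qn] and [dp]. *)
Notation quantum_int := qn.
Notation divided_power := dp.

(** * Transition between the two PBW bases in type A2 *)

(** Lusztig's piecewise linear map between the PBW parameters of the two reduced words of the
    longest element in type A2. *)
Definition a2_mut (p : nat * nat * nat) : nat * nat * nat :=
  let m := minn p.1.1 p.2 in (p.1.2 + p.2 - m, m, p.1.1 + p.1.2 - m)%N.

Definition a2_fib n1 n2 (p : nat * nat * nat) := (p.1.1 + p.1.2 = n1 /\ p.1.2 + p.2 = n2)%N.

Lemma a2_mutK p : a2_mut (a2_mut p) = p.
Proof. by case: p => [[a b] c]; rewrite /a2_mut /=; congr (_, _, _); lia. Qed.

Lemma a2_mut_fib n1 n2 p : a2_fib n1 n2 p -> a2_fib n2 n1 (a2_mut p).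
Proof. by case: p => [[a b] c]; rewrite /a2_fib /a2_mut /=; lia. Qed.

Section RankTwoA.
Variables (F : fieldType) (v : F).
Hypotheses (v0 : v != 0) (qn_neq0 : forall n, qn v n.+1 != 0).
Variable U : algType F.

Local Notation qn := (qn v).
Local Notation qb := (qb v).
Local Notation dp := (dp v).

(** Plain subtraction on [nat] would give 1 instead of 0 for [k > m]. *)
Definition dpz (x : U) m k := if (k <= m)%N then dp x (m - k) else 0.

Lemma dp_commute (x y E : U) m : y * x = v *: (x * y) + E -> E * x = v^-1 *: (x * E) ->
  y * dp x m = v ^+ m *: (dp x m * y) + dpz x m 1 * E.
Proof.
move=> Hyx HEx; elim: m => [|m IH]; first by rewrite dp0 /dpz /= mul0r addr0 scale1r mulr1 mul1r.
apply: (scalerI (qn_neq0 m)); rewrite scalerAr -dpSl // mulrA Hyx.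
rewrite mulrDl -scalerAl -mulrA IH mulrDr (dp_skew _ _ HEx).
have -> : x * (dpz x m 1 * E) = qn m *: (dp x m * E).
  rewrite /dpz mulrA; case: m {IH} => [|m] /=; first by rewrite qn0 mulr0 mul0r scale0r.
  by rewrite subn1 /= dpSl // scalerAl.
rewrite -scalerAr mulrA dpSl // /dpz /= subn1 /=.
rewrite -addn1 qnD // addn1 qn1 // mulr1 exprVn expr1 exprS.
by nc F U; field; rewrite vX_neq0.
Qed.

(** [E] is the root vector of the sum of the two roots. The two rules are the Serre relations
    rewritten; they also hold for some pairs containing a composite root vector in type A3, to which
    the rank two results then apply. *)
Definition a2_pair (x y : U) :=
  let E := y * x - v *: (x * y) in
  y * E = v^-1 *: (E * y) /\ E * x = v^-1 *: (x * E).

Lemma a2_pair_serre (x y : U) :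
  x * x * y - (v + v^-1) *: (x * y * x) + y * x * x = 0 ->
  y * y * x - (v + v^-1) *: (y * x * y) + x * y * y = 0 -> a2_pair x y.
Proof.
move=> Hx Hy; split; apply/eqP; rewrite -subr_eq0; apply/eqP.
- by rewrite -[RHS]Hy; nc F U; field.
- by rewrite -[RHS]Hx; nc F U; field.
Qed.

Lemma a2_pairC (x y : U) : a2_pair x y -> a2_pair y x.
Proof.
case=> H1 H2.
have Hy : y * y * x - (v + v^-1) *: (y * x * y) + x * y * y = 0.
  have /eqP := H1; rewrite -subr_eq0 => /eqP <-; nc F U; field => //.
have Hx : x * x * y - (v + v^-1) *: (x * y * x) + y * x * x = 0.
  have /eqP := H2; rewrite -subr_eq0 => /eqP <-; nc F U; field => //.
exact: a2_pair_serre.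
Qed.

Section Commutation.
Variables x y : U.
Hypothesis Hxy : a2_pair x y.
Let E := y * x - v *: (x * y).

Lemma a2_yx m : y * dp x m = v ^+ m *: (dp x m * y) + dpz x m 1 * E.
Proof. by apply: dp_commute; [rewrite addrC subrK | case: Hxy]. Qed.

Lemma a2_yxz m k : y * dpz x m k = v ^+ (m - k) *: (dpz x m k * y) + dpz x m k.+1 * E.
Proof.
rewrite {1 2}/dpz; case: leqP => [le_km|lt_mk]; last first.
  by rewrite mulr0 mul0r scaler0 /dpz leqNgt ltnS (ltnW lt_mk) /= mul0r addr0.
rewrite a2_yx; congr (_ + _ * _); rewrite /dpz subn_gt0.
by case: ltnP => // lt; rewrite -subnDA addn1.
Qed.

(** By induction on [n], one more factor [y] either passes through a whole term (coefficient [al])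
    or is absorbed into a new factor [E] (coefficient [be]); the two contributions combine by the
    addition rule for quantum integers. *)
Lemma a2_expand n m : dp y n * dp x m =
  \sum_(k < n.+1) v ^+ ((n - k) * (m - k)) *: (dpz x m k * dp E k * dp y (n - k)).
Proof.
elim: n => [|n IH].
  by rewrite big_ord_recl big_ord0 addr0 !dp0 mul1r /dpz /= !subn0 mul0n !mulr1 scale1r.
apply: (scalerI (qn_neq0 n)); rewrite scalerAl -dpSl // -mulrA IH.
pose A k := dpz x m k * dp E k * dp y (n.+1 - k).
pose al k := v ^+ ((n - k) * (m - k)) * v ^+ (m - k) * v^-1 ^+ k * qn (n.+1 - k).
pose be k := v ^+ ((n.+1 - k) * (m.+1 - k)) * qn k.
transitivity (\sum_(k < n.+1) al k *: A k + \sum_(k < n.+1) be k.+1 *: A k.+1).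
  rewrite mulr_sumr -big_split; apply: eq_bigr => -[k /= le_kn] _.
  rewrite -scalerAr !mulrA a2_yxz /A /al /be !subSS mulrDl mulrDl.
  rewrite -scalerAl -scalerAl -(mulrA (dpz x m k) y) (@dp_skew _ v _ y E v^-1); last by case: Hxy.
  rewrite -scalerAr -scalerAl -!mulrA dpSl // (mulrA E) dpSl //.
  by rewrite subSn //; nc F U; ring.
have -> : \sum_(k < n.+1) al k *: A k = \sum_(k < n.+2) al k *: A k.
  by rewrite [RHS]big_ord_recr /= /al subnn qn0 mulr0 scale0r addr0.
have -> : \sum_(k < n.+1) be k.+1 *: A k.+1 = \sum_(k < n.+2) be k *: A k.
  by rewrite [RHS]big_ord_recl /= /be qn0 mulr0 scale0r add0r.
rewrite -big_split scaler_sumr; apply: eq_bigr => -[k /= le_kn] _.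
rewrite -scalerDl scalerA /A /al /be {A al be}.
case: (leqP k m) => [le_km|lt_mk]; last by rewrite /dpz leqNgt lt_mk /= !mul0r !scaler0.
congr (_ *: _).
have [a ->] : exists a, m = (k + a)%N by exists (m - k)%N; lia.
have [c Ec] : exists c, n.+1 = (k + c)%N by exists (n.+1 - k)%N; lia.
rewrite Ec qnD // -addnS !addKn exprVn.
case: c Ec => [|c] Ec.
  by rewrite !mul0n qn0 expr0 !mulr0 !mulr1 !mul1r add0r addr0.
have -> : (n - k)%N = c by lia.
by rewrite !mulnS !mulSn !exprD; field; rewrite !vX_neq0.
Qed.
End Commutation.

Variables S J : F -> Prop.
Hypotheses (HS : subring_set S) (HJ : ideal_set S J) (Sv : S v).
Hypothesis Jv : forall x, S x -> J (v * x).

Notation P3 := (nat * nat * nat)%type.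

Definition a2_pbw (x y : U) (p : P3) :=
  let E := y * x - v *: (x * y) in dp x p.1.1 * dp E p.1.2 * dp y p.2.

(** On the fibre, [n1 <= n2] makes the first exponent the minimum in [a2_mut]. The monomials [M],
    with factors in [x], [y], [x], are unitriangular with respect to both PBW families, hence
    congruent to each of them. *)
Lemma a2_cong_le x y n1 n2 : a2_pair x y -> (n1 <= n2)%N ->
  cong J (a2_pbw x y) (a2_pbw y x \o a2_mut) (a2_fib n1 n2) /\
  cong J (a2_pbw y x \o a2_mut) (a2_pbw x y) (a2_fib n1 n2).
Proof.
move=> Hxy le_n; have Hyx := a2_pairC Hxy.
pose M (p : P3) := dp x p.1.1 * dp y (p.1.2 + p.2) * dp x p.1.2.
have [MX XM] : cong J M (a2_pbw x y) (a2_fib n1 n2) /\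
               cong J (a2_pbw x y) M (a2_fib n1 n2).
  apply: (cong_triangular HS HJ (rk := fun p => p.1.2)) => -[[a b] c] /= D.
  rewrite /a2_fib /= in D; rewrite /M /= -mulrA a2_expand // mulr_sumr.
  set E := y * x - _.
  have tr k : dp x a * (v ^+ ((b + c - k) * (b - k)) *: (dpz x b k * dp E k * dp y (b + c - k)))
     = if (k <= b)%N then (v ^+ ((b + c - k) * (b - k)) * qb a (b - k)) *:
          a2_pbw x y (a + (b - k), k, b + c - k)%N else 0.
    rewrite /dpz; case: ifP => [le|_]; last by rewrite !mul0r scaler0 mulr0.
    by rewrite -scalerAr !mulrA dpM // -!scalerAl scalerA.
  have bin : (b < (b + c).+1)%N by lia.
  rewrite (bigD1 (Ordinal bin)) //= tr leqnn subnn muln0 qbn0 // mulr1 scale1r.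
  rewrite addn0 addKn addrAC subrr add0r; apply: spn_sum => -[k lt_k] /=.
  rewrite -val_eqE /= => ne_k; rewrite tr; case: ifP => le_k; last exact: spn0.
  apply: spn_in; first by rewrite /a2_fib /=; lia.
  rewrite -[_ * _]mulr1; apply: (vX_gb_J v0 qn_neq0 HS HJ Sv Jv); last exact: ss1.
  (* The exponent of [v] beats the binomial because [a <= c] and [k < b]. *)
  nia.
have [MY YM] : cong J M (a2_pbw y x \o a2_mut) (a2_fib n1 n2) /\
               cong J (a2_pbw y x \o a2_mut) M (a2_fib n1 n2).
  apply: (cong_triangular HS HJ (rk := fun p => p.1.1)) => -[[a b] c] /= D.
  rewrite /a2_fib /= in D; rewrite /M /= a2_expand // mulr_suml.
  set E := x * y - _.
  have tr k : (k <= a)%N ->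
     v ^+ ((a - k) * (b + c - k)) *: (dpz y (b + c) k * dp E k * dp x (a - k)) * dp x b
     = (v ^+ ((a - k) * (b + c - k)) * qb (a - k) b) *:
          (a2_pbw y x \o a2_mut) (k, (a - k) + b, c - a + k)%N.
    move=> le; rewrite /dpz ifT; last by lia.
    rewrite -scalerAl -!mulrA dpM // -!scalerAr scalerA mulrA; congr (_ *: _).
    rewrite /a2_pbw /a2_mut /=.
    congr (dp y _ * dp E _ * dp x _); lia.
  rewrite (bigD1 ord_max) //= tr // subnn mul0n qb0n // mulr1 scale1r.
  have -> : (a, 0 + b, c - a + a)%N = (a, b, c) by congr (_, _, _); lia.
  rewrite addrAC subrr add0r; apply: spn_sum => -[k lt_k] /=.
  rewrite -val_eqE /= => ne_k; rewrite tr; last by lia.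
  apply: spn_in; first by rewrite /a2_fib /=; lia.
  rewrite -[_ * _]mulr1; apply: (vX_gb_J v0 qn_neq0 HS HJ Sv Jv); last exact: ss1.
  nia.
split; first exact (cong_trans HJ XM MY).
exact (cong_trans HJ YM MX).
Qed.

Lemma a2_cong x y n1 n2 : a2_pair x y ->
  cong J (a2_pbw x y) (a2_pbw y x \o a2_mut) (a2_fib n1 n2) /\
  cong J (a2_pbw y x \o a2_mut) (a2_pbw x y) (a2_fib n1 n2).
Proof.
move=> Hxy; have [le|/ltnW le] := leqP n1 n2; first exact: a2_cong_le.
have [H1 H2] := a2_cong_le (a2_pairC Hxy) le.
split=> p Dp; have Dm := a2_mut_fib Dp.
- have := H2 _ Dm; rewrite /= a2_mutK.
  apply: spnE => [|u w|r c Dr Jc]; [exact: spn0 | exact: spnD |].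
  rewrite -[r]a2_mutK; apply: (spn_in (a2_pbw y x \o a2_mut)) => //.
  exact: a2_mut_fib.
have := H1 _ Dm; rewrite /= a2_mutK.
apply: spnE => [|u w|r c Dr Jc]; [exact: spn0 | exact: spnD |].
by apply: spn_in => //; apply: a2_mut_fib.
Qed.

(* Divided powers of the composite root vector stay in every subring stable
   under multiplication by [v^-1]-multiples containing those of [x], [y]. *)
Lemma a2_dp_closed (x y : U) (Q : U -> Prop) : a2_pair x y -> (forall n, S (v ^+ n)) ->
  Q 0 -> (forall a b, Q a -> Q b -> Q (a + b)) -> (forall a b, Q a -> Q b -> Q (a * b)) ->
  (forall c a, S c -> Q a -> Q (c *: a)) ->
  (forall n, Q (dp x n)) -> (forall n, Q (dp y n)) ->
  forall n, Q (dp (y * x - v *: (x * y)) n).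
Proof.
move=> Hxy Svn Q0 QD QM QZ Qx Qy n; have [m le_m] := ubnP n.
elim: m => // m IH in n le_m *.
(* In the product of the [n]-th divided powers of [y] and [x] the last term is the wanted divided
   power with coefficient 1; all others involve smaller ones. *)
have := a2_expand Hxy n n; rewrite big_ord_recr /= subnn mul0n scale1r dp0 mulr1.
rewrite /dpz leqnn subnn dp0 mul1r => /esym /(canRL (addKr _)) ->.
apply: (QD); last exact: QM.
rewrite -scaleN1r; apply: (QZ); first by apply: ssN => //; exact: ss1.
apply: big_ind => // -[k lt_k] _ /=; apply: (QZ) => //.
by rewrite ifT ?(ltnW lt_k) //; do 2?apply: (QM) => //; apply: IH; lia.
Qed.
End RankTwoA.

(** * Type B2: commutation relations *)

Section B2Relations.
Variables (F : fieldType) (v : F).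
Hypotheses (v0 : v != 0) (two_neq0 : v * v + 1 != 0) .
Variables (U : algType F) (s t : U).

(** [s] and [t] stand for the generators of the short and the long root, and [v] is the parameter of
    the short one; [w] and [z] are the root vectors of the two composite roots. *)
Definition b2_w := s * t - (v * v) *: (t * s).
Definition b2_z := (v + v^-1)^-1 *: (s * b2_w - b2_w * s).
Definition b2_beta := (v^-1 * v^-1 - 1) / (v + v^-1).
Definition b2_gamma := v / ((v + v^-1) * (v + v^-1)).
(** An element of weight twice the sum of the simple roots that commutes with [s] and [t];
    [b2_gamma] is the value that makes it commute with [s]. *)
Definition b2_C := t * b2_z - b2_gamma *: (b2_w * b2_w).

Local Notation w := b2_w.
Local Notation z := b2_z.
Local Notation C := b2_C.

Hypothesis serre_t :
  s * t * t - (v * v + v^-1 * v^-1) *: (t * s * t) + t * t * s = 0.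
Hypothesis serre_s :
  s * s * s * t - (v * v + 1 + v^-1 * v^-1) *: (s * s * t * s)
  + (v * v + 1 + v^-1 * v^-1) *: (s * t * s * s) - t * s * s * s = 0.

Lemma b2_st : s * t = (v * v) *: (t * s) + w.
Proof. by rewrite /w addrC subrK. Qed.

Lemma b2_sw : s * w = w * s + (v + v^-1) *: z.
Proof.
rewrite /z scalerA divff ?scale1r; first by rewrite addrC subrK.
by apply: contraNneq two_neq0 => E; rewrite -[1](divff v0) -mulrDr E mulr0.
Qed.

Let R3 : s * z - (v^-1 * v^-1) *: (z * s) = 0.
Proof.
rewrite -(scaler0 _ (v + v^-1)^-1) -[in RHS]serre_s /z /w.
by nc F U; field; rewrite ?two_neq0 ?v0.
Qed.

Let R4 : w * t - (v^-1 * v^-1) *: (t * w) = 0.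
Proof. by rewrite -serre_t /w; nc F U; field; rewrite ?v0. Qed.

(** The Serre relations give [R3] and [R4]. A twisted commutator of [s] with [R4] then gives [R6],
    and the commutator of [s] with [R6], corrected by [R3], gives [R5]. *)
Let R6 : z * t - t * z - b2_beta *: (w * w) = 0.
Proof.
have E : z * t - t * z - b2_beta *: (w * w) = (v + v^-1)^-1 *:
   (s * (w * t - (v^-1 * v^-1) *: (t * w))
    - (v * v) *: ((w * t - (v^-1 * v^-1) *: (t * w)) * s)).
  by rewrite /z /b2_beta /w; nc F U; field; rewrite ?two_neq0 ?v0.
by rewrite E R4 mulr0 mul0r !scaler0 subrr scaler0.
Qed.

Let R5 : z * w - (v^-1 * v^-1) *: (w * z) = 0.
Proof.
have E : z * w - (v^-1 * v^-1) *: (w * z) =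
   s * (z * t - t * z - b2_beta *: (w * w)) - (z * t - t * z - b2_beta *: (w * w)) * s
   - (s * z - (v^-1 * v^-1) *: (z * s)) * t + (v * v) *: (t * (s * z - (v^-1 * v^-1) *: (z * s))).
  by rewrite /z /b2_beta /w; nc F U; field; rewrite ?two_neq0 ?v0.
by rewrite E R6 R3 !mulr0 !mul0r scaler0 !subrr addr0.
Qed.

Lemma b2_sz : s * z = (v^-1 * v^-1) *: (z * s).
Proof. by apply/eqP; rewrite -subr_eq0 R3. Qed.

Lemma b2_wt : w * t = (v^-1 * v^-1) *: (t * w).
Proof. by apply/eqP; rewrite -subr_eq0 R4. Qed.

Lemma b2_zw : z * w = (v^-1 * v^-1) *: (w * z).
Proof. by apply/eqP; rewrite -subr_eq0 R5. Qed.

Lemma b2_zt : z * t = t * z + b2_beta *: (w * w).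
Proof. by apply/eqP; rewrite -subr_eq0 opprD addrA R6. Qed.

Lemma b2_Cs : s * C = C * s.
Proof.
apply/eqP; rewrite -subr_eq0; apply/eqP.
have -> : s * C - C * s = (v * v) *: (t * (s * z - (v^-1 * v^-1) *: (z * s)))
   - (b2_gamma * (v + v^-1)) *: (z * w - (v^-1 * v^-1) *: (w * z)).
  by rewrite /C /z /b2_gamma /w; nc F U; field; rewrite ?two_neq0 ?v0.
by rewrite R3 R5 mulr0 !scaler0 subrr.
Qed.

Lemma b2_Ct : C * t = t * C.
Proof.
apply/eqP; rewrite -subr_eq0; apply/eqP.
have -> : C * t - t * C = t * (z * t - t * z - b2_beta *: (w * w))
   - b2_gamma *: (w * (w * t - (v^-1 * v^-1) *: (t * w)))
   - (b2_gamma * (v^-1 * v^-1)) *: ((w * t - (v^-1 * v^-1) *: (t * w)) * w).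
  by rewrite /C; nc F U; rewrite /b2_beta /b2_gamma; field; rewrite ?two_neq0 ?v0.
by rewrite R6 R4 !mulr0 mul0r !scaler0 !subrr.
Qed.

(** The right side is [C] with all words reversed, which makes [C] fixed by the anti-involution that
    fixes the generators. *)
Lemma b2_C_palindromic : C = (v + v^-1)^-1 *: ((t * s - (v * v) *: (s * t)) * s
    - s * (t * s - (v * v) *: (s * t))) * t
  - b2_gamma *: ((t * s - (v * v) *: (s * t)) * (t * s - (v * v) *: (s * t))).
Proof.
apply/eqP; rewrite -subr_eq0; apply/eqP.
pose SR := s * t * t - (v * v + v^-1 * v^-1) *: (t * s * t) + t * t * s.
transitivity ((v * v / (v + v^-1)) *: (SR * s - s * SR)).
  by rewrite /C /z /b2_gamma /w /SR; nc F U; field; rewrite ?two_neq0 ?v0.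
by rewrite /SR serre_t mul0r mulr0 subrr scaler0.
Qed.
End B2Relations.

(** * Strings for one simple root *)

Section Ladder.
Variables (F : fieldType) (v : F).
Hypotheses (v0 : v != 0) (qn_neq0 : forall n, qn v n.+1 != 0).
Variables (U : algType F) (s : U) (k : F) (ka : nat -> U).

Local Notation qn := (qn v).
Local Notation qb := (qb v).
Local Notation dp := (dp v).

Hypothesis ka_s : forall r,
  s * ka r = (k * v ^- r * v ^- r) *: (ka r * s) + qn r.+1 *: ka r.+1.

(** By the hypothesis, [ka r] is the [r]-th divided power of a twisted commutator with [s], applied
    to [ka 0]; moving [dp s n] past [ka 0] runs through this string. *)
Lemma ladder n : dp s n * ka 0 =
  \sum_(r < n.+1) (k ^+ (n - r) * v ^- (r * (n - r))) *: (ka r * dp s (n - r)).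
Proof.
elim: n => [|n IH].
  by rewrite big_ord_recl big_ord0 addr0 !dp0 mul1r mulr1 mul0n expr0 invr1 mulr1 expr0 scale1r.
apply: (scalerI (qn_neq0 n)); rewrite scalerAl -dpSl // -mulrA IH.
pose A r := ka r * dp s (n.+1 - r).
pose al r := k ^+ (n - r) * v ^- (r * (n - r)) * (k * v ^- r * v ^- r) * qn (n.+1 - r).
pose be r := k ^+ (n.+1 - r) * v ^- (r.-1 * (n.+1 - r)) * qn r.
transitivity (\sum_(r < n.+1) al r *: A r + \sum_(r < n.+1) be r.+1 *: A r.+1).
  rewrite mulr_sumr -big_split; apply: eq_bigr => -[r /= le_rn] _.
  rewrite -scalerAr mulrA ka_s /A /al /be !subSS mulrDl -!scalerAl -(mulrA (ka r) s) dpSl //.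
  by rewrite subSn //; nc F U; ring.
have -> : \sum_(r < n.+1) al r *: A r = \sum_(r < n.+2) al r *: A r.
  by rewrite [RHS]big_ord_recr /= /al subnn qn0 mulr0 scale0r addr0.
have -> : \sum_(r < n.+1) be r.+1 *: A r.+1 = \sum_(r < n.+2) be r *: A r.
  by rewrite [RHS]big_ord_recl /= /be qn0 mulr0 scale0r add0r.
rewrite -big_split scaler_sumr; apply: eq_bigr => -[r /= le_rn] _.
rewrite -scalerDl scalerA /A /al /be {A al be}; congr (_ *: _).
have [c Ec] : exists c, n.+1 = (r + c)%N by exists (n.+1 - r)%N; lia.
rewrite Ec qnD // !addKn.
case: c Ec => [|c] Ec.
  by rewrite !muln0 qn0 expr0 invr1 !mulr0 !mulr1 !mul1r add0r addr0.
have -> : (n - r)%N = c by lia.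
case: r Ec le_rn => [|r] Ec le_rn.
  by rewrite qn0 !mul0n !expr0 invr1 exprS; ring.
by rewrite /= !mulnS !mulSn !exprS !exprD; field; rewrite !vX_neq0 // v0.
Qed.
End Ladder.

(** * A string of one generator seen from the left and from the right *)

Section RankOne.
Variables (F : fieldType) (v : F).
Hypotheses (v0 : v != 0) (qn_neq0 : forall n, qn v n.+1 != 0).
Variables (S J : F -> Prop).
Hypotheses (HS : subring_set S) (HJ : ideal_set S J) (Sv : S v).
Hypothesis Jv : forall x, S x -> J (v * x).
Variables (U : algType F) (s : U).

Local Notation qn := (qn v).
Local Notation qb := (qb v).
Local Notation dp := (dp v).

Variables ep et ft star : {linear U -> U}.
Hypothesis ep_s : forall x, ep (s * x) = (v^-1 * v^-1) *: (s * ep x) + x.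
Hypothesis ep_1 : ep 1 = 0.
Hypothesis et_0 : forall u, ep u = 0 -> et u = 0.
Hypothesis et_S : forall u n, ep u = 0 -> et (dp s n.+1 * u) = dp s n * u.
Hypothesis ft_E : forall u n, ep u = 0 -> ft (dp s n * u) = dp s n.+1 * u.
Hypothesis starM : forall x y, star (x * y) = star y * star x.
Hypothesis star_dp : forall n, star (dp s n) = dp s n.

Lemma ep_dp n x : ep (dp s n.+1 * x) =
  v ^- n *: (dp s n * x) + (v^-1 * v^-1) ^+ n.+1 *: (dp s n.+1 * ep x).
Proof.
elim: n x => [|n IH] x; first by rewrite dp1 // dp0 ep_s mul1r expr0 invr1 scale1r addrC !expr1.
apply: (scalerI (qn_neq0 n.+1)); rewrite -linearZ_LR scalerAl -dpSl // -mulrA ep_s IH.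
rewrite mulrDr -!scalerAr !mulrA !dpSl // scalerDr scalerDr !scalerA.
have -> : qn n.+2 = v^-1 * qn n.+1 + v ^+ n.+1 by rewrite -addn1 qnD' // qn1 // mulr1 expr1.
by rewrite -!scalerAl !scalerA; nc F U; rewrite !exprS; field; rewrite ?vX_neq0 ?v0.
Qed.

Variables (N : nat) (ka : nat -> U).
Local Notation K r := (v ^+ N * v ^- r * v ^- r).
Hypothesis ka_s : forall r, s * ka r = K r *: (ka r * s) + qn r.+1 *: ka r.+1.
Hypothesis ka_big : forall r, (N < r)%N -> ka r = 0.
Hypothesis ep_ka0 : ep (ka 0) = 0.
Hypothesis ep_ka : forall r y, ep (ka r * y) = ep (ka r) * y + K r *: (ka r * ep y).
Hypothesis star_ka0 : star (ka 0) = ka 0.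
Hypothesis ep_star : forall r, ep (star (ka r)) = 0.

Let xk r := star (ka r).
Let X a r := dp s a * xk r.
Let Y r a := ka r * dp s a.

Lemma star_Y r a : star (Y r a) = X a r.
Proof. by rewrite /Y starM star_dp. Qed.

(** Obtained by solving [ka_s] for [ka r.+1] and applying [ep], so that each value determines the
    next one. *)
Lemma ep_kaS r : ep (ka r.+1) = (v ^- r * (1 - v ^+ N * v ^+ N * v ^- r * v ^- r)) *: ka r.
Proof.
elim: r => [|r IH].
  apply: (scalerI (qn_neq0 0)); rewrite -linearZ_LR.
  have /(canRL (addKr _)) -> := esym (ka_s 0).
  rewrite linearD linearN linearZ_LR ep_s ep_ka ep_ka0 mulr0 mul0r.
  have -> : ep s = 1 by rewrite -[s]mulr1 ep_s ep_1 mulr0 scaler0 add0r.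
  by rewrite qn1 //; nc F U; rewrite !expr0; field; rewrite oner_eq0.
apply: (scalerI (qn_neq0 r.+1)); rewrite -linearZ_LR.
have /(canRL (addKr _)) -> := esym (ka_s r.+1).
have E := ka_s r.
rewrite linearD linearN linearZ_LR ep_s ep_ka IH.
have -> : ep s = 1 by rewrite -[s]mulr1 ep_s ep_1 mulr0 scaler0 add0r.
rewrite -scalerAr E -scalerAl.
have -> : qn r.+2 = v * qn r.+1 + v ^- r.+1 by rewrite -addn1 qnD // qn1 // mulr1 expr1.
rewrite qnE.
have Hv : v * v - 1 != 0 by exact: vvV_neq0.
by nc F U; rewrite !exprS; field; rewrite ?vX_neq0 ?v0 ?Hv.
Qed.

Lemma ep_X a r : ep (X a.+1 r) = v ^- a *: X a r.
Proof. by rewrite /X ep_dp /xk ep_star mulr0 scaler0 addr0. Qed.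

Lemma ep_YS r a : ep (Y r.+1 a.+1) =
  (v ^- r * (1 - v ^+ N * v ^+ N * v ^- r * v ^- r)) *: Y r a.+1 + (K r.+1 * v ^- a) *: Y r.+1 a.
Proof.
rewrite /Y ep_ka ep_kaS -scalerAl -[dp s a.+1]mulr1 ep_dp ep_1 mulr0 scaler0 addr0.
by rewrite !mulr1 -scalerAr scalerA.
Qed.

Lemma ep_Y0 a : ep (Y 0 a.+1) = (v ^+ N * v ^- a) *: Y 0 a.
Proof.
rewrite /Y ep_ka ep_ka0 mul0r add0r -[dp s a.+1]mulr1 ep_dp ep_1 mulr0 scaler0 addr0.
by rewrite !mulr1 -scalerAr scalerA expr0 invr1 !mulr1.
Qed.

Lemma ladder_coef n r : (r <= N)%N ->
  (v ^+ N) ^+ (n - r) * v ^- (r * (n - r)) = v ^+ ((n - r) * (N - r)).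
Proof.
move=> le; have [c ->] : exists c, N = (r + c)%N by exists (N - r)%N; lia.
rewrite addKn -exprM mulnDl exprD mulrAC mulfV ?mul1r ?(mulnC c) //.
exact: vX_neq0.
Qed.

Definition rk1_mid i j := dp s i * ka 0 * dp s j.

Lemma mid_Y i j : rk1_mid i j = \sum_(r < i.+1 | (r <= N)%N)
  (v ^+ ((i - r) * (N - r)) * qb (i - r) j) *: Y r (i + j - r).
Proof.
rewrite /rk1_mid (ladder v0 qn_neq0 ka_s) mulr_suml [RHS]big_mkcond /=.
apply: eq_bigr => -[r /= lt_r] _; case: ifP => [le|/negbT gt]; last first.
  by rewrite ka_big ?mul0r ?scaler0 ?mul0r // ltnNge.
rewrite ladder_coef // -scalerAl -mulrA dpM // -scalerAr scalerA.
by congr (_ *: (_ * dp s _)); lia.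
Qed.

Lemma star_mid i j : star (rk1_mid i j) = rk1_mid j i.
Proof. by rewrite /rk1_mid !starM !star_dp star_ka0 mulrA. Qed.

Lemma mid_X i j : rk1_mid i j = \sum_(r < j.+1 | (r <= N)%N)
  (v ^+ ((j - r) * (N - r)) * qb i (j - r)) *: X (i + j - r) r.
Proof.
rewrite -star_mid mid_Y linear_sum /=; apply: eq_bigr => r _.
by rewrite linearZ_LR star_Y qbC addnC.
Qed.

(** The two expansions of [rk1_mid (N - j) j], in [X] and in [Y], with [M - r] in place of [N - r]
    while the binomials keep [N]. With this continuation [ep] takes level [M.+1] to a multiple of
    level [M]. *)
Definition rk1_zx M j := \sum_(r < j.+1)
  (v ^+ ((j - r) * (M - r)) * qb (j - r) (N - j)) *: X (M - r) r.
Definition rk1_zy M j := \sum_(r < (N - j).+1)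
  (v ^+ ((N - j - r) * (M - r)) * qb (N - j - r) j) *: Y r (M - r).

(** Says that [u] has no component in the kernel of [ep], in the decomposition along divided powers
    of [s]. *)
Let fixed u := ft (et u) = u.

Lemma fixed_sum (I : Type) (r : seq I) (Q : pred I) (f : I -> U) :
  (forall i, Q i -> fixed (f i)) -> fixed (\sum_(i <- r | Q i) f i).
Proof.
move=> H; apply: (big_ind fixed) => //; rewrite /fixed ?linear0 //.
by move=> x y Hx Hy; rewrite !linearD Hx Hy.
Qed.

Lemma fixedZ c u : fixed u -> fixed (c *: u).
Proof. by rewrite /fixed => H; rewrite !linearZ_LR /= H. Qed.

Lemma fixed_X a r : (0 < a)%N -> fixed (X a r).
Proof.
case: a => // a _; have H : ep (xk r) = 0 by exact: ep_star.
by rewrite /fixed /X et_S // ft_E.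
Qed.

(** Since [r + a > N], the product [rk1_mid r a] expands in [X] with positive powers of [s] only,
    hence is fixed. In its expansion in [Y] every term but the top one [Y r a] is fixed by
    induction. *)
Lemma fixed_Y r a : (N < r + a)%N -> fixed (Y r a).
Proof.
elim/ltn_ind: r a => r IH a lt_N.
have [gt|le] := ltnP N r.
  by rewrite /fixed /Y ka_big // mul0r !linear0.
have : fixed (rk1_mid r a).
  rewrite mid_X; apply: fixed_sum => -[k lt_k] /= le_k.
  by apply/fixedZ/fixed_X; lia.
rewrite mid_Y (bigD1 ord_max) //= subnn mul0n expr0 mul1r qb0n // scale1r addKn.
set R := (X in _ + X); move=> H.
have HR : fixed R.
  apply: fixed_sum => -[k lt_k] /= /andP[le_k ne_k]; apply/fixedZ/IH => //; last by lia.
  by move: ne_k; rewrite -val_eqE /=; lia.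
by move: H; rewrite /fixed !linearD HR => /addIr.
Qed.

Lemma rk1_base j : (j <= N)%N -> rk1_zx N j = rk1_zy N j.
Proof.
move=> le; have := mid_X (N - j) j; rewrite mid_Y subnK // => E.
rewrite /rk1_zx /rk1_zy.
transitivity (\sum_(r < j.+1 | (r <= N)%N)
  (v ^+ ((j - r) * (N - r)) * qb (N - j) (j - r)) *: X (N - r) r).
  rewrite [RHS]big_mkcond; apply: eq_bigr => -[r /= lt] _.
  rewrite ifT; last by lia.
  by rewrite (qbC _ (N - j)).
rewrite -E big_mkcond; apply: eq_bigr => -[r /= lt] _.
by rewrite ifT //; lia.
Qed.

Lemma ep_zx M j : (j <= N)%N -> (N <= M)%N ->
  ep (rk1_zx M.+1 j) = (v ^+ j * v ^- M) *: rk1_zx M j.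
Proof.
move=> le_j le_M; rewrite linear_sum scaler_sumr; apply: eq_bigr => -[r /= lt] _.
rewrite linearZ_LR subSn; last by lia.
rewrite /= ep_X !scalerA; congr (_ *: _).
have [c ->] : exists c, j = (r + c)%N by exists (j - r)%N; lia.
have [d ->] : exists d, M = (r + d)%N by exists (M - r)%N; lia.
by rewrite !addKn mulnS !exprD; field; rewrite !vX_neq0.
Qed.

Lemma ep_zy M j : (j <= N)%N -> (N <= M)%N ->
  ep (rk1_zy M.+1 j) = (v ^+ j * v ^- M) *: rk1_zy M j.
Proof.
move=> le_j le_M; have Hv : v * v - 1 != 0 by exact: vvV_neq0.
have [n En] : exists n, N = (j + n)%N by exists (N - j)%N; lia.
have -> : rk1_zy M.+1 j = \sum_(r < n.+1)
  (v ^+ ((n - r) * (M - r).+1) * qb (n - r) j) *: Y r (M - r).+1.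
  rewrite /rk1_zy En addKn; apply: eq_bigr => -[r /= lt] _.
  by rewrite subSn //; lia.
have -> : rk1_zy M j = \sum_(r < n.+1)
  (v ^+ ((n - r) * (M - r)) * qb (n - r) j) *: Y r (M - r).
  by rewrite /rk1_zy En addKn.
rewrite linear_sum.
pose al r := v ^+ ((n - r) * (M - r).+1) * qb (n - r) j * (K r * v ^- (M - r)).
(* The last factor removes the term [r = n], where [n - r.+1] is truncated. *)
pose be r := v ^+ ((n - r.+1) * (M - r.+1).+1) * qb (n - r.+1) j *
   (v ^- r * (1 - v ^+ N * v ^+ N * v ^- r * v ^- r)) * (r < n)%N%:R.
transitivity (\sum_(r < n.+1) al r *: Y r (M - r) + \sum_(r < n.+1) be r *: Y r (M - r)).
  rewrite [X in _ = _ + X]big_ord_recr /= {2}/be ltnn mulr0 scale0r addr0.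
  rewrite big_ord_recl [X in _ = X + _]big_ord_recl /= -addrA -big_split /=; congr (_ + _).
    by rewrite linearZ_LR /= ep_Y0 scalerA /al !subn0 expr0 invr1 !mulr1.
  apply: eq_bigr => -[r /= lt] _; rewrite linearZ_LR /= /bump /= add1n ep_YS.
  rewrite scalerDr !scalerA addrC /al /be lt mulr1; congr (_ *: _ + _ *: Y _ _).
  by congr (Y _ _); lia.
rewrite -big_split scaler_sumr; apply: eq_bigr => -[r /= lt] _.
rewrite -scalerDl scalerA; congr (_ *: _); rewrite /al /be.
have [d Ed] : exists d, M = (r + d)%N by exists (M - r)%N; lia.
rewrite Ed addKn En; move: lt; rewrite ltnS => lt.
have [c Ec] : exists c, n = (r + c)%N by exists (n - r)%N; lia.
rewrite Ec addKn; case: c Ec => [|c] Ec.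
  by rewrite addn0 ltnn mulr0 addr0 !mul0n !mul1r !exprD; field; rewrite !vX_neq0.
rewrite -[X in (X < _)%N]addn0 ltn_add2l ltn0Sn mulr1 subnS addKn /=.
have [e Ee] : exists e, d = e.+1 by exists d.-1; lia.
rewrite Ee.
have -> : qb c j = qb c.+1 j * qn c.+1 / qn (c + j).+1.
  by rewrite !qbE addSn !qfS //; field; rewrite !qf_neq0 // !qn_neq0.
have -> : (r + e.+1 - r.+1)%N = e by lia.
have Hd : v * v ^+ c * v ^+ j * (v * v ^+ c * v ^+ j) - 1 != 0.
  apply: contraNneq (qn_neq0 (c + j)) => E; apply/eqP; rewrite qnE exprS exprD mulrA.
  have -> : v * v ^+ c * v ^+ j - (v * v ^+ c * v ^+ j)^-1 =
    (v * v ^+ c * v ^+ j * (v * v ^+ c * v ^+ j) - 1) / (v * v ^+ c * v ^+ j).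
    by field; rewrite !vX_neq0 // v0.
  by rewrite E !mul0r.
set B := qb c.+1 j; rewrite !qnE !(mulnS, mulSn) ?(exprS, exprD).
have Vr := vX_neq0 v0 r; have Vc := vX_neq0 v0 c; have Vj := vX_neq0 v0 j.
have Ve := vX_neq0 v0 e; have Vce := vX_neq0 v0 (c * e).
move: (v ^+ r) (v ^+ c) (v ^+ j) (v ^+ e) (v ^+ (c * e)) Vr Vc Vj Ve Vce Hd.
move=> xr xc xj xe xce Vr Vc Vj Ve Vce Hd.
field; rewrite Ve v0 Vr Hv Vj Vc /=.
by apply: contraNneq Hd => E; rewrite -E; apply/eqP; ring.
Qed.

(** By induction on [M] the difference of the two sides is killed by [ep], hence by [et]; above
    level [N] it is also fixed by [ft \o et], so it vanishes. *)
Lemma rk1_zxy M j : (j <= N)%N -> (N <= M)%N -> rk1_zx M j = rk1_zy M j.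
Proof.
move=> le_j; elim: M => [|M IH] le_M.
  by rewrite (_ : 0%N = N); [exact: rk1_base | lia].
have [EN|ltN] := eqVneq N M.+1; first by rewrite -EN rk1_base.
have le_M' : (N <= M)%N by lia.
apply/eqP; rewrite -subr_eq0; apply/eqP; set D := _ - _.
have epD : ep D = 0 by rewrite linearB ep_zx // ep_zy // IH // subrr.
have <- : ft (et D) = D.
  rewrite /D !linearB; congr (_ - _); apply: fixed_sum => -[r /= lt] _; apply: fixedZ.
    by apply: fixed_X; lia.
  by apply: fixed_Y; lia.
by rewrite et_0 // linear0.
Qed.

(* [rk1_mid] (for [M <= N]) and [rk1_zx = rk1_zy] (for [M >= N]) are
   unitriangular in both families. *)
Lemma rank_one_cong M :
  let D r := (r <= N)%N /\ (r <= M)%N in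
  let Xf r := X (M - r) r in
  let Yf r := Y (minn (M - r) (N - r)) (M - minn (M - r) (N - r)) in
  cong J Xf Yf D /\ cong J Yf Xf D.
Proof.
move=> D Xf Yf.
have S1 : S 1 by exact: ss1.
have [Z [rk1 [rk2 [H1 H2]]]] : exists (Z : nat -> U) (rk1 rk2 : nat -> nat),
  (forall r, D r -> spn J Xf (fun k => D k /\ (rk1 k < rk1 r)%N) (Z r - Xf r)) /\
  (forall r, D r -> spn J Yf (fun k => D k /\ (rk2 k < rk2 r)%N) (Z r - Yf r)).
  have [le|/ltnW le] := leqP M N.
    exists (fun r => rk1_mid (M - r) r), id, (fun r => (M - r)%N).
    split=> r [leN leM].
      rewrite mid_X (bigD1 ord_max) //= subnn mul0n expr0 mul1r qbn0 // scale1r.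
      rewrite subnK // addrAC subrr add0r; apply: spn_sum => -[k lt] /= /andP[leN' ne].
      apply: spn_in; first by rewrite /D; move: ne; rewrite -val_eqE /=; lia.
      rewrite -[_ * _]mulr1; apply: (vX_gb_J v0 qn_neq0 HS HJ Sv Jv) => //.
      by move: ne; rewrite -val_eqE /=; nia.
    rewrite mid_Y (bigD1 ord_max) /=; last by lia.
    rewrite subnn mul0n expr0 mul1r qb0n // scale1r subnK //.
    have -> : Y (M - r) (M - (M - r)) = Yf r by congr (Y _ _); lia.
    rewrite addrAC subrr add0r; apply: spn_sum => -[k lt] /= /andP[leN' ne].
    have -> : Y k (M - k) = Yf (M - k)%N by congr (Y _ _); lia.
    move: ne; rewrite -val_eqE /= => ne.
    apply: spn_in; first by rewrite /D; lia.
    rewrite -[_ * _]mulr1; apply: (vX_gb_J v0 qn_neq0 HS HJ Sv Jv) => //.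
    by nia.
  exists (rk1_zx M), id, (fun r => (N - r)%N).
  split=> r [leN leM].
    rewrite /rk1_zx (bigD1 ord_max) //= subnn mul0n expr0 mul1r qb0n // scale1r.
    rewrite addrAC subrr add0r; apply: spn_sum => -[k lt] /= ne.
    apply: spn_in; first by rewrite /D; move: ne; rewrite -val_eqE /=; lia.
    rewrite -[_ * _]mulr1; apply: (vX_gb_J v0 qn_neq0 HS HJ Sv Jv) => //.
    by move: ne; rewrite -val_eqE /=; nia.
  rewrite rk1_zxy // /rk1_zy (bigD1 ord_max) //= subnn mul0n expr0 mul1r qb0n // scale1r.
  have -> : Y (N - r) (M - (N - r)) = Yf r by congr (Y _ _); lia.
  rewrite addrAC subrr add0r; apply: spn_sum => -[k lt] /= ne.
  have -> : Y k (M - k) = Yf (N - k)%N by congr (Y _ _); lia.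
  move: ne; rewrite -val_eqE /= => ne.
  apply: spn_in; first by rewrite /D; lia.
  rewrite -[_ * _]mulr1; apply: (vX_gb_J v0 qn_neq0 HS HJ Sv Jv) => //.
  by nia.
have [ZX XZ] := cong_triangular HS HJ H1.
have [ZY YZ] := cong_triangular HS HJ H2.
by split; [exact (cong_trans HJ XZ ZY) | exact (cong_trans HJ YZ ZX)].
Qed.
End RankOne.

(** * Type B2: comparison of the two PBW bases *)

Section Skew.
Variables (F : fieldType) (v : F).
Variables (U : algType F) (f : {linear U -> U}).

(** The operator [f], later [ep], is prescribed on left multiplication by generators; [twisted] and
    [skew] are the forms in which its rule passes to products and divided powers. [skew] corresponds
    to [f x = 0]. *)
Definition twisted k (x : U) := forall y, f (x * y) = f x * y + k *: (x * f y).

Lemma twisted1 : f 1 = 0 -> twisted 1 1.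
Proof. by move=> f1 y; rewrite f1 mul0r add0r !mul1r scale1r. Qed.

Lemma twistedM k k' x x' : twisted k x -> twisted k' x' -> twisted (k * k') (x * x').
Proof.
move=> Hx Hx' y; rewrite -mulrA Hx Hx' Hx mulrDl mulrDr -!scalerAr scalerDr.
by rewrite -!scalerAl !mulrA scalerA addrA.
Qed.

Lemma twistedD k x x' : twisted k x -> twisted k x' -> twisted k (x + x').
Proof.
move=> Hx Hx' y; rewrite !mulrDl linearD Hx Hx' linearD mulrDl /=.
by rewrite scalerDr addrACA.
Qed.

Lemma twistedZ k c x : twisted k x -> twisted k (c *: x).
Proof.
move=> Hx y; rewrite -scalerAl !linearZ_LR /= Hx scalerDr -!scalerAl.
by rewrite !scalerA [c * k]mulrC.
Qed.

Lemma twisted0 k : twisted k 0.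
Proof. by move=> y; rewrite !mul0r linear0 mul0r scaler0 addr0. Qed.

Lemma twistedX k x n : f 1 = 0 -> twisted k x -> twisted (k ^+ n) (x ^+ n).
Proof.
move=> f1 Hx; elim: n => [|n IH]; first exact: twisted1.
by rewrite !exprS; apply: twistedM.
Qed.

Lemma twisted_dp k x n : f 1 = 0 -> twisted k x -> twisted (k ^+ n) (dp v x n).
Proof. by move=> f1 Hx; rewrite dpE; apply/twistedZ/twistedX. Qed.

Lemma twisted_sum k (I : Type) (r : seq I) (Q : pred I) (g : I -> U) :
  (forall i, Q i -> twisted k (g i)) -> twisted k (\sum_(i <- r | Q i) g i).
Proof. by move=> H; apply: (big_ind (twisted k)) => //; [exact: twisted0 | exact: twistedD]. Qed.

(* Elements that skew-commute with [f]. *)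
Definition skew k (x : U) := forall y, f (x * y) = k *: (x * f y).

Lemma skewM k k' x x' : skew k x -> skew k' x' -> skew (k * k') (x * x').
Proof. by move=> Hx Hx' y; rewrite -mulrA Hx Hx' -scalerAr scalerA mulrA. Qed.

Lemma skewD k x x' : skew k x -> skew k x' -> skew k (x + x').
Proof. by move=> Hx Hx' y; rewrite !mulrDl linearD Hx Hx' -scalerDr. Qed.

Lemma skewZ k c x : skew k x -> skew k (c *: x).
Proof. by move=> Hx y; rewrite -!scalerAl linearZ_LR Hx !scalerA mulrC. Qed.

Lemma skew_dp k x n : skew k x -> skew (k ^+ n) (dp v x n).
Proof.
move=> Hx; rewrite dpE; apply: skewZ; elim: n => [|n IH].
  by move=> y; rewrite !mul1r scale1r.
by rewrite !exprS; apply: skewM.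
Qed.

Lemma skew_ker k x : f 1 = 0 -> skew k x -> f x = 0.
Proof. by move=> f1 Hx; rewrite -[x]mulr1 Hx f1 mulr0 scaler0. Qed.

Lemma skew_kerM k x y : skew k x -> f y = 0 -> f (x * y) = 0.
Proof. by move=> Hx Hy; rewrite Hx Hy mulr0 scaler0. Qed.
End Skew.

Section B2.
Variables (F : fieldType) (v : F).
Hypotheses (v0 : v != 0) (two_neq0 : v * v + 1 != 0).
Hypotheses (qn_neq0 : forall n, qn v n.+1 != 0).
Hypotheses (qn2_neq0 : forall n, qn (v * v) n.+1 != 0).
Variables (U : algType F) (s t : U).

Local Notation qn := (qn v).
Local Notation dp := (dp v).
Local Notation qn2 := (quantum_int (v * v)).
Local Notation dpl := (divided_power (v * v)).
Local Notation w := (b2_w v s t).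
Local Notation z := (b2_z v s t).
Local Notation C := (b2_C v s t).

Hypothesis serre_t :
  s * t * t - (v * v + v^-1 * v^-1) *: (t * s * t) + t * t * s = 0.
Hypothesis serre_s :
  s * s * s * t - (v * v + 1 + v^-1 * v^-1) *: (s * s * t * s)
  + (v * v + 1 + v^-1 * v^-1) *: (s * t * s * s) - t * s * s * s = 0.

Let st := b2_st v s t.
Let sw := b2_sw v0 two_neq0 s t.
Let sz := b2_sz v0 two_neq0 serre_s.
Let wt := b2_wt v0 serre_t.
Let zw := b2_zw v0 two_neq0 serre_t serre_s.
Let Cs := b2_Cs v0 two_neq0 serre_t serre_s.
Let Ct := b2_Ct v0 two_neq0 serre_t.
Let vv0 : v * v != 0. Proof. by rewrite mulf_neq0. Qed.
Let vVvV : v^-1 * v^-1 = (v * v)^-1. Proof. by rewrite invfM. Qed.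

Lemma qn_double n : qn n.*2 = (v + v^-1) * qn2 n.
Proof.
have H1 : v * v - 1 != 0 by exact: vvV_neq0.
have H2 : v * v * (v * v) - 1 != 0 by exact: vvV_neq0.
rewrite !qnE -addnn !exprD exprMn; field.
by rewrite ?H1 ?H2 ?v0 ?vX_neq0.
Qed.

Definition b2_mon u c b := dpl t u * dp w c * dpl z b.
Local Notation B3 := b2_mon.

Lemma s_dpw c : s * dp w c = dp w c * s +
  (if c is c'.+1 then (v ^- c' * (v + v^-1)) *: (dp w c' * z) else 0).
Proof.
elim: c => [|c IH]; first by rewrite dp0 mul1r mulr1 addr0.
apply: (scalerI (qn_neq0 c)); rewrite scalerAr -dpSl // mulrA.
have -> : s * w * dp w c = w * (s * dp w c) + (v + v^-1) *: (z * dp w c).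
  by rewrite sw mulrDl -mulrA -scalerAl.
rewrite IH (dp_skew v c zw) mulrDr scalerDr mulrA dpSl // -scalerAl -addrA; congr (_ + _).
case: c {IH} => [|c]; first by rewrite mulr0 add0r qn1 // scale1r !scalerA !expr0 invr1 mulr1 mul1r.
rewrite -scalerAr mulrA dpSl // -scalerAl !scalerA -scalerDl; congr (_ *: _).
have -> : qn c.+2 = v * qn c.+1 + v ^- c.+1 by rewrite -addn1 qnD // qn1 // mulr1 expr1.
by rewrite !exprS !exprMn !exprVn; field; rewrite ?vX_neq0 ?v0.
Qed.

Lemma s_B3 u c b : s * B3 u c b = (v ^+ u.*2 * v ^- b.*2) *: (B3 u c b * s)
  + (if u is u'.+1 then qn c.+1 *: B3 u' c.+1 b else 0)
  + (if c is c'.+1 then (v ^+ u.*2 * v ^- c' * qn b.+1.*2) *: B3 u c' b.+1 else 0).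
Proof.
have wt' : w * t = (v * v)^-1 *: (t * w) by rewrite wt vVvV.
rewrite /B3 !mulrA (dp_commute vv0 qn2_neq0 u st wt').
have E1 : s * dpl z b = (v^-1 * v^-1) ^+ b *: (dpl z b * s) by apply: dp_skew; exact: sz.
have E2 : dpl t u * s * dp w c * dpl z b =
    (v^-1 * v^-1) ^+ b *: (dpl t u * dp w c * dpl z b * s) +
    (if c is c'.+1 then (v ^- c' * qn b.+1.*2) *: (dpl t u * dp w c' * dpl z b.+1) else 0).
  rewrite -(mulrA (dpl t u)) s_dpw mulrDr mulrDl; congr (_ + _).
    by rewrite -!mulrA E1 -!scalerAr.
  case: c => [|c]; first by rewrite mulr0 mul0r.
  rewrite -scalerAr -scalerAl -!mulrA dpSl // -!scalerAr !scalerA qn_double.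
  by congr (_ *: _); rewrite mulrA.
rewrite !mulrDl -!scalerAl E2 scalerDr !scalerA addrAC; congr (_ + _ + _).
- by congr (_ *: _); rewrite !exprMn !exprVn -!addnn !exprD invfM; field; rewrite ?vX_neq0 ?v0.
- rewrite /dpz; case: u {E2} => [|u] /=; first by rewrite !mul0r.
  by rewrite subn1 /= -(mulrA (dpl t u) w) dpSl // -scalerAr -scalerAl.
case: c {E2} => [|c]; first by rewrite scaler0.
by rewrite scalerA; congr (_ *: _); rewrite !exprMn -!addnn !exprD !mulrA.
Qed.

(** The monomials of weight [k] in [t] and [r] in [s], indexed by the exponent [b] of [z], and 0
    when another exponent would be negative. *)
Definition PB k r b := if (b.*2 <= r)%N && (r <= k + b)%N
  then B3 (k + b - r) (r - b.*2) b else 0.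

Lemma s_PB k r b : s * PB k r b = (v ^+ k.*2 * v ^- r * v ^- r) *: (PB k r b * s)
  + qn (r.+1 - b.*2) *: PB k r.+1 b
  + (v ^+ (k + b - r).*2 * v ^- (r - b.*2).-1 * qn b.+1.*2) *: PB k r.+1 b.+1.
Proof.
rewrite {1 2}/PB; case: ifP => [/andP[le1 le2]|H]; last first.
  rewrite mulr0 mul0r scaler0 add0r; have -> : PB k r.+1 b.+1 = 0.
    by rewrite /PB ifF //; apply/negbTE/negP => /andP[]; move: H => /negbT; lia.
  rewrite scaler0 addr0; have [E|ne] := eqVneq b.*2 r.+1; first by rewrite E subnn qn0 scale0r.
  by rewrite /PB ifF ?scaler0 //; apply/negbTE/negP => /andP[]; move: H => /negbT; lia.
rewrite s_B3; congr (_ *: _ + _ + _).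
- have [u Eu] : exists u, (k + b = r + u)%N by exists (k + b - r)%N; lia.
  have E : v ^+ k = v ^+ r * v ^+ u / v ^+ b.
    by rewrite -exprD -Eu exprD mulfK // vX_neq0.
  by rewrite Eu addKn -!addnn !exprD E; field; rewrite ?vX_neq0 ?v0.
- have E : (r - b.*2).+1 = (r.+1 - b.*2)%N by lia.
  case Eu : (k + b - r)%N => [|u]; rewrite /PB.
    by rewrite ifF ?scaler0 //; apply/negbTE/negP => /andP[]; lia.
  by rewrite ifT; [rewrite E; congr (_ *: B3 _ _ _); lia | apply/andP; split; lia].
case Ec : (r - b.*2)%N => [|c]; rewrite /PB.
  by rewrite ifF ?scaler0 //; apply/negbTE/negP => /andP[]; lia.
by rewrite ifT; [congr (_ *: B3 _ _ _); lia | apply/andP; split; lia].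
Qed.

(** The [r]-th divided power of the twisted commutator with [s], applied to [dpl t k]: by [s_T]
    these elements satisfy the hypothesis of [ladder], and by [T_big] the string stops after
    [k.*2]. *)
Definition b2_T k r := \sum_(b < r.+1) v ^+ ((k + b - r) * b).*2 *: PB k r b.
Local Notation T := b2_T.

Lemma s_T k r : s * T k r = (v ^+ k.*2 * v ^- r * v ^- r) *: (T k r * s) + qn r.+1 *: T k r.+1.
Proof.
pose al b := v ^+ ((k + b - r) * b).*2 * qn (r.+1 - b.*2).
pose be b := v ^+ ((k + b.-1 - r) * b.-1).*2 *
  (v ^+ (k + b.-1 - r).*2 * v ^- (r - b.-1.*2).-1 * qn b.*2).
pose A b := PB k r.+1 b.
transitivity ((v ^+ k.*2 * v ^- r * v ^- r) *: (T k r * s) +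
   (\sum_(b < r.+1) al b *: A b + \sum_(b < r.+1) be b.+1 *: A b.+1)).
  rewrite /T mulr_sumr mulr_suml scaler_sumr -!big_split; apply: eq_bigr => -[b /= _] _.
  rewrite -scalerAr s_PB -scalerAl !scalerDr !scalerA -addrA; congr (_ *: _ + _).
  by rewrite mulrC.
congr (_ + _).
have -> : \sum_(b < r.+1) al b *: A b = \sum_(b < r.+2) al b *: A b.
  rewrite [RHS]big_ord_recr /= /A /PB ifF ?scaler0 ?addr0 //.
  by apply/negbTE/negP => /andP[]; lia.
have -> : \sum_(b < r.+1) be b.+1 *: A b.+1 = \sum_(b < r.+2) be b *: A b.
  by rewrite [RHS]big_ord_recl /= /be double0 qn0 !mulr0 scale0r add0r.
rewrite -big_split scaler_sumr; apply: eq_bigr => -[b /= _] _.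
rewrite -scalerDl scalerA /A /PB; case: ifP => [/andP[le1 le2]|_]; last by rewrite !scaler0.
congr (_ *: _); rewrite /al /be.
have [u Eu] : exists u, (k + b = r + u.+1)%N by exists (k + b - r.+1)%N; lia.
have [c Ec] : exists c, r.+1 = (b.*2 + c)%N by exists (r.+1 - b.*2)%N; lia.
have -> : (k + b - r.+1)%N = u by lia.
rewrite Eu addKn Ec addKn; case: b => [|b] in le1 le2 Eu Ec *.
  by rewrite double0 qn0 !mulr0 addr0 !muln0 mulr1 mul1r add0n.
have -> : (k + b.+1.-1 - r)%N = u by rewrite /=; lia.
have -> : (r - b.+1.-1.*2).-1 = c by rewrite /=; lia.
rewrite qnD' // !mulnS !mulSn !doubleD !exprD /= !doubleS !exprS.
by field; rewrite ?vX_neq0 ?v0.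
Qed.

Lemma T_big k r : (k.*2 < r)%N -> T k r = 0.
Proof.
move=> lt; rewrite /T big1 // => -[b /= _] _; rewrite /PB ifF ?scaler0 //.
by apply/negbTE/negP => /andP[]; lia.
Qed.

Lemma T_0 k : T k 0 = dpl t k.
Proof.
rewrite /T big_ord_recl big_ord0 /PB /= muln0 expr0 scale1r !addr0 !subn0.
by rewrite addn0 /B3 !dp0 !mulr1.
Qed.
End B2.

Definition fib3 n m (p : nat * nat * nat) :=
  (p.1.1 + p.1.2 + p.2 = n /\ p.1.2 + p.2.*2 = m)%N.

(* The string parameters [(K, j, r)] of a PBW exponent and back. *)
Definition par (p : nat * nat * nat) :=
  let j := minn p.1.1 p.2 in (p.1.1 + p.1.2 + p.2 - j.*2, j, (p.2 - j).*2 + p.1.2)%N.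
Definition tri K j r : nat * nat * nat :=
  if (r <= K)%N then (K - r + j, r, j)%N else (j, K.*2 - r, r - K + j)%N.

Arguments par : simpl never.
Arguments tri : simpl never.

Lemma triK p : tri (par p).1.1 (par p).1.2 (par p).2 = p.
Proof.
case: p => [[u c] b]; rewrite /tri /par /=; case: ifP => H; congr (_, _, _); lia.
Qed.

Lemma parK K j r : (r <= K.*2)%N -> par (tri K j r) = (K, j, r).
Proof.
move=> le; rewrite /tri /par; case: ifP => H /=; congr (_, _, _); lia.
Qed.

Lemma tri_fib K j r : (r <= K.*2)%N -> fib3 (K + j.*2) (r + j.*2) (tri K j r).
Proof. by move=> le; rewrite /tri; case: ifP => H; rewrite /fib3 /=; lia. Qed.

Lemma par_le p : ((par p).2 <= (par p).1.1.*2)%N.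
Proof. by case: p => [[u c] b]; rewrite /par /=; lia. Qed.

Section B2Congruence.
Variables (F : fieldType) (v : F).
Hypotheses (v0 : v != 0) (two_neq0 : v * v + 1 != 0).
Hypotheses (qn_neq0 : forall n, qn v n.+1 != 0).
Hypotheses (qn2_neq0 : forall n, qn (v * v) n.+1 != 0).
Variables (S J : F -> Prop).
Hypotheses (HS : subring_set S) (HJ : ideal_set S J) (Sv : S v).
Hypothesis Jv : forall x, S x -> J (v * x).
Hypothesis Junit : forall a, J a -> (1 - a) != 0 /\ S (1 - a)^-1.
Variables (U : algType F) (s t : U).

Local Notation qn := (qn v).
Local Notation dp := (dp v).
Local Notation qn2 := (quantum_int (v * v)).
Local Notation dpl := (divided_power (v * v)).
Local Notation w := (b2_w v s t).
Local Notation z := (b2_z v s t).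
Local Notation C := (b2_C v s t).
Local Notation B3 := (b2_mon v s t).
Local Notation T := (b2_T v s t).

Hypothesis serre_t :
  s * t * t - (v * v + v^-1 * v^-1) *: (t * s * t) + t * t * s = 0.
Hypothesis serre_s :
  s * s * s * t - (v * v + 1 + v^-1 * v^-1) *: (s * s * t * s)
  + (v * v + 1 + v^-1 * v^-1) *: (s * t * s * s) - t * s * s * s = 0.

Let vv0 : v * v != 0. Proof. by rewrite mulf_neq0. Qed.
Let Jvv x : S x -> J (v * v * x).
Proof. by move=> Sx; rewrite -mulrA; apply: Jv; apply: (ssM HS). Qed.
Let Svv : S (v * v). Proof. exact: (ssM HS). Qed.

Definition b2_mont (p : nat * nat * nat) := B3 p.1.1 p.1.2 p.2.
Local Notation B3t := b2_mont.

Lemma C_B3 u c b : C * B3 u c b =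
  (v ^- c.*2 * qn2 u.+1 * qn2 b.+1) *: B3 u.+1 c b.+1
  - (b2_gamma v * qn c.+1 * qn c.+2) *: B3 u c.+2 b.
Proof.
have Cd : C * dpl t u = dpl t u * C.
  have /(dp_skew (v * v) u) : C * t = 1 *: (t * C).
    by rewrite scale1r (b2_Ct v0 two_neq0 serre_t).
  by rewrite expr1n scale1r.
have zd : z * dp w c = (v^-1 * v^-1) ^+ c *: (dp w c * z).
  by apply: dp_skew; exact: b2_zw.
have E : C * dp w c = (v^-1 * v^-1) ^+ c *: (t * dp w c * z)
    - (b2_gamma v * qn c.+1 * qn c.+2) *: dp w c.+2.
  rewrite /b2_C mulrBl -(mulrA t z) zd -scalerAr (mulrA t); congr (_ - _).
  by rewrite -scalerAl -(mulrA w w) dpSl // -scalerAr dpSl // !scalerA.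
rewrite /b2_mon !mulrA Cd -(mulrA _ C) E mulrBr mulrBl; congr (_ - _).
  rewrite -scalerAr -scalerAl !mulrA dpSr // -!scalerAl -(mulrA _ z) dpSl // -!scalerAr.
  rewrite !scalerA; congr (_ *: _).
  by rewrite exprMn !exprVn -addnn exprD invfM; ring.
by rewrite -scalerAr -scalerAl.
Qed.

Lemma J1M a b : J (a - 1) -> J (b - 1) -> J (a * b - 1).
Proof.
move=> Ja Jb; have -> : a * b - 1 = (a - 1) * (b - 1) + (a - 1) + (b - 1) by ring.
by apply: (isD HJ) => //; apply: (isD HJ) => //; apply: (ideal_mulr HJ).
Qed.

Lemma qn2_J n : J ((v * v) ^+ n * qn2 n.+1 - 1).
Proof.
have := gb_J vv0 qn2_neq0 HS HJ Svv Jvv 1 n.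
by rewrite mul1n qb1n.
Qed.

Lemma qn_S n : S (v ^+ n * qn n.+1).
Proof. by have := gb_S v0 qn_neq0 HS HJ Sv Jv 1 n; rewrite mul1n qb1n. Qed.

(** Rescaled by this power of [v], multiplication by [C] raises the exponents of [t] and [z] by one
    up to [J]: the first coefficient of [C_B3] becomes a product of factors congruent to 1, the
    second acquires a factor [v]. *)
Lemma Chat_B3 u c b :
  spn J B3t (fib3 (u + c + b).+2 (c + b.*2).+2)
    (v ^+ (u + c + b).*2 *: (C * B3 u c b) - B3 u.+1 c b.+1).
Proof.
rewrite C_B3 scalerBr !scalerA addrAC; apply: spnD.
  rewrite -[X in _ - X]scale1r -scalerBl.
  apply: (spn_in B3t (p := (u.+1, c, b.+1))); first by rewrite /fib3 /=; lia.
  have -> : v ^+ (u + c + b).*2 * (v ^- c.*2 * qn2 u.+1 * qn2 b.+1) =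
     ((v * v) ^+ u * qn2 u.+1) * ((v * v) ^+ b * qn2 b.+1).
    by rewrite !exprMn -!addnn !exprD; field; rewrite ?vX_neq0.
  by apply: J1M; apply: qn2_J.
rewrite -scaleNr; apply: (spn_in B3t (p := (u, c.+2, b))); first by rewrite /fib3 /=; lia.
(* Up to powers of [v], the denominator of [b2_gamma] is the square of [v * v + 1], which is a unit
   of [S]. *)
have [Hu0 Su] : 1 - - (v * v) != 0 /\ S (1 - - (v * v))^-1.
  by apply: Junit; rewrite -mulrN; apply: Jv; exact: ssN.
rewrite opprK addrC in Hu0 Su.
have -> : - (v ^+ (u + c + b).*2 * (b2_gamma v * qn c.+1 * qn c.+2)) =
  v * (- (v * v ^+ (u + b).*2 * (v * v + 1)^-1 * (v * v + 1)^-1 *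
     (v ^+ c * qn c.+1) * (v ^+ c.+1 * qn c.+2))).
  rewrite /b2_gamma -!addnn !exprD exprS; field.
  by rewrite ?v0 ?two_neq0 ?vX_neq0.
apply: Jv; apply: ssN => //.
have := qn_S c.+1; have := qn_S c; move: (_ * qn c.+1) (_ * qn c.+2) => x y Sx Sy.
by do 5?[apply: (ssM HS) => //]; exact: ssX.
Qed.

(* [Ycal] is the basis of twisted strings [C^j ad(s)^(r) t^(K)]; [sc] is the
   power of [v] that makes it congruent to the PBW basis. *)
Fixpoint sc K j := if j is j'.+1 then sc K j' * v ^+ (K + j'.*2).*2 else 1.

Definition b2_ka K j r := sc K j *: (C ^+ j * T K r).
Local Notation ka := b2_ka.

(** A monomial with exponents [u'] of [t] and [b'] of [z] occurs in [T] with [v] to the power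
    [(u' * b').*2]. The weight fixes [u' - b'], so this product vanishes for one monomial only. *)
Lemma T_B3 u c b : (u * b = 0)%N ->
  spn J B3t (fib3 (u + c + b) (c + b.*2)) (T (u + c + b) (c + b.*2) - B3 u c b).
Proof.
move=> ub0; rewrite /b2_T.
have lt_b : (b < (c + b.*2).+1)%N by lia.
have PBE b' : PB v s t (u + c + b) (c + b.*2) b' =
  if (b'.*2 <= c + b.*2)%N && (b <= u + b')%N then B3 (u + b' - b) (c + b.*2 - b'.*2) b' else 0.
  rewrite /PB; have -> : (c + b.*2 <= u + c + b + b')%N = (b <= u + b')%N by lia.
  by case: ifP => // /andP[le1 le2]; congr (b2_mon v s t _ _ _); lia.
rewrite (bigD1 (Ordinal lt_b)) //= PBE ifT; last by apply/andP; split; lia.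
have -> : ((u + c + b + b - (c + b.*2)) * b = 0)%N.
  by have -> : (u + c + b + b - (c + b.*2) = u)%N by lia.
rewrite expr0 scale1r addnK addnK addrAC subrr add0r.
apply: spn_sum => -[b' /= lt']; rewrite -val_eqE /= => ne.
rewrite PBE; case: ifP => [/andP[le1 le2]|_]; last by rewrite scaler0; apply: spn0.
apply: (spn_in B3t (p := ((u + b' - b)%N, (c + b.*2 - b'.*2)%N, b'))).
  by rewrite /fib3 /=; lia.
have : (0 < ((u + c + b + b' - (c + b.*2)) * b').*2)%N.
  have -> : (u + c + b + b' - (c + b.*2) = u + b' - b)%N by lia.
  by move/eqP: ub0; rewrite muln_eq0 => /orP[] /eqP E; nia.
by case: (_.*2) => // e _; rewrite exprS; apply: Jv; exact: ssX.
Qed.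

Lemma ka_B3 j u c b : (u * b = 0)%N ->
  spn J B3t (fib3 (u + c + b + j.*2) (c + b.*2 + j.*2))
    (ka (u + c + b) j (c + b.*2) - B3 (u + j) c (b + j)).
Proof.
move=> ub0; elim: j => [|j IH].
  by rewrite /ka /= expr0 mul1r scale1r !addn0; exact: T_B3.
set n := (u + c + b + j.*2)%N in IH *; set m := (c + b.*2 + j.*2)%N in IH *.
rewrite doubleS !addnS -/n -/m.
have -> : ka (u + c + b) j.+1 (c + b.*2) = v ^+ n.*2 *: (C * ka (u + c + b) j (c + b.*2)).
  by rewrite /ka /= exprS -scalerAr scalerA mulrA [_ * sc _ _]mulrC.
rewrite -[ka _ _ _](subrK (B3 (u + j) c (b + j))) mulrDr scalerDr -addrA.
have CB q : fib3 n m q -> spn J B3t (fib3 n.+2 m.+2)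
    (v ^+ n.*2 *: (C * B3t q) - B3 q.1.1.+1 q.1.2 q.2.+1).
  by move: q => [[u' c'] b'] [/= <- <-]; exact: Chat_B3.
apply: spnD; last first.
  have D : fib3 n m (u + j, c, b + j)%N by rewrite /fib3 /n /m /=; lia.
  exact: (CB _ D).
apply: (spnE (Q := fun x => spn J B3t (fib3 n.+2 m.+2) (v ^+ n.*2 *: (C * x))) _ _ _ IH) => [|x y Hx Hy|q a Dq Ja].
- by rewrite mulr0 scaler0; apply: spn0.
- by rewrite mulrDr scalerDr; apply: spnD.
rewrite -scalerAr scalerA mulrC -scalerA -[_ *: (C * _)](subrK (B3 q.1.1.+1 q.1.2 q.2.+1)).
rewrite scalerDr; apply: spnD.
  by apply: spn_scale (CB q Dq) => e Je; apply: (ideal_mulr HJ).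
apply: (spn_in B3t (p := (q.1.1.+1, q.1.2, q.2.+1))) => //.
by move: Dq; rewrite /fib3 /=; lia.
Qed.

Definition b2_Y p := ka (par p).1.1 (par p).1.2 (par p).2.
Local Notation Ycal := b2_Y.

Lemma Ycal_cong n m : cong J Ycal B3t (fib3 n m).
Proof.
move=> [[u c] b] [/= <- <-].
pose j := minn u b.
have E := @ka_B3 j (u - j) c (b - j).
have H : ((u - j) * (b - j) = 0)%N by rewrite /j; nia.
have {E} := E H.
have -> : (u - j + c + (b - j) + j.*2 = u + c + b)%N by rewrite /j; lia.
have -> : (c + (b - j).*2 + j.*2 = c + b.*2)%N by rewrite /j; lia.
rewrite !subnK ?geq_minl ?geq_minr // /Ycal /par /= -/j.
have -> : (u - j + c + (b - j) = u + c + b - j.*2)%N by rewrite /j; lia.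
by rewrite (addnC (b - j).*2).
Qed.
End B2Congruence.

(** * Finite sets of exponents and the involution of the type B2 parameters *)

Section Boxes.

Definition box (n : nat) : seq nat := iota 0 n.
Definition boxX (A B : Type) (s : seq A) (r : seq B) : seq (A * B) :=
  [seq (a, b) | a <- s, b <- r].

Lemma mem_box n a : (a \in box n) = (a < n)%N.
Proof. by rewrite mem_iota add0n. Qed.

Lemma mem_boxX (A B : eqType) (s : seq A) (r : seq B) a b :
  ((a, b) \in boxX s r) = (a \in s) && (b \in r).
Proof.
apply/allpairsP/andP => [[[x y] /= [Hx Hy [-> ->]]]|[Ha Hb]] //.
by exists (a, b).
Qed.

Lemma boxX_uniq (A B : eqType) (s : seq A) (r : seq B) :
  uniq s -> uniq r -> uniq (boxX s r).
Proof. by move=> Hs Hr; apply: allpairs_uniq => // -[a b] [a' b'] _ _ /= [-> ->]. Qed.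

Definition box4 n := boxX (boxX (boxX (box n) (box n)) (box n)) (box n).

Lemma mem_box4 n u c b a : ((u, c, b, a) \in box4 n) =
  [&& (u < n), (c < n), (b < n) & (a < n)]%N.
Proof. by rewrite !mem_boxX !mem_box -!andbA. Qed.
End Boxes.

Definition fib4 n m (p : nat * nat * nat * nat) :=
  let '(u, c, b, a) := p in (u + c + b = n /\ c + b.*2 + a = m)%N.

(** How the anti-involution acts on PBW parameters modulo [q]: it preserves the string parameters
    [K] and [j], and on the other two it is the passage from [Xf] to [Yf] in [rank_one_cong]. *)
Definition psi (p : nat * nat * nat * nat) : nat * nat * nat * nat :=
  let '(K, j, r) := par p.1 in
  let r' := minn p.2 (K.*2 - r) in (tri K j r', p.2 + r - r')%N.

Lemma psiE q0 a K j r : par q0 = (K, j, r) ->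
  psi (q0, a) = (tri K j (minn a (K.*2 - r)), a + r - minn a (K.*2 - r))%N.
Proof. by rewrite /psi => ->. Qed.

Lemma psiK p : psi (psi p) = p.
Proof.
case: p => [q0 a].
have := par_le q0; have := triK q0; case E0: (par q0) => [[K j] r].
rewrite (psiE _ E0) => E le; rewrite /= in E le; rewrite (psiE _ (parK _ _)); last by lia.
by rewrite -[in RHS]E; congr (tri _ _ _, _); lia.
Qed.

Lemma fib4E n m q0 a : fib4 n m (q0, a) <->
  fib3 n (m - a) q0 /\ (a <= m)%N.
Proof. by case: q0 => [[u c] b]; rewrite /fib4 /fib3 /=; split; lia. Qed.

Lemma psi_fib n m p : fib4 n m p -> fib4 n m (psi p).
Proof.
case: p => [q0 a] /fib4E [D le_a].
have := par_le q0; have := triK q0; case E0: (par q0) => [[K j] r].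
rewrite (psiE _ E0) => E le; rewrite /= in E le.
have [H3 H4] : fib3 (K + j.*2) (r + j.*2) q0 by rewrite -E; exact: tri_fib.
have le' : (minn a (K.*2 - r) <= K.*2)%N by lia.
have [H5 H6] := tri_fib j le'; case: D => [D1 D2].
by apply/fib4E; split; [split; lia | lia].
Qed.

(** * Type B2: the anti-involution modulo the ideal *)

Section B2Star.
Variables (F : fieldType) (v : F).
Hypotheses (v0 : v != 0) (two_neq0 : v * v + 1 != 0).
Hypotheses (qn_neq0 : forall n, qn v n.+1 != 0).
Hypotheses (qn2_neq0 : forall n, qn (v * v) n.+1 != 0).
Variables (S J : F -> Prop).
Hypotheses (HS : subring_set S) (HJ : ideal_set S J) (Sv : S v).
Hypothesis Jv : forall x, S x -> J (v * x).
Hypothesis Junit : forall a, J a -> (1 - a) != 0 /\ S (1 - a)^-1.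
Variables (U : algType F) (s t : U).

Local Notation qn := (qn v).
Local Notation dp := (dp v).
Local Notation qn2 := (quantum_int (v * v)).
Local Notation dpl := (divided_power (v * v)).
Local Notation w := (b2_w v s t).
Local Notation z := (b2_z v s t).
Local Notation C := (b2_C v s t).
Local Notation B3 := (b2_mon v s t).
Local Notation B3t := (b2_mont v s t).
Local Notation T := (b2_T v s t).
Local Notation ka := (b2_ka v s t).
Local Notation Ycal := (b2_Y v s t).

Hypothesis serre_t :
  s * t * t - (v * v + v^-1 * v^-1) *: (t * s * t) + t * t * s = 0.
Hypothesis serre_s :
  s * s * s * t - (v * v + 1 + v^-1 * v^-1) *: (s * s * t * s)
  + (v * v + 1 + v^-1 * v^-1) *: (s * t * s * s) - t * s * s * s = 0.

Variables ep et ft star : {linear U -> U}.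
Hypothesis ep_s : forall x, ep (s * x) = (v^-1 * v^-1) *: (s * ep x) + x.
Hypothesis ep_t : forall x, ep (t * x) = (v * v) *: (t * ep x).
Hypothesis ep_1 : ep 1 = 0.
Hypothesis et_0 : forall u, ep u = 0 -> et u = 0.
Hypothesis et_S : forall u n, ep u = 0 -> et (dp s n.+1 * u) = dp s n * u.
Hypothesis ft_E : forall u n, ep u = 0 -> ft (dp s n * u) = dp s n.+1 * u.
Hypothesis starM : forall x y, star (x * y) = star y * star x.
Hypothesis star_1 : star 1 = 1.
Hypothesis star_s : star s = s.
Hypothesis star_t : star t = t.

Lemma star_X x n : star (x ^+ n) = star x ^+ n.
Proof. by elim: n => [|n IH]; rewrite ?star_1 // exprS starM IH exprSr. Qed.

Lemma star_dpE k x n : star (divided_power k x n) = divided_power k (star x) n.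
Proof. by rewrite !dpE linearZ_LR star_X. Qed.

Lemma star_w : star w = t * s - (v * v) *: (s * t).
Proof. by rewrite /b2_w linearB linearZ_LR /= !starM star_s star_t. Qed.

Lemma star_z : star z = (v + v^-1)^-1 *: (star w * s - s * star w).
Proof. by rewrite /b2_z linearZ_LR linearB /= !starM star_s. Qed.

Lemma star_C : star C = C.
Proof.
rewrite [RHS](b2_C_palindromic v0 two_neq0 serre_t) /b2_C linearB linearZ_LR /= !starM.
by rewrite star_z star_w star_t.
Qed.

Lemma skew_t : skew ep (v * v) t. Proof. exact: ep_t. Qed.

Lemma skew_w : skew ep 1 (star w).
Proof.
move=> y; rewrite star_w mulrBl linearB /= -scalerAl linearZ_LR /= -!mulrA.
by rewrite ep_t !ep_s ep_t; nc F U; field; rewrite ?v0.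
Qed.

Lemma skew_z : skew ep (v^-1 * v^-1) (star z).
Proof.
rewrite star_z; apply: skewZ => y; rewrite !mulrBl linearB /= -!mulrA ep_s !skew_w ep_s.
by nc F U; field; rewrite ?v0.
Qed.

Lemma skew_C : skew ep 1 C.
Proof.
rewrite -star_C /b2_C linearB linearZ_LR /= !starM star_t -scaleNr.
apply: skewD; last by apply: skewZ; rewrite -[1]mulr1; apply: skewM; exact: skew_w.
have -> : 1 = v^-1 * v^-1 * (v * v) :> F by field; rewrite ?v0 ?oner_eq0.
by apply: skewM; [exact: skew_z | exact: skew_t].
Qed.

Lemma ep_star_B3 u c b : ep (star (B3 u c b)) = 0.
Proof.
rewrite /b2_mon !starM !star_dpE star_t; apply: (skew_kerM (skew_dp _ _ skew_z)).
apply: (skew_kerM (skew_dp _ _ skew_w)); apply: (skew_ker ep_1 (skew_dp _ _ skew_t)).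
Qed.

Lemma twisted_s : twisted ep (v^-1 * v^-1) s.
Proof.
move=> y; rewrite ep_s; have -> : ep s = 1 by rewrite -[s]mulr1 ep_s ep_1 mulr0 scaler0 add0r.
by rewrite mul1r addrC.
Qed.

Lemma twisted_t : twisted ep (v * v) t.
Proof.
move=> y; rewrite ep_t; have -> : ep t = 0 by apply: skew_ker ep_1 skew_t.
by rewrite mul0r add0r.
Qed.

Lemma twisted_w : twisted ep 1 w.
Proof.
rewrite /b2_w -scaleNr; apply: twistedD; last apply: twistedZ.
  have -> : 1 = v^-1 * v^-1 * (v * v) :> F by field; rewrite ?v0 ?oner_eq0.
  by apply: twistedM; [exact: twisted_s | exact: twisted_t].
have -> : 1 = v * v * (v^-1 * v^-1) :> F by field; rewrite ?v0 ?oner_eq0.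
by apply: twistedM; [exact: twisted_t | exact: twisted_s].
Qed.

Lemma twisted_z : twisted ep (v^-1 * v^-1) z.
Proof.
rewrite /b2_z; apply: twistedZ; rewrite -scaleN1r; apply: twistedD; last apply: twistedZ.
  by rewrite -[X in twisted _ X]mulr1; apply: twistedM; [exact: twisted_s | exact: twisted_w].
by rewrite -[X in twisted _ X]mul1r; apply: twistedM; [exact: twisted_w | exact: twisted_s].
Qed.

Lemma twisted_T k r : twisted ep (v ^+ k.*2 * v ^- r * v ^- r) (T k r).
Proof.
rewrite /b2_T; apply: twisted_sum => b _; apply: twistedZ; rewrite /PB.
case: ifP => [/andP[le1 le2]|_]; last exact: twisted0.
have [u Eu] : exists u, (k + b = r + u)%N by exists (k + b - r)%N; lia.
have E : v ^+ k = v ^+ r * v ^+ u / v ^+ b.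
  by rewrite -exprD -Eu exprD mulfK // vX_neq0.
have -> : v ^+ k.*2 * v ^- r * v ^- r =
  (v * v) ^+ (k + b - r) * 1 ^+ (r - b.*2) * (v^-1 * v^-1) ^+ b.
  rewrite Eu addKn expr1n -!addnn !exprD !exprMn !exprVn E.
  by field; rewrite ?vX_neq0 ?v0.
by do 2?apply: twistedM; apply: twisted_dp ep_1 _;
  [exact: twisted_t | exact: twisted_w | exact: twisted_z].
Qed.

Lemma CXs j : s * C ^+ j = C ^+ j * s.
Proof.
have H := b2_Cs v0 two_neq0 serre_t serre_s.
by elim: j => [|j IH]; rewrite ?expr0 ?mulr1 ?mul1r // exprS mulrA H -mulrA IH mulrA.
Qed.

Lemma CX_dpt j k : C ^+ j * dpl t k = dpl t k * C ^+ j.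
Proof.
have H : C * t = 1 *: (t * C) by rewrite scale1r (b2_Ct v0 two_neq0 serre_t).
have Hd : C * dpl t k = dpl t k * C by rewrite (dp_skew _ k H) expr1n scale1r.
by elim: j => [|j IH]; rewrite ?expr0 ?mulr1 ?mul1r // exprS -mulrA IH mulrA Hd mulrA.
Qed.

Lemma skew_CX j : skew ep 1 (C ^+ j).
Proof.
elim: j => [|j IH]; first by move=> y; rewrite !mul1r scale1r.
by rewrite exprS -[1]mulr1; apply: skewM => //; exact: skew_C.
Qed.

Definition b2_pbw (p : nat * nat * nat * nat) := B3t p.1 * dp s p.2.
Local Notation Btf := b2_pbw.
Definition Ytf (p : nat * nat * nat * nat) := Ycal p.1 * dp s p.2.
Lemma Ytf_cong n m : cong J Ytf Btf (fib4 n m).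
Proof.
move=> [[[u c] b] a] /= [E1 E2]; rewrite /Ytf /Btf /= -mulrBl.
have D : fib3 n (c + b.*2) (u, c, b) by rewrite /fib3 /=; lia.
have := Ycal_cong v0 two_neq0 qn_neq0 qn2_neq0 HS HJ Sv Jv Junit serre_t serre_s D.
apply: (spnE (Q := fun x => spn J Btf (fib4 n m) (x * dp s a))) => [|x y Hx Hy|q e Dq Je].
- by rewrite mul0r; apply: spn0.
- by rewrite mulrDl; apply: spnD.
rewrite -scalerAl; apply: (spn_in Btf (p := (q, a))) => //.
by move: q Dq => [[u' c'] b']; rewrite /fib3 /=; lia.
Qed.

(** [C] commutes with the generators and is fixed by [star], so for given [K] and [j] the elements
    [ka K j r] form one string, whose bottom is fixed by [star]; [rank_one_cong] describes [star] on
    it. *)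
Lemma star_Ytf_cong n m : cong J (star \o Ytf) (Ytf \o psi) (fib4 n m).
Proof.
move=> [[[u c] b] a] /= [E1 E2].
case E0: (par (u, c, b)) => [[K j] r].
have le0 : (r <= K.*2)%N by have := par_le (u, c, b); rewrite E0.
have Ktri : tri K j r = (u, c, b) by have := triK (u, c, b); rewrite E0.
have [D1 D2] := tri_fib j le0; rewrite Ktri /= in D1 D2.
have YE q0 i : Ytf (q0, i) = ka (par q0).1.1 (par q0).1.2 (par q0).2 * dp s i by [].
change (spn J (Ytf \o psi) (fib4 n m) (star (Ytf (u, c, b, a)) - Ytf (psi (u, c, b, a)))).
rewrite (psiE a E0) !YE E0 parK; last by lia.
change (spn J (Ytf \o psi) (fib4 n m) (star (ka K j r * dp s a) -
  ka K j (minn a (K.*2 - r)) * dp s (a + r - minn a (K.*2 - r)))).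
have Hka i : s * ka K j i = (v ^+ K.*2 * v ^- i * v ^- i) *: (ka K j i * s)
                          + qn i.+1 *: ka K j i.+1.
  rewrite /b2_ka -scalerAr mulrA CXs -(mulrA (C ^+ j)) s_T // mulrDr scalerDr -!scalerAr -!scalerAl mulrA.
  by rewrite !scalerA ![sc _ _ _ * _]mulrC.
have Hbig i : (K.*2 < i)%N -> ka K j i = 0.
  by move=> lt; rewrite /b2_ka T_big // mulr0 scaler0.
have H0 : ep (ka K j 0) = 0.
  rewrite /b2_ka linearZ_LR /= T_0 skew_CX; have -> : ep (dpl t K) = 0.
    exact: skew_ker ep_1 (skew_dp _ _ skew_t).
  by rewrite mulr0 !scaler0.
have Htw i : twisted ep (v ^+ K.*2 * v ^- i * v ^- i) (ka K j i).
  rewrite /b2_ka; apply: twistedZ; rewrite -[X in twisted _ X]mul1r; apply: twistedM.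
    move=> y; rewrite skew_CX; have -> : ep (C ^+ j) = 0.
      exact: skew_ker ep_1 (skew_CX j).
    by rewrite mul0r add0r.
  exact: twisted_T.
have Hs0 : star (ka K j 0) = ka K j 0.
  by rewrite /b2_ka linearZ_LR /= T_0 starM star_X star_C star_dpE star_t CX_dpt.
have Hs i : ep (star (ka K j i)) = 0.
  rewrite /b2_ka linearZ_LR /= starM star_X star_C linearZ_LR /=.
  have -> : star (T K i) * C ^+ j = star (C ^+ j * T K i) by rewrite starM star_X star_C.
  rewrite starM star_X star_C /b2_T linear_sum mulr_suml linear_sum /= big1 ?scaler0 // => b' _.
  rewrite linearZ_LR /= -scalerAl linearZ_LR /= /PB; case: ifP => _; last first.
    by rewrite linear0 mul0r linear0 scaler0.
  rewrite /b2_mon !starM !star_dpE star_t -!mulrA (skew_kerM (skew_dp _ _ skew_z)) ?scaler0 //.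
  apply: (skew_kerM (skew_dp _ _ skew_w)); apply: (skew_kerM (skew_dp _ _ skew_t)).
  exact: skew_ker ep_1 (skew_CX j).
have star_dps n' : star (dp s n') = dp s n' by rewrite star_dpE star_s.
have [RX _] := rank_one_cong v0 qn_neq0 HS HJ Sv Jv ep_s ep_1 et_0 et_S ft_E starM star_dps
  Hka Hbig H0 Htw Hs0 Hs (a + r).
have := RX r; rewrite /= addnK => {}RX.
rewrite starM star_dps.
have : spn J (fun r0 : nat => ka K j (minn (a + r - r0) (K.*2 - r0)) *
     dp s (a + r - minn (a + r - r0) (K.*2 - r0)))
   (fun r0 : nat => (r0 <= K.*2)%N /\ (r0 <= a + r)%N)
   (dp s a * star (ka K j r) - ka K j (minn a (K.*2 - r)) *
      dp s (a + r - minn a (K.*2 - r))).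
  by apply: RX; lia.
apply: spnE => [|x y|r0 e [le1 le2] Je]; [exact: spn0 | exact: spnD |].
have -> : ka K j (minn (a + r - r0) (K.*2 - r0)) *
     dp s (a + r - minn (a + r - r0) (K.*2 - r0)) = (Ytf \o psi) (tri K j r0, a + r - r0)%N.
  transitivity (Ytf (psi (tri K j r0, (a + r - r0)%N))); last by [].
  rewrite (psiE _ (parK j le1)) YE parK; last by lia.
  by congr (_ * dp s _); lia.
apply: (spn_in (Ytf \o psi)) => //.
by have := tri_fib j le1; move: (tri K j r0) => [[u' c'] b'] [/= F1 F2]; lia.
Qed.

(** The PBW family is exchanged for the string family, reflected, and exchanged back; finiteness of
    the fibre gives the reversed congruence used first. *)
Lemma star_Btf_cong n m : cong J (star \o Btf) (Btf \o psi) (fib4 n m).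
Proof.
have YB := @Ytf_cong n m.
have BY : cong J Btf Ytf (fib4 n m).
  apply: (cong_sym (s := [seq p <- box4 (n + m).+1 |
     let '(u, c, b, a) := p in (u + c + b == n)%N && (c + b.*2 + a == m)%N])
     HS HJ Junit _ YB).
  move=> [[[u c] b] a]; rewrite mem_filter mem_box4 /fib4; split.
    by move=> [<- <-]; rewrite !eqxx /=; apply/and4P; split; lia.
  by case/andP => /andP[/eqP -> /eqP ->].
have H1 := cong_linear star BY.
have H2 := @star_Ytf_cong n m.
have H3 : cong J (Ytf \o psi) (Btf \o psi) (fib4 n m).
  apply: (cong_relabel (psi := psi) _ _ _ YB) => p Dp; [exact: psiK | exact: psi_fib | exact: psi_fib].
exact (cong_trans HJ (cong_trans HJ H1 H2) H3).
Qed.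
End B2Star.

(** * Type B2: the integral form *)

Section B2Integral.
Variables (F : fieldType) (v : F).
Hypotheses (v0 : v != 0) (two_neq0 : v * v + 1 != 0).
Hypotheses (qn_neq0 : forall n, qn v n.+1 != 0).
Hypotheses (qn2_neq0 : forall n, qn (v * v) n.+1 != 0).
Variable (L : F -> Prop).
Hypotheses (HL : subring_set L) (Lv : L v) (LV : L v^-1).
Variables (U : algType F) (s t : U).

Local Notation qn := (qn v).
Local Notation dp := (dp v).
Local Notation qn2 := (quantum_int (v * v)).
Local Notation dpl := (divided_power (v * v)).
Local Notation w := (b2_w v s t).
Local Notation z := (b2_z v s t).
Local Notation B3 := (b2_mon v s t).
Local Notation T := (b2_T v s t).
Local Notation Btf := (b2_pbw v s t).

Hypothesis serre_t :
  s * t * t - (v * v + v^-1 * v^-1) *: (t * s * t) + t * t * s = 0.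
Hypothesis serre_s :
  s * s * s * t - (v * v + 1 + v^-1 * v^-1) *: (s * s * t * s)
  + (v * v + 1 + v^-1 * v^-1) *: (s * t * s * s) - t * s * s * s = 0.

Let vv0 : v * v != 0. Proof. by rewrite mulf_neq0. Qed.

(** The integral form, graded by the degrees in [t] and [s], so that spanning statements keep track
    of the weight. *)
Inductive b2gen : nat -> nat -> U -> Prop :=
| b2gen_0 n m : b2gen n m 0
| b2gen_1 : b2gen 0 0 1
| b2gen_s k : b2gen 0 k (dp s k)
| b2gen_t k : b2gen k 0 (dpl t k)
| b2gen_D n m x y : b2gen n m x -> b2gen n m y -> b2gen n m (x + y)
| b2gen_M n m n' m' x y : b2gen n m x -> b2gen n' m' y ->
    b2gen (n + n') (m + m') (x * y)
| b2gen_Z n m c x : L c -> b2gen n m x -> b2gen n m (c *: x).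

Lemma b2gen_sum n m (I : Type) (r : seq I) (Q : pred I) (f : I -> U) :
  (forall i, Q i -> b2gen n m (f i)) -> b2gen n m (\sum_(i <- r | Q i) f i).
Proof. by move=> H; apply: (big_ind (b2gen n m)) => //; [exact: b2gen_0 | exact: b2gen_D]. Qed.

Lemma b2gen_cast n m n' m' x : n = n' -> m = m' -> b2gen n m x -> b2gen n' m' x.
Proof. by move=> -> ->. Qed.

Lemma LX n : L (v ^+ n). Proof. exact: ssX. Qed.
Lemma LXV n : L (v ^- n). Proof. by rewrite -exprVn; exact: ssX. Qed.

Lemma b2gen_B n m x y : b2gen n m (x + y) -> b2gen n m x -> b2gen n m y.
Proof.
move=> Hxy Hx; have -> : y = (x + y) + (-1) *: x by rewrite scaleN1r addrAC subrr add0r.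
by apply: b2gen_D => //; apply: b2gen_Z => //; apply: ssN => //; exact: ss1.
Qed.

Lemma ladder_T n k : dp s n * dpl t k =
  \sum_(r < n.+1) ((v ^+ k.*2) ^+ (n - r) * v ^- (r * (n - r))) *: (T k r * dp s (n - r)).
Proof.
have <- : T k 0 = dpl t k by exact: T_0.
by apply: ladder => // r; apply: s_T.
Qed.

(** [T k n] is the last term of [ladder_T], with coefficient 1. The divided powers of [z] and [w]
    are recovered below as the single monomial of [T k k.*2] and as the term [b = 0] of [T k k]. *)
Lemma b2gen_T k n : b2gen k n (T k n).
Proof.
elim/ltn_ind: n => n IH.
have H : b2gen k n (dp s n * dpl t k).
  by apply: b2gen_cast (b2gen_M (b2gen_s n) (b2gen_t k)); rewrite ?addn0.
move: H; rewrite ladder_T big_ord_recr /= subnn muln0 !expr0 invr1 mulr1 scale1r.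
rewrite dp0 mulr1 => H; apply: b2gen_B H _; apply: b2gen_sum => -[r /= lt] _.
apply: b2gen_Z; first by apply: (ssM HL); [rewrite -exprM; exact: LX | exact: LXV].
by apply: b2gen_cast (b2gen_M (IH r lt) (b2gen_s (n - r))); lia.
Qed.

Lemma b2gen_z k : b2gen k k.*2 (dpl z k).
Proof.
have <- : T k k.*2 = dpl z k; last exact: b2gen_T.
have lt : (k < k.*2.+1)%N by lia.
rewrite /b2_T (bigD1 (Ordinal lt)) //= big1 ?addr0 => [|[b /= ltb]].
  rewrite /PB leqnn addnn leqnn subnn /= mul0n double0 expr0 scale1r.
  by rewrite /b2_mon !dp0 !mul1r.
rewrite -val_eqE /= => ne; rewrite /PB ifF ?scaler0 //.
by apply/negbTE/negP => /andP[]; lia.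
Qed.

Lemma b2gen_w k : b2gen k k (dp w k).
Proof.
elim/ltn_ind: k => k IH; have := b2gen_T k k.
rewrite /b2_T (bigD1 ord0) //= /PB double0 addn0 leq0n leqnn subn0 subnn /= mul0n double0.
rewrite expr0 scale1r /b2_mon !dp0 mul1r mulr1 addrC => H; apply: b2gen_B H _.
apply: b2gen_sum => -[b /= lt]; rewrite -val_eqE /= => ne.
apply: b2gen_Z; first exact: LX.
case: ifP => [/andP[le1 le2]|_]; last exact: b2gen_0.
have lt' : (k - b.*2 < k)%N by lia.
apply: b2gen_cast (b2gen_M (b2gen_M (b2gen_t (k + b - k)) (IH _ lt')) (b2gen_z b)); lia.
Qed.

Lemma b2gen_Btf n m p : fib4 n m p -> b2gen n m (Btf p).
Proof.
case: p => [[[u c] b] a] /= [<- <-]; rewrite /b2_pbw /b2_mont /b2_mon /=.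
apply: b2gen_cast (b2gen_M (b2gen_M (b2gen_M (b2gen_t u) (b2gen_w c)) (b2gen_z b)) (b2gen_s a)); lia.
Qed.

Let Lqb m n : L (qb v m n).
Proof.
by apply: (qb_S v0 qn_neq0 HL (ideal_self HL) Lv) => // x Lx; apply: (ssM HL).
Qed.

Let Lqb2 m n : L (qb (v * v) m n).
Proof.
have Lvv : L (v * v) by exact: (ssM HL).
apply: (qb_S vv0 qn2_neq0 HL (ideal_self HL) Lvv) => [x Lx|]; first exact: (ssM HL).
by rewrite invfM; exact: (ssM HL).
Qed.

(** The coefficient of [kb c r], the [r]-th element of the string of [dp w c] under [s]; its factors
    come from [qn r.*2 = (v ^+ r + v ^- r) * qn r]. *)
Fixpoint alw c r := if r is r'.+1
  then alw c r' * (v ^- (c - r) * (v ^+ r + v ^- r)) else 1.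

Lemma alw_L c r : L (alw c r).
Proof.
elim: r => [|r IH] /=; first exact: ss1.
apply: (ssM HL) => //; apply: (ssM HL); first exact: LXV.
by apply: ssD => //; [exact: LX | exact: LXV].
Qed.

Definition kb c r := if (r <= c)%N then alw c r *: (dp w (c - r) * dpl z r) else 0.

Lemma s_kb c r : s * kb c r = (1 * v ^- r * v ^- r) *: (kb c r * s) + qn r.+1 *: kb c r.+1.
Proof.
rewrite /kb; case: (leqP r c) => [le|lt]; last first.
  by rewrite ifF ?mulr0 ?mul0r ?scaler0 ?addr0 //; apply/negbTE; rewrite -ltnNge ltnW.
have E1 : s * dpl z r = (v^-1 * v^-1) ^+ r *: (dpl z r * s).
  by apply: dp_skew; exact: b2_sz.
rewrite -scalerAr mulrA s_dpw // mulrDl -(mulrA _ s) E1 -scalerAr mulrA scalerDr; congr (_ + _).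
  by rewrite -scalerAl !scalerA; congr (_ *: _); rewrite exprMn exprVn; ring.
case Ec : (c - r)%N => [|c'].
  by rewrite mul0r ifF ?scaler0 //; lia.
rewrite ifT; last by lia.
have -> : (c - r.+1)%N = c' by lia.
rewrite -scalerAl -mulrA dpSl // -scalerAr !scalerA; congr (_ *: _).
rewrite /= (_ : (c - r.+1)%N = c'); last by lia.
transitivity (alw c r * v ^- c' * ((v + v^-1) * qn2 r.+1)); first by ring.
by rewrite -qn_double // -addnn qnD //; ring.
Qed.

(** [dp s n] is moved past the power of [t] by the ladder of [T], past the power of [w] by that of
    [kb], and skew-commutes with the power of [z]; the factors are then sorted with integral
    coefficients. *)
Lemma s_Btf n p N M : fib4 N M p -> spn L Btf (fib4 N (n + M)) (dp s n * Btf p).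
Proof.
case: p => [[[u c] b] a] /= [<- <-] {N M}.
have E1 i : dp s i * dpl z b = ((v^-1 * v^-1) ^+ b) ^+ i *: (dpl z b * dp s i).
  by apply: dp_skewl; apply: dp_skew; exact: b2_sz.
have zw i j : dpl z i * dp w j = ((v^-1 * v^-1) ^+ j) ^+ i *: (dp w j * dpl z i).
  by apply: dp_skewl; apply: dp_skew; exact: b2_zw.
have Lc i j : L (((v^-1 * v^-1) ^+ j) ^+ i).
  by do 2?apply: ssX => //; exact: (ssM HL).
have stepB u' c' b' i : spn L Btf
    (fib4 (u' + c' + b' + c + b) (c' + b'.*2 + i + c + b.*2 + a))%N
    (B3 u' c' b' * dp s i * (dp w c * dpl z b * dp s a)).
  have -> : B3 u' c' b' * dp s i * (dp w c * dpl z b * dp s a) =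
     B3 u' c' b' * (dp s i * dp w c) * (dpl z b * dp s a) by rewrite !mulrA.
  have Kb : dp w c = kb c 0 by rewrite /kb /= subn0 dp0 mulr1 scale1r.
  rewrite {1}Kb (ladder v0 qn_neq0 (s_kb c)) mulr_sumr mulr_suml.
  apply: spn_sum => -[h /= lt] _; rewrite expr1n mul1r -scalerAr -scalerAl.
  have [le|gt] := leqP h c; last first.
    by rewrite /kb leqNgt gt /= mul0r mulr0 mul0r scaler0; apply: spn0.
  have -> : B3 u' c' b' * (kb c h * dp s (i - h)) * (dpl z b * dp s a) =
     (alw c h * (((v^-1 * v^-1) ^+ (c - h)) ^+ b') * (((v^-1 * v^-1) ^+ b) ^+ (i - h)) *
      qb v c' (c - h) * qb (v * v) b' h * qb (v * v) (b' + h) b * qb v (i - h) a) *: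
     Btf (u', c' + (c - h), b' + h + b, i - h + a)%N.
    rewrite /kb le -scalerAl -scalerAr -scalerAl.
    have -> : B3 u' c' b' * (dp w (c - h) * dpl z h * dp s (i - h)) * (dpl z b * dp s a) =
       dpl t u' * dp w c' * (dpl z b' * dp w (c - h)) * dpl z h * (dp s (i - h) * dpl z b) * dp s a.
      by rewrite /b2_mon !mulrA.
    have -> : dpl t u' * dp w c' * (dpl z b' * dp w (c - h)) * dpl z h *
        (dp s (i - h) * dpl z b) * dp s a =
       ((((v^-1 * v^-1) ^+ (c - h)) ^+ b') * (((v^-1 * v^-1) ^+ b) ^+ (i - h))) *:
       (dpl t u' * (dp w c' * dp w (c - h)) * (dpl z b' * dpl z h * dpl z b) *
        (dp s (i - h) * dp s a)) by rewrite zw E1; nc F U; ring.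
    rewrite /b2_pbw /b2_mont /b2_mon !dpM // -scalerAl dpM //.
    by rewrite -!(scalerAr, scalerAl) !scalerA; congr (_ *: _); ring.
  rewrite scalerA; apply: spn_in; first by rewrite /fib4; split; lia.
  apply: (ssM HL); last by do 6?[apply: (ssM HL) => //]; exact: alw_L.
  exact: LXV.
have -> : dp s n * Btf (u, c, b, a) = dp s n * dpl t u * (dp w c * dpl z b * dp s a).
  by rewrite /b2_pbw /b2_mont /b2_mon /= !mulrA.
rewrite ladder_T mulr_suml; apply: spn_sum => -[r /= lt] _.
rewrite -scalerAl /b2_T !mulr_suml scaler_sumr; apply: spn_sum => -[b' /= _] _.
rewrite /PB; case: ifP => [/andP[le1 le2]|_]; last first.
  by rewrite scaler0 !mul0r scaler0; apply: spn0.
have := stepB (u + b' - r)%N (r - b'.*2)%N b' (n - r)%N.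
have -> : (u + b' - r + (r - b'.*2) + b' + c + b = u + c + b)%N by lia.
have -> : (r - b'.*2 + b'.*2 + (n - r) + c + b.*2 + a = n + (c + b.*2 + a))%N by lia.
move=> H; rewrite -!scalerAl scalerA; apply: spn_scale H => e Le; apply: (ssM HL) => //.
apply: (ssM HL); last exact: LX.
by apply: (ssM HL); [rewrite -exprM; exact: LX | exact: LXV].
Qed.

Lemma t_Btf n p N M : fib4 N M p -> spn L Btf (fib4 (n + N) M) (dpl t n * Btf p).
Proof.
case: p => [[[u c] b] a] /= [<- <-] {N M}.
rewrite /b2_pbw /b2_mont /b2_mon /= !mulrA dpM // -!scalerAl.
apply: (spn_in Btf (p := (n + u, c, b, a)%N)) => //=.
by split; lia.
Qed.

(** Stability under left multiplication by the generators passes to the whole integral form; applied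
    to 1, it shows that the PBW monomials span this form. *)
Lemma b2gen_mul n m x : b2gen n m x -> forall N M u, spn L Btf (fib4 N M) u ->
  spn L Btf (fib4 (n + N) (m + M)) (x * u).
Proof.
have lin n' m' x' : (forall N M p, fib4 N M p -> spn L Btf (fib4 (n' + N) (m' + M)) (x' * Btf p)) ->
    forall N M u, spn L Btf (fib4 N M) u -> spn L Btf (fib4 (n' + N) (m' + M)) (x' * u).
  move=> H N M u; apply: (spnE (Q := fun u => spn L Btf _ (x' * u))) => [|y y' Hy Hy'|p c Dp Lc].
  - by rewrite mulr0; apply: spn0.
  - by rewrite mulrDr; apply: spnD.
  by rewrite -scalerAr; apply: spn_scale (H _ _ _ Dp) => e Le; apply: (ssM HL).
elim=> {n m x} [n m||k|k|n m x y _ IHx _ IHy|n m n' m' x y _ IHx _ IHy|n m c x Lc _ IH] /=.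
- by move=> N M u _; rewrite mul0r; apply: spn0.
- by move=> N M u; rewrite mul1r.
- by apply: (lin 0%N k) => N M p; exact: s_Btf.
- by apply: (lin k 0%N) => N M p; exact: t_Btf.
- by move=> N M u Hu; rewrite mulrDl; apply: spnD; [exact: IHx | exact: IHy].
- by move=> N M u Hu; rewrite -mulrA -!addnA; apply/IHx/IHy.
move=> N M u Hu; rewrite -scalerAl; apply: spn_scale (IH _ _ _ Hu) => e Le.
exact: (ssM HL).
Qed.

Lemma b2gen_span n m x : b2gen n m x -> spn L Btf (fib4 n m) x.
Proof.
move=> Hx; have B1 : Btf (0, 0, 0, 0)%N = 1 by rewrite /b2_pbw /b2_mont /b2_mon !dp0 !mulr1.
have H1 : spn L Btf (fib4 0 0) 1 by rewrite -B1; apply: spn_gen.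
by have := b2gen_mul Hx H1; rewrite mulr1 !addn0.
Qed.

Variable star : {linear U -> U}.
Hypothesis starM : forall x y, star (x * y) = star y * star x.
Hypothesis star_1 : star 1 = 1.
Hypothesis star_s : star s = s.
Hypothesis star_t : star t = t.

Lemma star_b2gen n m x : b2gen n m x -> b2gen n m (star x).
Proof.
elim=> {n m x} [n m||k|k|n m x y _ IHx _ IHy|n m n' m' x y _ IHx _ IHy|n m c x Lc _ IH].
- by rewrite linear0; apply: b2gen_0.
- by rewrite star_1; apply: b2gen_1.
- by rewrite star_dpE // star_s; apply: b2gen_s.
- by rewrite star_dpE // star_t; apply: b2gen_t.
- by rewrite linearD; apply: b2gen_D.
- by rewrite starM [(n + _)%N]addnC [(m + _)%N]addnC; apply: b2gen_M.
by rewrite linearZ_LR; apply: b2gen_Z.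
Qed.

Lemma star_Btf_span n m p : fib4 n m p -> spn L Btf (fib4 n m) (star (Btf p)).
Proof. by move=> Dp; apply/b2gen_span/star_b2gen/b2gen_Btf. Qed.
End B2Integral.

(** * The coefficient rings *)

(* The rings of scalars are studied over an arbitrary field of fractions [K] of
   the polynomial ring, because reasoning directly in the concrete quotient
   [Qq] makes unification unfold it. *)
Section Scalars.
Variables (K : fieldType) (phi : {rmorphism {poly rat} -> K}).
Hypothesis phi_inj : injective phi.
Hypothesis phi_frac : forall c, exists2 p : {poly rat} * {poly rat},
  p.2 != 0 & c = phi p.1 / phi p.2.

Definition qK := phi 'X.
(** [AK], [LK] and [ZK] are the local ring at [q = 0], the integral Laurent polynomials and the
    integral polynomials. *)
Definition AK (c : K) := exists2 p : {poly rat} * {poly rat},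
  p.2.[0] != 0 & c = phi p.1 / phi p.2.
Definition LK (c : K) := exists (p : {poly int}) (n : nat),
  c = phi (map_poly intr p) / qK ^+ n.
Definition ZK (c : K) := exists p : {poly int}, c = phi (map_poly intr p).
Definition qAK (x : K) := exists2 y, AK y & x = qK * y.
Definition qZK (x : K) := exists2 y, ZK y & x = qK * y.

Lemma phi_neq0 (p : {poly rat}) : p != 0 -> phi p != 0.
Proof. by apply: contraNneq => E; apply/eqP/phi_inj; rewrite E rmorph0. Qed.

Lemma phi_neq00 (p : {poly rat}) : p.[0] != 0 -> phi p != 0.
Proof. by move=> H; apply: phi_neq0; apply: contraNneq H => ->; rewrite horner0. Qed.

Lemma qK_neq0 : qK != 0.
Proof. by apply: phi_neq0; rewrite polyX_eq0. Qed.

Lemma qKX_neq0 n : qK ^+ n != 0.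
Proof. by rewrite expf_neq0 // qK_neq0. Qed.

Lemma qKX_inj m n : qK ^+ m = qK ^+ n -> m = n.
Proof.
rewrite /qK -!rmorphXn => /phi_inj /(congr1 (fun p : {poly rat} => size p)).
by rewrite !size_polyXn => -[].
Qed.

Lemma AK_poly (p : {poly rat}) : AK (phi p).
Proof. by exists (p, 1) => /=; rewrite ?hornerC ?oner_eq0 // rmorph1 divr1. Qed.

Lemma AK_ring : subring_set AK.
Proof.
split.
- by rewrite -(rmorph1 phi); exact: AK_poly.
- move=> _ _ [[a b] /= Hb ->] [[c d] /= Hd ->].
  exists (a * d - c * b, b * d) => /=; first by rewrite hornerM mulf_neq0.
  have [Nb Nd] := (phi_neq00 Hb, phi_neq00 Hd).
  by rewrite rmorphB !rmorphM; field; rewrite Nb Nd.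
move=> _ _ [[a b] /= Hb ->] [[c d] /= Hd ->].
exists (a * c, b * d) => /=; first by rewrite hornerM mulf_neq0.
by rewrite !rmorphM mulf_div.
Qed.

Lemma AK_q : AK qK. Proof. exact: AK_poly. Qed.

Lemma qAK_ideal : ideal_set AK qAK.
Proof. exact (ideal_mul AK_ring AK_q). Qed.

Lemma AK_unit a : qAK a -> (1 - a) != 0 /\ AK (1 - a)^-1.
Proof.
move=> [_ [[b c] /= Hc ->] ->]; have Nc := phi_neq00 Hc.
have Hd : (c - 'X * b).[0] != 0.
  by rewrite hornerD hornerN hornerM hornerX mul0r subr0.
have Nd := phi_neq00 Hd.
have E : 1 - qK * (phi b / phi c) = phi (c - 'X * b) / phi c.
  by rewrite rmorphB rmorphM mulrBl divff // mulrA.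
rewrite E; split; first by rewrite mulf_neq0 ?invr_eq0.
by exists (c, c - 'X * b) => //=; rewrite invf_div.
Qed.

Lemma poly_val0 (p : {poly rat}) : p != 0 ->
  exists n r, r.[0] != 0 /\ p = r * 'X^n.
Proof.
move=> Np; have [n [r Hr ->]] := multiplicity_XsubC p 0; rewrite Np /= in Hr.
by exists n, r; rewrite subr0.
Qed.

Lemma AK_den c : exists n, AK (qK ^+ n * c).
Proof.
have [[a b] /= Nb ->] := phi_frac c.
have [n [r [Hr ->]]] := poly_val0 Nb; exists n, (a, r) => //=.
by rewrite rmorphM rmorphXn -/qK; field; rewrite qKX_neq0 phi_neq00.
Qed.

Lemma AK_inf c : (forall n, exists2 a, AK a & c = qK ^+ n * a) -> c = 0.
Proof.
move=> H; have [[a b] /= Nb Ec] := phi_frac c.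
have [Ea|Na] := eqVneq a 0; first by rewrite Ec Ea rmorph0 mul0r.
have [n [r [Hr Er]]] := poly_val0 Na.
have [_ [[e d] /= Hd ->] E] := H n.+1.
have Nd := phi_neq00 Hd; have Nphib := phi_neq0 Nb.
have : phi (r * d) * qK ^+ n = phi (b * e) * qK * qK ^+ n.
  move: E; rewrite Ec Er !rmorphM rmorphXn -/qK exprS => E.
  transitivity (phi r * qK ^+ n / phi b * phi b * phi d); first by field.
  by rewrite E; field.
move=> /(mulIf (qKX_neq0 n)); rewrite -rmorphM => /phi_inj /(congr1 (fun p => p.[0])).
by rewrite !hornerM hornerX mulr0 => /eqP; rewrite mulf_eq0 (negPf Hr) (negPf Hd).
Qed.

Lemma ZK_ring : subring_set ZK.
Proof.
split.
- by exists 1; rewrite !rmorph1.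
- by move=> _ _ [p ->] [r ->]; exists (p - r); rewrite !rmorphB.
by move=> _ _ [p ->] [r ->]; exists (p * r); rewrite !rmorphM.
Qed.

Lemma ZK_A c : ZK c -> AK c. Proof. by case=> p ->; exact: AK_poly. Qed.

Lemma ZK_L c : ZK c -> LK c.
Proof. by case=> p ->; exists p, 0%N; rewrite expr0 divr1. Qed.

Lemma ZK_q : ZK qK.
Proof. by exists 'X; rewrite map_polyX. Qed.

Lemma qZK_ideal : ideal_set ZK qZK.
Proof. exact (ideal_mul ZK_ring ZK_q). Qed.

Lemma qZK_qA c : qZK c -> qAK c.
Proof. by case=> y Zy ->; exists y => //; exact: ZK_A. Qed.

Lemma LK_pole c : LK c <-> exists n, ZK (qK ^+ n * c).
Proof.
split=> [[p [n ->]]|[n [p E]]].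
  by exists n, p; rewrite mulrC divfK ?qKX_neq0.
by exists p, n; rewrite -E mulrC mulKf ?qKX_neq0.
Qed.

Lemma LK_ring : subring_set LK.
Proof.
split; first exact: ZK_L (ss1 ZK_ring).
  move=> x y /LK_pole [m Zx] /LK_pole [n Zy]; apply/LK_pole; exists (m + n)%N.
  have -> : qK ^+ (m + n) * (x - y) = qK ^+ n * (qK ^+ m * x) - qK ^+ m * (qK ^+ n * y).
    by rewrite exprD; ring.
  by apply: (ssB ZK_ring); apply: (ssM ZK_ring) => //; apply: (ssX ZK_ring); exact: ZK_q.
move=> x y /LK_pole [m Zx] /LK_pole [n Zy]; apply/LK_pole; exists (m + n)%N.
have -> : qK ^+ (m + n) * (x * y) = (qK ^+ m * x) * (qK ^+ n * y).
  by rewrite exprD; ring.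
exact: (ssM ZK_ring).
Qed.

Lemma LK_q : LK qK. Proof. exact: ZK_L ZK_q. Qed.

Lemma LK_qV n : LK (qK ^- n).
Proof. by apply/LK_pole; exists n; rewrite mulfV ?qKX_neq0 //; exact: ss1 ZK_ring. Qed.

Lemma ZK_head c : ZK c -> exists (a : int) c', ZK c' /\ c = a%:~R + qK * c'.
Proof.
case; elim/poly_ind => [|p a _] ->.
  by exists 0, 0; split; [exact: ss0 ZK_ring | rewrite !rmorph0 mulr0 addr0].
exists a, (phi (map_poly intr p)); split; first by exists p.
rewrite rmorphD rmorphM /= map_polyX map_polyC /= rmorphD rmorphM addrC mulrC.
by congr (_ + _); rewrite !rmorph_int.
Qed.

Lemma int_qA (a : int) : qAK a%:~R -> a = 0.
Proof.
case=> _ [[b c] /= Hc ->] E; have Nc := phi_neq00 Hc.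
have : phi (a%:~R * c) = phi ('X * b).
  by rewrite !rmorphM rmorph_int E -/qK -mulrA divfK.
move/phi_inj/(congr1 (fun p => p.[0])); rewrite !hornerM hornerX mul0r.
have -> : (a%:~R : {poly rat}).[0] = a%:~R by rewrite -[a%:~R](rmorph_int polyC) hornerC.
by move=> /eqP; rewrite mulf_eq0 (negPf Hc) orbF intr_eq0 => /eqP.
Qed.

(** A Laurent polynomial regular at 0 is a polynomial: the constant term of [qK ^+ n.+1 * c] is an
    integer divisible by [q] in [AK], so it is 0 and one power of [q] cancels. *)
Lemma LA_Z c : LK c -> AK c -> ZK c.
Proof.
move=> /LK_pole [n]; elim: n c => [|n IH] c; first by rewrite expr0 mul1r.
rewrite exprSr -mulrA => Zc Ac; apply: IH => //.
have [m Em] : exists m, m = n by exists n.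
have [a [c' [Zc' E]]] := ZK_head Zc.
have a0 : a = 0.
  apply: int_qA; have -> : a%:~R = qK ^+ n * (qK * c) - qK * c' by rewrite E addrK.
  exists (qK ^+ n * c - c'); last by ring.
  apply: (ssB AK_ring); last exact: ZK_A.
  by apply: (ssM AK_ring) => //; apply: (ssX AK_ring); exact: AK_q.
move: E; rewrite a0 add0r mulrCA => /(mulfI qK_neq0) -> //.
Qed.

Lemma LqA_qZ c : LK c -> qAK c -> qZK c.
Proof.
move=> Lc [y Ay E]; exists y => //; apply: LA_Z => //.
have -> : y = qK ^- 1 * c by rewrite E expr1 mulKf ?qK_neq0.
by apply: (ssM LK_ring) => //; exact: LK_qV.
Qed.

Lemma qn_neq0K d n : (0 < d)%N -> qn (qK ^+ d) n.+1 != 0.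
Proof.
move=> d0; have E (m : nat) : (0 < m)%N -> (qK ^+ d) ^+ m - (qK ^+ d) ^- m != 0.
  move=> m0; rewrite -exprM subr_eq0; apply/eqP => E.
  have : qK ^+ (d * m + d * m) = qK ^+ 0.
    by rewrite exprD {1}E mulVf ?qKX_neq0 // expr0.
  by move/qKX_inj; nia.
by rewrite qnE mulf_neq0 ?invr_eq0 ?E // -[_ - _](_ : (qK ^+ d) ^+ 1 - (qK ^+ d) ^- 1 = _) ?E ?expr1.
Qed.
End Scalars.

(** * Crystal lattices from PBW-type bases *)

Section FiniteSums.
Variables (K : fieldType) (U : lmodType K) (P : eqType).
Implicit Types (S : K -> Prop) (X : P -> U) (D : P -> Prop) (s : seq P).

Lemma spn_coef S X D s u : S 0 -> (forall x y, S x -> S y -> S (x + y)) ->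
  uniq s -> (forall p, D p -> p \in s) -> spn S X D u ->
  exists c : P -> K, [/\ forall p, S (c p), forall p, c p != 0 -> D p
    & u = \sum_(p <- s) c p *: X p].
Proof.
move=> S0 SD Us Ds; elim=> [|p c w Dp Sc _ [d [Sd Dd ->]]].
  by exists (fun _ => 0); split=> // [p|]; rewrite ?eqxx // big1 // => p _; rewrite scale0r.
exists (fun r => (if r == p then c else 0) + d r); split=> [r|r|].
- by apply: SD => //; case: ifP.
- by case: (eqVneq r p) => [->|_] //; rewrite add0r; exact: Dd.
rewrite (bigD1_seq p (Ds _ Dp) Us) /= [in RHS](bigD1_seq p (Ds _ Dp) Us) /= eqxx.
rewrite scalerDl addrA; congr (_ + _); apply: eq_bigr => r Hr.
by rewrite (negPf Hr) add0r.
Qed.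

End FiniteSums.

Section Crystal.
Variables (K : fieldType) (phi : {rmorphism {poly rat} -> K}).
Hypothesis phi_inj : injective phi.
Hypothesis phi_frac : forall c, exists2 p : {poly rat} * {poly rat},
  p.2 != 0 & c = phi p.1 / phi p.2.

Local Notation q := (qK phi).
Local Notation A := (AK phi).
Local Notation L := (LK phi).
Local Notation Z := (ZK phi).
Local Notation qA := (qAK phi).
Local Notation qZ := (qZK phi).

Let A_ring := AK_ring phi_inj.
Let qA_ideal := qAK_ideal phi_inj.
Let qA_unit := AK_unit phi_inj.

Variables (U : algType K).

Section Independence.
Variables (P : eqType) (s : seq P).

Definition indep (X : P -> U) := forall c : P -> K,
  \sum_(p <- s) c p *: X p = 0 -> forall p, p \in s -> c p = 0.

(* A relation can be rescaled to have coefficients in [A]; if these are then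
   always divisible by [q], infinite descent makes them vanish. *)
Lemma indep_descent (X : P -> U) :
  (forall c : P -> K, (forall p, A (c p)) ->
    \sum_(p <- s) c p *: X p = 0 -> forall p, p \in s -> qA (c p)) -> indep X.
Proof.
move=> H c Ec.
have [n Hn] : exists n, forall p, p \in s -> A (q ^+ n * c p).
  elim: s => [|p r [n IH]]; first by exists 0%N.
  have [m Hm] := AK_den phi_inj phi_frac (c p).
  exists (m + n)%N => p'; rewrite inE => /orP[/eqP ->|pr].
    by rewrite addnC exprD -mulrA; apply: (ssM A_ring) => //; apply: (ssX A_ring); exact: AK_q.
  rewrite exprD -mulrA; apply: (ssM A_ring); last exact: IH.
  by apply: (ssX A_ring); exact: AK_q.
have Hk k : exists2 d : P -> K, (forall p, A (d p)) &
    forall p, p \in s -> q ^+ n * c p = q ^+ k * d p.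
  elim: k => [|k [d Ad Ed]].
    exists (fun p => if p \in s then q ^+ n * c p else 0) => p.
      by case: ifP => [/Hn|_] //; exact: ss0 A_ring.
    by move=> ->; rewrite mul1r.
  have E0 : \sum_(p <- s) d p *: X p = 0.
    apply: (scalerI (qKX_neq0 phi_inj k)); rewrite scaler0 scaler_sumr.
    rewrite (eq_big_seq (fun p => q ^+ n *: (c p *: X p))) => [|p ps].
      by rewrite -scaler_sumr Ec scaler0.
    by rewrite !scalerA -Ed.
  exists (fun p => if p \in s then q^-1 * d p else 0) => p.
    case: ifP => [ps|_]; last exact: ss0 A_ring.
    by have [y Ay ->] := H d Ad E0 p ps; rewrite mulKf // (qK_neq0 phi_inj).
  by move=> ps; rewrite ps Ed // exprSr -mulrA mulVKf // (qK_neq0 phi_inj).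
move=> p ps; have : q ^+ n * c p = 0.
  apply: (AK_inf phi_inj phi_frac) => k; have [d Ad Ed] := Hk k.
  by exists (d p) => //; exact: Ed.
by move/eqP; rewrite mulf_eq0 (negPf (qKX_neq0 phi_inj n)) => /eqP.
Qed.

Lemma indep_cong (X Y : P -> U) : uniq s ->
  cong qA X Y (fun p => p \in s) -> indep Y -> indep X.
Proof.
move=> Us XY HY; apply: indep_descent => c Ac Ec p ps.
have H : spn qA Y (fun p => p \in s) (\sum_(r <- s) c r *: (X r - Y r)).
  rewrite big_seq; apply: spn_sum => r rs.
  by apply: spn_scale (XY r rs) => a; apply: (isM qA_ideal).
have [d [Sd _ Ed]] := spn_coef (is0 qA_ideal) (@isD _ _ _ qA_ideal) Us (fun _ => id) H.
have := HY (fun r => c r + d r) _ p ps.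
have -> : \sum_(r <- s) (c r + d r) *: Y r = 0.
  rewrite -[RHS]Ec (eq_bigr (fun r => c r *: Y r + d r *: Y r)) => [|r _]; last by rewrite scalerDl.
  rewrite big_split /= -Ed -big_split /=; apply: eq_bigr => r _.
  by rewrite -scalerDr addrC subrK.
move=> /(_ erefl) /eqP; rewrite addr_eq0 => /eqP ->.
have -> : - d p = -1 * d p by rewrite mulN1r.
by apply: (isM qA_ideal) => //; apply: (ssN A_ring); exact: (ss1 A_ring).
Qed.

Lemma spn_indep (X : P -> U) S1 S2 D1 D2 u : uniq s -> indep X ->
  S1 0 -> (forall x y, S1 x -> S1 y -> S1 (x + y)) ->
  S2 0 -> (forall x y, S2 x -> S2 y -> S2 (x + y)) ->
  (forall p, D1 p -> p \in s) -> (forall p, D2 p -> p \in s) ->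
  spn S1 X D1 u -> spn S2 X D2 u ->
  spn (fun c => S1 c /\ S2 c) X (fun p => D1 p /\ D2 p) u.
Proof.
move=> Us HX S10 S1D S20 S2D Hs1 Hs2 H1 H2.
have [c [Sc Dc Ec]] := spn_coef S10 S1D Us Hs1 H1.
have [d [Sd Dd Ed]] := spn_coef S20 S2D Us Hs2 H2.
have E p : p \in s -> c p = d p.
  move=> ps; apply/eqP; rewrite -subr_eq0; apply/eqP.
  apply: (HX (fun r => c r - d r)) => //.
  rewrite (eq_bigr (fun r => c r *: X r - d r *: X r)) => [|r _]; last by rewrite scalerBl.
  by rewrite big_split /= sumrN -Ec -Ed subrr.
rewrite Ec big_seq; apply: spn_sum => p ps.
have [->|N0] := eqVneq (c p) 0; first by rewrite scale0r; exact: spn0.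
by apply: spn_in; split=> //; [exact: Dc | apply: Dd; rewrite -E | rewrite E].
Qed.
End Independence.
End Crystal.

(** [cr_fib] is equality of weights, and [cr_upto] lists the elements of bounded height. For each
    side and index, [cr_eps] counts how often the index can be split off, [cr_base] splits it off
    completely and [cr_up] puts it back; all these maps are total. *)
Record crystal (I P : Type) := Crystal {
  cr_fib : rel P;
  cr_ht : P -> nat;
  cr_upto : nat -> seq P;
  cr_p0 : P;
  cr_eps : bool -> I -> P -> nat;
  cr_base : bool -> I -> P -> P;
  cr_up : bool -> I -> nat -> P -> P }.

(* The boolean distinguishes the crystal structure attached to left
   multiplication by [f_i] ([true]) from the one attached to right
   multiplication ([false]). *)
Record is_crystal (I : Type) (P : eqType) (C : crystal I P) : Prop := IsCrystal {
  fib_refl : forall p, cr_fib C p p;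
  fib_sym : forall p r, cr_fib C p r = cr_fib C r p;
  fib_trans : forall p r s, cr_fib C p r -> cr_fib C r s -> cr_fib C p s;
  fib_ht : forall p r, cr_fib C p r -> cr_ht C p = cr_ht C r;
  upto_uniq : forall N, uniq (cr_upto C N);
  mem_upto : forall N p, (p \in cr_upto C N) = (cr_ht C p <= N)%N;
  ht_eq0 : forall p, (cr_ht C p == 0%N) = (p == cr_p0 C);
  eps_base : forall h i p, cr_eps C h i (cr_base C h i p) = 0%N;
  up_base : forall h i p, cr_up C h i (cr_eps C h i p) (cr_base C h i p) = p;
  eps_up : forall h i n p, cr_eps C h i (cr_up C h i n p) = (n + cr_eps C h i p)%N;
  base_up : forall h i n p, cr_base C h i (cr_up C h i n p) = cr_base C h i p;
  up_up : forall h i m n p, cr_up C h i m (cr_up C h i n p) = cr_up C h i (m + n) p;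
  fib_up : forall h i n p r, cr_fib C (cr_up C h i n p) (cr_up C h i n r) = cr_fib C p r;
  ht_up : forall h i n p, cr_ht C (cr_up C h i n p) = (n + cr_ht C p)%N;
  eps_pos : forall p, p != cr_p0 C -> exists i, (0 < cr_eps C true i p)%N;
  eps_sep : forall p r, p != cr_p0 C -> cr_fib C p r ->
    ~ (forall h i, (0 < cr_eps C h i p)%N -> (cr_eps C h i p < cr_eps C h i r)%N) }.

Section Model.
Variables (K : fieldType) (phi : {rmorphism {poly rat} -> K}).

Section Form.
Variables (I : Type) (U : algType K) (f : I -> U) (d : I -> nat).

Definition dpf i n := dp (qK phi ^+ d i) (f i) n.

Definition act (h : bool) i n (u : U) := if h then dpf i n * u else u * dpf i n.

Lemma act_linear h i n : linear (act h i n).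
Proof.
by move=> a u w; rewrite /act; case: h; rewrite ?mulrDr ?mulrDl -?scalerAr -?scalerAl.
Qed.

HB.instance Definition _ h i n :=
  GRing.isLinear.Build K U U *:%R (act h i n) (act_linear h i n).

Inductive zform : U -> Prop :=
| zf_dp i n : zform (dpf i n)
| zf_1 : zform 1
| zf_D x y : zform x -> zform y -> zform (x + y)
| zf_M x y : zform x -> zform y -> zform (x * y)
| zf_Z c x : LK phi c -> zform x -> zform (c *: x).
End Form.

(** [Bh h i] is the family on which divided powers of [f i] act freely from side [h]. It is
    congruent to [B] modulo [q] over the local ring and spans the same Laurent module; together
    these give congruence over the integral polynomials, in [Bh_qZ] and [B_qZ]. *)
Record pbw_model (I : Type) (P : eqType) (C : crystal I P) (U : algType K)
    (f : I -> U) (d : I -> nat) (B : P -> U) (Bh : bool -> I -> P -> U) : Prop := PbwModel {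
  pm_d : forall i, (0 < d i)%N;
  pm_cong : forall h i p, spn (qAK phi) B (cr_fib C p) (Bh h i p - B p);
  pm_L1 : forall h i p, spn (LK phi) B (cr_fib C p) (Bh h i p);
  pm_L2 : forall h i p, spn (LK phi) (Bh h i) (cr_fib C p) (B p);
  pm_up : forall h i n p, cr_eps C h i p = 0%N ->
    Bh h i (cr_up C h i n p) = act f d h i n (Bh h i p);
  pm_1 : B (cr_p0 C) = 1;
  pm_Z : forall p, zform f d (B p) }.

Hypothesis phi_inj : injective phi.
Hypothesis phi_frac : forall c, exists2 p : {poly rat} * {poly rat},
  p.2 != 0 & c = phi p.1 / phi p.2.

Local Notation q := (qK phi).
Local Notation A := (AK phi).
Local Notation L := (LK phi).
Local Notation Z := (ZK phi).
Local Notation qA := (qAK phi).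
Local Notation qZ := (qZK phi).

Let A_ring := AK_ring phi_inj.
Let qA_ideal := qAK_ideal phi_inj.
Let qA_unit := AK_unit phi_inj.

Variables (I : Type) (P : eqType) (C : crystal I P) (HC : is_crystal C).
Variables (U : algType K) (f : I -> U) (d : I -> nat).
Variables (B : P -> U) (Bh : bool -> I -> P -> U).
Hypothesis HM : pbw_model C f d B Bh.

Local Notation fib := (cr_fib C).
Local Notation ht := (cr_ht C).
Local Notation upto := (cr_upto C).
Local Notation p0 := (cr_p0 C).
Local Notation eps := (cr_eps C).
Local Notation base := (cr_base C).
Local Notation up := (cr_up C).

Variables (e : I -> U -> U) (et ft : I -> {linear U -> U}) (eta : {linear U -> K^o}).
Hypothesis e_Bh : forall i p, eps true i p = 0%N -> e i (Bh true i p) = 0.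
Hypothesis et_0 : forall i u, e i u = 0 -> et i u = 0.
Hypothesis et_S : forall i u n, e i u = 0 -> et i (dpf f d i n.+1 * u) = dpf f d i n * u.
Hypothesis ft_E : forall i u n, e i u = 0 -> ft i (dpf f d i n * u) = dpf f d i n.+1 * u.
Hypothesis eta_1 : eta 1 = 1.
Hypothesis eta_B : forall p, p != p0 -> eta (B p) = 0.

Definition fibs p := [seq r <- upto (ht p) | fib p r].

Lemma mem_fibs p r : fib p r <-> r \in fibs p.
Proof.
rewrite mem_filter (mem_upto HC); split=> [H|/andP[] //].
by rewrite H (fib_ht HC H) leqnn.
Qed.

Lemma Bh_B_ht h i N : cong qA (Bh h i) B (fun p => (ht p <= N)%N).
Proof. by move=> p Hp; apply: spnW (pm_cong HM h i p) => // r /(fib_ht HC) <-. Qed.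

Lemma B_Bh_ht h i N : cong qA B (Bh h i) (fun p => (ht p <= N)%N).
Proof.
apply: (cong_sym (s := upto N) A_ring qA_ideal qA_unit _ (@Bh_B_ht h i N)) => p.
by rewrite (mem_upto HC).
Qed.

Lemma up0 h i p : up h i 0 p = p.
Proof. by rewrite -{1}(up_base HC h i p) (up_up HC) (up_base HC). Qed.

Lemma ft_Bh i p : ft i (Bh true i p) = Bh true i (up true i 1 p).
Proof.
rewrite -{1}(up_base HC true i p) (pm_up HM) ?(eps_base HC) //.
rewrite /act ft_E ?e_Bh ?(eps_base HC) // -[X in _ = Bh _ _ (up _ _ _ X)](up_base HC true i p).
by rewrite (up_up HC) add1n (pm_up HM) ?(eps_base HC).
Qed.

Lemma et_Bh0 i p : eps true i p = 0%N -> et i (Bh true i p) = 0.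
Proof. by move=> H; apply: et_0; apply: e_Bh. Qed.

Lemma et_BhS i p : et i (Bh true i (up true i 1 p)) = Bh true i p.
Proof.
rewrite -{1}(up_base HC true i p) (up_up HC) add1n (pm_up HM) ?(eps_base HC) //.
rewrite /act et_S ?e_Bh ?(eps_base HC) // -[in RHS](up_base HC true i p).
by rewrite (pm_up HM) ?(eps_base HC).
Qed.

Lemma A_Bh h i N p : (ht p <= N)%N -> spn A B (fun r => (ht r <= N)%N) (Bh h i p).
Proof. exact: (cong_span A_ring qA_ideal (@Bh_B_ht h i N)). Qed.

Lemma ft_B i N p : (ht p <= N)%N ->
  spn qA B (fun r => (ht r <= N.+1)%N) (ft i (B p) - B (up true i 1 p)).
Proof.
move=> Hp; have Hup r : (ht r <= N)%N -> (ht (up true i 1 r) <= N.+1)%N.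
  by rewrite (ht_up HC).
have -> : ft i (B p) - B (up true i 1 p) = ft i (B p - Bh true i p)
    + (Bh true i (up true i 1 p) - B (up true i 1 p)).
  by rewrite linearB /= ft_Bh addrA subrK.
apply: spnD; last exact: Bh_B_ht (Hup _ Hp).
apply: (spnE (Q := fun u => spn qA B _ (ft i u))) (B_Bh_ht true i Hp) => [|u w|r c Hr qc].
- by rewrite linear0; exact: spn0.
- by rewrite linearD; exact: spnD.
rewrite linearZ /= ft_Bh; apply: spn_scale (A_Bh true i (Hup _ Hr)) => a Aa.
by rewrite mulrC; apply: (isM qA_ideal).
Qed.

Lemma et_span i N u : spn qA (Bh true i) (fun r => (ht r <= N.+1)%N) u ->
  spn qA B (fun r => (ht r <= N)%N) (et i u).
Proof.
apply: (spnE (Q := fun u => spn qA B _ (et i u))) => [|v w|r c Hr qc].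
- by rewrite linear0; exact: spn0.
- by rewrite linearD; exact: spnD.
rewrite linearZ /=; case E : (eps true i r) => [|n].
  by rewrite et_Bh0 // scaler0; exact: spn0.
have Er : r = up true i 1 (up true i n (base true i r)).
  by rewrite (up_up HC) add1n -E (up_base HC).
rewrite Er et_BhS.
apply: spn_scale (A_Bh (N := N) true i _) => [a Aa|].
  by rewrite mulrC; apply: (isM qA_ideal).
by move: Hr; rewrite {1}Er (ht_up HC).
Qed.

Lemma et_B0 i N p : (ht p <= N.+1)%N -> eps true i p = 0%N ->
  spn qA B (fun r => (ht r <= N)%N) (et i (B p)).
Proof.
move=> Hp Ep; have := et_span (B_Bh_ht true i Hp).
by rewrite linearB /= et_Bh0 // subr0.
Qed.

Lemma et_BS i N p : (ht p <= N)%N ->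
  spn qA B (fun r => (ht r <= N)%N) (et i (B (up true i 1 p)) - B p).
Proof.
move=> Hp; have Hp1 : (ht (up true i 1 p) <= N.+1)%N by rewrite (ht_up HC).
have := spnD (et_span (B_Bh_ht true i Hp1)) (Bh_B_ht true i Hp).
by rewrite linearB /= et_BhS addrA subrK.
Qed.

Lemma upto_up i N : perm_eq [seq p <- upto N.+1 | (0 < eps true i p)%N]
  [seq up true i 1 p | p <- upto N].
Proof.
have upI : injective (up true i 1).
  move=> p r E; rewrite -(up_base HC true i p) -(up_base HC true i r).
  rewrite -(base_up HC true i 1 p) -(base_up HC true i 1 r) E; congr (up _ _ _ _).
  by have := congr1 (eps true i) E; rewrite !(eps_up HC) => /addnI.
apply: uniq_perm; [exact: filter_uniq (upto_uniq HC _) | |].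
  by rewrite map_inj_uniq ?(upto_uniq HC).
move=> p; rewrite mem_filter (mem_upto HC); apply/andP/mapP => [[Ep Hp]|[r]].
  have E : p = up true i 1 (up true i (eps true i p).-1 (base true i p)).
    by rewrite (up_up HC) add1n prednK // (up_base HC).
  eexists; last exact: E.
  by rewrite (mem_upto HC); move: Hp; rewrite {1}E (ht_up HC).
by rewrite (mem_upto HC) => Hr ->; rewrite (eps_up HC) (ht_up HC).
Qed.

(** Applying [et i] turns a relation into one of smaller height modulo [q], so by induction every
    coefficient at an element with positive [eps] lies in [qA]. Only [p0] escapes; [eta] isolates
    its coefficient. Descent then finishes. *)
Lemma B_indep N : indep (upto N) B.
Proof.
have spn_qA M c u : A c -> spn qA B (fun r => (ht r <= M)%N) u ->
    spn qA B (fun r => (ht r <= M)%N) (c *: u).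
  by move=> Ac Hu; apply: spn_scale Hu => b; apply: (isM qA_ideal).
elim: N => [|N IH]; apply: (indep_descent phi_inj phi_frac) => c Ac Ec.
  move=> p ps; have Ep r : r \in upto 0 -> r = p0.
    by rewrite (mem_upto HC) leqn0 (ht_eq0 HC) => /eqP.
  move/(congr1 eta): Ec; rewrite linear_sum linear0 (bigD1_seq p) ?(upto_uniq HC) //=.
  rewrite big_seq_cond big1 => [|r /andP[/Ep -> ]]; last by rewrite (Ep _ ps) eqxx.
  rewrite addr0 (Ep _ ps) linearZ /= (pm_1 HM) eta_1 /= => E.
  have -> : c p0 = 0 by rewrite -[LHS]mulr1.
  exact: (is0 qA_ideal).
have main i p : (ht p <= N)%N -> qA (c (up true i 1 p)).
  move=> Hp; have : spn qA B (fun r => r \in upto N) (\sum_(r <- upto N) c (up true i 1 r) *: B r).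
    have E0 : \sum_(r <- upto N.+1) c r *: et i (B r) = 0.
      move/(congr1 (et i)): Ec; rewrite linear_sum linear0 => {2}<-.
      by apply: eq_bigr => r _; rewrite linearZ.
    have E1 : \sum_(r <- upto N.+1 | (0 < eps true i r)%N) c r *: et i (B r) =
        \sum_(r <- upto N) c (up true i 1 r) *: et i (B (up true i 1 r)).
      by rewrite -big_filter (perm_big _ (upto_up i N)) big_map.
    move: E0; rewrite (bigID (fun r => (0 < eps true i r)%N)) /= E1 => E0.
    have -> : \sum_(r <- upto N) c (up true i 1 r) *: B r =
        - \sum_(r <- upto N) c (up true i 1 r) *: (et i (B (up true i 1 r)) - B r)
        - \sum_(r <- upto N.+1 | ~~ (0 < eps true i r)%N) c r *: et i (B r).
      rewrite -opprD -[LHS]opprK; congr (- _); move/eqP: E0; rewrite addr_eq0 => /eqP E0.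
      rewrite -[X in _ + X]opprK -E0 -sumrB -sumrN; apply: eq_bigr => r _.
      by rewrite -scalerBr addrAC subrr add0r scalerN.
    apply: (spnW (S := qA) (D := fun r => (ht r <= N)%N)) => // [r|]; first by rewrite (mem_upto HC).
    apply: spnD; apply: (spnN A_ring qA_ideal).
      rewrite big_seq; apply: spn_sum => r; rewrite (mem_upto HC) => Hr.
      by apply: (spn_qA) => //; apply: et_BS.
    rewrite big_seq_cond; apply: spn_sum => r /andP[]; rewrite (mem_upto HC) -eqn0Ngt => Hr /eqP Er.
    by apply: (spn_qA) => //; apply: et_B0.
  move=> /(spn_coef (is0 qA_ideal) (@isD _ _ _ qA_ideal) (upto_uniq HC N) (fun _ => id)) [b [Sb _ Eb]].
  have E : \sum_(r <- upto N) (c (up true i 1 r) - b r) *: B r = 0.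
    rewrite (eq_bigr (fun r => c (up true i 1 r) *: B r - b r *: B r)) => [|r _].
      by rewrite sumrB -Eb subrr.
    by rewrite scalerBl.
  have := IH _ E p; rewrite (mem_upto HC) => /(_ Hp) /eqP.
  by rewrite subr_eq0 => /eqP ->.
have nz p : p \in upto N.+1 -> p != p0 -> qA (c p).
  move=> ps /(eps_pos HC) [i Hi].
  have E : p = up true i 1 (up true i (eps true i p).-1 (base true i p)).
    by rewrite (up_up HC) add1n prednK // (up_base HC).
  by rewrite E; apply: main; move: ps; rewrite (mem_upto HC) {1}E (ht_up HC).
move=> p ps; have [->|] := eqVneq p p0; last exact: nz.
have p0s : p0 \in upto N.+1 by rewrite (mem_upto HC) (eqP (etrans (ht_eq0 HC p0) (eqxx _))).
move/(congr1 eta): Ec; rewrite linear_sum linear0 (bigD1_seq p0) ?(upto_uniq HC) //=.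
rewrite big1 => [|r Hr]; last by rewrite linearZ /= eta_B // scaler0.
rewrite addr0 linearZ /= (pm_1 HM) eta_1 => E.
have -> : c p0 = 0 by rewrite -[LHS]mulr1.
exact: (is0 qA_ideal).
Qed.

Definition ftstr (s : seq I) : U := foldr (fun i => ft i) 1 s.
Definition pstr (s : seq I) : P := foldr (fun i => up true i 1) p0 s.

Lemma ht_pstr s : ht (pstr s) = size s.
Proof.
elim: s => [|i s IH] /=; last by rewrite (ht_up HC) IH.
by apply/eqP; rewrite (ht_eq0 HC).
Qed.

Lemma pstr_surj p : exists s, pstr s = p.
Proof.
have [n le_n] := ubnP (ht p); elim: n => // n IH in p le_n *.
have [->|Np] := eqVneq p p0; first by exists [::].
have [i Hi] := eps_pos HC Np.
have E : p = up true i 1 (up true i (eps true i p).-1 (base true i p)).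
  by rewrite (up_up HC) add1n prednK // (up_base HC).
have [|s Es] := IH (up true i (eps true i p).-1 (base true i p)).
  by move: le_n; rewrite {1}E (ht_up HC); lia.
by exists (i :: s); rewrite /= Es -E.
Qed.

Lemma ftstr_B s : spn qA B (fun r => (ht r <= size s)%N) (ftstr s - B (pstr s)).
Proof.
elim: s => [|i s IH] /=; first by rewrite (pm_1 HM) subrr; exact: spn0.
have -> : ft i (ftstr s) - B (up true i 1 (pstr s)) =
    ft i (ftstr s - B (pstr s)) + (ft i (B (pstr s)) - B (up true i 1 (pstr s))).
  by rewrite linearB /= addrA subrK.
apply: spnD; last by apply: ft_B; rewrite ht_pstr.
apply: spn_lin IH => r c Hr qc; apply: (@spn_scale _ _ _ A) => [a Aa|].
  by rewrite mulrC; apply: (isM qA_ideal).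
rewrite -[ft i (B r)](subrK (B (up true i 1 r))); apply: spnD.
  by apply: spnW (ft_B i Hr) => // a; apply: (is_sub qA_ideal).
by apply: (spn_gen _ A_ring); rewrite (ht_up HC).
Qed.

(** Strings of Kashiwara operators equal PBW elements modulo [q]; for bounded height, Nakayama's
    lemma therefore puts [B] in the lattice that they generate. *)
Lemma spn_ftstr u : spn A ftstr (fun _ => True) u <-> spn A B (fun _ => True) u.
Proof.
split; apply: (spn_trans (@ssM _ _ A_ring)) => p _.
  rewrite -[ftstr p](subrK (B (pstr p))); apply: spnD; last exact: (spn_gen _ A_ring).
  by apply: spnW (ftstr_B p) => // a; apply: (is_sub qA_ideal).
have : p \in upto (ht p) by rewrite (mem_upto HC).
move: (ht p) => N; move: p.
apply: (nakayama (N := spn A ftstr (fun _ => True)) A_ring qA_ideal qA_unit); first exact: spn0.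
- by move=> x y; exact: spnD.
- by move=> a x Aa; apply: spn_scale => b; apply: (ssM A_ring).
move=> r; rewrite (mem_upto HC) => Hr; have [s Es] := pstr_surj r.
exists (ftstr s); first exact: (spn_gen _ A_ring).
rewrite -opprB; apply: (spnN A_ring qA_ideal); rewrite -Es.
by apply: spnW (ftstr_B s) => // x; rewrite (mem_upto HC) -ht_pstr Es => /leq_trans; exact.
Qed.

Lemma ft_span i u : spn A B (fun _ => True) u -> spn A B (fun _ => True) (ft i u).
Proof.
apply: spn_lin => p c _ Ac; apply: (@spn_scale _ _ _ A) => [a Aa|]; first exact: (ssM A_ring).
rewrite -[ft i (B p)](subrK (B (up true i 1 p))); apply: spnD; last exact: (spn_gen _ A_ring).
by apply: spnW (ft_B i (leqnn (ht p))) => // a; apply: (is_sub qA_ideal).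
Qed.

Let v0 i : q ^+ d i != 0. Proof. exact: qKX_neq0. Qed.
Let vn i n : qn (q ^+ d i) n.+1 != 0. Proof. exact: (qn_neq0K phi_inj _ (pm_d HM i)). Qed.

Lemma act_Bh h i n p :
  act f d h i n (Bh h i p) = qb (q ^+ d i) n (eps h i p) *: Bh h i (up h i n p).
Proof.
rewrite -[X in Bh h i X](up_base HC h i p) (pm_up HM) ?(eps_base HC) //.
rewrite -[X in _ = _ *: Bh h i (up h i n X)](up_base HC h i p) (up_up HC) (pm_up HM) ?(eps_base HC) //.
rewrite /act /dpf; case: h; first by rewrite mulrA dpM // -scalerAl.
by rewrite -mulrA dpM // -scalerAr qbC // addnC.
Qed.

Lemma qb_L i m n : L (qb (q ^+ d i) m n).
Proof.
have L_ring := LK_ring phi_inj.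
have Lq : L (q ^+ d i) by apply: (ssX L_ring); exact: LK_q.
apply: (qb_S (J := L) (v0 i) (@vn i) L_ring (ideal_self L_ring) Lq); last exact: LK_qV.
by move=> c Lc; apply: (ssM L_ring).
Qed.

Let L_ring := LK_ring phi_inj.
Let Z_ring := ZK_ring phi.
Let qZ_ideal := qZK_ideal phi.

Lemma L_act h i n p u : spn L B (fib p) u ->
  spn L B (fib (up h i n p)) (act f d h i n u).
Proof.
apply: spn_lin => r c pr Lc; apply: (@spn_scale _ _ _ L) => [a La|]; first exact: (ssM L_ring).
apply: spn_lin (pm_L2 HM h i r) => x a rx La.
rewrite /= act_Bh scalerA; apply: (@spn_scale _ _ _ L) => [b Lb|].
  by apply: (ssM L_ring) => //; apply: (ssM L_ring) => //; exact: qb_L.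
apply: spnW (pm_L1 HM h i (up h i n x)) => // y; apply: (fib_trans HC).
by rewrite (fib_up HC); apply: (fib_trans HC) rx.
Qed.

(** Left multiplication by the integral form does not lower heights, which later allows the regular
    representation to be cut off. *)
Lemma zform_ge u k w : zform f d u ->
  spn L B (fun r => (k <= ht r)%N) w -> spn L B (fun r => (k <= ht r)%N) (u * w).
Proof.
move=> Zu; elim: Zu w => [i n|w|x y _ IHx _ IHy w Hw|x y _ IHx _ IHy w Hw|c x Lc _ IH w Hw].
- move=> w; rewrite -/(act f d true i n w).
  apply: spn_lin => r c kr Lc; apply: (@spn_scale _ _ _ L) => [a La|]; first exact: (ssM L_ring).
  apply: spnW (L_act true i n (spn_gen B L_ring (fib_refl HC r))) => // x /(fib_ht HC) <-.
  by rewrite (ht_up HC) (leq_trans kr) // leq_addl.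
- by rewrite mul1r.
- by rewrite mulrDl; apply: spnD; auto.
- by rewrite -mulrA; auto.
by rewrite -scalerAl; apply: spn_scale (IH _ Hw) => a; apply: (ssM L_ring).
Qed.

Lemma spn_bound (S : K -> Prop) (X : P -> U) D u : spn S X D u ->
  exists N, spn S X (fun r => D r /\ (ht r <= N)%N) u.
Proof.
elim=> [|p c w Dp Sc _ [N HN]]; first by exists 0%N; exact: spn0.
exists (maxn (ht p) N); apply: spnS => //; first by rewrite leq_maxl.
by apply: spnW HN => // r [Dr Hr]; rewrite leq_max Hr orbT.
Qed.

Lemma zform_span u : zform f d u -> spn L B (fun _ => True) u.
Proof.
move=> Zu; rewrite -[u]mulr1; apply: (spnW (S := L) (D := fun r => (0 <= ht r)%N)) => //.
by apply: zform_ge => //; rewrite -(pm_1 HM); apply: (spn_gen _ L_ring).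
Qed.

Lemma spn_LqA N (X : P -> U) D1 D2 u : indep (upto N) X ->
  (forall p, D1 p -> (ht p <= N)%N) -> (forall p, D2 p -> (ht p <= N)%N) ->
  spn L X D1 u -> spn qA X D2 u -> spn qZ X (fun p => D1 p /\ D2 p) u.
Proof.
move=> IX H1 H2 SL SA.
have := spn_indep (upto_uniq HC N) IX (ss0 L_ring) (@ssD _ _ L_ring)
  (is0 qA_ideal) (@isD _ _ _ qA_ideal) _ _ SL SA.
move=> H; apply: spnW (H _ _) => // [c []|p|p]; rewrite ?(mem_upto HC); auto.
exact: LqA_qZ.
Qed.

Lemma Bh_indep h i N : indep (upto N) (Bh h i).
Proof.
apply: (indep_cong phi_inj phi_frac (upto_uniq HC N) _ (@B_indep N)) => p.
rewrite (mem_upto HC) => Hp.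
by apply: spnW (Bh_B_ht h i Hp) => // r; rewrite (mem_upto HC).
Qed.

Lemma fib_le p r : fib p r -> (ht r <= ht p)%N.
Proof. by move/(fib_ht HC) ->. Qed.

Lemma Bh_qZ h i p : spn qZ B (fib p) (Bh h i p - B p).
Proof.
have H : spn L B (fib p) (Bh h i p - B p).
  by apply: (spnB L_ring); [exact: (pm_L1 HM) | apply: (spn_gen _ L_ring); exact: (fib_refl HC)].
apply: spnW (spn_LqA (@B_indep (ht p)) _ _ H (pm_cong HM h i p)) => // r; last exact: fib_le.
- by case.
- exact: fib_le.
Qed.

Lemma B_qZ h i p : spn qZ (Bh h i) (fib p) (B p - Bh h i p).
Proof.
have H : spn L (Bh h i) (fib p) (B p - Bh h i p).
  by apply: (spnB L_ring); [exact: (pm_L2 HM) | apply: (spn_gen _ L_ring); exact: (fib_refl HC)].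
have H' : spn qA (Bh h i) (fib p) (B p - Bh h i p).
  have Hc : cong qA (Bh h i) B (fib p).
    move=> r pr; apply: spnW (pm_cong HM h i r) => // x; exact: (fib_trans HC).
  exact: (cong_sym A_ring qA_ideal qA_unit (mem_fibs p) Hc (fib_refl HC p)).
apply: spnW (spn_LqA (@Bh_indep h i (ht p)) _ _ H H') => // r; last exact: fib_le.
- by case.
- exact: fib_le.
Qed.

Lemma qZ_change (X Y : P -> U) p u : (forall r, spn qZ Y (fib r) (X r - Y r)) ->
  spn qZ X (fib p) u -> spn qZ Y (fib p) u.
Proof.
move=> H; apply: (@spn_trans _ _ _ _ qZ Z) => [a b qa Zb|r pr].
  by rewrite mulrC; apply: (isM qZ_ideal).
rewrite -[X r](subrK (Y r)); apply: spnD; last by apply: (spn_gen _ Z_ring).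
by apply: spnW (H r) => // [a|x]; [apply: (is_sub qZ_ideal) | apply: (fib_trans HC)].
Qed.

(** * Cancelling poles *)

Section Pole.
Variables (T : K -> Prop) (t : nat -> K) (X g : P -> U) (D : P -> Prop).
Hypotheses (Tt : forall (a : int) n, T (a%:~R * t n)).
Hypotheses (t1 : forall n, qZ (q ^+ n * t n - 1)) (gX : cong qZ g X D).

Lemma pole_top n u : spn Z X D u ->
  exists2 w, spn T g D w & spn qZ X D (u - q ^+ n *: w).
Proof.
apply: (spnE (Q := fun u => exists2 w, spn T g D w & spn qZ X D (u - q ^+ n *: w))).
- by exists 0; [exact: spn0 | rewrite scaler0 subr0; exact: spn0].
- move=> x y [w Tw Hw] [w' Tw' Hw']; exists (w + w'); first exact: spnD.
  by rewrite scalerDr opprD addrACA; exact: spnD.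
move=> p c Dp /ZK_head [a [c' [Zc' ->]]]; exists ((a%:~R * t n) *: g p).
  by apply: spn_in.
have Za : Z a%:~R by exists a%:~R; rewrite !rmorph_int.
have Zt : Z (q ^+ n * t n).
  rewrite -(subrK 1 (_ * _)); apply: (ssD Z_ring); last exact: (ss1 Z_ring).
  by apply: (is_sub qZ_ideal).
have -> : (a%:~R + q * c') *: X p - q ^+ n *: ((a%:~R * t n) *: g p) =
    (q * c' - a%:~R * (q ^+ n * t n - 1)) *: X p
    + (- (a%:~R * (q ^+ n * t n))) *: (g p - X p).
  rewrite scalerBr scalerA [q ^+ n * _]mulrCA addrCA scaleNr addrC; congr (_ - _).
  by rewrite scaleNr opprK -scalerDl; congr (_ *: _); ring.
apply: spnD.
  apply: spn_in => //; apply: (isD qZ_ideal); first by exists c'.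
  rewrite -mulNr; apply: (isM qZ_ideal) => //; exact: (ssN Z_ring).
apply: spn_scale (gX Dp) => b; apply: (isM qZ_ideal).
by apply: (ssN Z_ring); apply: (ssM Z_ring).
Qed.

(** Poles are removed from the highest order down: at order [n] the integral leading coefficient is
    cancelled by a multiple of [t n], which begins with [q ^- n]. For positive [n] the choices are
    [q ^+ n + q ^- n], which is bar-invariant, and [q ^- n]. *)
Lemma pole_reduction u : spn L X D u -> exists2 w, spn T g D w & spn qZ X D (u - w).
Proof.
move=> Lu; have [N HN] : exists N, spn Z X D (q ^+ N *: u).
  elim: Lu => [|p c w Dp /(LK_pole phi_inj) [n Hn] _ [m Hm]].
    by exists 0%N; rewrite scaler0; exact: spn0.
  have Zq k : Z (q ^+ k) by apply: (ssX Z_ring); exact: ZK_q.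
  exists (n + m)%N; rewrite scalerDr scalerA; apply: spnD.
    by apply: spn_in => //; rewrite addnC exprD -mulrA; apply: (ssM Z_ring).
  by rewrite exprD -scalerA; apply: spn_scale Hm => a; apply: (ssM Z_ring).
elim: N u HN {Lu} => [|N IH] u HN.
  have [w Tw Hw] := pole_top 0 HN; exists w => //.
  by move: Hw; rewrite expr0 !scale1r.
have [w Tw Hw] := pole_top N.+1 HN.
have [|w' Tw' Hw'] := IH (u - w).
  have -> : q ^+ N *: (u - w) = q^-1 *: (q ^+ N.+1 *: u - q ^+ N.+1 *: w).
    by rewrite -scalerBr scalerA exprS mulKf // qK_neq0.
  by apply: spn_scale Hw => _ [c Zc ->]; rewrite mulKf // qK_neq0.
by exists (w + w'); [exact: spnD | rewrite opprD addrA].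
Qed.
End Pole.

(** * The bar involution and the canonical basis *)

Section Bar.
Variable bar : {rmorphism U -> U}.
Hypothesis bar_q : bar (q *: 1) = q^-1 *: 1.
Hypothesis bar_f : forall i, bar (f i) = f i.

Let q0 : q != 0. Proof. exact: qK_neq0. Qed.

Lemma bar_scale a a' u : bar (a *: 1) = a' *: 1 -> bar (a *: u) = a' *: bar u.
Proof. by move=> E; rewrite -[u in LHS]mul1r scalerAl rmorphM E -scalerAl mul1r. Qed.

Lemma bar_ratio a a' b b' : b != 0 -> b' != 0 ->
  bar (a *: 1) = a' *: 1 -> bar (b *: 1) = b' *: 1 -> bar ((a / b) *: 1) = (a' / b') *: 1.
Proof.
move=> Nb Nb' Ea Eb; apply: (scalerI Nb'); rewrite -(bar_scale _ Eb) !scalerA.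
by rewrite [b * _]mulrC [b' * _]mulrC !divfK.
Qed.

Lemma bar_1q (c : K) : bar (1 *: 1) = 1 *: 1.
Proof. by rewrite scale1r rmorph1. Qed.

Lemma bar_qX n : bar (q ^+ n *: 1) = q ^- n *: 1.
Proof.
elim: n => [|n IH]; first by rewrite expr0 invr1 scale1r rmorph1.
by rewrite exprS -scalerA (bar_scale _ bar_q) IH scalerA invfM.
Qed.

Lemma bar_qXV n : bar (q ^- n *: 1) = q ^+ n *: 1.
Proof.
have := @bar_ratio 1 1 (q ^+ n) (q ^- n).
rewrite !div1r invrK => -> //; rewrite ?invr_eq0 ?expf_neq0 //; last exact: bar_qX.
by rewrite scale1r rmorph1.
Qed.

Lemma bar_int (a : int) u : bar (a%:~R *: u) = a%:~R *: bar u.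
Proof. by rewrite !scaler_int raddfMz. Qed.

Lemma phi_cons (p : {poly int}) (a : int) :
  phi (map_poly intr (p * 'X + a%:P)) = phi (map_poly intr p) * q + a%:~R.
Proof.
rewrite rmorphD rmorphM /= map_polyX map_polyC /= rmorphD rmorphM.
by congr (_ + _); rewrite !rmorph_int.
Qed.

Lemma bar_Z c : Z c -> exists2 c', L c' & bar (c *: 1) = c' *: 1.
Proof.
move=> [p ->]; elim/poly_ind: p => [|p a [c' Lc' E]].
  by exists 0; [exact: (ss0 L_ring) | rewrite !rmorph0 !scale0r rmorph0].
exists (c' * q^-1 + a%:~R).
  apply: (ssD L_ring); last by apply: ZK_L; exists a%:P; rewrite map_polyC /= !rmorph_int.
  by apply: (ssM L_ring) => //; rewrite -[q]expr1; exact: LK_qV.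
rewrite phi_cons scalerDl rmorphD /=.
rewrite bar_int rmorph1 scalerDl; congr (_ + _).
by rewrite -scalerA mulrC -scalerA (bar_scale _ E) bar_q scalerA mulrC -scalerA.
Qed.

Lemma bar_L c : L c -> exists2 c', L c' & forall u, bar (c *: u) = c' *: bar u.
Proof.
move=> [p [n ->]]; have [c' Lc' E] := bar_Z (ex_intro _ p erefl).
exists (c' * q ^+ n) => [|u].
  by apply: (ssM L_ring) => //; apply: (ssX L_ring); exact: LK_q.
apply: bar_scale; rewrite -scalerA (bar_scale _ E) bar_qXV scalerA //.
Qed.

Lemma bar_dpf i n : bar (dpf f d i n) = dpf f d i n.
Proof.
have Eq m : bar (qn (q ^+ d i) m *: 1) = qn (q ^+ d i) m *: 1.
  have N1 k : (0 < k)%N -> (q ^+ d i) ^+ k - (q ^+ d i) ^- k != 0.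
    move=> k0; case: k k0 => // k _; have := vn i k; rewrite qnE.
    by apply: contraNneq => ->; rewrite mul0r.
  have Ek k : bar (((q ^+ d i) ^+ k - (q ^+ d i) ^- k) *: 1) =
      - ((q ^+ d i) ^+ k - (q ^+ d i) ^- k) *: 1.
    by rewrite -!exprM !scalerBl rmorphB /= bar_qX bar_qXV opprB scalerBl.
  have N2 := N1 1%N isT; have := Ek 1%N; rewrite expr1 in N2 * => E1.
  rewrite qnE; transitivity ((- ((q ^+ d i) ^+ m - (q ^+ d i) ^- m) /
    - (q ^+ d i - (q ^+ d i)^-1)) *: (1 : U)); last by rewrite invrN mulrNN.
  by apply: bar_ratio; rewrite ?oppr_eq0.
have Ef m : bar (qf (q ^+ d i) m *: 1) = qf (q ^+ d i) m *: 1.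
  elim: m => [|m IH]; first by rewrite qf0 scale1r rmorph1.
  by rewrite qfS -scalerA (bar_scale _ IH) Eq.
have := bar_ratio (qf_neq0 (vn i) n) (qf_neq0 (vn i) n) (bar_1q 1) (Ef n).
rewrite !div1r /dpf dpE => /bar_scale ->.
by rewrite rmorphXn bar_f.
Qed.

Lemma zform_bar u : zform f d u -> zform f d (bar u).
Proof.
elim=> [i n||x y _ IHx _ IHy|x y _ IHx _ IHy|c x Lc _ IH].
- by rewrite bar_dpf; exact: zf_dp.
- by rewrite rmorph1; exact: zf_1.
- by rewrite rmorphD; exact: zf_D.
- by rewrite rmorphM; exact: zf_M.
by have [c' Lc' ->] := bar_L Lc; exact: zf_Z.
Qed.

Lemma zform_barK u : zform f d u -> bar (bar u) = u.
Proof.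
elim=> [i n||x y _ IHx _ IHy|x y _ IHx _ IHy|c x Lc _ IH].
- by rewrite !bar_dpf.
- by rewrite !rmorph1.
- by rewrite !rmorphD IHx IHy.
- by rewrite !rmorphM IHx IHy.
have barqK a : bar (bar (a *: x)) = a *: x -> bar (bar ((q * a) *: x)) = (q * a) *: x.
  move=> E; rewrite -scalerA (bar_scale _ bar_q).
  by have := bar_qXV 1; rewrite expr1 => /bar_scale ->; rewrite E.
have barqVK a : bar (bar (a *: x)) = a *: x -> bar (bar ((q^-1 * a) *: x)) = (q^-1 * a) *: x.
  move=> E; rewrite -scalerA; have := bar_qXV 1; rewrite expr1 => /bar_scale ->.
  by rewrite (bar_scale _ bar_q) E.
move: Lc => [p [n ->]]; rewrite mulrC.
elim: n => [|n IHn]; last by rewrite exprS invfM -mulrA; exact: barqVK.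
rewrite invr1 mul1r; elim/poly_ind: p => [|p a IHp].
  by rewrite !rmorph0 scale0r !rmorph0.
rewrite rmorphD rmorphM /= map_polyX map_polyC /= rmorphD rmorphM scalerDl !rmorphD /=.
have -> : phi (a%:~R)%:P = a%:~R by rewrite !rmorph_int.
by rewrite !bar_int IH mulrC barqK.
Qed.

(* The uniqueness half of the isomorphism defining [G]; existence is proved
   below. *)
Hypothesis bar_uniq : forall u, zform f d u -> spn qA B (fun _ => True) u ->
  spn A B (fun _ => True) (bar u) -> u = 0.

Definition canon p g := [/\ zform f d g, bar g = g & spn qA B (fib p) (g - B p)].

Definition Gp p : U := xget 0 [set g | canon p g].

Lemma canon_uniq p g g' : canon p g -> canon p g' -> g = g'.
Proof.
move=> [Zg bg Hg] [Zg' bg' Hg']; apply/eqP; rewrite -subr_eq0; apply/eqP.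
have zf_B x y : zform f d x -> zform f d y -> zform f d (x - y).
  move=> Zx Zy; apply: zf_D => //; rewrite -scaleN1r; apply: zf_Z => //.
  by apply: (ssN L_ring); exact: (ss1 L_ring).
have H : spn qA B (fun _ => True) (g - g').
  have -> : g - g' = (g - B p) - (g' - B p) by rewrite opprB addrA subrK.
  by apply: spnD; [exact: spnW Hg | apply: (spnN A_ring qA_ideal); exact: spnW Hg'].
apply: bar_uniq => //; first exact: zf_B.
by rewrite rmorphB /= bg bg'; apply: spnW H => // c; exact: (is_sub qA_ideal).
Qed.

Lemma GpP p g : canon p g -> canon p (Gp p) /\ Gp p = g.
Proof.
move=> H; have H' : canon p (Gp p) by rewrite /Gp; case: xgetP => [_ -> //|/(_ g)].
by split=> //; exact: canon_uniq H' H.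
Qed.

Lemma canon_qZ p g : canon p g -> spn qZ B (fib p) (g - B p).
Proof.
case=> Zg _ Hg; have [N HN] := spn_bound (zform_span Zg).
have H : spn L B (fun r => (ht r <= maxn N (ht p))%N) (g - B p).
  apply: (spnB L_ring).
    by apply: spnW HN => // r [_ Hr]; rewrite leq_max Hr.
  by apply: (spn_gen _ L_ring); rewrite leq_max leqnn orbT.
apply: spnW (spn_LqA (@B_indep (maxn N (ht p))) _ _ H Hg) => // r; first by case.
by move=> /fib_le Hr; rewrite leq_max Hr orbT.
Qed.

(** A canonical element known more precisely: in the family adapted to [h] and [i] it involves no
    element with smaller [eps]. *)
Definition hcanon h i p g := [/\ zform f d g, bar g = g &
  spn qZ (Bh h i) (fun r => fib p r /\ (eps h i p <= eps h i r)%N) (g - Bh h i p)].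

Lemma hcanon_canon h i p g : hcanon h i p g -> canon p g.
Proof.
case=> Zg bg Hg; split=> //; rewrite -[g - _](subrKA (Bh h i p)); apply: spnD.
  apply: (spnW (S := qZ) (D := fib p)) => //; first exact: qZK_qA.
  by apply: (qZ_change (Bh_qZ h i)); apply: spnW Hg => // r [].
exact: (pm_cong HM).
Qed.

Definition barT c := L c /\ forall u, bar (c *: u) = c *: bar u.

Definition tbar n : K := if n is 0%N then 1 else q ^+ n + q ^- n.

Lemma barT_tbar (a : int) n : barT (a%:~R * tbar n).
Proof.
split=> [|u].
  apply: (ssM L_ring); first by apply: ZK_L; exists a%:~R; rewrite !rmorph_int.
  case: n => [|n]; first exact: (ss1 L_ring).
  by apply: (ssD L_ring); [apply: (ssX L_ring); exact: LK_q | exact: LK_qV].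
rewrite -!scalerA bar_int; congr (_ *: _); case: n => [|n]; first by rewrite !scale1r.
by rewrite !scalerDl rmorphD /= (bar_scale _ (bar_qX _)) (bar_scale _ (bar_qXV _)) addrC.
Qed.

Lemma tbar_1 n : qZ (q ^+ n * tbar n - 1).
Proof.
case: n => [|n]; first by rewrite mulr1 subrr; exact: (is0 qZ_ideal).
rewrite mulrDr mulfV ?expf_neq0 // addrK exprS -mulrA; exists (q ^+ n * (q * q ^+ n)) => //.
by apply: (ssM Z_ring); rewrite -?exprS; apply: (ssX Z_ring); exact: ZK_q.
Qed.

Lemma zform_spn (S : K -> Prop) (X : P -> U) (D : P -> Prop) u :
  (forall c, S c -> L c) -> (forall p, D p -> zform f d (X p)) -> spn S X D u -> zform f d u.
Proof.
have zf0 : zform f d 0.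
  by rewrite -(scale0r (1 : U)); apply: zf_Z; [exact: (ss0 L_ring) | exact: zf_1].
move=> HS HX; apply: spnE => // [x y|p c Dp Sc]; first exact: zf_D.
by apply: zf_Z; [exact: HS | exact: HX].
Qed.

Lemma zf_B x y : zform f d x -> zform f d y -> zform f d (x - y).
Proof.
move=> Zx Zy; apply: zf_D => //; rewrite -scaleN1r; apply: zf_Z => //.
by apply: (ssN L_ring); exact: (ss1 L_ring).
Qed.

Lemma act_zform h i n u : zform f d u -> zform f d (act f d h i n u).
Proof. by move=> Zu; case: h; apply: zf_M => //; exact: zf_dp. Qed.

Lemma act_bar h i n u : bar (act f d h i n u) = act f d h i n (bar u).
Proof. by rewrite /act; case: h; rewrite rmorphM bar_dpf. Qed.

Lemma eps_le h i p : (eps h i p <= ht p)%N.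
Proof. by rewrite -{2}(up_base HC h i p) (ht_up HC) leq_addr. Qed.

Definition above h i p r := fib p r /\ (eps h i p < eps h i r)%N.

(** The divided power times [Gp (base h i r)] is bar-invariant. Apart from the leading term, its
    terms with the same [eps] as [r] have coefficients divisible by [q]; those with larger [eps] may
    have poles. These are cancelled by bar-invariant multiples of elements [Gp x] of larger [eps],
    known by descending induction on [eps]. *)
Lemma Gp_step h i p : (forall p', (ht p' < ht p)%N -> canon p' (Gp p')) ->
  forall r, fib p r -> (0 < eps h i r)%N -> hcanon h i r (Gp r) /\
    spn barT Gp (above h i r) (act f d h i (eps h i r) (Gp (base h i r)) - Gp r).
Proof.
move=> IH r; have [n le_n] := ubnP (ht p - eps h i r); elim: n => // n IHn in r le_n *.
move=> pr eps_r; set m := eps h i r; set b := base h i r.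
have ht_b : (ht b < ht p)%N.
  by rewrite (fib_ht HC pr) -(up_base HC h i r) (ht_up HC) -/b -addn1 addnC leq_add2r.
have [Zb bb _] := IH b ht_b; have qZb := canon_qZ (IH b ht_b).
have fib_b x : fib b x -> fib r (up h i m x).
  by rewrite -(fib_up HC h i m) (up_base HC).
(* The binomial of [act_Bh] is 1 on elements with [eps = 0], so divisibility by [q] survives there;
   elsewhere it is just a Laurent polynomial, but the result has [eps] above [m]. *)
have split_act u : spn qZ (Bh h i) (fib b) u -> exists u1 u2,
    [/\ act f d h i m u = u1 + u2,
      spn qZ (Bh h i) (fun x => fib r x /\ (m <= eps h i x)%N) u1 &
      spn L (Bh h i) (above h i r) u2].
  elim=> [|x c w bx qc _ [u1 [u2 [E H1 H2]]]].
    by exists 0, 0; rewrite linear0 addr0; split=> //; exact: spn0.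
  have Ez : eps h i (up h i m x) = (m + eps h i x)%N by exact: eps_up.
  rewrite linearD linearZ /= E act_Bh; case Ex : (eps h i x) => [|k].
    rewrite qbn0 // scale1r; exists (c *: Bh h i (up h i m x) + u1), u2.
    rewrite addrA; split=> //; apply: spnD => //; apply: spn_in => //.
    by split; [exact: fib_b | rewrite Ez leq_addr].
  exists u1, ((c * qb (q ^+ d i) m k.+1) *: Bh h i (up h i m x) + u2).
  rewrite scalerA addrCA; split=> //; apply: spnD => //; apply: spn_in.
    by split; [exact: fib_b | rewrite Ez -/m; lia].
  apply: (ssM L_ring); last exact: qb_L.
  by apply: ZK_L; exact: (is_sub qZ_ideal).
have [u1 [u2 [E H1 H2]]] : exists u1 u2,
    [/\ act f d h i m (Gp b) - Bh h i r = u1 + u2,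
      spn qZ (Bh h i) (fun x => fib r x /\ (m <= eps h i x)%N) u1 &
      spn L (Bh h i) (above h i r) u2].
  have [|u1 [u2 [E H1 H2]]] := split_act (Gp b - Bh h i b).
    rewrite -[Gp b - _](subrKA (B b)); apply: spnD (B_qZ h i b).
    exact: (qZ_change (B_qZ h i)).
  exists u1, u2; split=> //; rewrite -E linearB /= -(pm_up HM) ?(up_base HC) //.
  exact: (eps_base HC).
have hIH x : above h i r x -> hcanon h i x (Gp x).
  move=> [rx lt_m]; have px : fib p x by exact: (fib_trans HC pr rx).
  have := eps_le h i x; rewrite -(fib_ht HC px) => le_x.
  by case: (IHn x) => //; rewrite -/m in lt_m *; lia.
have gX : cong qZ Gp (Bh h i) (above h i r).
  move=> x Hx; have [_ _ Hc] := hIH x Hx; case: Hx => rx lt_m.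
  apply: spnW Hc => // y [xy le_y]; split; first exact: (fib_trans HC rx xy).
  exact: leq_trans lt_m le_y.
have [w Tw Hw] := pole_reduction barT_tbar tbar_1 gX H2.
have hc : hcanon h i r (act f d h i m (Gp b) - w).
  split.
  - apply: zf_B; first exact: act_zform.
    by apply: zform_spn Tw => [c []|x /hIH []].
  - rewrite rmorphB /= act_bar bb; congr (_ - _).
    apply: (spnE (Q := fun w => bar w = w)) Tw => [|x y|x c /hIH [_ bx _] [_ ->]].
    + exact: rmorph0.
    + by rewrite rmorphD /= => -> ->.
    by rewrite bx.
  rewrite addrAC E -addrA; apply: spnD => //.
  by apply: spnW Hw => // x [rx /ltnW].
have [_ EG] := GpP (hcanon_canon hc); rewrite EG; split=> //.
by rewrite opprB addrCA subrr addr0.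
Qed.

Lemma canon_p0 : canon p0 1.
Proof. by split; [exact: zf_1 | exact: rmorph1 | rewrite (pm_1 HM) subrr; exact: spn0]. Qed.

Lemma Gp_canon p : canon p (Gp p).
Proof.
have [n le_n] := ubnP (ht p); elim: n => // n IH in p le_n *.
have [->|Np] := eqVneq p p0; first by case: (GpP canon_p0).
have [i Hi] := eps_pos HC Np.
have [|hc _] := Gp_step (h := true) (i := i) _ (fib_refl HC p) Hi.
  by move=> p' lt_p; apply: IH; lia.
by have [] := GpP (hcanon_canon hc).
Qed.

Lemma Gp_p0 : Gp p0 = 1.
Proof. by case: (GpP canon_p0). Qed.

(* Multiplying a canonical basis element by a divided power of a generator
   produces one canonical basis element and error terms in which that
   generator can be split off more often. *)
Lemma Gp_act h i p : spn L Gp (above h i p) (act f d h i (eps h i p) (Gp (base h i p)) - Gp p).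
Proof.
have [E|] := posnP (eps h i p).
  have Eb : base h i p = p by rewrite -[RHS](up_base HC h i p) E up0.
  by rewrite Eb E /act /dpf dp0 mul1r mulr1 if_same subrr; exact: spn0.
move=> eps_p; have [_] := Gp_step (fun p' _ => Gp_canon p') (fib_refl HC p) eps_p.
by apply: spnW => // c [].
Qed.

Lemma Gp_zform p : zform f d (Gp p). Proof. by case: (Gp_canon p). Qed.

Lemma Gp_B N : cong qA Gp B (fun p => (ht p <= N)%N).
Proof.
by move=> p Hp; have [_ _ H] := Gp_canon p; apply: spnW H => // r /fib_le Hr; exact: leq_trans Hr Hp.
Qed.

Lemma Gp_indep N : indep (upto N) Gp.
Proof.
apply: (indep_cong phi_inj phi_frac (upto_uniq HC N) _ (@B_indep N)) => p.
by rewrite (mem_upto HC) => Hp; apply: spnW (Gp_B Hp) => // r; rewrite (mem_upto HC).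
Qed.

(** Write [u = w + r], with [w] a combination of [Gp] over polynomials in [q^-1] and [r] one of [B]
    with coefficients divisible by [q]. The same reduction of [bar r] leaves a remainder that
    vanishes by [bar_uniq], so [r] is a combination of [Gp] as well; independence removes its part
    of height below [k]. *)
Lemma zform_Gp u k : zform f d u -> spn L B (fun r => (k <= ht r)%N) u ->
  spn L Gp (fun r => (k <= ht r)%N) u.
Proof.
pose D r := (k <= ht r)%N; pose E (c : K) := L c /\ exists2 c', Z c' & forall u, bar (c *: u) = c' *: bar u.
have gX : cong qZ Gp B D.
  move=> p Dp; apply: spnW (canon_qZ (Gp_canon p)) => // r /(fib_ht HC) Er.
  by rewrite /D -Er.
have Et (a : int) n : E (a%:~R * q ^- n).
  have Za : Z a%:~R by exists a%:~R; rewrite !rmorph_int.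
  split; first by apply: (ssM L_ring); [exact: ZK_L | exact: LK_qV].
  exists (a%:~R * q ^+ n); first by apply: (ssM Z_ring) => //; apply: (ssX Z_ring); exact: ZK_q.
  by move=> w; rewrite -!scalerA bar_int (bar_scale _ (bar_qXV _)).
have Et1 n : qZ (q ^+ n * q ^- n - 1).
  by rewrite mulfV ?expf_neq0 // subrr; exact: (is0 qZ_ideal).
have red x : zform f d x -> spn L B D x -> exists2 w, spn E Gp D w & spn qZ B D (x - w).
  by move=> _; exact: (pole_reduction Et Et1 gX).
have Zs (D' : P -> Prop) w : spn E Gp D' w -> zform f d w.
  by apply: zform_spn => [c []|p _] //; exact: Gp_zform.
have bw D' w : spn E Gp D' w -> spn Z Gp D' (bar w).
  apply: (spnE (Q := fun w => spn Z Gp D' (bar w))) => [|x y|p c Dp [_ [c' Zc' ->]]].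
  - by rewrite rmorph0; exact: spn0.
  - by rewrite rmorphD; exact: spnD.
  by have [_ -> _] := Gp_canon p; exact: spn_in.
move=> Zu Lu; have [w Tw Hw] := red u Zu Lu.
rewrite -[u](subrK w) ; apply: spnD; last by apply: spnW Tw => // c [].
set r := u - w in Hw *; have Zr : zform f d r by apply: zf_B => //; exact: Zs Tw.
have [w' Tw' Hw'] : exists2 w', spn E Gp (fun _ => True) w' &
    spn qZ B (fun _ => True) (bar r - w').
  apply: (pole_reduction (g := Gp) Et Et1); last exact: zform_span (zform_bar Zr).
  by move=> p _; apply: spnW (canon_qZ (Gp_canon p)).
have E1 : bar r - w' = 0.
  apply: bar_uniq; first by apply: zf_B; [exact: zform_bar | exact: Zs Tw'].
    by apply: spnW Hw' => // c; exact: qZK_qA.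
  rewrite rmorphB /= zform_barK //; apply: (spnB A_ring).
    by apply: spnW Hw => // c /(is_sub qZ_ideal); exact: ZK_A.
  apply: (spn_trans (S := Z) (T := A) (X := Gp) (D := fun _ => True)); last exact: bw Tw'.
    by move=> a b /ZK_A; exact: (ssM A_ring).
  move=> p _; apply: spnW (cong_span A_ring qA_ideal (@Gp_B (ht p)) (leqnn _)) => //.
have Er : r = bar w' by rewrite -[r]zform_barK // (subr0_eq E1).
have Lr : spn L Gp (fun _ => True) r.
  by rewrite Er; apply: spnW (bw _ _ Tw') => // c; exact: ZK_L.
have [r1 [r2 [E12 H1 H2]]] : exists r1 r2, [/\ r = r1 + r2,
    spn L Gp (fun x => (ht x < k)%N) r1 & spn L Gp D r2].
  elim: Lr => [|p c x _ Lc _ [r1 [r2 [-> H1 H2]]]].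
    by exists 0, 0; rewrite addr0; split=> //; exact: spn0.
  have [lt_k|le_k] := ltnP (ht p) k.
    by exists (c *: Gp p + r1), r2; rewrite addrA; split=> //; exact: spnS.
  by exists r1, (c *: Gp p + r2); rewrite addrCA; split=> //; exact: spnS.
have GB p : spn L B (fib p) (Gp p).
  rewrite -[Gp p](subrK (B p)); apply: spnD; last by apply: (spn_gen _ L_ring); exact: (fib_refl HC).
  by apply: spnW (canon_qZ (Gp_canon p)) => // c /(is_sub qZ_ideal); exact: ZK_L.
have LB (E' : P -> Prop) x : (forall p r, fib p r -> E' p -> E' r) ->
    spn L Gp E' x -> spn L B E' x.
  move=> HE; apply: (spn_trans (@ssM _ _ L_ring)) => p Ep.
  by apply: spnW (GB p) => // y /HE; apply.
have H1B : spn L B (fun x => (ht x < k)%N) r1.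
  by apply: LB H1 => p y /(fib_ht HC) ->.
have H2B : spn L B D r1.
  have -> : r1 = r - r2 by rewrite E12 addrK.
  apply: (spnB L_ring); last by apply: LB H2 => p y /(fib_ht HC) Ey; rewrite /D Ey.
  by apply: spnW Hw => // c /(is_sub qZ_ideal); exact: ZK_L.
have [N2 HN2] := spn_bound H2B.
have := spn_indep (upto_uniq HC (maxn k N2)) (@B_indep _) (ss0 L_ring) (@ssD _ _ L_ring)
  (ss0 L_ring) (@ssD _ _ L_ring) _ _ H1B HN2.
move=> H3; have r10 : r1 = 0.
  apply: (spnE (Q := fun x => x = 0)) (H3 _ _) => // [x y -> ->|p c [lt_k [le_k _]] _|p lt_k|p [_ le_N]].
  - by rewrite addr0.
  - by move: le_k; rewrite /D leqNgt lt_k.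
  - by rewrite (mem_upto HC) leq_max ltnW.
  by rewrite (mem_upto HC) leq_max le_N orbT.
by rewrite E12 r10 add0r.
Qed.
End Bar.
End Model.

(** * Specialisation at a root of unity *)

Section Specialisation.
Variables (K : fieldType) (phi : {rmorphism {poly rat} -> K}).
Hypothesis phi_inj : injective phi.
Variables (R : comUnitRingType) (zeta : R).
Hypothesis zeta_unit : zeta \is a GRing.unit.

Local Notation q := (qK phi).
Local Notation L := (LK phi).
Local Notation Z := (ZK phi).

Let L_ring := LK_ring phi_inj.

Definition pev (p : {poly int}) : R := (map_poly intr p).[zeta].

Lemma pevD p r : pev (p + r) = pev p + pev r.
Proof. by rewrite /pev rmorphD hornerD. Qed.

Lemma pevM p r : pev (p * r) = pev p * pev r.
Proof. by rewrite /pev rmorphM hornerM. Qed.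

Lemma pevXn n : pev 'X^n = zeta ^+ n.
Proof. by rewrite /pev rmorphXn /= map_polyX hornerXn. Qed.

(** The specialisation of Laurent polynomials, chosen by [xget] because [LK] is a predicate on the
    field; [specE] shows independence of the numerator and the exponent. *)
Definition spec (c : K) : R := xget 0 [set x | exists (p : {poly int}) (n : nat),
  c = phi (map_poly intr p) / q ^+ n /\ x = pev p / zeta ^+ n].

Lemma specE (p : {poly int}) n : spec (phi (map_poly intr p) / q ^+ n) = pev p / zeta ^+ n.
Proof.
rewrite /spec; case: xgetP => [_ -> [r [m [E ->]]]|/(_ (pev p / zeta ^+ n))]; last first.
  by case; exists p, n.
have zU k : zeta ^+ k \is a GRing.unit by exact: unitrX.
have : p * 'X^m = r * 'X^n.
  apply: (@map_inj_poly _ _ (intr : int -> rat)); [exact: intr_inj | by [] |].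
  rewrite !rmorphM !rmorphXn /= map_polyX; apply: phi_inj; rewrite !rmorphM !rmorphXn /= -/q.
  move/(congr1 (fun x => x * q ^+ n * q ^+ m)): E; rewrite divfK ?(qKX_neq0 phi_inj) // => ->.
  by rewrite [_ * q ^+ n]mulrC -mulrA divfK ?(qKX_neq0 phi_inj) // mulrC.
move/(congr1 pev); rewrite !pevM !pevXn => E'.
apply: (mulIr (zU n)); apply: (mulIr (zU m)); rewrite divrK // E' -mulrA [_ * zeta ^+ m]mulrC mulrA.
by rewrite divrK // mulrC.
Qed.

Lemma spec0 : spec 0 = 0.
Proof.
have := specE 0 0; rewrite !rmorph0 mul0r => ->.
by rewrite /pev rmorph0 horner0 mul0r.
Qed.

Lemma spec1 : spec 1 = 1.
Proof.
have := specE 1 0; rewrite !rmorph1 !expr0 divr1 => ->.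
by rewrite /pev rmorph1 hornerC invr1 mulr1.
Qed.

Lemma spec_q : spec q = zeta.
Proof.
have := specE 'X 0; rewrite map_polyX expr0 divr1 => ->.
by rewrite -['X]expr1 pevXn expr0 invr1 mulr1.
Qed.

Lemma specM a b : L a -> L b -> spec (a * b) = spec a * spec b.
Proof.
move=> [p [m ->]] [r [n ->]].
have -> : phi (map_poly intr p) / q ^+ m * (phi (map_poly intr r) / q ^+ n) =
    phi (map_poly intr (p * r)) / q ^+ (m + n).
  by rewrite !rmorphM exprD invfM mulrACA.
rewrite !specE pevM exprD invrM ?unitrX //.
by rewrite [zeta ^- n * _]mulrC mulrACA.
Qed.

Lemma specD a b : L a -> L b -> spec (a + b) = spec a + spec b.
Proof.
move=> [p [m ->]] [r [n ->]].
have -> : phi (map_poly intr p) / q ^+ m + phi (map_poly intr r) / q ^+ n =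
    phi (map_poly intr (p * 'X^n + r * 'X^m)) / q ^+ (m + n).
  rewrite !rmorphD !rmorphM !rmorphXn /= map_polyX -/q exprD.
  by rewrite addf_div ?(qKX_neq0 phi_inj).
rewrite !specE pevD !pevM !pevXn exprD invrM ?unitrX // mulrDl; congr (_ + _).
  by rewrite -!mulrA; congr (_ * _); rewrite mulrA divrr ?unitrX // mul1r.
by rewrite -!mulrA [zeta ^- n * _]mulrC; congr (_ * _); rewrite mulrA divrr ?unitrX // mul1r.
Qed.

Lemma spec_sum (T : eqType) (s : seq T) (F : T -> K) : (forall p, p \in s -> L (F p)) ->
  spec (\sum_(p <- s) F p) = \sum_(p <- s) spec (F p).
Proof.
elim: s => [|p s IH] H; first by rewrite !big_nil spec0.
have Hs r : r \in s -> L (F r) by move=> rs; apply: H; rewrite inE rs orbT.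
rewrite !big_cons specD ?IH //; first by apply: H; exact: mem_head.
by rewrite big_seq; apply: (big_ind L) => //; [exact: (ss0 L_ring) | exact: (ssD L_ring)].
Qed.

Section Hom.
Variables (U : algType K) (W : U -> Prop).
Hypotheses (W1 : W 1) (WD : forall x y, W x -> W y -> W (x + y)).
Hypotheses (WM : forall x y, W x -> W y -> W (x * y)) (WZ : forall c x, L c -> W x -> W (c *: x)).

Definition zhom (B : algType R) (g : U -> B) := g 1 = 1 /\ forall x y, W x -> W y ->
  [/\ g (x + y) = g x + g y, g (x * y) = g x * g y & g (q *: x) = zeta *: g x].

(** Additivity and compatibility with [q] give linearity over integers and polynomials, and then
    over Laurent polynomials because [zeta] is invertible. *)
Lemma zhomZ (B : algType R) (g : U -> B) c x : zhom g -> L c -> W x ->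
  g (c *: x) = spec c *: g x.
Proof.
move=> [_ Hg] Lc; have [p [n Ec]] := Lc; move=> Wx.
have gD a b : W a -> W b -> g (a + b) = g a + g b by move=> Wa Wb; case: (Hg a b Wa Wb).
have gq a : W a -> g (q *: a) = zeta *: g a by move=> Wa; case: (Hg a a Wa Wa).
have W0 : W 0 by rewrite -(scale0r 1); apply: WZ => //; exact: (ss0 L_ring).
have g0 : g 0 = 0 by apply: (addrI (g 0)); rewrite -gD // !addr0.
have gN a : W a -> g (- a) = - g a.
  move=> Wa; have WNa : W (- a).
    by rewrite -scaleN1r; apply: WZ => //; apply: (ssN L_ring); exact: (ss1 L_ring).
  by apply/eqP; rewrite -addr_eq0 -gD // addNr g0.
have gn (m : nat) a : W a -> g (m%:R *: a) = m%:R *: g a.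
  move=> Wa; elim: m => [|m IH]; first by rewrite !scale0r.
  rewrite -!natr1 !scalerDl !scale1r gD ?IH //; apply: WZ => //.
  exact: (ss_nat L_ring).
have gi (m : int) a : W a -> g (m%:~R *: a) = m%:~R *: g a.
  move=> Wa; case: m => m; first exact: gn.
  rewrite NegzE !mulrNz !scaleNr gN ?gn //.
  by apply: WZ => //; exact: (ss_nat L_ring).
have gX m a : W a -> g (q ^+ m *: a) = zeta ^+ m *: g a.
  move=> Wa; elim: m => [|m IH]; first by rewrite !scale1r.
  rewrite !exprS -!scalerA gq ?IH //; apply: WZ => //; apply: (ssX L_ring); exact: LK_q.
have gp (r : {poly int}) a : W a -> g (phi (map_poly intr r) *: a) = pev r *: g a.
  move=> Wa; elim/poly_ind: r => [|r b IH].
    by rewrite !rmorph0 /pev rmorph0 horner0 !scale0r.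
  have Lr : L (phi (map_poly intr r)) by apply: ZK_L; exists r.
  have Lb : L b%:~R by apply: ZK_L; exists b%:~R; rewrite !rmorph_int.
  have Er : pev (r * 'X + b%:P) = zeta * pev r + b%:~R.
    rewrite pevD pevM -['X]expr1 pevXn expr1 [zeta * _]mulrC; congr (_ + _).
    by rewrite /pev map_polyC hornerC.
  rewrite phi_cons Er !scalerDl gD ?gi //; last first.
  - exact: WZ.
  - by apply: WZ => //; apply: (ssM L_ring) => //; exact: LK_q.
  by rewrite [_ * q]mulrC -!scalerA gq ?IH //; apply: WZ.
rewrite Ec specE; have zU := unitrX n zeta_unit.
have Wc : W (c *: x) by exact: WZ.
rewrite -Ec -[LHS]scale1r -(mulVr zU) -[in LHS]scalerA -gX // scalerA Ec mulrC.
by rewrite divfK ?(qKX_neq0 phi_inj) // gp // scalerA mulrC.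
Qed.

Section Basis.
Variables (P : eqType) (ht : P -> nat) (upto : nat -> seq P) (p0 : P) (G : P -> U).
Hypotheses (upto_uniq : forall N, uniq (upto N)).
Hypotheses (mem_upto : forall N p, (p \in upto N) = (ht p <= N)%N).
Hypotheses (G_W : forall p, W (G p)) (G_p0 : G p0 = 1) (ht_p0 : ht p0 = 0%N).
Hypothesis G_indep : forall N, indep (upto N) G.
Hypothesis G_span : forall u k, W u -> forall p, (k <= ht p)%N ->
  spn L G (fun r => (k <= ht r)%N) (u * G p).

Definition rep (c : P -> K) u := (forall p, L (c p)) /\ exists N,
  (forall p, (N < ht p)%N -> c p = 0) /\ u = \sum_(p <- upto N) c p *: G p.

Lemma upto_widen (V : nmodType) (F : P -> V) M N : (M <= N)%N ->
  (forall p, (M < ht p)%N -> F p = 0) -> \sum_(p <- upto N) F p = \sum_(p <- upto M) F p.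
Proof.
move=> le_MN H; rewrite (bigID (fun p => (ht p <= M)%N)) /=.
rewrite [X in _ + X]big1 => [|p]; last by rewrite -ltnNge; apply: H.
rewrite addr0 -big_filter; apply: perm_big; apply: uniq_perm => //.
  exact: filter_uniq.
move=> p; rewrite mem_filter !mem_upto; case: leqP => //= Hp.
by rewrite (leq_trans Hp).
Qed.

Lemma rep_at c u N : rep c u -> (forall p, (N < ht p)%N -> c p = 0) ->
  u = \sum_(p <- upto N) c p *: G p.
Proof.
move=> [_ [M [HM ->]]] HN.
have Z0 k : (forall p, (k < ht p)%N -> c p = 0) -> forall p, (k < ht p)%N -> c p *: G p = 0.
  by move=> H p /H ->; rewrite scale0r.
rewrite -(upto_widen (leq_maxl M N) (Z0 _ HM)); exact: (upto_widen (leq_maxr M N) (Z0 _ HN)).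
Qed.

Lemma rep_widen c u : rep c u -> exists N, forall M, (N <= M)%N ->
  (forall p, (M < ht p)%N -> c p = 0) /\ u = \sum_(p <- upto M) c p *: G p.
Proof.
move=> Hr; have [_ [N [HN _]]] := Hr; exists N => M le_NM.
have HM p : (M < ht p)%N -> c p = 0 by move=> Hp; apply: HN; exact: leq_ltn_trans Hp.
by split=> //; exact: rep_at Hr HM.
Qed.

Lemma rep_uniq c c' u : rep c u -> rep c' u -> c =1 c'.
Proof.
move=> /rep_widen [N HN] /rep_widen [N' HN'] p.
pose M := maxn (ht p) (maxn N N').
have [_ E] := HN M ltac:(rewrite /M; lia); have [_ E'] := HN' M ltac:(rewrite /M; lia).
apply/eqP; rewrite -subr_eq0; apply/eqP.
apply: (G_indep (N := M) (c := fun r => c r - c' r)); last by rewrite mem_upto leq_maxl.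
rewrite (eq_bigr (fun r => c r *: G r - c' r *: G r)) => [|r _]; last by rewrite scalerBl.
by rewrite sumrB -E -E' subrr.
Qed.

Lemma repD c c' u u' : rep c u -> rep c' u' -> rep (fun p => c p + c' p) (u + u').
Proof.
move=> Hr Hr'; have [N HN] := rep_widen Hr; have [N' HN'] := rep_widen Hr'.
have [Z1 ->] := HN _ (leq_maxl N N'); have [Z2 ->] := HN' _ (leq_maxr N N').
rewrite -big_split /=; split=> [p|].
  by apply: (ssD L_ring); [case: Hr | case: Hr'].
exists (maxn N N'); split=> [p Hp|]; first by rewrite Z1 // Z2 // addr0.
by apply: eq_bigr => p _; rewrite scalerDl.
Qed.

Lemma repZ a c u : L a -> rep c u -> rep (fun p => a * c p) (a *: u).
Proof.
move=> La [Lc [N [HN ->]]]; split=> [p|]; first exact: (ssM L_ring).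
exists N; split=> [p /HN ->|]; first by rewrite mulr0.
by rewrite scaler_sumr; apply: eq_bigr => p _; rewrite scalerA.
Qed.

Lemma rep0 : rep (fun _ => 0) 0.
Proof.
split=> [_|]; first exact: (ss0 L_ring).
by exists 0%N; split=> //; rewrite big1 // => p _; rewrite scale0r.
Qed.

Lemma rep_G p : rep (fun r => (r == p)%:R) (G p).
Proof.
split=> [r|]; first by case: eqP => _; [exact: (ss1 L_ring) | exact: (ss0 L_ring)].
exists (ht p); split=> [r|]; first by case: eqP => [->|//]; rewrite ltnn.
rewrite (bigD1_seq p) ?mem_upto //= eqxx scale1r big1 ?addr0 // => r /negPf ->.
by rewrite scale0r.
Qed.

Lemma rep_ex D u : spn L G D u -> exists2 c, rep c u & forall p, c p != 0 -> D p.
Proof.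
elim=> [|p c w Dp Lc _ [c' Hc' HD]].
  by exists (fun _ => 0); [exact: rep0 | move=> p; rewrite eqxx].
exists (fun r => c * (r == p)%:R + c' r); first exact: repD (repZ Lc (rep_G p)) Hc'.
move=> r; case: (eqVneq r p) => [->|_] //=; rewrite mulr0 add0r; exact: HD.
Qed.

Definition coef u : P -> K := xget (fun _ => 0) [set c | rep c u].

Lemma coefE c u : rep c u -> coef u =1 c.
Proof.
move=> H; rewrite /coef; case: xgetP => [_ -> /= H'|/(_ c) //]; exact: rep_uniq H' H.
Qed.

Lemma coefP u : W u -> rep (coef u) u.
Proof.
move=> Wu; have [c Hc _] := rep_ex (@G_span u 0 Wu p0 (leq0n _)).
rewrite G_p0 mulr1 in Hc; rewrite /coef; case: xgetP => [_ -> //|/(_ c) //].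
Qed.

Lemma coef_ge u r p : W u -> (ht p < ht r)%N -> coef (u * G r) p = 0.
Proof.
move=> Wu lt_pr; have [c Hc HD] := rep_ex (G_span Wu (leqnn (ht r))).
rewrite (coefE Hc); apply/eqP; apply: contraTT lt_pr => /HD; by rewrite -leqNgt.
Qed.

(** By [coef_ge], terms of height above [M] contribute nothing at [p], so the matrix product may be
    restricted to [upto M]. *)
Lemma coefM x y p M : W x -> W y -> (ht p <= M)%N ->
  coef (x * y) p = \sum_(r <- upto M) coef (x * G r) p * coef y r.
Proof.
move=> Wx Wy HM; have [N HN] := rep_widen (coefP Wy).
have [_ Ey] := HN _ (leq_maxr M N).
have H : rep (fun t => \sum_(r <- upto (maxn M N)) coef y r * coef (x * G r) t) (x * y).
  rewrite {2}Ey mulr_sumr; elim: (upto _) => [|r s IH].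
    rewrite big_nil; have -> : (fun t => \sum_(r <- [::]) coef y r * coef (x * G r) t) = (fun _ => 0).
      by apply: funext => t; rewrite big_nil.
    exact: rep0.
  rewrite big_cons; have -> : (fun t => \sum_(i <- r :: s) coef y i * coef (x * G i) t) =
      (fun t => coef y r * coef (x * G r) t + \sum_(i <- s) coef y i * coef (x * G i) t).
    by apply: funext => t; rewrite big_cons.
  apply: repD => //; rewrite -scalerAr; apply: repZ; first by case: (coefP Wy).
  by apply: coefP; apply: WM.
rewrite (coefE H) (upto_widen (M := M)) ?leq_maxl // => [|r Hr].
  by apply: eq_bigr => r _; rewrite mulrC.
by rewrite coef_ge ?mulr0 //; exact: leq_ltn_trans Hr.
Qed.

(* [U] acts on the truncation to height at most [M] of its left regular
   representation, which keeps its basis after specialisation. *)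
Theorem specialisation_indep (V : algType R) (iota : U -> V) M (c : P -> R) :
  (forall (B : algType R) (g : U -> B), zhom g ->
    exists psi : {lrmorphism V -> B}, forall x, W x -> psi (iota x) = g x) ->
  \sum_(p <- upto M) c p *: iota (G p) = 0 -> forall p, p \in upto M -> c p = 0.
Proof.
move=> univ Ec p ps; set s := upto M in Ec ps.
have [n Hn] : exists n, size s = n.+1 by move: ps; case: (s) => // a s' _; exists (size s').
have sM (i : 'I_n.+1) : (ht (nth p0 s i) <= M)%N.
  by rewrite -mem_upto mem_nth // Hn.
pose g (x : U) : 'M[R]_n.+1 := \matrix_(i, j) spec (coef (x * G (nth p0 s j)) (nth p0 s i)).
have Lcoef u r : W u -> L (coef u r) by move=> /coefP [].
have gh : zhom g.
  split=> [|x y Wx Wy].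
    apply/matrixP => i j; rewrite !mxE mul1r (coefE (rep_G _)).
    have -> : (nth p0 s i == nth p0 s j) = (i == j) by rewrite nth_uniq ?Hn ?ltn_ord ?upto_uniq.
    by case: eqP => _; rewrite ?spec1 ?spec0.
  have WG u r : W u -> W (u * G r) by move=> Wu; apply: WM.
  split; apply/matrixP => i j; rewrite !mxE.
  - rewrite mulrDl (coefE (repD (coefP (WG _ _ Wx)) (coefP (WG _ _ Wy)))).
    by rewrite specD //; apply: Lcoef; apply: WG.
  - rewrite -mulrA (coefM Wx (WG _ _ Wy) (sM i)) spec_sum => [|r _]; last first.
      by apply: (ssM L_ring); apply: Lcoef; apply: WG.
    rewrite (big_nth p0) big_mkord -/s Hn; apply: eq_bigr => k _.
    by rewrite !mxE specM //; apply: Lcoef; apply: WG.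
  rewrite -scalerAl (coefE (repZ (LK_q phi) (coefP (WG _ _ Wx)))).
  by rewrite specM ?spec_q //; [exact: LK_q | apply: Lcoef; apply: WG].
have [psi Hpsi] := univ _ g gh.
have p0s : p0 \in s by rewrite mem_upto ht_p0.
(* As [G p0 = 1], the column of [p0] in the matrix of [G r] is the unit vector at [r], which reads
   off the coefficients of the relation. *)
have gG r : r \in s -> forall i, g (G r) i (inord (index p0 s)) = (nth p0 s i == r)%:R.
  move=> rs i; rewrite mxE inordK -?Hn ?index_mem // nth_index // G_p0 mulr1 (coefE (rep_G r)).
  by case: eqP => _; rewrite ?spec1 ?spec0.
move/(congr1 psi): Ec; rewrite linear_sum linear0 => /matrixP.
have ip : (index p s < n.+1)%N by rewrite -Hn index_mem.
move/(_ (Ordinal ip) (inord (index p0 s))); rewrite mxE summxE.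
rewrite (bigD1_seq p) ?upto_uniq //= linearZ /= Hpsi // mxE gG // nth_index // eqxx mulr1.
rewrite big_seq_cond big1 ?addr0 // => r /andP[rs Nr].
rewrite linearZ /= Hpsi // mxE gG // nth_index //.
by rewrite eq_sym (negPf Nr) mulr0.
Qed.
End Basis.
End Hom.
End Specialisation.

(** * The splitting on canonical bases *)

Section Discrepancy.
Variables (K : fieldType) (phi : {rmorphism {poly rat} -> K}).
Hypothesis phi_inj : injective phi.
Variables (R : comUnitRingType) (zeta : R).
Hypothesis zeta_unit : zeta \is a GRing.unit.
Variables (I : Type) (P : eqType) (Cs C : crystal I P).
Hypotheses (HCs : is_crystal Cs) (HC : is_crystal C).
Variables (Us U : algType K) (fs : I -> Us) (f : I -> U) (ds d : I -> nat).
Variables (Gs : P -> Us) (G : P -> U).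

Local Notation L := (LK phi).
Local Notation Ws := (zform phi fs ds).
Local Notation W := (zform phi f d).

Hypotheses (Gs_W : forall p, Ws (Gs p)) (G_W : forall p, W (G p)).
Hypotheses (Gs_p0 : Gs (cr_p0 Cs) = 1) (G_p0 : G (cr_p0 C) = 1).
Hypothesis Gs_act : forall h i p, spn L Gs (above Cs h i p)
  (act phi fs ds h i (cr_eps Cs h i p) (Gs (cr_base Cs h i p)) - Gs p).
Hypothesis G_act : forall h i p, spn L G (above C h i p)
  (act phi f d h i (cr_eps C h i p) (G (cr_base C h i p)) - G p).

Variables (Vs V : algType R) (iotas : Us -> Vs) (iota : U -> V).
Hypotheses (iotas_hom : zhom phi zeta Ws iotas) (iota_hom : zhom phi zeta W iota).
Hypothesis iota_indep : forall M (c : P -> R),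
  \sum_(p <- cr_upto C M) c p *: iota (G p) = 0 -> forall p, p \in cr_upto C M -> c p = 0.

Variables (li : I -> nat) (sigma : P -> P) (Fr : {lrmorphism Vs -> V}).
Hypothesis li_gt0 : forall i, (0 < li i)%N.
Hypothesis Fr_dp : forall i n,
  Fr (iotas (dpf phi fs ds i n)) = iota (dpf phi f d i (li i * n)).
Hypothesis sigma_fib : forall p r, cr_fib Cs p r -> cr_fib C (sigma p) (sigma r).
Hypothesis sigma_eps : forall h i p, cr_eps C h i (sigma p) = (li i * cr_eps Cs h i p)%N.
Hypothesis sigma_base : forall h i p, cr_base C h i (sigma p) = sigma (cr_base Cs h i p).
Hypothesis sigma_p0 : sigma (cr_p0 Cs) = cr_p0 C.

Definition rspan N (D : P -> Prop) (v : V) := exists2 c : P -> R,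
  (forall r, c r != 0 -> D r) & v = \sum_(r <- cr_upto C N) c r *: iota (G r).

Lemma rspan0 N D : rspan N D 0.
Proof. by exists (fun _ => 0) => [r|]; rewrite ?eqxx // big1 // => r _; rewrite scale0r. Qed.

Lemma rspanD N D u v : rspan N D u -> rspan N D v -> rspan N D (u + v).
Proof.
move=> [c Hc ->] [c' Hc' ->]; exists (fun r => c r + c' r) => [r|].
  by case: (eqVneq (c r) 0) => [->|/Hc //]; rewrite add0r => /Hc'.
by rewrite -big_split; apply: eq_bigr => r _; rewrite scalerDl.
Qed.

Lemma rspanZ N D a u : rspan N D u -> rspan N D (a *: u).
Proof.
move=> [c Hc ->]; exists (fun r => a * c r) => [r|].
  by move=> H; apply: Hc; apply: contraNneq H => ->; rewrite mulr0.
by rewrite scaler_sumr; apply: eq_bigr => r _; rewrite scalerA.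
Qed.

Lemma rspanW N (D E : P -> Prop) u : (forall r, D r -> E r) -> rspan N D u -> rspan N E u.
Proof. by move=> H [c Hc ->]; exists c => // r /Hc /H. Qed.

Lemma rspan_gen N (D : P -> Prop) r : D r -> (cr_ht C r <= N)%N -> rspan N D (iota (G r)).
Proof.
move=> Dr Hr; exists (fun x => (x == r)%:R) => [x|]; first by case: (eqVneq x r) => [->|_] //=; rewrite eqxx.
rewrite (bigD1_seq r) ?(mem_upto HC) ?(upto_uniq HC) //= eqxx scale1r big1 ?addr0 // => x /negPf ->.
by rewrite scale0r.
Qed.

Let W0 : W 0.
Proof. by rewrite -(scale0r (1 : U)); apply: zf_Z; [exact: (ss0 (LK_ring phi_inj)) | exact: zf_1]. Qed.

Let Ws0 : Ws 0.
Proof. by rewrite -(scale0r (1 : Us)); apply: zf_Z; [exact: (ss0 (LK_ring phi_inj)) | exact: zf_1]. Qed.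

Let iotaZ c x : L c -> W x -> iota (c *: x) = spec phi zeta c *: iota x.
Proof. by apply: (zhomZ phi_inj zeta_unit) => //; [exact: zf_1 | move=> *; exact: zf_Z]. Qed.

Let iotasZ c x : L c -> Ws x -> iotas (c *: x) = spec phi zeta c *: iotas x.
Proof. by apply: (zhomZ phi_inj zeta_unit) => //; [exact: zf_1 | move=> *; exact: zf_Z]. Qed.

Let iotaD x y : W x -> W y -> iota (x + y) = iota x + iota y.
Proof. by move=> Wx Wy; case: (iota_hom.2 x y Wx Wy). Qed.

Let iotasD x y : Ws x -> Ws y -> iotas (x + y) = iotas x + iotas y.
Proof. by move=> Wx Wy; case: (iotas_hom.2 x y Wx Wy). Qed.

Let iota0 : iota 0 = 0.
Proof. by apply: (addrI (iota 0)); rewrite -iotaD // !addr0. Qed.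

Let iotas0 : iotas 0 = 0.
Proof. by apply: (addrI (iotas 0)); rewrite -iotasD // !addr0. Qed.

Lemma iota_span N (D : P -> Prop) u : (forall r, D r -> (cr_ht C r <= N)%N) ->
  spn L G D u -> W u /\ rspan N D (iota u).
Proof.
move=> HD; elim=> [|p c w Dp Lc _ [Ww Hw]]; first by rewrite iota0; split=> //; exact: rspan0.
have WG : W (c *: G p) by exact: zf_Z.
rewrite iotaD // iotaZ //; split; first exact: zf_D.
by apply: rspanD => //; apply: rspanZ; apply: rspan_gen => //; exact: HD.
Qed.

Lemma Fr_span (Q : V -> Prop) (D : P -> Prop) u : Q 0 ->
  (forall x y, Q x -> Q y -> Q (x + y)) -> (forall a x, Q x -> Q (a *: x)) ->
  (forall r, D r -> Q (Fr (iotas (Gs r)))) ->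
  spn L Gs D u -> Ws u /\ Q (Fr (iotas u)).
Proof.
move=> Q0 QD QZ HD; elim=> [|p c w Dp Lc _ [Ww Hw]]; first by rewrite iotas0 linear0.
have WG : Ws (c *: Gs p) by exact: zf_Z.
rewrite iotasD // iotasZ // linearD linearZ; split; first exact: zf_D.
by apply: QD => //; apply: QZ; exact: HD.
Qed.

Local Notation Fi p := (Fr (iotas (Gs p))).

Lemma discrepancy h i p :
  (forall p', (cr_ht Cs p' < cr_ht Cs p)%N -> Fi p' = iota (G (sigma p'))) ->
  forall r, cr_fib Cs p r -> (0 < cr_eps Cs h i r)%N ->
  rspan (cr_ht C (sigma p)) (above C h i (sigma r)) (Fi r - iota (G (sigma r))).
Proof.
(* Descending induction on [eps], which the common height of the fibre bounds. *)
move=> IH r; have [n le_n] := ubnP (cr_ht Cs p - cr_eps Cs h i r); elim: n => // n IHn in r le_n *.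
move=> pr eps_r; set m := cr_eps Cs h i r; set b := cr_base Cs h i r.
have ht_b : (cr_ht Cs b < cr_ht Cs p)%N.
  by rewrite (fib_ht HCs pr) -(up_base HCs h i r) (ht_up HCs) -/b -addn1 addnC leq_add2r.
have fibC x : cr_fib C (sigma r) x -> (cr_ht C x <= cr_ht C (sigma p))%N.
  by move=> H; rewrite (fib_ht HC (sigma_fib pr)) (fib_ht HC H).
have WT h' i' n' u : W u -> W (act phi f d h' i' n' u).
  by move=> Wu; rewrite /act; case: h'; apply: zf_M => //; exact: zf_dp.
have WsT h' i' n' u : Ws u -> Ws (act phi fs ds h' i' n' u).
  by move=> Wu; rewrite /act; case: h'; apply: zf_M => //; exact: zf_dp.
have E1 : Fr (iotas (act phi fs ds h i m (Gs b))) = iota (act phi f d h i (li i * m) (G (sigma b))).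
  have Wd k := zf_dp phi fs ds i k; have Wd' k := zf_dp phi f d i k.
  rewrite /act; case: (h).
    have [_ -> _] := iotas_hom.2 _ _ (Wd m) (Gs_W b).
    have [_ -> _] := iota_hom.2 _ _ (Wd' (li i * m)%N) (G_W (sigma b)).
    by rewrite rmorphM /= Fr_dp IH.
  have [_ -> _] := iotas_hom.2 _ _ (Gs_W b) (Wd m).
  have [_ -> _] := iota_hom.2 _ _ (G_W (sigma b)) (Wd' (li i * m)%N).
  by rewrite rmorphM /= Fr_dp IH.
have [|W2 H2] := @iota_span (cr_ht C (sigma p)) _ _ _ (G_act h i (sigma r)).
  by move=> x [/fibC].
have [||||Ww Hw] := @Fr_span (rspan (cr_ht C (sigma p)) (above C h i (sigma r))) _ _ _ _ _ _ (Gs_act h i r).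
- exact: rspan0.
- exact: rspanD.
- by move=> a x; exact: rspanZ.
- move=> x [rx lt_x]; have px := fib_trans HCs pr rx.
  have le_x : (cr_eps Cs h i x <= cr_ht Cs x)%N.
    by rewrite -{2}(up_base HCs h i x) (ht_up HCs) leq_addr.
  rewrite -(fib_ht HCs px) in le_x.
  have lt_s : (cr_eps C h i (sigma r) < cr_eps C h i (sigma x))%N.
    by rewrite !sigma_eps ltn_pmul2l.
  rewrite -[Fi x](subrK (iota (G (sigma x)))); apply: rspanD.
    apply: rspanW (IHn x _ px _) => [y [xy lt_y]||].
    + by split; [exact: (fib_trans HC (sigma_fib rx) xy) | exact: ltn_trans lt_y].
    + by move: le_n lt_x le_x; rewrite /m; lia.
    + exact: leq_ltn_trans lt_x.
  by apply: rspan_gen; [split=> //; exact: sigma_fib | apply: fibC; exact: sigma_fib].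
set w1 := act phi fs ds h i _ _ - _ in Ww Hw; set w2 := act phi f d h i _ _ - _ in W2 H2.
have E2 : Fi r = Fr (iotas (act phi fs ds h i m (Gs b))) - Fr (iotas w1).
  rewrite -linearB -[act _ _ _ _ _ _ _ in RHS](subrK (Gs r)) -/w1 iotasD //=.
  by rewrite addrAC subrr add0r.
have E3 : iota (act phi f d h i (li i * m) (G (sigma b))) = iota w2 + iota (G (sigma r)).
  by rewrite -iotaD // /w2 subrK sigma_eps sigma_base.
have -> : Fi r - iota (G (sigma r)) = iota w2 + -1 *: Fr (iotas w1).
  by rewrite E2 E1 E3 scaleN1r addrAC addrK.
by apply: rspanD => //; exact: rspanZ.
Qed.

Theorem Fr_canonical p : Fi p = iota (G (sigma p)).
Proof.
have [n le_n] := ubnP (cr_ht Cs p); elim: n => // n IH in p le_n *.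
have [->|Np] := eqVneq p (cr_p0 Cs).
  by rewrite sigma_p0 Gs_p0 G_p0 iotas_hom.1 iota_hom.1 rmorph1.
have IHp p' : (cr_ht Cs p' < cr_ht Cs p)%N -> Fi p' = iota (G (sigma p')).
  by move=> lt_p; apply: IH; apply: leq_trans lt_p _.
have H h i := @discrepancy h i p IHp p (fib_refl HCs p).
have [i0 Hi0] := eps_pos HCs Np.
have Nsp : sigma p != cr_p0 C.
  apply: contraTneq Hi0 => E; have := sigma_eps true i0 p; rewrite E -sigma_p0 sigma_eps.
  have -> : cr_eps Cs true i0 (cr_p0 Cs) = 0%N.
    apply/eqP; rewrite -leqn0; have /eqP <- : cr_ht Cs (cr_p0 Cs) == 0%N by rewrite (ht_eq0 HCs).
    by rewrite -{2}(up_base HCs true i0 (cr_p0 Cs)) (ht_up HCs) leq_addr.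
  by rewrite muln0 => /esym/eqP; rewrite muln_eq0 eqn0Ngt li_gt0 /= => /eqP ->.
have [c0 Hc0 Ec0] := H true i0 Hi0.
apply/eqP; rewrite -subr_eq0 Ec0 big1_seq // => r /andP[_ rs].
have [-> |Nr] := eqVneq (c0 r) 0; first by rewrite scale0r.
have [fr _] := Hc0 r Nr; case: (eps_sep HC Nsp fr) => h i.
rewrite sigma_eps muln_gt0 => /andP[_ Hi]; rewrite -sigma_eps.
(* By independence all expansions of this difference coincide, so [r] satisfies the strict
   inequality for every side and index at once. *)
have [c Hc Ec] := H h i Hi.
have E : c r = c0 r.
  apply/eqP; rewrite -subr_eq0; apply/eqP.
  apply: (iota_indep (M := cr_ht C (sigma p)) (c := fun x => c x - c0 x)) => //.
  rewrite (eq_bigr (fun r => c r *: iota (G r) - c0 r *: iota (G r))) => [|x _]; last by rewrite scalerBl.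
  by rewrite sumrB -Ec -Ec0 subrr.
by case: (Hc r); rewrite ?E.
Qed.
End Discrepancy.

(** * Quantum groups *)

Section Fractions.
Import generic_quotient.
Local Open Scope quotient_scope.

Lemma tofrac_repr (R : idomainType) (c : {fraction R}) :
  exists2 p : R * R, p.2 != 0 & c = tofrac p.1 / tofrac p.2.
Proof.
elim/quotW: c => x; exists (frac x); first exact: denom_ratioP.
have Nd : tofrac (frac x).2 != 0 by rewrite tofrac_eq0 denom_ratioP.
apply: (canRL (mulfK Nd)); unlock tofrac; rewrite -[LHS]FracField.pi_mul.
apply/eqP; rewrite FracField.equivf_def /FracField.mulf /=.
by rewrite !numden_Ratio ?mulf_neq0 ?oner_eq0 ?denom_ratioP // !mulr1 mulrC.
Qed.
End Fractions.

Definition phiQ : {rmorphism {poly rat} -> Qq} := @tofrac {poly rat}.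

Lemma phiQ_inj : injective phiQ.
Proof. by move=> x y /eqP; rewrite tofrac_eq => /eqP. Qed.

Lemma phiQ_frac c : exists2 p : {poly rat} * {poly rat}, p.2 != 0 & c = phiQ p.1 / phiQ p.2.
Proof. exact: tofrac_repr. Qed.

Section UqModel.
Variables (D : root_datum) (U : uq_data D).

Local Notation dpU := (dpf phiQ (ud_f U) (@half_sq D)).
Local Notation Zf := (zform phiQ (ud_f U) (@half_sq D)).

Lemma divpowE i n : divpow (ud_f U) i n = dpU i n.
Proof.
rewrite /dpf dpE /divpow /qfact qfE; congr (_^-1 *: _).
by apply: eq_bigr => k _; rewrite qnE.
Qed.

Lemma UZ_zform u : UZ u <-> Zf u.
Proof.
split.
  elim=> [x [i [n ->]]||x y _ IHx _ IHy|x y _ IHx _ IHy|c x Lc _ IH].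
  - by rewrite divpowE; exact: zf_dp.
  - exact: zf_1.
  - exact: zf_D.
  - exact: zf_M.
  exact: zf_Z.
elim=> [i n||x y _ IHx _ IHy|x y _ IHx _ IHy|c x Lc _ IH].
- by apply: subalg_in; exists i, n; rewrite divpowE.
- exact: subalg_1.
- exact: subalg_D.
- exact: subalg_M.
exact: subalg_Z.
Qed.

Variables (P : eqType) (C : crystal (rd_I D) P) (B : P -> U).
Variable (Bh : bool -> rd_I D -> P -> U).

Record uq_model : Prop := UqModel {
  um_cry : is_crystal C;
  um_pbw : pbw_model phiQ C (ud_f U) (@half_sq D) B Bh;
  um_e : forall i p, cr_eps C true i p = 0%N -> ud_e' U i (Bh true i p) = 0 }.

Hypothesis HU : uq_model.
Let HC := um_cry HU.
Let HM := um_pbw HU.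

Let A_ring := AK_ring phiQ_inj.
Let qA_ideal := qAK_ideal phiQ_inj.
Let qA_unit := AK_unit phiQ_inj.

(** The presentation provides the character sending all generators to 0. It kills every element
    [Bh true i r] with positive [eps], which has a generator as left factor, and hence [B p] by
    Nakayama's lemma on the fibre. *)
Lemma augmentation : exists2 eta : {linear U -> Qq^o}, eta 1 = 1 &
  forall p, p != cr_p0 C -> eta (B p) = 0.
Proof.
have [_ univ _] := ud_pres U.
have [|eta Heta] := univ (Qq^o : algType Qq) (fun _ => 0).
  by move=> i j _; apply: big1 => k _; rewrite mulr0 mul0r scaler0.
exists eta => [|p Np]; first exact: rmorph1.
have : p \in fibs C p by apply/(mem_fibs HC); exact: (fib_refl HC).
have Hp r : r \in fibs C p -> cr_ht C r = cr_ht C p by move/(mem_fibs HC)/(fib_ht HC).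
apply: (nakayama (N := fun u => eta u = 0) A_ring qA_ideal qA_unit); first exact: linear0.
- by move=> x y /= Ex Ey; rewrite linearD /= Ex Ey addr0.
- by move=> a x _ Ex; rewrite linearZ /= Ex scaler0.
move=> r rs; have Nr : r != cr_p0 C by rewrite -(ht_eq0 HC) (Hp r rs) (ht_eq0 HC).
have [i Hi] := eps_pos HC Nr; exists (Bh true i r).
  have Ed n : eta (dpU i n.+1) = 0.
    by rewrite /dpf dpE linearZ /= exprS rmorphM /= Heta mul0r scaler0.
  rewrite -(up_base HC true i r) (pm_up HM) ?(eps_base HC) // /act rmorphM /=.
  by rewrite -(prednK Hi) Ed mul0r.
rewrite -opprB; apply: (spnN A_ring qA_ideal).
apply: spnW (pm_cong HM true i r) => // x rx; apply/(mem_fibs HC).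
exact: (fib_trans HC (proj2 (mem_fibs HC p r) rs) rx).
Qed.

Let et_0 : forall i u, ud_e' U i u = 0 -> ud_et U i u = 0.
Proof. exact: ud_et0. Qed.

Let et_S i u n : ud_e' U i u = 0 -> ud_et U i (dpU i n.+1 * u) = dpU i n * u.
Proof. by move=> H; rewrite -!divpowE ud_etS. Qed.

Let ft_E i u n : ud_e' U i u = 0 -> ud_ft U i (dpU i n * u) = dpU i n.+1 * u.
Proof. by move=> H; rewrite -!divpowE ud_ftE. Qed.

Lemma Linf_span u : Linf u <-> spn (AK phiQ) B (fun _ => True) u.
Proof.
rewrite -(spn_ftstr phiQ_inj HC HM (um_e HU) ft_E).
split; last first.
  elim=> [|s c w _ Ac _ IH]; first exact: submod_0.
  by apply: submod_D => //; apply: submod_Z => //; apply: submod_in; exists s.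
elim=> [x [s _ <-]||x y _ IHx _ IHy|c x Ac _ IH].
- exact: (spn_gen (ftstr (ud_ft U)) A_ring (p := s)).
- exact: spn0.
- exact: spnD.
by apply: spn_scale IH => a; apply: (ssM A_ring).
Qed.

Lemma cls_eq (u w : U) : spn (qAK phiQ) B (fun _ => True) (u - w) -> cls u = cls w.
Proof.
have sub x y : spn (qAK phiQ) B (fun _ => True) (x - y) -> forall z, cls x z -> cls y z.
  move=> H z [t Lt <-]; have [t' Lt' E] : exists2 t', Linf t' & x - y = q *: t'.
    exists (q^-1 *: (x - y)); last by rewrite scalerA divff ?scale1r //; exact: (qK_neq0 phiQ_inj).
    apply/Linf_span; apply: spn_scale H => _ [c Ac ->].
    by rewrite mulrA mulVf ?mul1r //; exact: (qK_neq0 phiQ_inj).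
  exists (t' + t); first by apply: submod_D.
  by rewrite scalerDr -E addrA addrCA subrr addr0.
move=> H; apply/seteqP; split; apply: (sub) => //.
by rewrite -opprB; apply: (spnN A_ring qA_ideal).
Qed.

Lemma Linf_B p : Linf (B p).
Proof. by apply/Linf_span; exact: (spn_gen _ A_ring). Qed.

Lemma Linf_qA u : spn (qAK phiQ) B (fun _ => True) u -> Linf u.
Proof. by move=> H; apply/Linf_span; apply: spnW H => // c; exact: (is_sub qA_ideal). Qed.

Lemma cls_ft_string s : cls (ft_string U s) = cls (B (pstr C s)).
Proof. by apply: cls_eq; apply: spnW (ftstr_B phiQ_inj HC HM (um_e HU) ft_E s). Qed.

Lemma cft_cls i u : Linf u -> cft U i (cls u) = cls (ud_ft U i u).
Proof.
move=> Lu; have Lft x : Linf x -> Linf (ud_ft U i x).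
  by move=> /Linf_span Lx; apply/Linf_span; exact: (ft_span phiQ_inj HC HM (um_e HU) ft_E).
have E x : Linf x -> cls (ud_ft U i (u + q *: x)) = cls (ud_ft U i u).
  move=> Lx; apply: cls_eq; rewrite linearD linearZ /= addrAC subrr add0r.
  by apply: spn_scale (proj1 (Linf_span _) (Lft x Lx)) => a Aa; exists a.
apply/seteqP; split=> [z [_ [x Lx <-]]|z Hz]; first by rewrite E.
by exists u => //; exists 0; [exact: submod_0 | rewrite scaler0 addr0].
Qed.

Lemma cft_B i p : cft U i (cls (B p)) = cls (B (cr_up C true i 1 p)).
Proof.
rewrite cft_cls; last exact: Linf_B.
by apply: cls_eq; apply: spnW (ft_B phiQ_inj HC HM (um_e HU) ft_E i (leqnn _)).
Qed.

Lemma iter_cft_B n i p : iter n (cft U i) (cls (B p)) = cls (B (cr_up C true i n p)).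
Proof.
elim: n => [|n IH] /=; first by rewrite (up0 HC).
by rewrite IH cft_B (up_up HC) add1n.
Qed.

Section Global.
Variable G : set U -> U.
Hypothesis HG : is_global G.

Let bar_q : ud_bar U (qK phiQ *: 1) = (qK phiQ)^-1 *: 1.
Proof. exact: ud_bar_q. Qed.

Let bar_f : forall i, ud_bar U (ud_f U i) = ud_f U i.
Proof. exact: ud_bar_f. Qed.

(** Such a [u] is balanced and lies in the class of 0, and [G] inverts [cls] on balanced
    elements. *)
Lemma global_uniq u : Zf u -> spn (qAK phiQ) B (fun _ => True) u ->
  spn (AK phiQ) B (fun _ => True) (ud_bar U u) -> u = 0.
Proof.
move=> Zu Hu Hbu; have bal x : UZ x -> Linf x -> Linf (ud_bar U x) -> balanced x.
  move=> Ux Lx Lbx; split; first by split=> //; exact: submod_in.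
  exists (ud_bar U x) => //; apply: (zform_barK phiQ_inj HM bar_q bar_f).
  exact/UZ_zform.
have <- : G (cls u) = u.
  by apply: HG.2; apply: bal; [exact/UZ_zform | exact: Linf_qA | exact/Linf_span].
have -> : cls u = cls 0 by apply: cls_eq; rewrite subr0.
apply: HG.2; apply: bal; rewrite ?rmorph0; try exact: submod_0.
rewrite -(scale0r (1 : U)); apply: subalg_Z; last exact: subalg_1.
exact (ss0 (LK_ring phiQ_inj)).
Qed.

Local Notation Gb := (Gp phiQ C (ud_f U) (@half_sq D) B (ud_bar U)).

Record global_basis (g : P -> U) : Prop := GlobalBasis {
  gb_form : forall p, Zf (g p);
  gb_1 : g (cr_p0 C) = 1;
  gb_G : forall p, G (cls (B p)) = g p;
  gb_act : forall h i p, spn (LK phiQ) g (above C h i p)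
    (act phiQ (ud_f U) (@half_sq D) h i (cr_eps C h i p) (g (cr_base C h i p)) - g p);
  gb_indep : forall N, indep (cr_upto C N) g;
  gb_span : forall u k, Zf u -> forall p, (k <= cr_ht C p)%N ->
    spn (LK phiQ) g (fun r => (k <= cr_ht C r)%N) (u * g p) }.

Lemma global_basisP : exists g, global_basis g.
Proof.
have [eta eta_1 eta_B] := augmentation.
have um_eU := um_e HU.
have canonP := Gp_canon phiQ_inj phiQ_frac HC HM um_eU et_0 et_S eta_1 eta_B bar_q bar_f global_uniq.
exists Gb; split.
- exact: (Gp_zform phiQ_inj phiQ_frac HC HM um_eU et_0 et_S eta_1 eta_B bar_q bar_f global_uniq).
- exact: (Gp_p0 phiQ_inj HM global_uniq).
- move=> p; have [Zg bg Hg] := canonP p.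
  have Lg : Linf (Gb p).
    by rewrite -[Gb p](subrK (B p)); apply: submod_D (Linf_B p); apply: Linf_qA; exact: spnW Hg.
  have -> : cls (B p) = cls (Gb p).
    by apply/esym/cls_eq; exact: spnW Hg.
  apply: HG.2; split; first by split=> //; apply: submod_in; exact/UZ_zform.
  by exists (Gb p).
- exact: (Gp_act phiQ_inj phiQ_frac HC HM um_eU et_0 et_S eta_1 eta_B bar_q bar_f global_uniq).
- exact: (Gp_indep phiQ_inj phiQ_frac HC HM um_eU et_0 et_S eta_1 eta_B bar_q bar_f global_uniq).
move=> u k Zu p le_k; have [Zg bg Hg] := canonP p.
apply: (zform_Gp phiQ_inj phiQ_frac HC HM um_eU et_0 et_S eta_1 eta_B bar_q bar_f global_uniq).
  exact: zf_M.
apply: (zform_ge phiQ_inj HC HM) => //.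
have qZ_B := canon_qZ phiQ_inj phiQ_frac HC HM um_eU et_0 et_S eta_1 eta_B (canonP p).
rewrite -[Gb p](subrK (B p)); apply: spnD; last exact: (spn_gen _ (LK_ring phiQ_inj)).
apply: spnW qZ_B => [c /(is_sub (qZK_ideal phiQ)) /ZK_L //|r /(fib_ht HC) <- //].
Qed.
End Global.
End UqModel.

(** * Reduction to a map of parameters *)

Section Transfer.
Variables (D : root_datum) (l : nat) (li : rd_I D -> nat).
Hypothesis Hli : is_multipliers l li.
Variables (R : idomainType) (zeta : R).
Hypotheses (Hl : (1 <= l)%N) (Hzeta : good_root_of_unity l zeta).
Variables (U : uq_data D) (Us : uq_data (star li)).
Variables (G : set U -> U) (Gs : set Us -> Us).
Hypotheses (HG : is_global G) (HGs : is_global Gs).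
Variables (V Vs : algType R) (iota : U -> V) (iotas : Us -> Vs).
Hypotheses (Hiota : is_specialization zeta iota) (Hiotas : is_specialization zeta iotas).
Variable Fr : {lrmorphism Vs -> V}.
Hypothesis HFr : is_Fr_splitting iotas iota Fr.
Variable S : set Us -> set U.
Hypothesis HS : is_crystal_embedding S.

Variables (P : eqType) (C Cs : crystal (rd_I D) P).
Variables (B : P -> U) (Bs : P -> Us).
Variables (Bh : bool -> rd_I D -> P -> U) (Bhs : bool -> rd_I D -> P -> Us).
Hypotheses (HU : uq_model C B Bh) (HUs : @uq_model (star li) Us P Cs Bs Bhs).
Variable sigma : P -> P.
Hypothesis sigma_fib : forall p r, cr_fib Cs p r -> cr_fib C (sigma p) (sigma r).
Hypothesis sigma_eps : forall h i p, cr_eps C h i (sigma p) = (li i * cr_eps Cs h i p)%N.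
Hypothesis sigma_base : forall h i p, cr_base C h i (sigma p) = sigma (cr_base Cs h i p).
Hypothesis sigma_p0 : sigma (cr_p0 Cs) = cr_p0 C.

Lemma zeta_unit : zeta \is a GRing.unit.
Proof.
have unit_root k : (0 < k)%N -> zeta ^+ k = 1 -> zeta \is a GRing.unit.
  by case: k => // k _ E; apply/unitrPr; exists (zeta ^+ k); rewrite -exprS.
case/orP: Hzeta => [/andP[_ H]|H]; apply: unit_root (prim_expr_order H) => //.
by rewrite double_gt0.
Qed.

Lemma zhom_UZ (D' : root_datum) (U' : uq_data D') (B' : algType R) (g : U' -> B') :
  hom_on_UZ zeta g <-> zhom phiQ zeta (zform phiQ (ud_f U') (@half_sq D')) g.
Proof.
by split=> -[g1 Hg]; split=> // x y /UZ_zform Zx /UZ_zform Zy; apply: Hg.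
Qed.

Lemma sigma_up i p : cr_up C true i (li i) (sigma p) = sigma (cr_up Cs true i 1 p).
Proof.
have [HC HCs] := (um_cry HU, um_cry HUs).
rewrite -[RHS](up_base HC true i) sigma_eps sigma_base (eps_up HCs) (base_up HCs).
rewrite -[sigma p in LHS](up_base HC true i) sigma_eps sigma_base (up_up HC).
by rewrite mulnDr muln1.
Qed.

Theorem transfer b : Binf b -> Fr (iotas (Gs b)) = iota (G (S b)).
Proof.
case=> s _ <-; have [HC HCs] := (um_cry HU, um_cry HUs).
have [g Hg] := global_basisP HU HG; have [gs Hgs] := global_basisP HUs HGs.
(* The embedding is forced by its value at [b_inf] and by the operators [cft], so it is [sigma] on
   parameters. *)
have ES : S (cls (ft_string Us s)) = cls (B (sigma (pstr Cs s))).
  elim: s => [|i s IH].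
    rewrite /= sigma_p0 (pm_1 (um_pbw HU)); exact: (ce_b_inf HS).
  have -> : cls (ft_string Us (i :: s)) = cft Us i (cls (ft_string Us s)).
    rewrite (cls_ft_string HUs) /= (cls_ft_string HUs) (cft_B HUs) //.
  rewrite (ce_ft HS); last by exists s.
  by rewrite IH (iter_cft_B HU) sigma_up.
rewrite /= ES (gb_G Hg) (cls_ft_string HUs) (gb_G Hgs).
have [hom univ _] := Hiota; have [homs _ _] := Hiotas.
apply: (Fr_canonical phiQ_inj zeta_unit HCs HC (gb_form Hgs) (gb_form Hg) (gb_1 Hgs) (gb_1 Hg)
  (gb_act Hgs) (gb_act Hg) (proj1 (zhom_UZ _) homs) (proj1 (zhom_UZ _) hom)
  _ (li := li) _ _ sigma_fib sigma_eps sigma_base sigma_p0).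
- move=> M c Ec p ps; apply: (specialisation_indep phiQ_inj zeta_unit _ (upto_uniq HC)
    (mem_upto HC) (gb_form Hg) (gb_1 Hg) _ (gb_indep Hg) (gb_span Hg) _ Ec ps).
  + exact: zf_M.
  + by apply/eqP; rewrite (ht_eq0 HC).
  move=> B' g' /zhom_UZ /univ [psi Hpsi]; exists psi => x /UZ_zform; exact: Hpsi.
- by move=> i; have [] := Hli i.
move=> i n; have := HFr i n; rewrite (divpowE U) => <-.
by rewrite (@divpowE (star li) Us).
Qed.
End Transfer.

(** * Crystals given by parametrizations *)

(* The crystal structure with index [i] on side [h] is read off one coordinate
   [sl h k] of the parametrization [m h k] attached to [k = ix i]. *)
Section Coordinates.
Variables (I : Type) (P : eqType) (n : nat) (ix : I -> nat).
Hypotheses (ix_lt : forall i, (ix i < n)%N) (ix_surj : forall k, (k < n)%N -> exists i, ix i = k).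
Variables (wt : nat -> P -> nat) (m m' : bool -> nat -> P -> P).
Variables (sl : bool -> nat -> P -> nat) (st : bool -> nat -> nat -> P -> P).
Variables (grid : nat -> seq P) (p0 : P).

Definition cheight p := (\sum_(k < n) wt k p)%N.

Definition coord_crystal : crystal I P := Crystal
  (fun p r => [forall k : 'I_n, wt k p == wt k r]) cheight
  (fun N => [seq p <- grid N | (cheight p <= N)%N]) p0
  (fun h i p => sl h (ix i) (m h (ix i) p))
  (fun h i p => m' h (ix i) (st h (ix i) 0 (m h (ix i) p)))
  (fun h i a p => m' h (ix i) (st h (ix i) (a + sl h (ix i) (m h (ix i) p)) (m h (ix i) p))).

Hypotheses (mK : forall h k p, (k < n)%N -> m' h k (m h k p) = p).
Hypotheses (m'K : forall h k p, (k < n)%N -> m h k (m' h k p) = p).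
Hypothesis sl_st : forall h k a p, (k < n)%N -> sl h k (st h k a p) = a.
Hypothesis st_sl : forall h k p, (k < n)%N -> st h k (sl h k p) p = p.
Hypothesis st_st : forall h k a b p, (k < n)%N -> st h k a (st h k b p) = st h k a p.
Hypothesis wt_st : forall h j k a p, (j < n)%N -> (k < n)%N ->
  (wt k (m' h j (st h j a p)) + (k == j) * sl h j p = wt k (m' h j p) + (k == j) * a)%N.
Hypothesis grid_uniq : forall N, uniq (grid N).
Hypothesis mem_grid : forall p, p \in grid (cheight p).
Hypothesis gridS : forall M N p, (M <= N)%N -> p \in grid M -> p \in grid N.
Hypothesis wt_eq0 : forall p, (forall k, (k < n)%N -> wt k p = 0%N) -> p = p0.
Hypothesis wt_p0 : forall k, wt k p0 = 0%N.
Hypothesis sl_pos : forall p, p != p0 -> exists2 k, (k < n)%N & (0 < sl true k (m true k p))%N.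
Hypothesis sl_sep : forall p r, p != p0 -> (forall k, (k < n)%N -> wt k p = wt k r) ->
  ~ (forall h k, (k < n)%N -> (0 < sl h k (m h k p))%N -> (sl h k (m h k p) < sl h k (m h k r))%N).

Let wt_up h i a p k : (k < n)%N ->
  wt k (cr_up coord_crystal h i a p) = (wt k p + (k == ix i) * a)%N.
Proof.
move=> lt_k; have := @wt_st h (ix i) k (a + sl h (ix i) (m h (ix i) p)) (m h (ix i) p) (ix_lt i) lt_k.
by rewrite /= mK //; case: (k == ix i); lia.
Qed.

Lemma coord_crystalP : is_crystal coord_crystal.
Proof.
split.
- by move=> p; apply/forallP.
- by move=> p r; apply: eq_forallb => k; rewrite eq_sym.
- move=> p r s /forallP H1 /forallP H2; apply/forallP => k.
  by rewrite (eqP (H1 k)) (eqP (H2 k)).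
- move=> p r /forallP H; apply: eq_bigr => k _; exact/eqP.
- by move=> N; apply: filter_uniq.
- move=> N p; rewrite mem_filter; case: leqP => //= le_N.
  exact: gridS le_N (mem_grid p).
- move=> p; apply/idP/eqP => [|->] /=.
    rewrite /cheight sum_nat_eq0 => /forallP H; apply: wt_eq0 => k lt_k.
    by have := H (Ordinal lt_k) => /eqP.
  by rewrite /cheight big1.
- by move=> h i p /=; rewrite m'K // sl_st.
- by move=> h i p /=; rewrite m'K // sl_st // addn0 st_st // st_sl // mK.
- by move=> h i a p /=; rewrite m'K // sl_st.
- by move=> h i a p /=; rewrite m'K // st_st.
- by move=> h i a b p /=; rewrite m'K // sl_st // st_st // addnA.
- move=> h i a p r; apply: eq_forallb => k; rewrite !wt_up //.
  by rewrite eqn_add2r.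
- move=> h i a p; rewrite /= /cheight (eq_bigr (fun k : 'I_n => wt k p + ((k : nat) == ix i) * a))%N; last first.
    by move=> k _; exact: (wt_up h i a p (ltn_ord k)).
  rewrite big_split /= addnC; congr (_ + _)%N.
  by rewrite (bigD1 (Ordinal (ix_lt i))) //= eqxx mul1n big1 ?addn0 // => k /negPf; rewrite -val_eqE /= => ->.
- by move=> p /sl_pos [k /ix_surj [i <-] H]; exists i.
move=> p r Np /forallP H Hs; apply: (sl_sep (p := p) (r := r)) => // [k lt_k|h k /ix_surj [i <-]].
  by have /eqP := H (Ordinal lt_k).
exact: Hs.
Qed.

End Coordinates.

(** * Parameters in types A1 and A2 *)

Definition wtA1 (k p : nat) := p.
Definition idm (P : Type) (h : bool) (k : nat) (p : P) := p.

Definition crA1 (I : Type) (ix : I -> nat) : crystal I nat :=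
  coord_crystal 1 ix wtA1 (@idm nat) (@idm nat) (fun _ _ p => p) (fun _ _ a _ => a)
    (fun N => box N.+1) 0%N.

Lemma crA1P (I : Type) (ix : I -> nat) : (forall i, (ix i < 1)%N) ->
  (forall k, (k < 1)%N -> exists i, ix i = k) -> is_crystal (crA1 ix).
Proof.
move=> lt_ix surj_ix.
have hE p : cheight 1 wtA1 p = p by rewrite /cheight big_ord1.
apply: coord_crystalP => //.
- by move=> h [|//] [|//] a p; rewrite /= !mul1n addnC.
- by move=> N; rewrite iota_uniq.
- by move=> p; rewrite hE mem_box.
- by move=> M N p le_MN; rewrite !mem_box !ltnS => /leq_trans; apply.
- by move=> p /(_ 0%N isT).
- by move=> p Np; exists 0%N; rewrite ?lt0n.
move=> p r Np H1 H2; have := H2 true 0%N isT; rewrite lt0n => /(_ Np).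
by rewrite /idm [p](H1 0%N isT) ltnn.
Qed.

Definition box3 n := boxX (boxX (box n) (box n)) (box n).

Lemma mem_box3 n a b c : ((a, b, c) \in box3 n) = [&& (a < n), (b < n) & (c < n)]%N.
Proof. by rewrite !mem_boxX !mem_box -!andbA. Qed.

Definition wtA2 (k : nat) (p : nat * nat * nat) : nat :=
  let '(a, b, c) := p in if k == 0%N then (a + b)%N else (b + c)%N.
(** [p] itself belongs to the monomials that begin with generator 0 and end with generator 1; the
    other two cases need the transformed parameters. *)
Definition mA2 (h : bool) (k : nat) (p : nat * nat * nat) := if h (+) (k == 0%N) then a2_mut p else p.
Definition slA2 (h : bool) (k : nat) (p : nat * nat * nat) : nat := if h then p.1.1 else p.2.
Definition stA2 (h : bool) (k a : nat) (p : nat * nat * nat) : nat * nat * nat :=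
  if h then (a, p.1.2, p.2) else (p.1.1, p.1.2, a).

Definition crA2 (I : Type) (ix : I -> nat) : crystal I (nat * nat * nat) :=
  coord_crystal 2 ix wtA2 mA2 mA2 slA2 stA2 (fun N => box3 N.+1) (0, 0, 0)%N.

Lemma crA2P (I : Type) (ix : I -> nat) : (forall i, (ix i < 2)%N) ->
  (forall k, (k < 2)%N -> exists i, ix i = k) -> is_crystal (crA2 ix).
Proof.
move=> lt_ix surj_ix.
have hE p : cheight 2 wtA2 p = (wtA2 0 p + wtA2 1 p)%N by rewrite /cheight !big_ord_recl big_ord0 addn0.
have mK h k p : mA2 h k (mA2 h k p) = p by rewrite /mA2; case: (h (+) (k == 0%N)) => //; exact: a2_mutK.
apply: coord_crystalP => //.
- by move=> [] k a p.
- by move=> [] k [[a b] c].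
- by move=> [] k a b p.
- by move=> [] [|[|//]] [|[|//]] a [[x y] z] _ _; rewrite /mA2 /wtA2 /stA2 /slA2 /a2_mut /=; lia.
- by move=> N; rewrite !boxX_uniq ?iota_uniq.
- by move=> [[a b] c]; rewrite hE mem_box3 /=; lia.
- by move=> M N [[a b] c] le_MN; rewrite !mem_box3; lia.
- move=> [[a b] c] H; have := H 0%N isT; have := H 1%N isT; rewrite /wtA2 /= => H1 H0.
  by congr (_, _, _); lia.
- by case=> [|[|k]].
- move=> [[a b] c] Np; case: (posnP a) => [a0|a_gt]; last by exists 0%N.
  exists 1%N => //; rewrite /slA2 /mA2 /a2_mut a0 /= min0n subn0 addn_gt0 !lt0n -negb_and.
  by apply: contra Np => /andP[/eqP -> /eqP ->]; rewrite a0.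
move=> [[a b] c] [[a' b'] c'] Np H1 H2.
have := H1 0%N isT; have := H1 1%N isT.
have := H2 true 0%N isT; have := H2 true 1%N isT; have := H2 false 0%N isT; have := H2 false 1%N isT.
rewrite /slA2 /mA2 /a2_mut /wtA2 /=.
have : (0 < a + b + c)%N.
  rewrite lt0n; apply: contra Np; rewrite !addn_eq0 => /andP[/andP[/eqP -> /eqP ->] /eqP ->] //.
lia.
Qed.

(** * Parameters in type A3 *)

Notation nat6 := (nat * nat * nat * nat * nat * nat)%type.

(* The parameters for the reduced word 213213 are transformed into those for
   312132 by four rank two moves. *)
Definition a3_g1 (p : nat6) : nat6 := let '(c1, c2, c3, c4, c5, c6) := p in
  let '(x, y, z) := a2_mut (c2, c4, c5) in (c1, c3, x, y, z, c6).
Definition a3_g1' (p : nat6) : nat6 := let '(c1, c3, x, y, z, c6) := p in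
  let '(c2, c4, c5) := a2_mut (x, y, z) in (c1, c2, c3, c4, c5, c6).
Definition a3_g2 (p : nat6) : nat6 := let '(a, b, c, y, z, c6) := p in
  let '(a1, a2, a3) := a2_mut (a, b, c) in (a1, a2, a3, y, z, c6).
Definition a3_g3 (p : nat6) : nat6 := let '(a1, a2, a3, y, z, c6) := p in
  let '(b1, b2, b3) := a2_mut (a3, z, c6) in (a1, a2, y, b1, b2, b3).
Definition a3_g3' (p : nat6) : nat6 := let '(a1, a2, y, b1, b2, b3) := p in
  let '(a3, z, c6) := a2_mut (b1, b2, b3) in (a1, a2, a3, y, z, c6).
Definition a3_g4 (p : nat6) : nat6 := let '(a1, a2, y, b1, b2, b3) := p in
  let '(d1, d2, d3) := a2_mut (a2, y, b1) in (a1, d1, d2, d3, b2, b3).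

Definition a3_mut p := a3_g4 (a3_g3 (a3_g2 (a3_g1 p))).
Arguments a3_mut : simpl never.
Definition a3_mut' p := a3_g1' (a3_g2 (a3_g3' (a3_g4 p))).

Lemma a3_g1K p : a3_g1' (a3_g1 p) = p.
Proof.
case: p => [[[[[c1 c2] c3] c4] c5] c6]; rewrite /a3_g1 /a3_g1'.
have := a2_mutK (c2, c4, c5); case: (a2_mut (c2, c4, c5)) => [[x y] z] -> //.
Qed.

Lemma a3_g1'K p : a3_g1 (a3_g1' p) = p.
Proof.
case: p => [[[[[c1 c3] x] y] z] c6]; rewrite /a3_g1 /a3_g1'.
have := a2_mutK (x, y, z); case: (a2_mut (x, y, z)) => [[c2 c4] c5] -> //.
Qed.

Lemma a3_g2K p : a3_g2 (a3_g2 p) = p.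
Proof.
case: p => [[[[[a b] c] y] z] c6]; rewrite /a3_g2.
have := a2_mutK (a, b, c); case: (a2_mut (a, b, c)) => [[a1 a2] a3] -> //.
Qed.

Lemma a3_g3K p : a3_g3' (a3_g3 p) = p.
Proof.
case: p => [[[[[a b] c] y] z] c6]; rewrite /a3_g3 /a3_g3'.
have := a2_mutK (c, z, c6); case: (a2_mut (c, z, c6)) => [[a1 a2] a3] -> //.
Qed.

Lemma a3_g3'K p : a3_g3 (a3_g3' p) = p.
Proof.
case: p => [[[[[a b] c] y] z] c6]; rewrite /a3_g3 /a3_g3'.
have := a2_mutK (y, z, c6); case: (a2_mut (y, z, c6)) => [[a1 a2] a3] -> //.
Qed.

Lemma a3_g4K p : a3_g4 (a3_g4 p) = p.
Proof.
case: p => [[[[[a b] c] y] z] c6]; rewrite /a3_g4.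
have := a2_mutK (b, c, y); case: (a2_mut (b, c, y)) => [[a1 a2] a3] -> //.
Qed.

Lemma a3_mutK p : a3_mut' (a3_mut p) = p.
Proof. by rewrite /a3_mut /a3_mut' a3_g4K a3_g3K a3_g2K a3_g1K. Qed.

Lemma a3_mut'K p : a3_mut (a3_mut' p) = p.
Proof. by rewrite /a3_mut /a3_mut' a3_g1'K a3_g2K a3_g3'K a3_g4K. Qed.

Definition wtA3 (k : nat) (p : nat6) : nat := let '(c1, c2, c3, c4, c5, c6) := p in
  if k == 0%N then (c2 + c4 + c6)%N else if k == 1%N then (c1 + c2 + c3 + c4)%N
  else (c3 + c4 + c5)%N.

Definition wtA3' (k : nat) (p : nat6) : nat := let '(a1, d1, d2, d3, b2, b3) := p in
  if k == 0%N then (d1 + d2 + b2)%N else if k == 1%N then (d2 + d3 + b2 + b3)%N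
  else (a1 + d2 + d3)%N.

Lemma a2_mut_spec a b c : exists x m z, a2_mut (a, b, c) = (x, m, z) /\
  [/\ m <= a, m <= c, m = a \/ m = c, x + m = b + c & z + m = a + b]%N.
Proof.
exists (b + c - minn a c)%N, (minn a c), (a + b - minn a c)%N; split=> //.
by split; lia.
Qed.

(* The numbers of times that f3, f1 can be split off on the left and f2 on the
   right. *)
Lemma a3_mutE c1 c2 c3 c4 c5 c6 : exists a1 d1 d2 d3 b2 b3,
  [/\ a3_mut (c1, c2, c3, c4, c5, c6) = (a1, d1, d2, d3, b2, b3),
    forall k, (k < 3)%N -> wtA3' k (a1, d1, d2, d3, b2, b3) = wtA3 k (c1, c2, c3, c4, c5, c6),
    [/\ c3 <= a1, c3 + c4 <= a1 + c1, c3 + c4 + c5 <= a1 + c1 + c2 &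
      [\/ a1 = c3, a1 + c1 = c3 + c4 | a1 + c1 + c2 = c3 + c4 + c5]]%N,
    [/\ c2 <= d1, c2 + c4 <= d1 + c1, c2 + c4 + c6 <= d1 + c1 + c3 &
      [\/ d1 = c2, d1 + c1 = c2 + c4 | d1 + c1 + c3 = c2 + c4 + c6]]%N &
    [/\ c4 <= b3, c2 + c4 <= b3 + c5, c3 + c4 <= b3 + c6,
        c2 + c3 + c4 <= b3 + c5 + c6 & c1 + c2 + c3 <= b3 + c5 + c6]%N /\
      [\/ b3 = c4, b3 + c5 = c2 + c4, b3 + c6 = c3 + c4 |
        b3 + c5 + c6 = c2 + c3 + c4 \/ b3 + c5 + c6 = c1 + c2 + c3]%N].
Proof.
rewrite /a3_mut /a3_g1.
have [x [m1 [z [-> [E1 E1' E1'' Ex Ez]]]]] := a2_mut_spec c2 c4 c5; rewrite /a3_g2.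
have [a1 [m2 [a3 [-> [E2 E2' E2'' Ea1 Ea3]]]]] := a2_mut_spec c1 c3 x; rewrite /a3_g3.
have [b1 [m3 [b3 [-> [E3 E3' E3'' Eb1 Eb3]]]]] := a2_mut_spec a3 z c6; rewrite /a3_g4.
have [d1 [m4 [d3 [-> [E4 E4' E4'' Ed1 Ed3]]]]] := a2_mut_spec m2 m1 b1.
exists a1, d1, m4, d3, m3, b3; split=> //.
- by move=> [|[|[|//]]] _; rewrite /=; clear E1 E1' E1'' E2 E2' E2'' E3 E3' E3'' E4 E4' E4''; lia.
- clear E3 E3' E3'' Eb1 Eb3 E4 E4' E4'' Ed1 Ed3.
  case: E1'' => F1; case: E2'' => F2; subst; (split; try lia);
    (have [F|[F|F]] : (a1 = c3 \/ a1 + c1 = c3 + c4 \/ a1 + c1 + c2 = c3 + c4 + c5)%N by lia);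
    by [constructor 1 | constructor 2 | constructor 3].
- case: E1'' => F1; case: E2'' => F2; case: E3'' => F3; case: E4'' => F4; subst; (split; try lia);
    (have [F|[F|F]] : (d1 = c2 \/ d1 + c1 = c2 + c4 \/ d1 + c1 + c3 = c2 + c4 + c6)%N by lia);
    by [constructor 1 | constructor 2 | constructor 3].
clear E4 E4' E4'' Ed1 Ed3.
case: E1'' => F1; case: E2'' => F2; case: E3'' => F3; subst; (split; first by split; lia);
  (have [F|[F|[F|F]]] : (b3 = c4 \/ b3 + c5 = c2 + c4 \/ b3 + c6 = c3 + c4 \/
    (b3 + c5 + c6 = c2 + c3 + c4 \/ b3 + c5 + c6 = c1 + c2 + c3))%N by lia);
  by [constructor 1 | constructor 2 | constructor 3 | constructor 4].
Qed.

(** [L1], [L3], [R2] and [M1], [M3], [N2] are the counters of the two elements that need transformed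
    parameters. Each is a maximum of linear expressions, given by lower bounds for the first element
    and by the attained value for the second. The weights then force [L1] and [L3] to vanish, and
    the rest collapses. *)
Lemma a3_sep c1 c2 c3 c4 c5 c6 d1 d2 d3 d4 d5 d6 L1 L3 R2 M1 M3 N2 :
  (c2 + c4 + c6 = d2 + d4 + d6 -> c3 + c4 + c5 = d3 + d4 + d5 ->
   c1 + c2 + c3 + c4 = d1 + d2 + d3 + d4 ->
   c3 <= L3 -> c3 + c4 <= L3 + c1 -> c3 + c4 + c5 <= L3 + c1 + c2 ->
   c2 <= L1 -> c2 + c4 <= L1 + c1 -> c2 + c4 + c6 <= L1 + c1 + c3 ->
   c4 <= R2 -> c2 + c4 <= R2 + c5 -> c3 + c4 <= R2 + c6 ->
   c2 + c3 + c4 <= R2 + c5 + c6 -> c1 + c2 + c3 <= R2 + c5 + c6 ->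
   [\/ M3 = d3, M3 + d1 = d3 + d4 | M3 + d1 + d2 = d3 + d4 + d5] ->
   [\/ M1 = d2, M1 + d1 = d2 + d4 | M1 + d1 + d3 = d2 + d4 + d6] ->
   [\/ N2 = d4, N2 + d5 = d2 + d4, N2 + d6 = d3 + d4 |
      N2 + d5 + d6 = d2 + d3 + d4 \/ N2 + d5 + d6 = d1 + d2 + d3] ->
   (0 < c1 -> c1 < d1) -> (0 < c5 -> c5 < d5) -> (0 < c6 -> c6 < d6) ->
   (0 < L1 -> L1 < M1) -> (0 < L3 -> L3 < M3) -> (0 < R2 -> R2 < N2) ->
   c1 + c2 + c3 + c4 + c5 + c6 = 0)%N.
Proof.
move=> W1 W2 W3 a1 a2 a3 b1 b2 b3 e1 e2 e3 e4 e5 H3 H1 H2 G1 G5 G6 GL1 GL3 GR2.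
have strict k k' : (0 < k -> k < k')%N -> k = 0%N \/ (k < k')%N.
  by case: k => [|k] H; [left | right; apply: H].
have x1 : (c1 <= d1)%N by case: (strict _ _ G1) => [->|/ltnW].
have x5 : (c5 <= d5)%N by case: (strict _ _ G5) => [->|/ltnW].
have x6 : (c6 <= d6)%N by case: (strict _ _ G6) => [->|/ltnW].
have x4 : (c4 <= d4)%N.
  case: (strict _ _ GR2) => [E|lt_R]; first by rewrite E leqn0 in e1; rewrite (eqP e1).
  clear - W1 W2 W3 x1 x5 x6 e1 e2 e3 e4 e5 H2 lt_R.
  by case: H2 => [E|E|E|[E|E]]; lia.
have E3 : L3 = 0%N.
  case: (strict _ _ GL3) => // lt_L; clear - W1 W2 W3 x1 x5 x6 x4 a1 a2 a3 H3 lt_L.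
  by case: H3 => E; lia.
have E1 : L1 = 0%N.
  case: (strict _ _ GL1) => // lt_L; clear - W1 W2 W3 x1 x5 x6 x4 b1 b2 b3 H1 lt_L.
  by case: H1 => E; lia.
have [c30 c20] : c3 = 0%N /\ c2 = 0%N by clear - a1 b1 E3 E1; lia.
have [[y1 y4] [y5 y6]] : (d1 = c1 /\ d4 = c4) /\ (d5 = c5 /\ d6 = c6).
  by clear - W1 W2 W3 x1 x5 x6 x4 c30 c20; lia.
have c10 : c1 = 0%N by case: (strict _ _ G1) => //; rewrite y1 ltnn.
have c50 : c5 = 0%N by case: (strict _ _ G5) => //; rewrite y5 ltnn.
have c60 : c6 = 0%N by case: (strict _ _ G6) => //; rewrite y6 ltnn.
have c40 : c4 = 0%N by clear - a2 E3 c10 c30; lia.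
by rewrite c10 c20 c30 c40 c50 c60.
Qed.

Definition mA3 (h : bool) (k : nat) (p : nat6) := if h (+) (k == 1%N) then a3_mut p else p.
Definition mA3' (h : bool) (k : nat) (p : nat6) := if h (+) (k == 1%N) then a3_mut' p else p.
Definition slA3 (h : bool) (k : nat) (p : nat6) : nat := let '(a, b, c, d, e, f) := p in
  if h then (if k == 0%N then b else a) else (if k == 2%N then e else f).
Definition stA3 (h : bool) (k n : nat) (p : nat6) : nat6 := let '(a, b, c, d, e, f) := p in
  if h then (if k == 0%N then (a, n, c, d, e, f) else (n, b, c, d, e, f))
  else (if k == 2%N then (a, b, c, d, n, f) else (a, b, c, d, e, n)).
Definition box6 n := boxX (boxX (boxX (boxX (boxX (box n) (box n)) (box n)) (box n)) (box n)) (box n).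

Lemma mem_box6 n a b c d e f : ((a, b, c, d, e, f) \in box6 n) =
  [&& (a < n), (b < n), (c < n), (d < n), (e < n) & (f < n)]%N.
Proof. by rewrite !mem_boxX !mem_box -!andbA. Qed.

Definition crA3 (I : Type) (ix : I -> nat) : crystal I nat6 :=
  coord_crystal 3 ix wtA3 mA3 mA3' slA3 stA3 (fun N => box6 N.+1) (0, 0, 0, 0, 0, 0)%N.

Lemma wtA3_mut k p : (k < 3)%N -> wtA3' k (a3_mut p) = wtA3 k p.
Proof.
case: p => [[[[[c1 c2] c3] c4] c5] c6].
by have [a1 [d1 [d2 [d3 [b2 [b3 [-> H _ _ _]]]]]]] := a3_mutE c1 c2 c3 c4 c5 c6; exact: H.
Qed.

Lemma wtA3_mut' k p : (k < 3)%N -> wtA3 k (a3_mut' p) = wtA3' k p.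
Proof. by move=> lt_k; rewrite -[p in RHS]a3_mut'K wtA3_mut. Qed.

Lemma crA3P (I : Type) (ix : I -> nat) : (forall i, (ix i < 3)%N) ->
  (forall k, (k < 3)%N -> exists i, ix i = k) -> is_crystal (crA3 ix).
Proof.
move=> lt_ix surj_ix.
have hE p : cheight 3 wtA3 p = (wtA3 0 p + wtA3 1 p + wtA3 2 p)%N.
  by rewrite /cheight !big_ord_recl big_ord0 addn0 addnA.
have mut_eq h k p : mA3' h k (mA3 h k p) = p.
  by rewrite /mA3' /mA3; case: (h (+) _) => //; exact: a3_mutK.
have mut_eq' h k p : mA3 h k (mA3' h k p) = p.
  by rewrite /mA3' /mA3; case: (h (+) _) => //; exact: a3_mut'K.
have wtm h j k p : (j < 3)%N -> (k < 3)%N ->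
    wtA3 k (mA3' h j p) = if h (+) (j == 1%N) then wtA3' k p else wtA3 k p.
  by move=> lt_j lt_k; rewrite /mA3'; case: (h (+) _) => //; exact: wtA3_mut'.
have Em h k q : h (+) (k == 1%N) -> mA3 h k q = a3_mut q by rewrite /mA3 => ->.
apply: coord_crystalP => //.
- by move=> h k n [[[[[a b] c] d] e] f] _; rewrite /stA3 /slA3; case: h; case: eqP.
- by move=> h k [[[[[a b] c] d] e] f] _; rewrite /stA3 /slA3; case: h; case: eqP.
- by move=> h k n n' [[[[[a b] c] d] e] f] _; rewrite /stA3; case: h; case: eqP.
- move=> h j k n [[[[[a b] c] d] e] f] lt_j lt_k; rewrite !wtm // /stA3 /slA3.
  by case: h j k lt_j lt_k => [] [|[|[|//]]] [|[|[|//]]] _ _ /=; lia.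
- by move=> N; rewrite !boxX_uniq ?iota_uniq.
- by move=> [[[[[a b] c] d] e] f]; rewrite hE mem_box6 /=; lia.
- by move=> M N [[[[[a b] c] d] e] f] le_MN; rewrite !mem_box6; lia.
- move=> [[[[[a b] c] d] e] f] H; have := H 0%N isT; have := H 1%N isT; have := H 2%N isT.
  by rewrite /wtA3 /= => H1 H2 H3; congr (_, _, _, _, _, _); lia.
- by case=> [|[|[|k]]].
- move=> [[[[[c1 c2] c3] c4] c5] c6] Np.
  have [a1 [d1 [d2 [d3 [b2 [b3 [E _ HL3 HL1 _]]]]]]] := a3_mutE c1 c2 c3 c4 c5 c6.
  have [c1p|c1p] := posnP c1; last by exists 1%N; rewrite ?lt0n -?lt0n.
  have [a1p|a1p] := posnP a1; last by exists 2%N => //; rewrite Em // E.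
  exists 0%N => //; rewrite Em // E /=; case: HL3 HL1 => A1 A2 A3 _ [D1 D2 D3 _].
  rewrite lt0n; apply: contra Np => /eqP d10; apply/eqP; congr (_, _, _, _, _, _); lia.
move=> [[[[[c1 c2] c3] c4] c5] c6] [[[[[c1' c2'] c3'] c4'] c5'] c6'] Np H1 H2.
have [a1 [d1 [d2 [d3 [b2 [b3 [E _ [A1 A2 A3 _] [D1 D2 D3 _] [[B1 B2 B3 B4 B5] _]]]]]]]] :=
  a3_mutE c1 c2 c3 c4 c5 c6.
have [a1' [d1' [d2' [d3' [b2' [b3' [E' _ [_ _ _ A'] [_ _ _ D'] [_ B']]]]]]]] :=
  a3_mutE c1' c2' c3' c4' c5' c6'.
have L1 := H2 true 0%N isT; rewrite !Em // E E' /= in L1.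
have L3 := H2 true 2%N isT; rewrite !Em // E E' /= in L3.
have R2 := H2 false 1%N isT; rewrite !Em // E E' /= in R2.
have L2 := H2 true 1%N isT; rewrite /mA3 /= in L2.
have R1 := H2 false 0%N isT; rewrite /mA3 /= in R1.
have R3 := H2 false 2%N isT; rewrite /mA3 /= in R3.
have := H1 0%N isT; have := H1 1%N isT; have := H1 2%N isT; rewrite /wtA3 /= => W2 W1 W0.
have E0 := a3_sep W0 W2 W1 A1 A2 A3 D1 D2 D3 B1 B2 B3 B4 B5 A' D' B' L2 R3 R1 L1 L3 R2.
by case/negP: Np; apply/eqP; congr (_, _, _, _, _, _); move: E0; clear; lia.
Qed.

(** * Parameters in type B2 *)

Notation nat4 := (nat * nat * nat * nat)%type.

(** Both outer coordinates of the image are maxima of three linear expressions; bounds and attained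
    cases suit linear arithmetic better than the definition through [par] and [tri]. *)
Lemma psi_spec u c b a : exists u' c' b' a', psi (u, c, b, a) = (u', c', b', a') /\
  [/\ [/\ b <= u', u + c <= u' + a, b + c <= u' + a &
        u' = b \/ u' + a = u + c \/ u' + a = b + c],
      [/\ c <= a', b.*2 + c <= a' + u.*2, a + b.*2 <= a' + u.*2 &
        a' = c \/ a' + u.*2 = b.*2 + c \/ a' + u.*2 = a + b.*2],
      u' + c' + b' = u + c + b & c' + b'.*2 + a' = c + b.*2 + a]%N.
Proof.
case E : (psi (u, c, b, a)) => [[[u' c'] b'] a']; exists u', c', b', a'; split=> //.
have [F1 F2] : fib4 (u + c + b) (c + b.*2 + a) (u', c', b', a').
  by rewrite -E; apply: psi_fib.
move: E; rewrite /psi /par /=.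
by case: leqP => H; rewrite /tri; case: leqP => H' [<- Ec Eb <-]; split; try split; lia.
Qed.

Definition wtB2 (k : nat) (p : nat4) : nat := let '(u, c, b, a) := p in
  if k == 0%N then (c + b.*2 + a)%N else (u + c + b)%N.
Definition mB2 (h : bool) (k : nat) (p : nat4) := if h (+) (k == 1%N) then psi p else p.
Definition slB2 (h : bool) (k : nat) (p : nat4) : nat := let '(u, c, b, a) := p in
  if k == 1%N then u else a.
Definition stB2 (h : bool) (k n : nat) (p : nat4) : nat4 := let '(u, c, b, a) := p in
  if k == 1%N then (n, c, b, a) else (u, c, b, n).

(* The index [0] is that of the short root. *)
Definition crB2 (I : Type) (ix : I -> nat) : crystal I nat4 :=
  coord_crystal 2 ix wtB2 mB2 mB2 slB2 stB2 (fun N => box4 N.+1) (0, 0, 0, 0)%N.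

Lemma wtB2_psi k p : wtB2 k (psi p) = wtB2 k p.
Proof.
case: p => [[[u c] b] a]; have [u' [c' [b' [a' [-> [_ _ E1 E2]]]]]] := psi_spec u c b a.
by rewrite /wtB2; case: eqP.
Qed.

Lemma crB2P (I : Type) (ix : I -> nat) : (forall i, (ix i < 2)%N) ->
  (forall k, (k < 2)%N -> exists i, ix i = k) -> is_crystal (crB2 ix).
Proof.
move=> lt_ix surj_ix.
have hE p : cheight 2 wtB2 p = (wtB2 0 p + wtB2 1 p)%N by rewrite /cheight !big_ord_recl big_ord0 addn0.
have mK h k p : mB2 h k (mB2 h k p) = p.
  by rewrite /mB2; case: (h (+) _) => //; exact: psiK.
have wtm h k j p : wtB2 k (mB2 h j p) = wtB2 k p.
  by rewrite /mB2; case: (h (+) _) => //; exact: wtB2_psi.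
have Em h k q : h (+) (k == 1%N) -> mB2 h k q = psi q by rewrite /mB2 => ->.
apply: coord_crystalP => //.
- by move=> h k n [[[u c] b] a] _; rewrite /stB2 /slB2; case: eqP.
- by move=> h k [[[u c] b] a] _; rewrite /stB2 /slB2; case: eqP.
- by move=> h k n n' [[[u c] b] a] _; rewrite /stB2; case: eqP.
- move=> h j k n [[[u c] b] a] lt_j lt_k; rewrite !wtm // /stB2 /slB2.
  by case: j k lt_j lt_k => [|[|//]] [|[|//]] _ _ /=; lia.
- by move=> N; rewrite !boxX_uniq ?iota_uniq.
- by move=> [[[u c] b] a]; rewrite hE mem_box4 /=; lia.
- by move=> M N [[[u c] b] a] le_MN; rewrite !mem_box4; lia.
- move=> [[[u c] b] a] H; have := H 0%N isT; have := H 1%N isT; rewrite /wtB2 /= => H1 H0.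
  by congr (_, _, _, _); lia.
- by case=> [|[|k]].
- move=> [[[u c] b] a] Np.
  have [up|up] := posnP u; last by exists 1%N.
  exists 0%N => //; rewrite Em //.
  have [u' [c' [b' [a' [-> [_ [H1 H2 H3 _] _ _]]]]]] := psi_spec u c b a.
  rewrite lt0n /=; apply: contra Np => /eqP E; apply/eqP; congr (_, _, _, _); lia.
move=> [[[u c] b] a] [[[x y] z] w] Np H1 H2.
have [u' [c' [b' [a' [E [[A1 A2 A3 _] [B1 B2 B3 _] _ _]]]]]] := psi_spec u c b a.
have [x' [y' [z' [w' [E' [[_ _ _ A4] [_ _ _ B4] _ _]]]]]] := psi_spec x y z w.
have W0 := H1 0%N isT; have W1 := H1 1%N isT; rewrite /wtB2 /= in W0 W1.
have Ls := H2 true 0%N isT; rewrite !Em // E E' /= in Ls.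
have Rt := H2 false 1%N isT; rewrite !Em // E E' /= in Rt.
have Lt := H2 true 1%N isT; rewrite /mB2 /= in Lt.
have Rs := H2 false 0%N isT; rewrite /mB2 /= in Rs.
have E0 : (u + c + b + a = 0)%N by move: W0 W1 Ls Rt Lt Rs A1 A2 A3 B1 B2 B3 A4 B4; clear; lia.
by case/negP: Np; apply/eqP; congr (_, _, _, _); move: E0; clear; lia.
Qed.

(** * PBW bases in type A3 *)

Section TypeA3.
Variables (F : fieldType) (v : F).
Hypotheses (v0 : v != 0) (qn_neq0 : forall n, qn v n.+1 != 0).
Variables (U : algType F) (f1 f2 f3 : U).
Local Notation dp := (dp v).

Definition vbr (x y : U) := y * x - v *: (x * y).

Hypotheses (H21 : a2_pair v f2 f1) (H23 : a2_pair v f2 f3) (H13 : f1 * f3 = f3 * f1).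

Local Notation F12 := (vbr f2 f1).
Local Notation F23 := (vbr f2 f3).
Local Notation F32 := (vbr f3 f2).
Local Notation F21 := (vbr f1 f2).
Local Notation F123 := (vbr F12 f3).
Local Notation F'' := (vbr f1 F32).
Local Notation F' := (vbr f3 F12).

Let two_neq0 : v * v + 1 != 0.
Proof.
have := qn_neq0 1; rewrite qnE; apply: contraNneq => E.
have -> : v ^+ 2 - v ^- 2 = (v - v^-1) * (v * v + 1) / v by rewrite !expr2; field.
by rewrite E mulr0 !mul0r.
Qed.

Let c13 : f1 * f3 - f3 * f1 = 0. Proof. by rewrite H13 subrr. Qed.

Lemma serre_a2_pair (x y : U) : a2_pair v x y ->
  x * x * y - (v + v^-1) *: (x * y * x) + y * x * x = 0.
Proof.
by case=> _ /eqP; rewrite -subr_eq0 => /eqP H; rewrite -[RHS]H; nc F U; field.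
Qed.

(** The same root vector of the highest root is built in two ways; the difference consists of
    commutators of [f1] and [f3]. *)
Lemma a3_F' : vbr F32 f1 = F'.
Proof.
apply/eqP; rewrite -subr_eq0; apply/eqP.
have -> : vbr F32 f1 - F' = v *: (f2 * (f1 * f3 - f3 * f1)) - v *: ((f1 * f3 - f3 * f1) * f2).
  by rewrite /vbr; nc F U; field.
by rewrite c13 mulr0 mul0r scaler0 subrr.
Qed.

Lemma a3_F'_f2 : F' * f2 = f2 * F'.
Proof.
have S1 := serre_a2_pair H21; have S3 := serre_a2_pair H23.
apply/eqP; rewrite -subr_eq0; apply/eqP.
pose c := (f1 * f3 - f3 * f1).
have E : F' * f2 - f2 * F' = (v + v^-1)^-1 *: (
    (f2 * f2 * f1 - (v + v^-1) *: (f2 * f1 * f2) + f1 * f2 * f2) * f3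
    - (v * v) *: (f3 * (f2 * f2 * f1 - (v + v^-1) *: (f2 * f1 * f2) + f1 * f2 * f2))
    + (v * v) *: ((f2 * f2 * f3 - (v + v^-1) *: (f2 * f3 * f2) + f3 * f2 * f2) * f1)
    - f1 * (f2 * f2 * f3 - (v + v^-1) *: (f2 * f3 * f2) + f3 * f2 * f2)
    + c * (f2 * f2) + (v * v) *: (f2 * f2 * c) - (v * v + 1) *: (f2 * c * f2)).
  by rewrite /vbr /c; nc F U; field; rewrite ?two_neq0 ?v0.
by rewrite E S1 S3 /c c13 !(mulr0, mul0r, oppr0, scaler0, addr0, add0r).
Qed.

Lemma a3_F12_F23 : F12 * F23 = F23 * F12.
Proof.
have S1 := serre_a2_pair H21; apply/eqP; rewrite -subr_eq0; apply/eqP.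
have -> : F12 * F23 - F23 * F12 = (F' * f2 - f2 * F')
   - v *: ((f2 * f2 * f1 - (v + v^-1) *: (f2 * f1 * f2) + f1 * f2 * f2) * f3)
   + v *: (f3 * (f2 * f2 * f1 - (v + v^-1) *: (f2 * f1 * f2) + f1 * f2 * f2)).
  by rewrite /vbr; nc F U; field.
by rewrite a3_F'_f2 S1 mulr0 mul0r scaler0 subrr subr0 addr0.
Qed.

(** The composite [F12] and [f3] again satisfy the type A2 rules, so the rank two transition applies
    to them inside a longer monomial. *)
Lemma a2_pair_F12_f3 : a2_pair v F12 f3.
Proof.
have [Hf1 Hf2] := H21; have [Hg1 Hg2] := H23.
rewrite -/(vbr f2 f1) -/(vbr f2 f3) in Hf1 Hf2 Hg1 Hg2.
rewrite /a2_pair -/(vbr F12 f3).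
have E123 : F123 = f1 * F23 - v *: (F23 * f1).
  apply/eqP; rewrite -subr_eq0; apply/eqP.
  have -> : F123 - (f1 * F23 - v *: (F23 * f1)) = - ((f1 * f3 - f3 * f1) * f2) + (v * v) *: (f2 * (f1 * f3 - f3 * f1)).
    by rewrite /vbr; nc F U; field.
  by rewrite c13 mulr0 mul0r oppr0 scaler0 addr0.
split; rewrite E123.
  have -> : f3 * (f1 * F23 - v *: (F23 * f1)) = f1 * (f3 * F23) - v *: (f3 * F23 * f1)
      - (f1 * f3 - f3 * f1) * F23 by nc F U; field.
  rewrite Hg1 c13 mul0r subr0.
  have -> : f1 * (v^-1 *: (F23 * f3)) - v *: (v^-1 *: (F23 * f3) * f1) =
    v^-1 *: ((f1 * F23 - v *: (F23 * f1)) * f3) + F23 * (f1 * f3 - f3 * f1) by nc F U; field.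
  by rewrite c13 mulr0 addr0.
have -> : (f1 * F23 - v *: (F23 * f1)) * F12 = f1 * (F23 * F12) - v *: (F23 * (f1 * F12)).
  by nc F U; field.
rewrite Hf1 -a3_F12_F23.
have -> : f1 * (F12 * F23) - v *: (F23 * (v^-1 *: (F12 * f1))) = (f1 * F12) * F23 - (F23 * F12) * f1.
  by nc F U; field.
by rewrite Hf1 -a3_F12_F23; nc F U; field.
Qed.

Lemma a2_pair_F32_f1 : a2_pair v F32 f1.
Proof.
have [Hf1 _] := H21; rewrite -/(vbr f2 f1) in Hf1.
have [_ Hg] := a2_pairC v0 a2_pair_F12_f3; rewrite -/(vbr f3 F12) in Hg.
rewrite /a2_pair -/(vbr F32 f1) a3_F'; split.
  have -> : f1 * F' = f1 * F12 * f3 - v *: (f3 * (f1 * F12)) - v *: ((f1 * f3 - f3 * f1) * F12).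
    by rewrite [F' in LHS]/vbr; nc F U; field.
  rewrite Hf1 c13 mul0r scaler0 subr0.
  have -> : v^-1 *: (F12 * f1) * f3 - v *: (f3 * (v^-1 *: (F12 * f1))) =
    v^-1 *: (F' * f1) + v^-1 *: (F12 * (f1 * f3 - f3 * f1)).
    by rewrite [F' in RHS]/vbr; nc F U; field.
  by rewrite c13 mulr0 scaler0 addr0.
have -> : F' * F32 = F' * f2 * f3 - v *: (F' * f3 * f2).
  by rewrite [F32 in LHS]/vbr; nc F U; field.
rewrite a3_F'_f2 Hg -mulrA Hg.
have -> : f2 * (v^-1 *: (f3 * F')) - v *: (v^-1 *: (f3 * F') * f2) =
  v^-1 *: (f2 * f3 * F') - f3 * (F' * f2) by nc F U; field.
by rewrite a3_F'_f2 [F32 in RHS]/vbr; nc F U; field.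
Qed.

Variables (S J : F -> Prop).
Hypotheses (HS : subring_set S) (HJ : ideal_set S J) (Sv : S v).
Hypothesis Jv : forall x, S x -> J (v * x).

(** The five families joined by the moves [a3_g1] to [a3_g4]. The first begins with [f2] and ends
    with the commuting [f3] and [f1]; the last begins with [f3], [f1] and ends with [f2]. These two
    together have every generator at either end. *)
Definition a3_M1 (p : nat6) : U := let '(c1, c2, c3, c4, c5, c6) := p in
  dp f2 c1 * dp F23 c3 * dp F12 c2 * dp F123 c4 * dp f3 c5 * dp f1 c6.
Definition a3_M2 (p : nat6) : U := let '(c1, c3, x, y, z, c6) := p in
  dp f2 c1 * dp F23 c3 * dp f3 x * dp F' y * dp F12 z * dp f1 c6.
Definition a3_M3 (p : nat6) : U := let '(a1, a2, a3, y, z, c6) := p in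
  dp f3 a1 * dp F32 a2 * dp f2 a3 * dp F' y * dp F12 z * dp f1 c6.
Definition a3_M4 (p : nat6) : U := let '(a1, a2, y, b1, b2, b3) := p in
  dp f3 a1 * dp F32 a2 * dp F' y * dp f1 b1 * dp F21 b2 * dp f2 b3.
Definition a3_M5 (p : nat6) : U := let '(a1, d1, d2, d3, b2, b3) := p in
  dp f3 a1 * dp f1 d1 * dp F'' d2 * dp F32 d3 * dp F21 b2 * dp f2 b3.

Definition fib1 n0 n1 n2 (p : nat6) := let '(c1, c2, c3, c4, c5, c6) := p in
  [/\ c2 + c4 + c6 = n0, c1 + c2 + c3 + c4 = n1 & c3 + c4 + c5 = n2]%N.
Definition fib2 n0 n1 n2 (p : nat6) := let '(c1, c3, x, y, z, c6) := p in
  [/\ y + z + c6 = n0, c1 + c3 + y + z = n1 & c3 + x + y = n2]%N.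
Definition fib3' n0 n1 n2 (p : nat6) := let '(a1, a2, a3, y, z, c6) := p in
  [/\ y + z + c6 = n0, a2 + a3 + y + z = n1 & a1 + a2 + y = n2]%N.
Definition fib4' n0 n1 n2 (p : nat6) := let '(a1, a2, y, b1, b2, b3) := p in
  [/\ y + b1 + b2 = n0, a2 + y + b2 + b3 = n1 & a1 + a2 + y = n2]%N.

Lemma a2_sandwich (M N : nat6 -> U) (D : nat6 -> Prop) (x y X Y : U) n1 n2
    (k : nat * nat * nat -> nat6) (t : nat * nat * nat) : a2_pair v x y ->
  (forall t, a2_fib n1 n2 t -> D (k t)) ->
  (forall t, M (k t) = X * a2_pbw v x y t * Y) ->
  (forall t, N (k t) = X * a2_pbw v y x (a2_mut t) * Y) -> a2_fib n1 n2 t ->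
  spn J N D (M (k t) - N (k t)) /\ spn J M D (N (k t) - M (k t)).
Proof.
move=> Hxy HD HM HN Ht; have [H1 H2] := a2_cong v0 qn_neq0 HS HJ Sv Jv n1 n2 Hxy.
rewrite HM HN -!mulrBl -!mulrBr; split.
  apply: (spnE (Q := fun u => spn J N D (X * u * Y))) (H1 t Ht) => [|u w Hu Hw|r c Dr Jc].
  - by rewrite mulr0 mul0r; exact: spn0.
  - by rewrite mulrDr mulrDl; exact: spnD.
  by rewrite -scalerAr -scalerAl /= -HN; apply: spn_in => //; exact: HD.
apply: (spnE (Q := fun u => spn J M D (X * u * Y))) (H2 t Ht) => [|u w Hu Hw|r c Dr Jc].
- by rewrite mulr0 mul0r; exact: spn0.
- by rewrite mulrDr mulrDl; exact: spnD.
by rewrite -scalerAr -scalerAl /= -HM; apply: spn_in => //; exact: HD.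
Qed.

Lemma dp_comm (x y : U) m n : x * y = y * x -> dp x m * dp y n = dp y n * dp x m.
Proof.
move=> E; have E1 : x * y = 1 *: (y * x) by rewrite scale1r.
have E2 := dp_skew v n E1; rewrite expr1n scale1r in E2.
have E3 : x * dp y n = 1 *: (dp y n * x) by rewrite scale1r.
by rewrite (dp_skewl v m E3) expr1n scale1r.
Qed.

Definition cong2 (M N : nat6 -> U) D := cong J M N D /\ cong J N M D.

Lemma a3_cong12 n0 n1 n2 : cong2 a3_M1 (a3_M2 \o a3_g1) (fib1 n0 n1 n2).
Proof.
suff H p : fib1 n0 n1 n2 p -> spn J (a3_M2 \o a3_g1) (fib1 n0 n1 n2) (a3_M1 p - (a3_M2 \o a3_g1) p) /\
    spn J a3_M1 (fib1 n0 n1 n2) ((a3_M2 \o a3_g1) p - a3_M1 p).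
  by split=> p /H [].
case: p => [[[[[c1 c2] c3] c4] c5] c6] [E0 E1 E2].
apply: (@a2_sandwich a3_M1 (a3_M2 \o a3_g1) _ F12 f3 (dp f2 c1 * dp F23 c3) (dp f1 c6) (c2 + c4) (c4 + c5)
  (fun t => (c1, t.1.1, c3, t.1.2, t.2, c6)) (c2, c4, c5) a2_pair_F12_f3) => //.
- by move=> [[a b] c]; rewrite /a2_fib /fib1 /=; split; lia.
- by move=> [[a b] c]; rewrite /a3_M1 /a2_pbw /= -!mulrA.
move=> [[a b] c]; rewrite -[LHS]/(a3_M2 (a3_g1 (c1, a, c3, b, c, c6))) /a3_g1.
case: (a2_mut (a, b, c)) => [[a' b'] c'].
by rewrite /a3_M2 /a2_pbw /= -!mulrA.
Qed.

Lemma a3_cong23 n0 n1 n2 : cong2 a3_M2 (a3_M3 \o a3_g2) (fib2 n0 n1 n2).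
Proof.
suff H p : fib2 n0 n1 n2 p -> spn J (a3_M3 \o a3_g2) (fib2 n0 n1 n2) (a3_M2 p - (a3_M3 \o a3_g2) p) /\
    spn J a3_M2 (fib2 n0 n1 n2) ((a3_M3 \o a3_g2) p - a3_M2 p).
  by split=> p /H [].
case: p => [[[[[c1 c3] x] y] z] c6] [E0 E1 E2].
apply: (@a2_sandwich a3_M2 (a3_M3 \o a3_g2) _ f2 f3 1 (dp F' y * dp F12 z * dp f1 c6) (c1 + c3) (c3 + x)
  (fun t => (t.1.1, t.1.2, t.2, y, z, c6)) (c1, c3, x) H23) => //.
- by move=> [[a b] c]; rewrite /a2_fib /fib2 /=; split; lia.
- by move=> [[a b] c]; rewrite /a3_M2 /a2_pbw /= mul1r -!mulrA.
move=> [[a b] c]; rewrite -[LHS]/(a3_M3 (a3_g2 (a, b, c, y, z, c6))) /a3_g2.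
case: (a2_mut (a, b, c)) => [[a' b'] c'].
by rewrite /a3_M3 /a2_pbw /= mul1r -!mulrA.
Qed.

Lemma a3_cong34 n0 n1 n2 : cong2 a3_M3 (a3_M4 \o a3_g3) (fib3' n0 n1 n2).
Proof.
suff H p : fib3' n0 n1 n2 p -> spn J (a3_M4 \o a3_g3) (fib3' n0 n1 n2) (a3_M3 p - (a3_M4 \o a3_g3) p) /\
    spn J a3_M3 (fib3' n0 n1 n2) ((a3_M4 \o a3_g3) p - a3_M3 p).
  by split=> p /H [].
case: p => [[[[[a1 a2] a3] y] z] c6] [E0 E1 E2].
apply: (@a2_sandwich a3_M3 (a3_M4 \o a3_g3) _ f2 f1 (dp f3 a1 * dp F32 a2 * dp F' y) 1 (a3 + z) (z + c6)
  (fun t => (a1, a2, t.1.1, y, t.1.2, t.2)) (a3, z, c6) H21) => //.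
- by move=> [[a b] c]; rewrite /a2_fib /fib3' /=; split; lia.
- move=> [[a b] c]; rewrite /a3_M3 /a2_pbw /= mulr1 -!mulrA [dp f2 _ * (_ * _)]mulrA.
  by rewrite -(dp_comm _ _ a3_F'_f2) -!mulrA.
move=> [[a b] c]; rewrite -[LHS]/(a3_M4 (a3_g3 (a1, a2, a, y, b, c))) /a3_g3.
case: (a2_mut (a, b, c)) => [[a' b'] c'].
by rewrite /a3_M4 /a2_pbw /= mulr1 -!mulrA.
Qed.

Lemma a3_cong45 n0 n1 n2 : cong2 a3_M4 (a3_M5 \o a3_g4) (fib4' n0 n1 n2).
Proof.
suff H p : fib4' n0 n1 n2 p -> spn J (a3_M5 \o a3_g4) (fib4' n0 n1 n2) (a3_M4 p - (a3_M5 \o a3_g4) p) /\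
    spn J a3_M4 (fib4' n0 n1 n2) ((a3_M5 \o a3_g4) p - a3_M4 p).
  by split=> p /H [].
case: p => [[[[[a1 a2] y] b1] b2] b3] [E0 E1 E2].
apply: (@a2_sandwich a3_M4 (a3_M5 \o a3_g4) _ F32 f1 (dp f3 a1) (dp F21 b2 * dp f2 b3) (a2 + y) (y + b1)
  (fun t => (a1, t.1.1, t.1.2, t.2, b2, b3)) (a2, y, b1) a2_pair_F32_f1) => //.
- by move=> [[a b] c]; rewrite /a2_fib /fib4' /=; split; lia.
- by move=> [[a b] c]; rewrite /a3_M4 /a2_pbw /= -!mulrA -a3_F'.
move=> [[a b] c]; rewrite -[LHS]/(a3_M5 (a3_g4 (a1, a, b, c, b2, b3))) /a3_g4.
case: (a2_mut (a, b, c)) => [[a' b'] c'].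
by rewrite /a3_M5 /a2_pbw /= -!mulrA.
Qed.

Lemma cong2_trans M N N' D : cong2 M N D -> cong2 N N' D -> cong2 M N' D.
Proof. by move=> [H1 H2] [H3 H4]; split; [exact (cong_trans HJ H1 H3) | exact (cong_trans HJ H4 H2)]. Qed.

Lemma cong2_relabel M N (g g' : nat6 -> nat6) (D E : nat6 -> Prop) :
  (forall p, g (g' p) = p) -> (forall p, E (g p) <-> D p) -> cong2 M N E ->
  cong2 (M \o g) (N \o g) D.
Proof.
move=> gK HE [H1 H2]; have HD p : E p -> D (g' p) by move=> Ep; apply/HE; rewrite gK.
split; [apply: (cong_relabel (psi := g') _ _ _ H1) | apply: (cong_relabel (psi := g') _ _ _ H2)];
  move=> p Hp; [exact: gK | exact: HD | exact/HE | exact: gK | exact: HD | exact/HE].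
Qed.

Lemma a3_cong15 n0 n1 n2 : cong2 a3_M1 (a3_M5 \o a3_mut) (fib1 n0 n1 n2).
Proof.
have F1 p : fib2 n0 n1 n2 (a3_g1 p) <-> fib1 n0 n1 n2 p.
  case: p => [[[[[c1 c2] c3] c4] c5] c6]; rewrite /a3_g1.
  have [x [m1 [z [-> [E1 E1' E1'' Ex Ez]]]]] := a2_mut_spec c2 c4 c5.
  by rewrite /fib2 /fib1; split=> -[]; clear E1''; split; lia.
have F2 p : fib3' n0 n1 n2 (a3_g2 p) <-> fib2 n0 n1 n2 p.
  case: p => [[[[[c1 c2] c3] c4] c5] c6]; rewrite /a3_g2.
  have [x [m1 [z [-> [E1 E1' E1'' Ex Ez]]]]] := a2_mut_spec c1 c2 c3.
  by rewrite /fib2 /fib3'; split=> -[]; clear E1''; split; lia.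
have F3 p : fib4' n0 n1 n2 (a3_g3 p) <-> fib3' n0 n1 n2 p.
  case: p => [[[[[c1 c2] c3] c4] c5] c6]; rewrite /a3_g3.
  have [x [m1 [z [-> [E1 E1' E1'' Ex Ez]]]]] := a2_mut_spec c3 c5 c6.
  by rewrite /fib4' /fib3'; split=> -[]; clear E1''; split; lia.
have G2 := cong2_relabel a3_g1'K F1 (@a3_cong23 n0 n1 n2).
have G3 := cong2_relabel a3_g1'K F1 (cong2_relabel a3_g2K F2 (@a3_cong34 n0 n1 n2)).
have G4 := cong2_relabel a3_g1'K F1 (cong2_relabel a3_g2K F2 (cong2_relabel a3_g3'K F3 (@a3_cong45 n0 n1 n2))).
exact (cong2_trans (cong2_trans (cong2_trans (@a3_cong12 n0 n1 n2) G2) G3) G4).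
Qed.
End TypeA3.

(** * From PBW families to models *)

Section FromCoordinates.
Variables (K : fieldType) (phi : {rmorphism {poly rat} -> K}).
Hypothesis phi_inj : injective phi.
Variables (I : Type) (P : eqType) (n : nat) (ix : I -> nat).
Variables (wt : nat -> P -> nat) (m m' : bool -> nat -> P -> P).
Variables (sl : bool -> nat -> P -> nat) (st : bool -> nat -> nat -> P -> P).
Variables (grid : nat -> seq P) (p0 : P).
Local Notation C := (coord_crystal n ix wt m m' sl st grid p0).
Variables (U : algType K) (f : I -> U) (d : I -> nat) (B : P -> U) (M : bool -> nat -> P -> U).
Hypothesis d_gt0 : forall i, (0 < d i)%N.
Hypothesis m'K : forall h i p, m h (ix i) (m' h (ix i) p) = p.
Hypothesis M_up : forall h i a p, sl h (ix i) p = 0%N ->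
  M h (ix i) (st h (ix i) a p) = act phi f d h i a (M h (ix i) p).
Hypotheses (B_1 : B p0 = 1) (B_Z : forall p, zform phi f d (B p)).

Definition coord_Bh (h : bool) (i : I) (p : P) := M h (ix i) (m h (ix i) p).

Lemma coord_model :
  (forall h i p, spn (qAK phi) B (cr_fib C p) (coord_Bh h i p - B p)) ->
  (forall h i p, spn (LK phi) B (cr_fib C p) (coord_Bh h i p)) ->
  (forall h i p, spn (LK phi) (coord_Bh h i) (cr_fib C p) (B p)) ->
  pbw_model phi C f d B coord_Bh.
Proof.
move=> H1 H2 H3; split=> // h i a p /= E.
by rewrite /coord_Bh m'K E addn0 M_up.
Qed.

Lemma coord_model_qZ : (forall p, cr_fib C p p) ->
  (forall h i p, spn (qZK phi) B (cr_fib C p) (coord_Bh h i p - B p)) ->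
  (forall h i p, spn (qZK phi) (coord_Bh h i) (cr_fib C p) (B p - coord_Bh h i p)) ->
  pbw_model phi C f d B coord_Bh.
Proof.
move=> Cp H1 H2; have L_ring := LK_ring phi_inj.
have ZL c : qZK phi c -> LK phi c by move/(is_sub (qZK_ideal phi))/ZK_L.
apply: coord_model => h i p.
- by apply: spnW (H1 h i p) => // c; exact: qZK_qA.
- rewrite -[coord_Bh h i p](subrK (B p)); apply: spnD; last exact: (spn_gen _ L_ring).
  by apply: spnW (H1 h i p).
rewrite -[B p](subrK (coord_Bh h i p)); apply: spnD; last exact: (spn_gen _ L_ring).
by apply: spnW (H2 h i p).
Qed.
End FromCoordinates.

Section TypeA.
Variables (K : fieldType) (phi : {rmorphism {poly rat} -> K}).
Hypothesis phi_inj : injective phi.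
Variables (I : Type) (ix : I -> nat) (n : nat).
Hypothesis ix_lt : forall i, (ix i < n)%N.
Hypothesis ix_surj : forall k, (k < n)%N -> exists i, ix i = k.
Variables (U : algType K) (f : I -> U) (d : I -> nat) (dc : nat) (g : nat -> U).
Hypotheses (dc_gt0 : (0 < dc)%N) (dE : forall i, d i = dc) (fE : forall i, f i = g (ix i)).

Local Notation v := (qK phi ^+ dc).
Local Notation dp := (dp v).
Local Notation Zf := (zform phi f d).

Let v0 : v != 0. Proof. exact: qKX_neq0. Qed.
Let vn k : qn v k.+1 != 0. Proof. exact: (qn_neq0K phi_inj). Qed.
Let Z_ring := ZK_ring phi.
Let qZ_ideal := qZK_ideal phi.
Let Zv : ZK phi v. Proof. by apply: (ssX Z_ring); exact: ZK_q. Qed.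
Let qZv x : ZK phi x -> qZK phi (v * x).
Proof.
move=> Zx; rewrite -(prednK dc_gt0) exprS -mulrA; exists (qK phi ^+ dc.-1 * x) => //.
by apply: (ssM Z_ring) => //; apply: (ssX Z_ring); exact: ZK_q.
Qed.

Let d_gt0 i : (0 < d i)%N. Proof. by rewrite dE. Qed.

Lemma dpfA i k : dpf phi f d i k = dp (g (ix i)) k.
Proof. by rewrite /dpf dE fE. Qed.

Lemma dpA_Z k a : (k < n)%N -> Zf (dp (g k) a).
Proof. by move=> /ix_surj [i <-]; rewrite -dpfA; exact: zf_dp. Qed.

Lemma zf_0 : Zf 0.
Proof. by rewrite -(scale0r (1 : U)); apply: zf_Z; [exact: (ss0 (LK_ring phi_inj)) | exact: zf_1]. Qed.

Lemma vbr_Z x y : a2_pair v x y -> (forall a, Zf (dp x a)) -> (forall a, Zf (dp y a)) ->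
  forall a, Zf (dp (vbr v x y) a).
Proof.
have L_ring := LK_ring phi_inj; have Lv k : LK phi (v ^+ k).
  by apply: (ssX L_ring); apply: (ssX L_ring); exact: LK_q.
move=> Hxy Zx Zy; apply: (a2_dp_closed v0 vn L_ring Hxy Lv zf_0) => //.
- by move=> a b; exact: zf_D.
- by move=> a b; exact: zf_M.
by move=> c a; exact: zf_Z.
Qed.

Definition BhA1 := coord_Bh ix (@idm nat) (fun (_ : bool) k => dp (g k)).

Lemma modelA1 : n = 1%N -> pbw_model phi (crA1 ix) f d (dp (g 0)) BhA1.
Proof.
move=> n1; have ix0 i : ix i = 0%N by have := ix_lt i; rewrite n1 ltnS leqn0 => /eqP.
have E h i p : BhA1 h i p = dp (g 0) p by rewrite /BhA1 /coord_Bh ix0.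
apply: coord_model_qZ => //.
- by move=> h i a p /= ->; rewrite /act dpfA dp0 mulr1 mul1r; case: h.
- exact: dp0.
- by move=> p; apply: dpA_Z; rewrite n1.
- by move=> p; apply/forallP.
- by move=> h i p; rewrite -/BhA1 E subrr; exact: spn0.
by move=> h i p; rewrite -/BhA1 E subrr; exact: spn0.
Qed.

Definition MA2 (h : bool) (k : nat) :=
  if h (+) (k == 0%N) then a2_pbw v (g 1) (g 0) else a2_pbw v (g 0) (g 1).
Definition BhA2 := coord_Bh ix mA2 MA2.

Lemma modelA2 : n = 2%N -> a2_pair v (g 0) (g 1) ->
  pbw_model phi (crA2 ix) f d (a2_pbw v (g 0) (g 1)) BhA2.
Proof.
move=> n2 Hg.
have fibP p r : a2_fib (wtA2 0 p) (wtA2 1 p) r -> cr_fib (crA2 ix) p r.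
  case: p r => [[a b] c] [[a' b'] c'] [/= E1 E2].
  by apply/forallP => -[k lt_k]; apply/eqP; case: k lt_k => [|[|//]] _ /=; lia.
have fib_self p : a2_fib (wtA2 0 p) (wtA2 1 p) p by case: p => [[a b] c].
have cases h i : (MA2 h (ix i) =1 a2_pbw v (g 0) (g 1) /\ mA2 h (ix i) =1 id) \/
    (MA2 h (ix i) =1 a2_pbw v (g 1) (g 0) /\ mA2 h (ix i) =1 a2_mut).
  by rewrite /MA2 /mA2; case: (h (+) _); [right | left].
have cg p := a2_cong v0 vn Z_ring qZ_ideal Zv qZv (wtA2 0 p) (wtA2 1 p) Hg.
apply: coord_model_qZ => //.
- by move=> h i p; rewrite /mA2; case: (h (+) _) => //; exact: a2_mutK.
- move=> h i a [[x y] z]; rewrite /slA2 /MA2 /stA2 /a2_pbw /act dpfA.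
  have := ix_lt i; rewrite n2; case: (ix i) => [|[|//]] _; case: h => /= ->;
  by rewrite dp0 ?mul1r ?mulr1 ?mulrA.
- by rewrite /a2_pbw !dp0 !mulr1.
- move=> p; rewrite /a2_pbw; apply: zf_M; last by apply: dpA_Z; rewrite n2.
  apply: zf_M; first by apply: dpA_Z; rewrite n2.
  by apply: (vbr_Z Hg) => a; apply: dpA_Z; rewrite n2.
- by move=> p; apply/forallP.
- move=> h i p; rewrite /coord_Bh; case: (cases h i) => -[-> ->]; first by rewrite subrr; exact: spn0.
  by apply: spnW ((cg p).2 p (fib_self p)) => // r; exact: fibP.
move=> h i p; case: (cases h i) => -[E1 E2].
  by rewrite /coord_Bh E1 E2 subrr; exact: spn0.
have E : coord_Bh ix mA2 MA2 h i = a2_pbw v (g 1) (g 0) \o a2_mut.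
  by apply: funext => r; rewrite /coord_Bh E1 E2.
by rewrite E; apply: spnW ((cg p).1 p (fib_self p)) => // r; exact: fibP.
Qed.

Definition MA3 (h : bool) (k : nat) :=
  if h (+) (k == 1%N) then a3_M5 v (g 0) (g 1) (g 2) else a3_M1 v (g 0) (g 1) (g 2).
Definition BhA3 := coord_Bh ix mA3 MA3.

Lemma modelA3 : n = 3%N -> a2_pair v (g 1) (g 0) -> a2_pair v (g 1) (g 2) ->
  g 0 * g 2 = g 2 * g 0 -> pbw_model phi (crA3 ix) f d (a3_M1 v (g 0) (g 1) (g 2)) BhA3.
Proof.
move=> n3 H10 H12 H02.
have fibP p r : fib1 (wtA3 0 p) (wtA3 1 p) (wtA3 2 p) r -> cr_fib (crA3 ix) p r.
  case: p r => [[[[[a b] c] x] y] z] [[[[[a' b'] c'] x'] y'] z'] [/= E1 E2 E3].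
  by apply/forallP => -[k lt_k]; apply/eqP; case: k lt_k => [|[|[|//]]] _ /=; lia.
have fib_self p : fib1 (wtA3 0 p) (wtA3 1 p) (wtA3 2 p) p by case: p => [[[[[a b] c] x] y] z].
have cases h i : (MA3 h (ix i) =1 a3_M1 v (g 0) (g 1) (g 2) /\ mA3 h (ix i) =1 id) \/
    (MA3 h (ix i) =1 a3_M5 v (g 0) (g 1) (g 2) /\ mA3 h (ix i) =1 a3_mut).
  by rewrite /MA3 /mA3; case: (h (+) _); [right | left].
have cg p := a3_cong15 v0 vn H10 H12 H02 Z_ring qZ_ideal Zv qZv (wtA3 0 p) (wtA3 1 p) (wtA3 2 p).
have c02 a b := dp_comm v a b H02.
apply: coord_model_qZ => //.
- by move=> h i p; rewrite /mA3 /mA3'; case: (h (+) _) => //; exact: a3_mut'K.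
- move=> h i a [[[[[c1 c2] c3] c4] c5] c6]; rewrite /slA3 /MA3 /stA3 /act dpfA.
  have := ix_lt i; rewrite n3; case: (ix i) => [|[|[|//]]] _; case: h => /= ->;
    rewrite ?dp0 ?mul1r ?mulr1 ?mulrA //; first by rewrite c02.
  by rewrite -!mulrA c02.
- by rewrite /a3_M1 !dp0 !mulr1.
- have Zg k b : (k < 3)%N -> Zf (dp (g k) b) by rewrite -n3; exact: dpA_Z.
  have Z12 := vbr_Z H10 (fun b => Zg 1%N b isT) (fun b => Zg 0%N b isT).
  have Z23 := vbr_Z H12 (fun b => Zg 1%N b isT) (fun b => Zg 2%N b isT).
  have Z123 := vbr_Z (a2_pair_F12_f3 v0 vn H10 H12 H02) Z12 (fun b => Zg 2%N b isT).
  by move=> [[[[[c1 c2] c3] c4] c5] c6]; rewrite /a3_M1; do !apply: zf_M; auto.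
- by move=> p; apply/forallP.
- move=> h i p; rewrite /coord_Bh; case: (cases h i) => -[-> ->]; first by rewrite subrr; exact: spn0.
  by apply: spnW ((cg p).2 p (fib_self p)) => // r; exact: fibP.
move=> h i p; case: (cases h i) => -[E1 E2].
  by rewrite /coord_Bh E1 E2 subrr; exact: spn0.
have E : coord_Bh ix mA3 MA3 h i = a3_M5 v (g 0) (g 1) (g 2) \o a3_mut.
  by apply: funext => r; rewrite /coord_Bh E1 E2.
by rewrite E; apply: spnW ((cg p).1 p (fib_self p)) => // r; exact: fibP.
Qed.

Section Vanishing.
Variable e : I -> {linear U -> U}.
Definition cA (k j : nat) : K := if k == j then v^-1 * v^-1
  else if (k.+1 == j) || (j.+1 == k) then v else 1.
Hypothesis e_1 : forall i, e i 1 = 0.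
Hypothesis e_f : forall i j x, (j < n)%N ->
  e i (g j * x) = cA (ix i) j *: (g j * e i x) + (ix i == j)%:R *: x.

(** The aim is that [e i] kills monomials without a leading factor [g (ix i)]: all their factors
    turn out to be skew for [e i]. *)
Let e_skew i j : (j < n)%N -> ix i != j -> skew (e i) (cA (ix i) j) (g j).
Proof. by move=> lt_j Nj x; rewrite e_f // (negPf Nj) scale0r addr0. Qed.

(** The two terms in which [e i] removes the generator cancel, because [z] passes through [e i] with
    the factor [v] that also twists the commutator. *)
Let vbr_skew i z : skew (e i) v z -> skew (e i) v^-1 (vbr v (g (ix i)) z).
Proof.
move=> Hz x; have e_g y : e i (g (ix i) * y) = (v^-1 * v^-1) *: (g (ix i) * e i y) + y.
  by rewrite e_f // /cA !eqxx scale1r.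
rewrite /vbr mulrBl linearB /= -scalerAl linearZ_LR /= -!mulrA Hz !e_g Hz.
by nc K U; field; rewrite ?v0.
Qed.

Lemma vanishA1 i p : cr_eps (crA1 ix) true i p = 0%N -> e i (BhA1 true i p) = 0.
Proof. by rewrite /BhA1 /coord_Bh /= /idm => ->; rewrite dp0. Qed.

Let ker i k z y : skew (e i) k z -> e i y = 0 -> e i (z * y) = 0.
Proof. exact: skew_kerM. Qed.

Lemma vanishA2 i p : n = 2%N -> cr_eps (crA2 ix) true i p = 0%N -> e i (BhA2 true i p) = 0.
Proof.
move=> n2; rewrite /BhA2 /coord_Bh /=; case: (mA2 _ _ p) => [[a b] c] /= ->.
rewrite /MA2; have := ix_lt i; rewrite {1}n2.
have E k : (k < 2)%N -> ix i != k -> skew (e i) v (g k).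
  move=> lt_k Nk; have := @e_skew i k; rewrite n2 => /(_ lt_k Nk); rewrite /cA (negPf Nk).
  by have := ix_lt i; rewrite n2; case: (ix i) k lt_k Nk => [|[|//]] [|[|//]].
have main k : (k < 2)%N -> ix i != k -> e i (a2_pbw v (g (ix i)) (g k) (0, b, c)) = 0.
  move=> lt_k Nk; rewrite /a2_pbw dp0 mul1r.
  apply: ker; first by apply: skew_dp; exact: (vbr_skew (E k lt_k Nk)).
  by apply: skew_ker (e_1 i) _; apply: skew_dp; exact: E.
by case Ei: (ix i) main => [|[|//]] main _ /=; apply: main.
Qed.

Lemma vanishA3 i p : n = 3%N -> g 0 * g 2 = g 2 * g 0 ->
  cr_eps (crA3 ix) true i p = 0%N -> e i (BhA3 true i p) = 0.
Proof.
move=> n3 H02; rewrite /BhA3 /coord_Bh /=; case: (mA3 _ _ p) => [[[[[a b] c] x] y] z].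
have Ek k : (k < 3)%N -> ix i != k -> skew (e i) (cA (ix i) k) (g k).
  by rewrite -n3; exact: e_skew.
have kd k u w m : skew (e i) k u -> e i w = 0 -> e i (dp u m * w) = 0.
  by move=> Hu; apply: ker; apply: skew_dp Hu.
have k1 k u m : skew (e i) k u -> e i (dp u m) = 0.
  by move=> Hu; apply: skew_ker (e_1 i) _; apply: skew_dp Hu.
have vb k u u' : skew (e i) k (u' * u) -> skew (e i) k (u * u') -> skew (e i) k (vbr v u u').
  by move=> H1 H2; rewrite /vbr -scaleNr; apply: skewD => //; exact: skewZ.
rewrite /slA3 /MA3; have := ix_lt i; rewrite {1}n3; case Ei: (ix i) Ek => [|[|[|//]]] Ek _ /= ->.
- have E1 := Ek 1%N isT isT; have E2 := Ek 2%N isT isT; rewrite /cA /= in E1 E2.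
  have E32 : skew (e i) v (vbr v (g 2) (g 1)).
    by apply: vb; [rewrite -[v in skew _ v]mulr1 | rewrite -[v in skew _ v]mul1r]; exact: skewM.
  rewrite dp0 mulr1 -!mulrA; apply: (kd _ _ _ _ E2).
  have := vbr_skew E32; rewrite Ei => H; apply: (kd _ _ _ _ H); apply: (kd _ _ _ _ E32).
  by have := vbr_skew E1; rewrite Ei => H'; apply: (kd _ _ _ _ H'); exact: (k1 _ _ _ E1).
- have E0 := Ek 0%N isT isT; have E2 := Ek 2%N isT isT; rewrite /cA /= in E0 E2.
  have := vbr_skew E0; have := vbr_skew E2; rewrite Ei => E23 E12.
  have E123 : skew (e i) 1 (vbr v (vbr v (g 1) (g 0)) (g 2)).
    by apply: vb; [rewrite -(mulfV v0) | rewrite -(mulVf v0)]; exact: skewM.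
  rewrite dp0 mul1r -!mulrA; apply: (kd _ _ _ _ E23); apply: (kd _ _ _ _ E12); apply: (kd _ _ _ _ E123).
  by apply: (kd _ _ _ _ E2); exact: (k1 _ _ _ E0).
have E0 := Ek 0%N isT isT; have E1 := Ek 1%N isT isT; rewrite /cA /= in E0 E1.
have E21 : skew (e i) v (vbr v (g 0) (g 1)).
  by apply: vb; [rewrite -[v in skew _ v]mulr1 | rewrite -[v in skew _ v]mul1r]; exact: skewM.
have := vbr_skew E1; rewrite Ei => E32.
have E'' : skew (e i) v^-1 (vbr v (g 0) (vbr v (g 2) (g 1))).
  by apply: vb; [rewrite -[v^-1]mulr1 | rewrite -[v^-1]mul1r]; exact: skewM.
rewrite dp0 mul1r -!mulrA; apply: (kd _ _ _ _ E0); apply: (kd _ _ _ _ E''); apply: (kd _ _ _ _ E32).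
by apply: (kd _ _ _ _ E21); exact: (k1 _ _ _ E1).
Qed.
End Vanishing.
End TypeA.

Section TypeB2.
Variables (K : fieldType) (phi : {rmorphism {poly rat} -> K}).
Hypothesis phi_inj : injective phi.
Variables (I : Type) (ix : I -> nat).
Hypothesis ix_lt : forall i, (ix i < 2)%N.
Hypothesis ix_surj : forall k, (k < 2)%N -> exists i, ix i = k.
Variables (U : algType K) (f : I -> U) (d : I -> nat) (dc : nat) (g : nat -> U).
Hypotheses (dc_gt0 : (0 < dc)%N) (fE : forall i, f i = g (ix i)).
Hypothesis dE : forall i, d i = if ix i == 0%N then dc else dc.*2.

Local Notation v := (qK phi ^+ dc).
Local Notation s := (g 0).
Local Notation t := (g 1).
Local Notation Zf := (zform phi f d).
Local Notation Bf := (b2_pbw v s t).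

Let v0 : v != 0. Proof. exact: qKX_neq0. Qed.
Let vn k : qn v k.+1 != 0. Proof. exact: (qn_neq0K phi_inj). Qed.
Let vvE : v * v = qK phi ^+ dc.*2. Proof. by rewrite -exprD addnn. Qed.
Let vvn k : qn (v * v) k.+1 != 0.
Proof. by rewrite vvE; apply: (qn_neq0K phi_inj); rewrite double_gt0. Qed.
Let two_neq0 : v * v + 1 != 0.
Proof.
have := vn 1; rewrite qnE; apply: contraNneq => E.
have -> : v ^+ 2 - v ^- 2 = (v - v^-1) * (v * v + 1) / v by rewrite !expr2; field.
by rewrite E mulr0 !mul0r.
Qed.
Let A_ring := AK_ring phi_inj.
Let qA_ideal := qAK_ideal phi_inj.
Let qA_unit := AK_unit phi_inj.
Let L_ring := LK_ring phi_inj.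
Let Av : AK phi v. Proof. by apply: (ssX A_ring); exact: AK_q. Qed.
Let qAv x : AK phi x -> qAK phi (v * x).
Proof.
move=> Ax; rewrite -(prednK dc_gt0) exprS -mulrA; exists (qK phi ^+ dc.-1 * x) => //.
by apply: (ssM A_ring) => //; apply: (ssX A_ring); exact: AK_q.
Qed.
Let Lv : LK phi v. Proof. by apply: (ssX L_ring); exact: LK_q. Qed.
Let LvV : LK phi v^-1. Proof. exact: LK_qV. Qed.

Hypothesis serre_t :
  s * t * t - (v * v + v^-1 * v^-1) *: (t * s * t) + t * t * s = 0.
Hypothesis serre_s :
  s * s * s * t - (v * v + 1 + v^-1 * v^-1) *: (s * s * t * s)
  + (v * v + 1 + v^-1 * v^-1) *: (s * t * s * s) - t * s * s * s = 0.
Variable star : {linear U -> U}.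
Hypothesis starM : forall x y, star (x * y) = star y * star x.
Hypotheses (star_1 : star 1 = 1) (starK : forall x, star (star x) = x).
Hypotheses (star_s : star s = s) (star_t : star t = t).
Variables (e : I -> {linear U -> U}) (et ft : I -> {linear U -> U}).
Hypothesis e_1 : forall i, e i 1 = 0.
Hypothesis e_ss : forall i x, ix i = 0%N -> e i (s * x) = (v^-1 * v^-1) *: (s * e i x) + x.
Hypothesis e_st : forall i x, ix i = 0%N -> e i (t * x) = (v * v) *: (t * e i x).
Hypothesis e_ts : forall i x, ix i = 1%N -> e i (s * x) = (v * v) *: (s * e i x).
Hypothesis e_tt : forall i x, ix i = 1%N ->
  e i (t * x) = (v^-1 * v^-1 * (v^-1 * v^-1)) *: (t * e i x) + x.
Hypothesis et_0 : forall i u, e i u = 0 -> et i u = 0.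
Hypothesis et_S : forall i u k, e i u = 0 -> et i (dpf phi f d i k.+1 * u) = dpf phi f d i k * u.
Hypothesis ft_E : forall i u k, e i u = 0 -> ft i (dpf phi f d i k * u) = dpf phi f d i k.+1 * u.

Lemma dpfB_s i k : ix i = 0%N -> dpf phi f d i k = dp v s k.
Proof. by move=> E; rewrite /dpf dE fE E. Qed.

Lemma dpfB_t i k : ix i = 1%N -> dpf phi f d i k = dp (v * v) t k.
Proof. by move=> E; rewrite /dpf dE fE E /= vvE. Qed.

(** Instead of the PBW basis of the other reduced word, the second adapted family is the image of
    the first under the anti-involution, which moves the end factors to the opposite side. *)
Definition MB2 (h : bool) (k : nat) (p : nat4) : U :=
  if h (+) (k == 1%N) then star (Bf p) else Bf p.
Definition BhB2 := coord_Bh ix mB2 MB2.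

Let fibP p r : fib4 (wtB2 1 p) (wtB2 0 p) r -> cr_fib (crB2 ix) p r.
Proof.
case: p r => [[[u c] b] a] [[[u' c'] b'] a'] [/= E1 E2].
by apply/forallP => -[k lt_k]; apply/eqP; case: k lt_k => [|[|//]] _ /=; lia.
Qed.

Let fib_self p : fib4 (wtB2 1 p) (wtB2 0 p) p. Proof. by case: p => [[[u c] b] a]. Qed.

Let cases h i : BhB2 h i =1 Bf \/ BhB2 h i =1 star \o Bf \o psi.
Proof. by rewrite /BhB2 /coord_Bh /MB2 /mB2; case: (h (+) _); [right | left]. Qed.

Lemma b2gen_zform n m x : b2gen v (LK phi) s t n m x -> Zf x.
Proof.
have [i0 E0] := ix_surj (isT : (0 < 2)%N); have [i1 E1] := ix_surj (isT : (1 < 2)%N).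
elim=> [_ _||k|k|n' m' y z _ IHy _ IHz|n1 m1 n2 m2 y z _ IHy _ IHz|n' m' c y Lc _ IH].
- by rewrite -(scale0r (1 : U)); apply: zf_Z; [exact: (ss0 L_ring) | exact: zf_1].
- exact: zf_1.
- by rewrite -(dpfB_s k E0); exact: zf_dp.
- by rewrite -(dpfB_t k E1); exact: zf_dp.
- exact: zf_D.
- exact: zf_M.
exact: zf_Z.
Qed.

Let star_span n m p : fib4 n m p -> spn (LK phi) Bf (fib4 n m) (star (Bf p)).
Proof. exact: (star_Btf_span v0 two_neq0 vn vvn L_ring Lv LvV serre_t serre_s starM star_1 star_s star_t). Qed.

Lemma modelB2 : pbw_model phi (crB2 ix) f d Bf BhB2.
Proof.
have [i0 E0] := ix_surj (isT : (0 < 2)%N).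
have et_Sv u k : e i0 u = 0 -> et i0 (dp v s k.+1 * u) = dp v s k * u.
  by move=> H; rewrite -!(dpfB_s _ E0) et_S.
have ft_Ev u k : e i0 u = 0 -> ft i0 (dp v s k * u) = dp v s k.+1 * u.
  by move=> H; rewrite -!(dpfB_s _ E0) ft_E.
have star_dps k := star_dpE starM star_1 v s k; have star_dpt k := star_dpE starM star_1 (v * v) t k.
have cg n m := star_Btf_cong v0 two_neq0 vn vvn A_ring qA_ideal Av qAv qA_unit serre_t serre_s
  (fun x => e_ss x E0) (fun x => e_st x E0) (e_1 i0) (@et_0 i0) et_Sv ft_Ev starM star_1 star_s star_t
  (n := n) (m := m).
apply: coord_model.
- by move=> i; rewrite dE; case: eqP => _ //; rewrite double_gt0.
- by move=> h i p; rewrite /mB2; case: (h (+) _) => //; exact: psiK.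
- move=> h i a [[[u c] b] x]; rewrite /slB2 /MB2 /stB2 /act /b2_pbw /b2_mont /b2_mon.
  have := ix_lt i; case Ei: (ix i) => [|[|//]] _; rewrite ?(dpfB_s _ Ei) ?(dpfB_t _ Ei);
    case: h => /= ->; rewrite ?starM ?star_dps ?star_dpt ?star_s ?star_t !dp0 ?star_1 ?mul1r ?mulr1 ?mulrA //.
- by rewrite /b2_pbw /b2_mont /b2_mon !dp0 !mulr1.
- move=> p; apply: b2gen_zform.
  exact: (b2gen_Btf v0 two_neq0 vn vvn L_ring Lv LvV serre_t serre_s (fib_self p)).
- move=> h i p; rewrite -/(BhB2 h i p); case: (cases h i) => -> /=; first by rewrite subrr; exact: spn0.
  have H := @cg (wtB2 1 p) (wtB2 0 p) (psi p) (psi_fib (fib_self p)).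
  rewrite /= psiK in H; apply: (spn_relabel (phi := psi)) H => r /psi_fib /fibP //.
- move=> h i p; rewrite -/(BhB2 h i p); case: (cases h i) => -> /=.
    by apply: (spn_gen _ L_ring); apply/forallP.
  by apply: spnW (star_span (psi_fib (fib_self p))) => // r /fibP.
move=> h i p; rewrite -/(BhB2 h i); case: (cases h i) => E.
  by rewrite -E; apply: (spn_gen _ L_ring); apply/forallP.
rewrite -[Bf p]starK; apply: spn_lin (star_span (fib_self p)) => r c Dr Lc.
have -> : star (Bf r) = BhB2 h i (psi r) by rewrite E /= psiK.
by apply: spn_in => //; apply: fibP; exact: psi_fib.
Qed.

Lemma vanishB2 i p : cr_eps (crB2 ix) true i p = 0%N -> e i (BhB2 true i p) = 0.
Proof.
rewrite /BhB2 /coord_Bh /=; case: (mB2 _ _ p) => [[[u c] b] a]; rewrite /slB2 /MB2.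
have := ix_lt i; case Ei: (ix i) => [|[|//]] _ /= ->.
  rewrite /b2_pbw /= dp0 mulr1.
  exact: (ep_star_B3 v0 (fun x => e_ss x Ei) (fun x => e_st x Ei) (e_1 i) starM star_1 star_s star_t).
have Ss : skew (e i) (v * v) s by move=> x; exact: e_ts.
have Sw : skew (e i) (v^-1 * v^-1) (b2_w v s t).
  move=> x; rewrite /b2_w mulrBl linearB /= -scalerAl linearZ_LR /= -!mulrA e_ts // !e_tt // e_ts //.
  by nc K U; field; rewrite ?v0.
have Sz : skew (e i) 1 (b2_z v s t).
  have E1 : (1 : K) = v * v * (v^-1 * v^-1) by field; rewrite ?v0.
  rewrite /b2_z; apply: skewZ; rewrite -scaleN1r; apply: skewD; last apply: skewZ.
    by rewrite E1; exact: skewM.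
  by rewrite E1 mulrC; exact: skewM.
rewrite /b2_pbw /b2_mont /b2_mon /= dp0 mul1r -mulrA.
apply: (skew_kerM (skew_dp _ _ Sw)); apply: (skew_kerM (skew_dp _ _ Sz)).
exact: (skew_ker (e_1 i) (skew_dp _ _ Ss)).
Qed.
End TypeB2.

(** * The anti-involution fixing the generators *)

(* The converse algebra is a record because an alias of [U] lets unification
   fall back on the product of [U]. *)
Section Opposite.
Variables (F : fieldType) (U : algType F).

Record opalg := Op { unop : U }.
HB.instance Definition _ := [isNew for unop].
HB.instance Definition _ := [Choice of opalg by <:].

Definition op_zero := Op 0.
Definition op_opp x := Op (- unop x).
Definition op_add x y := Op (unop x + unop y).
Definition op_one := Op 1.
Definition op_mul x y := Op (unop y * unop x).
Definition op_scale (a : F) x := Op (a *: unop x).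

Let unop_eq (x y : opalg) : unop x = unop y -> x = y.
Proof. by case: x y => [x] [y] /= ->. Qed.

Fact op_addA : associative op_add. Proof. by move=> x y z; apply: unop_eq; rewrite /= addrA. Qed.
Fact op_addC : commutative op_add. Proof. by move=> x y; apply: unop_eq; rewrite /= addrC. Qed.
Fact op_add0 : left_id op_zero op_add. Proof. by move=> x; apply: unop_eq; rewrite /= add0r. Qed.
Fact op_addN : left_inverse op_zero op_opp op_add.
Proof. by move=> x; apply: unop_eq; rewrite /= addNr. Qed.
HB.instance Definition _ := GRing.isZmodule.Build opalg op_addA op_addC op_add0 op_addN.

Fact op_mulA : associative op_mul. Proof. by move=> x y z; apply: unop_eq; rewrite /= mulrA. Qed.
Fact op_mul1l : left_id op_one op_mul. Proof. by move=> x; apply: unop_eq; rewrite /= mulr1. Qed.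
Fact op_mul1r : right_id op_one op_mul. Proof. by move=> x; apply: unop_eq; rewrite /= mul1r. Qed.
Fact op_mulDl : left_distributive op_mul +%R.
Proof. by move=> x y z; apply: unop_eq; rewrite /= mulrDr. Qed.
Fact op_mulDr : right_distributive op_mul +%R.
Proof. by move=> x y z; apply: unop_eq; rewrite /= mulrDl. Qed.
Fact op_1_neq0 : op_one != 0.
Proof. by rewrite -(inj_eq val_inj) /= oner_neq0. Qed.
HB.instance Definition _ := GRing.Zmodule_isNzRing.Build opalg
  op_mulA op_mul1l op_mul1r op_mulDl op_mulDr op_1_neq0.

Fact op_scaleA a b x : op_scale a (op_scale b x) = op_scale (a * b) x.
Proof. by apply: unop_eq; rewrite /= scalerA. Qed.
Fact op_scale1 : left_id 1 op_scale. Proof. by move=> x; apply: unop_eq; rewrite /= scale1r. Qed.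
Fact op_scaleDr : right_distributive op_scale +%R.
Proof. by move=> a x y; apply: unop_eq; rewrite /= scalerDr. Qed.
Fact op_scaleDl x : {morph op_scale^~ x : a b / a + b}.
Proof. by move=> a b; apply: unop_eq; rewrite /= scalerDl. Qed.
HB.instance Definition _ := GRing.Zmodule_isLmodule.Build F opalg
  op_scaleA op_scale1 op_scaleDr op_scaleDl.

Fact op_scalerAl (a : F) (x y : opalg) : a *: (x * y) = (a *: x) * y.
Proof. by apply: unop_eq; rewrite /= scalerAr. Qed.
HB.instance Definition _ := GRing.LSemiModule_isLSemiAlgebra.Build F opalg op_scalerAl.
Fact op_scalerAr (a : F) (x y : opalg) : a *: (x * y) = x * (a *: y).
Proof. by apply: unop_eq; rewrite /= scalerAl. Qed.
HB.instance Definition _ := GRing.LSemiAlgebra_isSemiAlgebra.Build F opalg op_scalerAr.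

Lemma unopM (x y : opalg) : unop (x * y) = unop y * unop x. Proof. by []. Qed.
Lemma unopZ a (x : opalg) : unop (a *: x) = a *: unop x. Proof. by []. Qed.
Lemma unopD (x y : opalg) : unop (x + y) = unop x + unop y. Proof. by []. Qed.

Lemma unop_sum (T : Type) (r : seq T) (E : T -> opalg) :
  unop (\sum_(i <- r) E i) = \sum_(i <- r) unop (E i).
Proof. by elim: r => [|x r IH]; rewrite ?big_nil // !big_cons unopD IH. Qed.
Lemma unopX (x : opalg) n : unop (x ^+ n) = unop x ^+ n.
Proof. by elim: n => [|n IH] //; rewrite exprS unopM IH -exprSr. Qed.

Lemma unop_inj : injective unop. Proof. exact: unop_eq. Qed.
End Opposite.
Arguments Op {F U}.

Section AntiInvolution.
Variables (D : root_datum) (U : uq_data D).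

(** Reversing words exchanges [k] and [b - k] in the Serre sum, which changes it by an overall
    sign. *)
Lemma op_serre : @quantum_serre D (opalg U) (fun i => Op (ud_f U i)).
Proof.
have [Hs _ _] := ud_pres U.
move=> i j Nij /=; set b := absz _; have := Hs i j Nij; rewrite /= -/b => E.
apply: (@unop_inj _ U); rewrite unop_sum.
have dpop k : unop (@divpow D (opalg U) (fun i => Op (ud_f U i)) i k) = divpow (ud_f U) i k.
  by rewrite /divpow unopZ unopX.
rewrite -[RHS](scaler0 _ ((-1) ^+ b)) -[in RHS]E scaler_sumr (reindex_inj rev_ord_inj).
apply: eq_bigr => k _; have le_k : (k <= b)%N by rewrite -ltnS.
rewrite unopZ !unopM !dpop /= subSS subKn // mulrA scalerA; congr (_ *: _).
by rewrite -signr_odd oddB // signr_addb !signr_odd.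
Qed.

Lemma anti_involution : exists star : {linear U -> U},
  [/\ forall x y, star (x * y) = star y * star x, star 1 = 1,
    forall i, star (ud_f U i) = ud_f U i & forall x, star (star x) = x].
Proof.
have [_ univ uniq] := ud_pres U; have [psi Hpsi] := univ _ _ op_serre.
pose st (x : U) : U := unop (psi x).
have st_lin : linear st by move=> a x y; rewrite /st linearP.
have stM x y : st (x * y) = st y * st x by rewrite /st rmorphM.
have st1 : st 1 = 1 by rewrite /st rmorph1.
have stf i : st (ud_f U i) = ud_f U i by rewrite /st Hpsi.
pose star : {linear U -> U} := HB.pack st (GRing.isLinear.Build _ _ _ _ st st_lin).
exists star; split=> //.
(* The square is an algebra endomorphism fixing the generators, hence the identity by uniqueness in
   the presentation. *)
pose ss (x : U) : U := st (st x).
have ss_lin : linear ss by move=> a x y; rewrite /ss !st_lin.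
have ss_mul : monoid_morphism ss by split=> [|x y]; rewrite /ss ?st1 ?stM.
pose ssm : {lrmorphism U -> U} := HB.pack ss (GRing.isLinear.Build _ _ _ _ ss ss_lin)
  (GRing.isMonoidMorphism.Build _ _ ss ss_mul).
pose idl : {lrmorphism U -> U} := idfun.
by move=> x; apply: (uniq _ ssm idl) => i; rewrite /= /ss !stf.
Qed.
End AntiInvolution.

(** * Arithmetic of root data and multipliers *)

Section RootData.
Variables (D : root_datum) (HD : is_root_datum D).
Local Notation form := (rd_form D).
Local Notation al := (rd_alpha D).

Lemma form_half (i : rd_I D) : (0 < half_sq i)%N /\ form (al i) (al i) = (2 * half_sq i)%:R.
Proof.
have [m m0 E] := rd_form_even HD i.
have Em : half_sq i = m.
  rewrite /half_sq E natrM mulrAC divff // mul1r.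
  by have -> : (m%:R : rat) = (m%:Z)%:~R by []; rewrite numq_int.
by rewrite Em.
Qed.

Lemma half_gt0 (i : rd_I D) : (0 < half_sq i)%N. Proof. by case: (form_half i). Qed.

Lemma h_form (i : rd_I D) v : (half_sq i)%:R * rd_h D i v = form (al i) v.
Proof.
have [H0 E] := form_half i; rewrite (rd_hE HD) E natrM.
have N : ((half_sq i)%:R : rat) != 0 by rewrite pnatr_eq0 -lt0n.
by field.
Qed.

Lemma cartanE (i j : rd_I D) : (cartan i j)%:~R = rd_h D i (al j).
Proof. by rewrite /cartan numqK //; apply: (rd_h_int HD); exact: (rd_alphaP HD). Qed.

Lemma cartan_sym (i j : rd_I D) : ((half_sq i)%:Z * cartan i j = (half_sq j)%:Z * cartan j i)%R.
Proof.
have N : injective (intr : int -> rat) by exact: intr_inj.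
by apply: N; rewrite !intrM !cartanE !h_form (rd_form_sym HD).
Qed.

Lemma h_mulrn (i : rd_I D) v n : rd_h D i (v *+ n) = rd_h D i v *+ n.
Proof.
have H0 : ((half_sq i)%:R : rat) != 0 by rewrite pnatr_eq0 -lt0n half_gt0.
have formD u w : form (al i) (u + w) = form (al i) u + form (al i) w.
  by rewrite -[u]scale1r (rd_form_lin HD) mul1r scale1r.
have form0 : form (al i) 0 = 0 by apply: (addrI (form (al i) 0)); rewrite -formD !addr0.
apply: (mulfI H0); rewrite mulrnAr !h_form; elim: n => [|n IH]; first by rewrite !mulr0n form0.
by rewrite mulrS formD IH -mulrS.
Qed.

Variable li : rd_I D -> nat.
Hypothesis li_gt0 : forall i, (0 < li i)%N.

Lemma star_half (i : rd_I D) : @half_sq (star li) i = (li i ^ 2 * half_sq i)%N.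
Proof.
have [H0 E] := form_half i.
have E2 : form (al i *+ li i) (al i *+ li i) / 2 = ((li i ^ 2 * half_sq i)%N%:Z)%:~R.
  have F v n : form v (al i *+ n) = form v (al i) *+ n.
    have formD u w : form v (u + w) = form v u + form v w.
      by rewrite -[u]scale1r (rd_form_lin HD) mul1r scale1r.
    have form0 : form v 0 = 0 by apply: (addrI (form v 0)); rewrite -formD !addr0.
    by elim: n => [|n IH]; rewrite ?mulr0n // !mulrS formD IH.
  rewrite F (rd_form_sym HD) F E -pmulrn -mulrnA -[_ *+ (_ * _)]mulr_natr !natrM ?natrX.
  by field.
by rewrite /half_sq /= E2 numq_int.
Qed.

Lemma star_cartan (i j : rd_I D) (c : int) : ((li j)%:Z * cartan i j = (li i)%:Z * c)%R ->
  @cartan (star li) i j = c.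
Proof.
move=> E; have Ni : ((li i)%:R : rat) != 0 by rewrite pnatr_eq0 -lt0n.
have -> : @cartan (star li) i j = numq ((li i)%:R^-1 * rd_h D i (al j *+ li j)) by [].
have -> : (li i)%:R^-1 * rd_h D i (al j *+ li j) = c%:~R :> rat.
  apply: (mulfI Ni); rewrite mulrA mulfV // mul1r h_mulrn -[_ *+ _]mulr_natl -cartanE.
  have := congr1 (intr : int -> rat) E; rewrite !intrM => <-.
  by rewrite -!pmulrn.
by rewrite numq_int.
Qed.
End RootData.

Section Multipliers.
Variables (D : root_datum) (l : nat) (li : rd_I D -> nat).
Hypotheses (HD : is_root_datum D) (Hli : is_multipliers l li).

Lemma li_eq (i j : rd_I D) : half_sq i = half_sq j -> li i = li j.
Proof.
move=> E; have [i0 idv imin] := Hli i; have [j0 jdv jmin] := Hli j.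
by apply/eqP; rewrite eqn_leq imin ?jmin ?E // -E.
Qed.

(** If [li i] is even, its half is a multiplier for [j]. If it is odd and larger than [li j], then
    [(li j).*2 - li i] is a smaller positive multiplier for [i], a contradiction. *)
Lemma li_double (i j : rd_I D) : half_sq j = (half_sq i).*2 ->
  li j = li i \/ li i = (li j).*2.
Proof.
move=> E; have [i0 idv imin] := Hli i; have [j0 jdv jmin] := Hli j.
rewrite E in jdv jmin.
have le1 : (li i <= (li j).*2)%N.
  by apply: imin; rewrite ?double_gt0 // -doubleMl doubleMr.
have le2 : (li j <= li i)%N by apply: jmin => //; rewrite -doubleMr -mul2n dvdn_mull.
have [odd_i|even_i] := boolP (odd (li i)).
  left; apply/eqP; rewrite eqn_leq le2 /= leqNgt; apply/negP => lt.
  have [r0|r0] := posnP ((li j).*2 - li i)%N; first by move: odd_i; have -> : li i = (li j).*2 by [apply/eqP; rewrite eqn_leq le1 -subn_eq0 r0]; rewrite odd_double.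
  have : (li i <= (li j).*2 - li i)%N.
    apply: imin => //; rewrite mulnBl; apply: dvdn_sub => //.
    by rewrite -doubleMl doubleMr.
  lia.
right; have Eh : li i = ((li i)./2).*2 by rewrite even_halfK.
have : (li j <= (li i)./2)%N.
  by apply: jmin; [lia | rewrite -doubleMr doubleMl -Eh].
lia.
Qed.
End Multipliers.

(** * Serre relations in expanded form *)

Section SerreRelations.
Variables (F : fieldType) (v : F).
Hypotheses (v0 : v != 0) (vn : forall n, qn v n.+1 != 0).
Variables (U : algType F) (x y : U).
Local Notation dp := (dp v).

Lemma serre_1 : \sum_(k < 2) (-1) ^+ k *: (dp x k * y * dp x (1 - k)) = 0 -> x * y = y * x.
Proof.
rewrite !big_ord_recl big_ord0 /= /bump /= !dp0 ?dp1 // expr0 expr1 scale1r mul1r mulr1 addr0 scaleN1r.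
by move/eqP; rewrite subr_eq0 => /eqP ->.
Qed.

Let two : qn v 2 = v + v^-1. Proof. exact: qn2. Qed.

Let N2' : v * v + 1 != 0.
Proof.
have := vn 1; rewrite two; apply: contraNneq => E.
by rewrite -[v + v^-1](mulfK v0) mulrDl mulVf // E mul0r.
Qed.

Lemma serre_2 : \sum_(k < 3) (-1) ^+ k *: (dp x k * y * dp x (2 - k)) = 0 ->
  x * x * y - (v + v^-1) *: (x * y * x) + y * x * x = 0.
Proof.
have N2 : v + v^-1 != 0 by rewrite -two.
have E2 : dp x 2 = (v + v^-1)^-1 *: (x * x).
  by rewrite dpE qfS // qfS // qf0 // qn1 // mul1r mul1r two expr2.
rewrite !big_ord_recl big_ord0 /= /bump /= !dp0 // !dp1 // E2 => E.
rewrite -(scaler0 _ (v + v^-1)) -E; nc F U; field; rewrite ?v0 ?N2' //.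
Qed.

Lemma serre_3 : \sum_(k < 4) (-1) ^+ k *: (dp x k * y * dp x (3 - k)) = 0 ->
  x * x * x * y - (v * v + 1 + v^-1 * v^-1) *: (x * x * y * x)
  + (v * v + 1 + v^-1 * v^-1) *: (x * y * x * x) - y * x * x * x = 0.
Proof.
have N2 : v + v^-1 != 0 by rewrite -two.
have three : qn v 3 = v * v + 1 + v^-1 * v^-1.
  have := qnD' v0 vn 1 2; rewrite qn1 // two !expr1 !expr2 => ->.
  by field.
have N3 : v * v + 1 + v^-1 * v^-1 != 0 by rewrite -three.
have N3' : (v * v + 1) * (v * v) + 1 != 0.
  apply: contraNneq N3 => E; apply/eqP.
  have -> : v * v + 1 + v^-1 * v^-1 = ((v * v + 1) * (v * v) + 1) / (v * v) by field.
  by rewrite E mul0r.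
have E2 : dp x 2 = (v + v^-1)^-1 *: (x * x).
  by rewrite dpE qfS // qfS // qf0 // qn1 // mul1r mul1r two expr2.
have E3 : dp x 3 = ((v + v^-1) * (v * v + 1 + v^-1 * v^-1))^-1 *: (x * x * x).
  by rewrite dpE qfS // qfS // qfS // qf0 // qn1 // !mul1r two three !exprS expr0 mulr1 mulrA.
rewrite !big_ord_recl big_ord0 /= /bump /= !dp0 // !dp1 // E2 E3 => E.
rewrite -(scaler0 _ (- ((v + v^-1) * (v * v + 1 + v^-1 * v^-1)))) -[in RHS]E; nc F U; field; rewrite ?v0 ?N2' ?N3' //.
Qed.
End SerreRelations.

(** * Models of the quantum groups *)

Section UqModels.
Variables (D : root_datum) (U : uq_data D) (n : nat) (ix : rd_I D -> nat).
Hypothesis ix_lt : forall i, (ix i < n)%N.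
Hypothesis ix_surj : forall k, (k < n)%N -> exists i, ix i = k.
Hypothesis ix_inj : injective ix.

Definition gen (k : nat) : U := if [pick i | ix i == k] is Some i then ud_f U i else 0.

Lemma genE i : ud_f U i = gen (ix i).
Proof. by rewrite /gen; case: pickP => [j /eqP /ix_inj -> //|/(_ i)]; rewrite eqxx. Qed.

Lemma uq_serre i j (b : nat) : i != j -> `|1 - cartan i j|%N = b ->
  let v := qK phiQ ^+ half_sq i in
  \sum_(k < b.+1) (-1) ^+ k *: (dp v (ud_f U i) k * ud_f U j * dp v (ud_f U i) (b - k)) = 0.
Proof.
move=> Nij <- /=; have [Hs _ _] := ud_pres U; rewrite -[RHS](Hs i j Nij).
by apply: eq_bigr => k _; rewrite !divpowE.
Qed.

Lemma expz_m2 (F : fieldType) (v : F) : v ^ (- 2%:Z) = v^-1 * v^-1.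
Proof. by rewrite -exprnN expr2 invfM. Qed.

Lemma expz_1 (F : fieldType) (v : F) : v ^ (- - 1%:Z) = v.
Proof. by rewrite opprK. Qed.

Lemma expz_2 (F : fieldType) (v : F) : v ^ (- - 2%:Z) = v * v.
Proof. by rewrite opprK -exprnP expr2. Qed.

Variable dc : nat.
Hypothesis dc_gt0 : (0 < dc)%N.

Section SimplyLaced.
Hypothesis half_dc : forall i : rd_I D, half_sq i = dc.
Hypothesis cartan_A : forall i j : rd_I D, cartan i j =
  if ix i == ix j then 2 else if ((ix i).+1 == ix j) || ((ix j).+1 == ix i) then -1 else 0.

Local Notation v := (qK phiQ ^+ dc).

Let v0 : v != 0. Proof. exact: (qKX_neq0 phiQ_inj). Qed.
Let vn k : qn v k.+1 != 0. Proof. exact: (qn_neq0K phiQ_inj). Qed.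

Let cartanii (i j : rd_I D) : ix i = ix j -> cartan i j = 2. Proof. by move=> E; rewrite cartan_A E eqxx. Qed.

Lemma gen_e i j x : (j < n)%N -> ud_e' U i (gen j * x) =
  cA phiQ dc (ix i) j *: (gen j * ud_e' U i x) + (ix i == j)%:R *: x.
Proof.
move=> /ix_surj [j' <-]; rewrite -genE ud_e'f half_dc cartan_A /cA (inj_eq ix_inj).
congr (_ *: _ + _); case: eqP => _; first exact: expz_m2.
by case: ifP => _; [exact: expz_1 | rewrite oppr0].
Qed.

Lemma gen_pair k j : (k < n)%N -> (j < n)%N -> (k.+1 == j) || (j.+1 == k) ->
  a2_pair v (gen k) (gen j).
Proof.
move=> /ix_surj [i <-] /ix_surj [i' <-] H; rewrite -!genE.
have Nii : ix i != ix i' by apply: contraTneq H => ->; rewrite orbb; elim: (ix i').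
have Nii' : i != i' by apply: contra Nii => /eqP ->.
have E1 : `|1 - cartan i i'|%N = 2%N by rewrite cartan_A (negPf Nii) H.
have E2 : `|1 - cartan i' i|%N = 2%N by rewrite cartan_A eq_sym (negPf Nii) orbC H.
have S1 := uq_serre Nii' E1; rewrite eq_sym in Nii'; have S2 := uq_serre Nii' E2.
rewrite /= !half_dc in S1 S2.
by apply: a2_pair_serre => //; apply: serre_2.
Qed.

Lemma gen_comm k j : (k < n)%N -> (j < n)%N -> k != j -> ~~ ((k.+1 == j) || (j.+1 == k)) ->
  gen k * gen j = gen j * gen k.
Proof.
move=> /ix_surj [i <-] /ix_surj [i' <-] Nii H; rewrite -!genE.
have Nii' : i != i' by apply: contra Nii => /eqP ->.
have E1 : `|1 - cartan i i'|%N = 1%N by rewrite cartan_A (negPf Nii) (negPf H).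
have S1 := uq_serre Nii' E1; rewrite /= half_dc in S1.
exact: serre_1 S1.
Qed.

Lemma uq_modelA1 : n = 1%N ->
  uq_model (crA1 ix) (dp v (gen 0)) (BhA1 phiQ ix dc gen).
Proof.
move=> n1; split.
- by apply: crA1P; rewrite -n1.
- exact: (modelA1 phiQ_inj ix_lt ix_surj dc_gt0 half_dc genE n1).
by move=> i p; apply: vanishA1 => // i'; exact: ud_e'1.
Qed.

Lemma uq_modelA2 : n = 2%N ->
  uq_model (crA2 ix) (a2_pbw v (gen 0) (gen 1)) (BhA2 phiQ ix dc gen).
Proof.
move=> n2; split.
- by apply: crA2P; rewrite -n2.
- apply: (modelA2 phiQ_inj ix_lt ix_surj dc_gt0 half_dc genE n2).
  by apply: gen_pair; rewrite ?n2.
by move=> i p; apply: (vanishA2 phiQ_inj ix_lt (ud_e'1 U) gen_e n2).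
Qed.

Lemma uq_modelA3 : n = 3%N ->
  uq_model (crA3 ix) (a3_M1 v (gen 0) (gen 1) (gen 2)) (BhA3 phiQ ix dc gen).
Proof.
move=> n3; have c02 : gen 0 * gen 2 = gen 2 * gen 0 by apply: gen_comm; rewrite ?n3.
split.
- by apply: crA3P; rewrite -n3.
- by apply: (modelA3 phiQ_inj ix_lt ix_surj dc_gt0 half_dc genE n3) => //; apply: gen_pair; rewrite ?n3.
by move=> i p; apply: (vanishA3 phiQ_inj ix_lt (ud_e'1 U) gen_e n3 c02).
Qed.
End SimplyLaced.
End UqModels.

Section UqModelB2.
Variables (D : root_datum) (U : uq_data D) (ix : rd_I D -> nat) (dc : nat).
Hypothesis ix_lt : forall i, (ix i < 2)%N.
Hypothesis ix_surj : forall k, (k < 2)%N -> exists i, ix i = k.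
Hypothesis ix_inj : injective ix.
Hypothesis dc_gt0 : (0 < dc)%N.
Hypothesis half_B : forall i : rd_I D, half_sq i = if ix i == 0%N then dc else dc.*2.
Hypothesis cartan_B : forall i j : rd_I D, cartan i j =
  if ix i == ix j then 2 else if ix i == 0%N then -2 else -1.

Local Notation v := (qK phiQ ^+ dc).
Local Notation s := (gen U ix 0).
Local Notation t := (gen U ix 1).

Let v0 : v != 0. Proof. exact: (qKX_neq0 phiQ_inj). Qed.
Let vn k : qn v k.+1 != 0. Proof. exact: (qn_neq0K phiQ_inj). Qed.
Let vvE : v * v = qK phiQ ^+ dc.*2. Proof. by rewrite -exprD addnn. Qed.
Let vv0 : v * v != 0. Proof. by rewrite mulf_neq0. Qed.
Let vvn k : qn (v * v) k.+1 != 0.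
Proof. by rewrite vvE; apply: (qn_neq0K phiQ_inj); rewrite double_gt0. Qed.

Lemma uq_modelB2 : exists Bh, uq_model (crB2 ix) (b2_pbw v s t) Bh.
Proof.
have [i0 E0] := ix_surj (isT : (0 < 2)%N); have [i1 E1] := ix_surj (isT : (1 < 2)%N).
have [Gs Gt] : ud_f U i0 = s /\ ud_f U i1 = t by rewrite !(genE U ix_inj) E0 E1.
have N01 : i0 != i1 by apply/eqP => E; move: E0; rewrite E E1.
have N10 : i1 != i0 by rewrite eq_sym.
have C01 : cartan i0 i1 = -2 by rewrite cartan_B E0 E1.
have C10 : cartan i1 i0 = -1 by rewrite cartan_B E0 E1.
have H0 : half_sq i0 = dc by rewrite half_B E0.
have H1 : half_sq i1 = dc.*2 by rewrite half_B E1.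
have S01 : `|1 - cartan i0 i1|%N = 3%N by rewrite C01.
have S10 : `|1 - cartan i1 i0|%N = 2%N by rewrite C10.
have serre_s := uq_serre U N01 S01; rewrite /= H0 Gs Gt in serre_s.
have serre_t := uq_serre U N10 S10; rewrite /= H1 Gs Gt -vvE in serre_t.
have {}serre_s := serre_3 v0 vn serre_s.
have {}serre_t := serre_2 vv0 vvn serre_t.
have {}serre_t : s * t * t - (v * v + v^-1 * v^-1) *: (t * s * t) + t * t * s = 0.
  by rewrite -[RHS]serre_t invfM [LHS]addrAC [RHS]addrAC; congr (_ - _); rewrite addrC.
have [star [starM star_1 star_f starK]] := anti_involution U.
have star_s : star s = s by rewrite -Gs star_f.
have star_t : star t = t by rewrite -Gt star_f.
have ix0 i : ix i = 0%N -> i = i0 by move=> E; apply: ix_inj; rewrite E.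
have ix1 i : ix i = 1%N -> i = i1 by move=> E; apply: ix_inj; rewrite E.
have e_ss i x : ix i = 0%N -> ud_e' U i (s * x) = (v^-1 * v^-1) *: (s * ud_e' U i x) + x.
  by move=> /ix0 ->; rewrite -Gs ud_e'f eqxx scale1r H0 cartan_B eqxx expz_m2.
have e_st i x : ix i = 0%N -> ud_e' U i (t * x) = (v * v) *: (t * ud_e' U i x).
  by move=> /ix0 ->; rewrite -Gt ud_e'f (negPf N01) scale0r addr0 H0 C01 expz_2.
have e_ts i x : ix i = 1%N -> ud_e' U i (s * x) = (v * v) *: (s * ud_e' U i x).
  by move=> /ix1 ->; rewrite -Gs ud_e'f (negPf N10) scale0r addr0 H1 C10 expz_1 -vvE.
have e_tt i x : ix i = 1%N ->
    ud_e' U i (t * x) = (v^-1 * v^-1 * (v^-1 * v^-1)) *: (t * ud_e' U i x) + x.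
  by move=> /ix1 ->; rewrite -Gt ud_e'f eqxx scale1r H1 cartan_B eqxx expz_m2 -vvE invfM.
exists (BhB2 phiQ ix dc (gen U ix) star); split.
- exact: crB2P.
- have et_S i u k : ud_e' U i u = 0 -> ud_et U i (dpf phiQ (ud_f U) (@half_sq D) i k.+1 * u) =
      dpf phiQ (ud_f U) (@half_sq D) i k * u by move=> H; rewrite -!divpowE ud_etS.
  have ft_E i u k : ud_e' U i u = 0 -> ud_ft U i (dpf phiQ (ud_f U) (@half_sq D) i k * u) =
      dpf phiQ (ud_f U) (@half_sq D) i k.+1 * u by move=> H; rewrite -!divpowE ud_ftE.
  exact: (modelB2 phiQ_inj ix_lt ix_surj dc_gt0 (genE U ix_inj) half_B serre_t serre_s starM star_1 starK
    star_s star_t (ud_e'1 U) e_ss e_st (@ud_et0 D U) et_S ft_E).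
by move=> i p; apply: (vanishB2 phiQ_inj ix_lt starM star_1 star_s star_t (ud_e'1 U) e_ss e_st e_ts e_tt).
Qed.
End UqModelB2.

(** * Rescaling the parameters *)

Lemma a2_mut_scale n a b c : a2_mut (n * a, n * b, n * c)%N =
  let '(x, y, z) := a2_mut (a, b, c) in (n * x, n * y, n * z)%N.
Proof. by rewrite /a2_mut /= -minnMr -!mulnDr -!mulnBr. Qed.

Definition scale3 n (p : nat * nat * nat) := let '(a, b, c) := p in (n * a, n * b, n * c)%N.
Definition scale4 n (p : nat4) : nat4 := let '(a, b, c, d) := p in (n * a, n * b, n * c, n * d)%N.
Definition scale6 n (p : nat6) : nat6 := let '(a, b, c, d, e, f) := p in
  (n * a, n * b, n * c, n * d, n * e, n * f)%N.

Lemma a3_mut_scale n p : a3_mut (scale6 n p) = scale6 n (a3_mut p).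
Proof.
case: p => [[[[[c1 c2] c3] c4] c5] c6]; rewrite /scale6 /a3_mut /a3_g1 a2_mut_scale.
case: (a2_mut (c2, c4, c5)) => [[x y] z]; rewrite /a3_g2 a2_mut_scale.
case: (a2_mut (c1, c3, x)) => [[a1 a2] a3]; rewrite /a3_g3 a2_mut_scale.
case: (a2_mut (a3, z, c6)) => [[b1 b2] b3]; rewrite /a3_g4 a2_mut_scale.
by case: (a2_mut (a2, y, b1)) => [[d1 d2] d3].
Qed.

Lemma a3_mut'_scale n p : a3_mut' (scale6 n p) = scale6 n (a3_mut' p).
Proof. by rewrite -{1}[p]a3_mut'K -a3_mut_scale a3_mutK. Qed.

Lemma psi_scale n p : psi (scale4 n p) = scale4 n (psi p).
Proof.
case: n => [|n].
  have E q : scale4 0 q = (0, 0, 0, 0)%N by case: q => [[[a b] c] d].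
  by rewrite !E.
case: p => [[[u c] b] a]; rewrite /scale4 /psi /par /= -minnMr.
set N := n.+1; rewrite !doubleMr -!mulnDr -!mulnBr !doubleMr -!mulnDr -!mulnBr -!minnMr -!mulnBr.
by rewrite /tri leq_pmul2l //; case: ifP => _; rewrite ?doubleMr -?mulnBr -?mulnDr.
Qed.

(** For the case where long and short root change places: the order of the factors is reversed, and
    the doubled entries reflect that the multiplier of the short root is twice that of the long
    one. *)
Definition swapB2 (p : nat4) : nat4 := let '(k, c, b, a) := p in (a, b.*2, c, k.*2).

Lemma psi_swap p : psi (swapB2 p) = swapB2 (psi p).
Proof.
case: p => [[[u c] b] a]; rewrite /swapB2.
have [u' [c' [b' [a' [-> [[A1 A2 A3 A4] [B1 B2 B3 B4] W1 W2]]]]]] := psi_spec u c b a.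
have [x [y [z [w [-> [[C1 C2 C3 C4] [D1 D2 D3 D4] W3 W4]]]]]] := psi_spec a b.*2 c u.*2.
have Ex : x = a' by clear A1 A2 A3 A4 D1 D2 D3 D4 W1 W2 W3 W4; lia.
have Ew : w = u'.*2 by clear B1 B2 B3 B4 C1 C2 C3 C4 W1 W2 W3 W4; lia.
by clear A1 A2 A3 A4 B1 B2 B3 B4 C1 C2 C3 C4 D1 D2 D3 D4; congr (_, _, _, _); lia.
Qed.

Lemma type_index (D : root_datum) n (C : 'M[int]_n) : has_type D C ->
  exists2 ix : rd_I D -> 'I_n, bijective ix & forall i j, cartan i j = C (ix i) (ix j).
Proof.
move=> [s [s' sK s'K] HC]; exists s'; first by exists s.
by move=> i j; rewrite -HC !s'K.
Qed.

(** * The four types *)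

Section Final.
Variables (D : root_datum) (l : nat) (li : rd_I D -> nat).
Hypotheses (HD : is_root_datum D) (Hli : is_multipliers l li).
Variables (R : idomainType) (zeta : R).
Hypotheses (Hl : (1 <= l)%N) (Hzeta : good_root_of_unity l zeta).
Variables (U : uq_data D) (Us : uq_data (star li)).
Variables (G : set U -> U) (Gs : set Us -> Us).
Hypotheses (HG : is_global G) (HGs : is_global Gs).
Variables (V Vs : algType R) (iota : U -> V) (iotas : Us -> Vs).
Hypotheses (Hiota : is_specialization zeta iota) (Hiotas : is_specialization zeta iotas).
Variable Fr : {lrmorphism Vs -> V}.
Hypothesis HFr : is_Fr_splitting iotas iota Fr.
Variable S : set Us -> set U.
Hypothesis HS : is_crystal_embedding S.

Let li_gt0 i : (0 < li i)%N. Proof. by have [] := Hli i. Qed.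

Section TypeA.
Variable n : nat.
Variable ix' : rd_I D -> 'I_n.
Hypotheses (ix_bij : bijective ix').
Hypothesis HC : forall i j, cartan i j = cartanA n (ix' i) (ix' j).
Hypothesis n_gt0 : (0 < n)%N.
Let ix i : nat := ix' i.

Let ix_lt i : (ix i < n)%N. Proof. exact: ltn_ord. Qed.
Let ix_inj : injective ix. Proof. by move=> i j /val_inj; exact: (bij_inj ix_bij). Qed.
Let ix_surj k : (k < n)%N -> exists i, ix i = k.
Proof. by move=> lt_k; have [g _ gK] := ix_bij; exists (g (Ordinal lt_k)); rewrite /ix gK. Qed.

Let cartan_A (i j : rd_I D) : cartan i j =
  if ix i == ix j then 2 else if ((ix i).+1 == ix j) || ((ix j).+1 == ix i) then -1 else 0.
Proof. by rewrite HC mxE -val_eqE. Qed.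

(** The diagram is a line, and symmetry of the form carries the length from each node to the
    next. *)
Let half_const : exists2 dc, (0 < dc)%N & forall i : rd_I D, half_sq i = dc.
Proof.
have [i0 E0] := ix_surj n_gt0; exists (half_sq i0); first exact: half_gt0.
move=> i; have [k le_k] := ubnP (ix i); elim: k => // k IH in i le_k *.
case Ei: (ix i) => [|m]; first by congr half_sq; apply: ix_inj; rewrite Ei.
have [|j Ej] := @ix_surj m; first by have := ix_lt i; rewrite Ei => /ltnW.
rewrite -(IH j); last by rewrite Ej; move: le_k; rewrite Ei.
have := cartan_sym HD i j; rewrite !cartan_A Ei Ej !eqxx orbT /=.
have -> : (m.+1 == m) = false by apply/negbTE; rewrite neq_ltn ltnSn orbT.
have -> : (m == m.+1) = false by apply/negbTE; rewrite neq_ltn ltnSn.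
by rewrite !mulrN1 => /oppr_inj [].
Qed.

Let li_const : exists2 L, (0 < L)%N & forall i, li i = L.
Proof.
have [dc _ Hdc] := half_const; have [i0 _] := ix_surj n_gt0.
by exists (li i0) => // i; apply: (li_eq Hli); rewrite !Hdc.
Qed.

Let cartan_As (i j : rd_I D) : @cartan (star li) i j =
  if ix i == ix j then 2 else if ((ix i).+1 == ix j) || ((ix j).+1 == ix i) then -1 else 0.
Proof.
have [L _ HL] := li_const.
by rewrite -cartan_A; apply: (star_cartan HD) => //; rewrite !HL.
Qed.

Lemma final_A : (n <= 3)%N -> forall b, Binf b -> Fr (iotas (Gs b)) = iota (G (S b)).
Proof.
have [dc dc_gt0 Hdc] := half_const; have [L L_gt0 HL] := li_const.
have Hdcs i : @half_sq (star li) i = (L ^ 2 * dc)%N by rewrite (star_half HD) HL Hdc.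
have dcs_gt0 : (0 < L ^ 2 * dc)%N by rewrite muln_gt0 expn_gt0 L_gt0.
have Hn : (n <= 3)%N -> [\/ n = 1%N, n = 2%N | n = 3%N].
  by case: n n_gt0 => [|[|[|[|//]]]] // _ _; [constructor 1 | constructor 2 | constructor 3].
case/Hn => [n1|n2|n3].
- have HU := uq_modelA1 U ix_lt ix_surj ix_inj dc_gt0 Hdc n1.
  have HUs := @uq_modelA1 (star li) Us n ix ix_lt ix_surj ix_inj _ dcs_gt0 Hdcs n1.
  apply: (transfer Hli Hl Hzeta HG HGs Hiota Hiotas HFr HS HU HUs (sigma := muln L)).
  + move=> p r /forallP H; apply/forallP => k; apply/eqP.
    by congr (L * _)%N; apply/eqP; exact: (H k).
  + by move=> h i p; rewrite HL.
  + by move=> h i p; rewrite /= /idm muln0.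
  by rewrite /= muln0.
- have HU := uq_modelA2 U ix_lt ix_surj ix_inj dc_gt0 Hdc cartan_A n2.
  have HUs := @uq_modelA2 (star li) Us n ix ix_lt ix_surj ix_inj _ dcs_gt0 Hdcs cartan_As n2.
  have mS h k p : mA2 h k (scale3 L p) = scale3 L (mA2 h k p).
    rewrite /mA2; case: (h (+) _) => //; case: p => [[a b] c]; rewrite /scale3 a2_mut_scale //.
  apply: (transfer Hli Hl Hzeta HG HGs Hiota Hiotas HFr HS HU HUs (sigma := scale3 L)).
  + move=> p r /forallP H; apply/forallP => k; apply/eqP; have /eqP := H k.
    case: p r {H} => [[a b] c] [[a' b'] c']; rewrite /wtA2 /scale3 -!mulnDr.
    by case: ifP => _ ->.
  + move=> h i p; rewrite /= mS HL; case: (mA2 _ _ p) => [[a b] c].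
    by rewrite /slA2; case: h.
  + move=> h i p; rewrite /= mS -[RHS]mS; congr (mA2 _ _ _); case: (mA2 _ _ p) => [[a b] c].
    by rewrite /stA2 /scale3; case: h; rewrite muln0.
  by rewrite /= muln0.
have HU := uq_modelA3 U ix_lt ix_surj ix_inj dc_gt0 Hdc cartan_A n3.
have HUs := @uq_modelA3 (star li) Us n ix ix_lt ix_surj ix_inj _ dcs_gt0 Hdcs cartan_As n3.
have mS h k p : mA3 h k (scale6 L p) = scale6 L (mA3 h k p).
  by rewrite /mA3; case: (h (+) _) => //; exact: a3_mut_scale.
have mS' h k p : mA3' h k (scale6 L p) = scale6 L (mA3' h k p).
  by rewrite /mA3'; case: (h (+) _) => //; exact: a3_mut'_scale.
apply: (transfer Hli Hl Hzeta HG HGs Hiota Hiotas HFr HS HU HUs (sigma := scale6 L)).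
- move=> p r /forallP H; apply/forallP => k; apply/eqP; have /eqP := H k.
  case: p r {H} => [[[[[a b] c] x] y] z] [[[[[a' b'] c'] x'] y'] z'].
  by rewrite /wtA3 /scale6 -!mulnDr; case: ifP => _ => [->|] //; case: ifP => _ ->.
- move=> h i p; rewrite /= mS HL; case: (mA3 _ _ p) => [[[[[a b] c] x] y] z].
  by rewrite /slA3 /scale6; case: h; case: ifP.
- move=> h i p; rewrite /= mS -[RHS]mS'; congr (mA3' _ _ _).
  case: (mA3 _ _ p) => [[[[[a b] c] x] y] z].
  by rewrite /stA3 /scale6; case: h; case: ifP; rewrite muln0.
by rewrite /= !muln0.
Qed.
End TypeA.

Section TypeB.
Variable ix' : rd_I D -> 'I_2.
Hypotheses (ix_bij : bijective ix').
Hypothesis HC : forall i j, cartan i j = cartanB2 (ix' i) (ix' j).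
Let ix i : nat := ix' i.

Let ix_lt i : (ix i < 2)%N. Proof. exact: ltn_ord. Qed.
Let ix_inj : injective ix. Proof. by move=> i j /val_inj; exact: (bij_inj ix_bij). Qed.
Let ix_surj k : (k < 2)%N -> exists i, ix i = k.
Proof. by move=> lt_k; have [g _ gK] := ix_bij; exists (g (Ordinal lt_k)); rewrite /ix gK. Qed.

Let cartan_B (i j : rd_I D) : cartan i j =
  if ix i == ix j then 2 else if ix i == 0%N then -2 else -1.
Proof. by rewrite HC mxE -!val_eqE. Qed.

Lemma final_B : forall b, Binf b -> Fr (iotas (Gs b)) = iota (G (S b)).
Proof.
have [i0 E0] := ix_surj (isT : (0 < 2)%N); have [i1 E1] := ix_surj (isT : (1 < 2)%N).
have ix01 i : (i = i0 /\ ix i = 0%N) \/ (i = i1 /\ ix i = 1%N).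
  have := ix_lt i; case Ei: (ix i) => [|[|//]] _; [left | right]; split=> //.
    by apply: ix_inj; rewrite Ei.
  by apply: ix_inj; rewrite Ei.
have H10 : half_sq i1 = (half_sq i0).*2.
  by have := cartan_sym HD i0 i1; rewrite !cartan_B E0 E1 /=; lia.
pose dc := half_sq i0; have dc_gt0 : (0 < dc)%N by exact: half_gt0.
have Hdc (i : rd_I D) : half_sq i = if ix i == 0%N then dc else dc.*2.
  by case: (ix01 i) => -[-> ->].
have [Bh HU] := uq_modelB2 U ix_lt ix_surj ix_inj dc_gt0 Hdc cartan_B.
case: (li_double Hli H10) => HL.
  pose L := li i0; have HLi i : li i = L by case: (ix01 i) => -[-> _].
  have L_gt0 : (0 < L)%N by exact: li_gt0.
  have Hdcs (i : rd_I D) : @half_sq (star li) i =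
      if ix i == 0%N then (L ^ 2 * dc)%N else (L ^ 2 * dc).*2.
    by rewrite (star_half HD) HLi Hdc; case: ifP => // _; rewrite doubleMr.
  have dcs_gt0 : (0 < L ^ 2 * dc)%N by rewrite muln_gt0 expn_gt0 L_gt0.
  have cartan_Bs (i j : rd_I D) : @cartan (star li) i j =
      if ix i == ix j then 2 else if ix i == 0%N then -2 else -1.
    by rewrite -cartan_B; apply: (star_cartan HD) => //; rewrite !HLi.
  have [Bhs HUs] := @uq_modelB2 (star li) Us ix _ ix_lt ix_surj ix_inj dcs_gt0 Hdcs cartan_Bs.
  have mS h k p : mB2 h k (scale4 L p) = scale4 L (mB2 h k p).
    by rewrite /mB2; case: (h (+) _) => //; exact: psi_scale.
  apply: (transfer Hli Hl Hzeta HG HGs Hiota Hiotas HFr HS HU HUs (sigma := scale4 L)).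
  - move=> p r /forallP H; apply/forallP => k; apply/eqP; have /eqP := H k.
    case: p r {H} => [[[u c] b] a] [[[u' c'] b'] a'].
    by rewrite /wtB2 /scale4 !doubleMr -!mulnDr; case: ifP => _ ->.
  - move=> h i p; rewrite /= mS HLi; case: (mB2 _ _ p) => [[[u c] b] a].
    by rewrite /slB2 /scale4; case: ifP.
  - move=> h i p; rewrite /= mS -[RHS]mS; congr (mB2 _ _ _).
    by case: (mB2 _ _ p) => [[[u c] b] a]; rewrite /stB2 /scale4; case: ifP; rewrite muln0.
  by rewrite /= !muln0.
(* Here [li i0 = L.*2], so in [star li] the long root is [i0] and the short one [i1]; [ixs]
   renumbers accordingly. *)
pose L := li i1; have L_gt0 : (0 < L)%N by exact: li_gt0.
pose ixs i := (1 - ix i)%N.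
have ixs01 i : (i = i0 /\ ix i = 0%N /\ ixs i = 1%N /\ li i = L.*2) \/
    (i = i1 /\ ix i = 1%N /\ ixs i = 0%N /\ li i = L).
  by rewrite /ixs; case: (ix01 i) => -[-> ->]; [left | right].
have Hdcs (i : rd_I D) : @half_sq (star li) i =
    if ixs i == 0%N then (L ^ 2 * dc).*2 else ((L ^ 2 * dc).*2).*2.
  rewrite (star_half HD) Hdc.
  by case: (ixs01 i) => -[_ [-> [-> ->]]] /=; rewrite -?doubleMr // -!mul2n expnMn !mulnA.
have dcs_gt0 : (0 < (L ^ 2 * dc).*2)%N by rewrite double_gt0 muln_gt0 expn_gt0 L_gt0.
have cartan_Bs (i j : rd_I D) : @cartan (star li) i j =
    if ixs i == ixs j then 2 else if ixs i == 0%N then -2 else -1.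
  apply: (star_cartan HD) => //; rewrite cartan_B.
  by case: (ixs01 i) => -[_ [-> [-> ->]]]; case: (ixs01 j) => -[_ [-> [-> ->]]] /=; lia.
have ixs_lt i : (ixs i < 2)%N by rewrite /ixs; have := ix_lt i; lia.
have ixs_inj : injective ixs.
  by move=> i j E; apply: ix_inj; have := ix_lt i; have := ix_lt j; move: E; rewrite /ixs; lia.
have ixs_surj k : (k < 2)%N -> exists i, ixs i = k.
  by case: k => [|[|//]] _; [exists i1; rewrite /ixs E1 | exists i0; rewrite /ixs E0].
have [Bhs HUs] := @uq_modelB2 (star li) Us ixs _ ixs_lt ixs_surj ixs_inj dcs_gt0 Hdcs cartan_Bs.
pose tau p := scale4 L (swapB2 p).
have psi_tau p : psi (tau p) = tau (psi p) by rewrite /tau psi_scale psi_swap.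
have m_sigma h i p : mB2 h (ix i) (psi (tau p)) = tau (mB2 h (ixs i) p).
  by rewrite /mB2; case: (ixs01 i) => -[_ [-> [-> _]]]; case: h; rewrite /= ?psiK ?psi_tau.
have mi_tau h i p : mB2 h (ix i) (tau p) = psi (tau (mB2 h (ixs i) p)).
  by rewrite /mB2; case: (ixs01 i) => -[_ [-> [-> _]]]; case: h; rewrite /= ?psi_tau ?psiK.
(* [psi] compensates the reversal in [tau]: the monomials of [Us] begin with the generator of [i0],
   those of [U] with that of [i1]. *)
apply: (transfer Hli Hl Hzeta HG HGs Hiota Hiotas HFr HS HU HUs (sigma := fun p => psi (tau p))).
- move=> p r /forallP H; apply/forallP => k; apply/eqP; rewrite !wtB2_psi.
  have /eqP := H ord0; have /eqP := H ord_max.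
  case: p r {H} => [[[u c] b] a] [[[u' c'] b'] a']; rewrite /wtB2 /= => F1 F0.
  case: k => [[|[|//]] lt_k] /=.
    by rewrite !doubleMr -!mulnDr; congr (L * _)%N; move: F1; lia.
  by rewrite -!mulnDr; congr (L * _)%N; move: F0; lia.
- move=> h i p; rewrite /= m_sigma; case: (mB2 _ (ixs i) p) => [[[u c] b] a].
  by case: (ixs01 i) => -[_ [-> [-> ->]]]; rewrite /slB2 /tau /scale4 /swapB2 /= -?doubleMr -?doubleMl.
- move=> h i p; rewrite /= m_sigma -mi_tau; congr (mB2 _ _ _).
  case: (mB2 _ (ixs i) p) => [[[u c] b] a].
  by case: (ixs01 i) => -[_ [-> [-> _]]]; rewrite /stB2 /tau /scale4 /swapB2 /= ?muln0.
by rewrite /tau /scale4 /swapB2 /= !muln0.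
Qed.
End TypeB.
End Final.

Theorem proposition5p4
  (D : root_datum) (HD : is_root_datum D)
  (Htype : [\/ has_type D (cartanA 1), has_type D (cartanA 2),
               has_type D (cartanA 3) | has_type D cartanB2])
  (l : nat) (Hl : (1 <= l)%N)
  (li : rd_I D -> nat) (Hli : is_multipliers l li)
  (R : idomainType) (zeta : R) (Hzeta : good_root_of_unity l zeta)
  (U : uq_data D) (Us : uq_data (star li))
  (G : set U -> U) (HG : is_global G)
  (Gs : set Us -> Us) (HGs : is_global Gs)
  (V Vs : algType R)
  (iota : U -> V) (Hiota : is_specialization zeta iota)
  (iotas : Us -> Vs) (Hiotas : is_specialization zeta iotas)
  (Fr : {lrmorphism Vs -> V}) (HFr : is_Fr_splitting iotas iota Fr)
  (S : set Us -> set U) (HS : is_crystal_embedding S) :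
  forall b : set Us, Binf b -> Fr (iotas (Gs b)) = iota (G (S b)).
Proof.
case: Htype => /type_index [ix ix_bij HC].
- exact (final_A HD Hli Hl Hzeta HG HGs Hiota Hiotas HFr HS ix_bij HC isT isT).
- exact (final_A HD Hli Hl Hzeta HG HGs Hiota Hiotas HFr HS ix_bij HC isT isT).
- exact (final_A HD Hli Hl Hzeta HG HGs Hiota Hiotas HFr HS ix_bij HC isT isT).
exact (final_B HD Hli Hl Hzeta HG HGs Hiota Hiotas HFr HS ix_bij HC).
Qed.
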